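(* Let $G$ be a simply-connected 2-step nilpotent Lie group and let $n\ge2$. If $G'=G^{\times_Z n}$ is the $n$-fold central product of $G$, then $$\delta_{G'}(\ell)\precsim \ell^2\log\ell.$$
   Context: For a 2-step nilpotent group $G$ with center $Z$, the $n$-fold central product $G^{\times_Z n}$ is the quotient of $G^n$ obtained by identifying the centers of all $n$ factors via $(z,1,1,\dots)\sim(1,z,1,\dots)\sim(1,1,z,\dots)\sim\cdots$ for all $z\in Z$. A simply-connected Lie group is given a left-invariant riemannian metric. For such a group $X$ and a Lipschitz closed curve $f:S^1\to X$, let $\delta_X(f)$ be the infimum of the areas of Lipschitz discs $g:D^2\to X$ with $g|_{S^1}=f$, and let $\delta_X(\ell)=\sup\{\delta_X(f)\mid \operatorname{length}(f)\le \ell\}$ be the Dehn function. For $f,g:\mathbb{R}^+\to\mathbb{R}^+$, $f\precsim g$ means there is a constant $c$ with $f(x)\le c\,g(cx+c)+cx+c$ for all $x$. *)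

(* Defs.v *)
From HB Require Import structures.
From mathcomp Require Import all_boot all_order all_algebra.
From mathcomp Require Import all_classical all_reals all_analysis.
Set Implicit Arguments.
Unset Strict Implicit.
Unset Printing Implicit Defensive.
Import Order.TTheory GRing.Theory Num.Theory.
Import numFieldNormedType.Exports.
Local Open Scope classical_set_scope.
Local Open Scope ring_scope.

(** * Smooth manifolds *)

(* For [U] open in a finite-dimensional space this is the usual class C^k:
   all iterated directional derivatives up to order [k] exist and are
   continuous on [U]. *)
Fixpoint Ck_on (R : realType) (E F : normedModType R) (k : nat)
    (U : set E) (f : E -> F) : Prop :=
  (forall x, U x -> {for x, continuous f}) /\
  (if k is k'.+1 then
     forall v : E, (forall x, U x -> derivable f x v) /\
                   Ck_on k' U (fun x => 'D_v f x)
   else True).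

Definition smooth_on (R : realType) (E F : normedModType R)
    (U : set E) (f : E -> F) : Prop :=
  forall k, Ck_on k U f.

(* A chart is a pair of total functions; only the values of [chart_to] on
   [chart_dom] and of [chart_of] on [chart_cod] are meaningful. *)
Record chart (R : realType) (M : topologicalType) (E : normedModType R) :=
  Chart {
    chart_dom : set M;
    chart_to : M -> E;
    chart_of : E -> M
  }.

Definition chart_cod (R : realType) (M : topologicalType)
    (E : normedModType R) (c : chart M E) : set E :=
  chart_to c @` chart_dom c.

(* [prefc x] is a preferred chart around [x]; it is only used to express
   quantities that do not depend on the chart. *)
Record atlas (R : realType) (M : topologicalType) (E : normedModType R) :=
  Atlas {
    aidx : Type;
    achart : aidx -> chart M E;
    prefc : M -> aidx
  }.

Definition is_chart (R : realType) (M : topologicalType)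
    (E : normedModType R) (c : chart M E) : Prop :=
  [/\ open (chart_dom c),
      open (chart_cod c),
      forall x, chart_dom c x -> chart_of c (chart_to c x) = x,
      forall x, chart_dom c x -> {for x, continuous (chart_to c)} &
      forall p, chart_cod c p -> {for p, continuous (chart_of c)}].

Definition smooth_map (R : realType) (M N : topologicalType)
    (E F : normedModType R) (A : atlas M E) (B : atlas N F)
    (f : M -> N) : Prop :=
  continuous f /\
  forall (i : aidx A) (j : aidx B),
    smooth_on (chart_to (achart i) @`
                 (chart_dom (achart i) `&` f @^-1` chart_dom (achart j)))
      (fun p => chart_to (achart j) (f (chart_of (achart i) p))).

(* Smoothness of the identity of [M] says that all transition maps are
   smooth. *)
Record smooth_manifold (R : realType) (M : topologicalType)
    (E : normedModType R) (A : atlas M E) : Prop := SmoothManifold {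
  sm_hausdorff : hausdorff_space M;
  sm_countable : @second_countable M;
  sm_chart : forall i : aidx A, is_chart (achart i);
  sm_prefc : forall x : M, chart_dom (achart (prefc A x)) x;
  sm_transition : smooth_map A A id
}.

Definition atlas_prod (R : realType) (M N : topologicalType)
    (E F : normedModType R) (A : atlas M E) (B : atlas N F) :
    atlas (M * N)%type (E * F)%type :=
  @Atlas R (M * N)%type (E * F)%type (aidx A * aidx B)%type
    (fun ij => @Chart R (M * N)%type (E * F)%type
       (chart_dom (achart ij.1) `*` chart_dom (achart ij.2))
       (fun x => (chart_to (achart ij.1) x.1, chart_to (achart ij.2) x.2))
       (fun p => (chart_of (achart ij.1) p.1, chart_of (achart ij.2) p.2)))
    (fun x => (prefc A x.1, prefc B x.2)).

(* The n-fold power of a manifold modelled on R^m, modelled on n x m matrices: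
   the i-th row holds the coordinates of the i-th point. *)
Definition atlas_pow (R : realType) (M : topologicalType) (m : nat)
    (A : atlas M 'rV[R]_m) (n : nat) :
    atlas {ptws 'I_n -> M} 'M[R]_(n, m) :=
  @Atlas R {ptws 'I_n -> M} 'M[R]_(n, m) ('I_n -> aidx A)
    (fun c => @Chart R {ptws 'I_n -> M} 'M[R]_(n, m)
       [set x | forall i, chart_dom (achart (c i)) (x i)]
       (fun x => \matrix_(i, j) chart_to (achart (c i)) (x i) 0 j)
       (fun p i => chart_of (achart (c i)) (row i p)))
    (fun x i => prefc A (x i)).

(** * Lie groups *)

(* Group and topology without compatibility; continuity and smoothness of the
   operations are part of [lie_group]. *)
#[short(type="groupTopType")]
HB.structure Definition GroupTop := {G of Group G & Topological G}.

Record lie_group (R : realType) (G : groupTopType) (m : nat)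
    (A : atlas G 'rV[R]_m) : Prop := LieGroup {
  lie_manifold : smooth_manifold A;
  lie_mul : smooth_map (atlas_prod A A) A (fun xy : G * G => (xy.1 * xy.2)%g);
  lie_inv : smooth_map A A (fun x : G => (x^-1)%g)
}.

Definition path_connected (R : realType) (T : topologicalType) : Prop :=
  forall x y : T, exists gamma : R -> T,
    [/\ {within `[0, 1], continuous gamma}, gamma 0 = x & gamma 1 = y].

Definition simply_connected (R : realType) (T : topologicalType) : Prop :=
  path_connected R T /\
  forall gamma : R -> T,
    {within `[0, 1], continuous gamma} -> gamma 0 = gamma 1 ->
    exists H : R * R -> T,
      {within (`[0, 1]%classic `*` `[0, 1]%classic), continuous H} /\
      (forall t, 0 <= t <= 1 ->
        [/\ H (0, t) = gamma t, H (1, t) = gamma 0,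
            H (t, 0) = gamma 0 & H (t, 1) = gamma 0]).

(* The third term of the lower central series is trivial; abelian groups are
   allowed. *)
Definition two_step_nilpotent (G : groupType) : Prop :=
  forall x y z : G, commg (commg x y) z = 1%g.

(** * Central products *)

Definition center (G : groupType) : set G :=
  [set z | forall x : G, (z * x = x * z)%g].

Definition pow_mul (G : groupType) (n : nat) (x y : 'I_n -> G) : 'I_n -> G :=
  fun i => (x i * y i)%g.

Definition pow_inv (G : groupType) (n : nat) (x : 'I_n -> G) : 'I_n -> G :=
  fun i => ((x i)^-1)%g.

Definition pow_one (G : groupType) (n : nat) : 'I_n -> G := fun=> 1%g.

(* (1, ..., 1, z, 1, ..., 1) with z in position i *)
Definition pow_in (G : groupType) (n : nat) (i : 'I_n) (z : G) : 'I_n -> G :=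
  fun j => if j == i then z else 1%g.

Definition pow_normal_subgroup (G : groupType) (n : nat)
    (K : set ('I_n -> G)) : Prop :=
  [/\ K (@pow_one G n),
      forall x y, K x -> K y -> K (pow_mul x y),
      forall x, K x -> K (pow_inv x) &
      forall x y, K x -> K (pow_mul (pow_inv y) (pow_mul x y))].

(* The normal subgroup of G^n generated by the relations
   (1, ..., z, ..., 1) ~ (1, ..., z, ..., 1), z central. *)
Definition central_relations (G : groupType) (n : nat) : set ('I_n -> G) :=
  [set x | forall K : set ('I_n -> G), pow_normal_subgroup K ->
     (forall (i j : 'I_n) (z : G), center z ->
        K (pow_mul (pow_in i z) (pow_inv (pow_in j z)))) ->
     K x].

(* [G'] is, as a Lie group, the quotient of [G^n] by [central_relations]; this
   determines [G'] up to isomorphism of Lie groups. *)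
Record is_central_product (R : realType) (G : groupTopType) (m : nat)
    (A : atlas G 'rV[R]_m) (n : nat) (G' : groupTopType) (m' : nat)
    (A' : atlas G' 'rV[R]_m') (proj : {ptws 'I_n -> G} -> G') : Prop :=
  IsCentralProduct {
  cp_morph : forall x y : 'I_n -> G, proj (pow_mul x y) = (proj x * proj y)%g;
  cp_surj : forall y : G', exists x : 'I_n -> G, proj x = y;
  cp_ker : forall x : 'I_n -> G,
    proj x = 1%g <-> @central_relations G n x;
  cp_quotient_topology : forall U : set G', open U <-> open (proj @^-1` U);
  cp_smooth : smooth_map (atlas_pow A n) A' proj
}.

(** * Riemannian metrics *)

(* The Gram matrix (g_ij) of the metric in each chart, as a function of the
   coordinates. *)
Definition metric (R : realType) (M : topologicalType) (m : nat)
    (A : atlas M 'rV[R]_m) := aidx A -> 'rV[R]_m -> 'M[R]_m.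

(* The inner product, at the point with coordinates [p] in the chart [i], of
   the tangent vectors with coordinates [v] and [w]. *)
Definition inner (R : realType) (M : topologicalType) (m : nat)
    (A : atlas M 'rV[R]_m) (h : metric A) (i : aidx A) (p v w : 'rV[R]_m) : R :=
  (v *m h i p *m w^T) 0 0.

Definition isometric_at (R : realType) (M : topologicalType) (m : nat)
    (A : atlas M 'rV[R]_m) (h : metric A) (f : M -> M) (x : M)
    (i j : aidx A) : Prop :=
  let p := chart_to (achart i) x in
  let q := chart_to (achart j) (f x) in
  let F := fun r : 'rV[R]_m =>
    chart_to (achart j) (f (chart_of (achart i) r)) in
  forall v w : 'rV[R]_m, inner h j q ('D_v F p) ('D_w F p) = inner h i p v w.

Definition isometric (R : realType) (M : topologicalType) (m : nat)
    (A : atlas M 'rV[R]_m) (h : metric A) (f : M -> M) : Prop :=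
  forall (x : M) (i j : aidx A), chart_dom (achart i) x ->
    chart_dom (achart j) (f x) -> isometric_at h f x i j.

(* That the identity is isometric is the change-of-coordinates rule for the
   matrices g_ij. *)
Record riemannian (R : realType) (M : topologicalType) (m : nat)
    (A : atlas M 'rV[R]_m) (h : metric A) : Prop := Riemannian {
  riem_smooth : forall i : aidx A, smooth_on (chart_cod (achart i)) (h i);
  riem_sym : forall (i : aidx A) (p : 'rV[R]_m),
    chart_cod (achart i) p -> (h i p)^T = h i p;
  riem_pos : forall (i : aidx A) (p v : 'rV[R]_m),
    chart_cod (achart i) p -> v != 0 -> 0 < inner h i p v v;
  riem_chart : isometric h id
}.

Definition left_invariant (R : realType) (G : groupTopType) (m : nat)
    (A : atlas G 'rV[R]_m) (h : metric A) : Prop :=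
  forall a : G, isometric h (fun x : G => (a * x)%g).

(** * Length, distance and area *)

(* Where a curve or a map of the plane is not differentiable, the values of
   [speed] and [jacobian] are meaningless; for the Lipschitz maps considered
   below this happens on a null set only. *)
Definition speed (R : realType) (M : topologicalType) (m : nat)
    (A : atlas M 'rV[R]_m) (h : metric A) (gamma : R -> M) (t : R) : R :=
  let i := prefc A (gamma t) in
  let phi := chart_to (achart i) in
  let v := 'D_1 (fun s : R => phi (gamma s)) t in
  Num.sqrt (inner h i (phi (gamma t)) v v).

Definition curve_length (R : realType) (M : topologicalType) (m : nat)
    (A : atlas M 'rV[R]_m) (h : metric A) (a b : R) (gamma : R -> M) : \bar R :=
  (\int[@lebesgue_measure R]_(t in `[a, b]) (speed h gamma t)%:E)%E.

Definition C1_curve (R : realType) (M : topologicalType) (m : nat)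
    (A : atlas M 'rV[R]_m) (gamma : R -> M) : Prop :=
  continuous gamma /\
  forall i : aidx A,
    Ck_on 1 (gamma @^-1` chart_dom (achart i))
      (fun t : R => chart_to (achart i) (gamma t)).

Definition riem_dist (R : realType) (M : topologicalType) (m : nat)
    (A : atlas M 'rV[R]_m) (h : metric A) (x y : M) : \bar R :=
  ereal_inf [set L | exists gamma : R -> M,
    [/\ C1_curve A gamma, gamma 0 = x, gamma 1 = y &
        L = curve_length h 0 1 gamma]].

Definition plane_dist (R : realType) (p q : R * R) : R :=
  Num.sqrt ((p.1 - q.1) ^+ 2 + (p.2 - q.2) ^+ 2).

Definition disc (R : realType) : set (R * R) :=
  [set p | p.1 ^+ 2 + p.2 ^+ 2 <= 1].

Definition circle (R : realType) : set (R * R) :=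
  [set p | p.1 ^+ 2 + p.2 ^+ 2 = 1].

(* Only the values of [f] on [S] matter; maps on the circle and on the disc are
   represented by maps on the plane. *)
Definition riem_lipschitz (R : realType) (M : topologicalType) (m : nat)
    (A : atlas M 'rV[R]_m) (h : metric A) (S : set (R * R))
    (f : R * R -> M) : Prop :=
  exists K : R, forall p q, S p -> S q ->
    (riem_dist h (f p) (f q) <= (K * plane_dist p q)%:E)%E.

Definition closed_curve_length (R : realType) (M : topologicalType) (m : nat)
    (A : atlas M 'rV[R]_m) (h : metric A) (f : R * R -> M) : \bar R :=
  curve_length h 0 (2 * pi) (fun t : R => f (cos t, sin t)).

Definition jacobian (R : realType) (M : topologicalType) (m : nat)
    (A : atlas M 'rV[R]_m) (h : metric A) (g : R * R -> M) (p : R * R) : R :=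
  let i := prefc A (g p) in
  let phi := chart_to (achart i) in
  let u := 'D_((1 : R), (0 : R)) (fun q : R * R => phi (g q)) p in
  let v := 'D_((0 : R), (1 : R)) (fun q : R * R => phi (g q)) p in
  let ip := inner h i (phi (g p)) in
  Num.sqrt (ip u u * ip v v - ip u v ^+ 2).

Definition disc_area (R : realType) (M : topologicalType) (m : nat)
    (A : atlas M 'rV[R]_m) (h : metric A) (g : R * R -> M) : \bar R :=
  (\int[@lebesgue_measure R \x @lebesgue_measure R]_(p in @disc R)
     (jacobian h g p)%:E)%E.

(** * Dehn functions *)

Definition filling_area (R : realType) (M : topologicalType) (m : nat)
    (A : atlas M 'rV[R]_m) (h : metric A) (f : R * R -> M) : \bar R :=
  ereal_inf [set a | exists g : R * R -> M,
    [/\ riem_lipschitz h (@disc R) g,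
        forall p, circle p -> g p = f p &
        a = disc_area h g]].

Definition dehn (R : realType) (M : topologicalType) (m : nat)
    (A : atlas M 'rV[R]_m) (h : metric A) (l : R) : \bar R :=
  ereal_sup [set a | exists f : R * R -> M,
    [/\ riem_lipschitz h (@circle R) f,
        (closed_curve_length h f <= l%:E)%E &
        a = filling_area h f]].

(* The left-hand side is allowed to take the value +oo, so that the relation
   includes its finiteness. *)
Definition precsim (R : realType) (f : R -> \bar R) (g : R -> R) : Prop :=
  exists2 c : R, 0 < c &
    forall x : R, 0 <= x ->
      (f x <= (c * g (c * x + c) + c * x + c)%:E)%E.

(* Main.v *)
(* In exponential coordinates G' is a vector space E with the product
   x + y + be(x, y)/2, where E is spanned by n >= 2 copies of the Lie algebra of
   G which commute with each other but have the same commutators.  A loop of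
   length l is cut at two points; the two halves become words of O(l) letters
   of bounded size with equal products, and the area of a homotopy between two
   words is controlled through the left-invariant metric.

   Consider words depending on a parameter, with letters of size lambda, up to
   homotopies of area O(lambda^2).  They form a group in which commuting letters
   commute.  If p, q lie in one copy and p', q' in another and [p, q] = [p', q'],
   then p + p' and q - q' commute, so the commutator word of p and q can be
   moved to the other copy; it is therefore central, bilinear, and depends only
   on its value.  By dyadic subdivision a word of length 2^k with trivial product
   is brought to a central normal form Z_k(M) at total cost O(4^k), as the
   costs 4^j 2^(k-j) of the levels form a geometric series.  Since Z_k(M) is
   equivalent to Z_{k-1}(M/4)^4 at cost O(4^k), filling it costs O(4^k) at
   each of k levels, which gives the factor log l. *)

Require Import Defs.
From HB Require Import structures.
From mathcomp Require Import all_boot all_order all_algebra.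
From mathcomp Require Import all_classical all_reals all_analysis.
From mathcomp Require measurable_realfun.
From mathcomp Require Import ring lra zify.
Set Implicit Arguments.
Unset Strict Implicit.
Unset Printing Implicit Defensive.
Import Order.TTheory GRing.Theory Num.Theory.
Import numFieldNormedType.Exports.
Local Open Scope classical_set_scope.
Local Open Scope ring_scope.

(** * Identities in abelian groups by reflection *)

(** The definitions of length and area integrate functions that are not known to be measurable and
    that take default values where a derivative fails to exist; what remains usable is monotonicity
    and superadditivity of the integral. A homotopy therefore carries a finite list of rectangles
    with constant jacobian bounds, valid off finitely many horizontal and vertical lines. Areas of
    glued homotopies are then finite sums, and the area integral is estimated only once, for the
    final disc. Global coordinates on [G'] come from those on [G]: simple connectedness makes the
    exponential map of [G] bijective, and in its coordinates the kernel of the projection from [G^n]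
    is a linear subspace. The exponential map itself is built from limits of powers; two-step
    nilpotency makes the commutator with a fixed element a homomorphism, and this homomorphism
    yields the bracket. The distance is an infimum over C^1 curves. A Lipschitz loop must first be
    shown to be Lipschitz in the coordinates; only then does its length control the letters of an
    inscribed polygon, whose number of sides depends on the loop and has to be reduced to a multiple
    of the length. *)

Inductive zterm := ZVar of nat | ZAdd of zterm & zterm | ZOpp of zterm | ZZero.

Fixpoint zeval (V : zmodType) (e : seq V) (t : zterm) : V :=
  match t with
  | ZVar i => e`_i
  | ZAdd a b => zeval e a + zeval e b
  | ZOpp a => - zeval e a
  | ZZero => 0
  end.

Fixpoint zcoef (t : zterm) (i : nat) : int :=
  match t with
  | ZVar j => if i == j then 1 else 0
  | ZAdd a b => zcoef a i + zcoef b i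
  | ZOpp a => - zcoef a i
  | ZZero => 0
  end.

Fixpoint zclosed (n : nat) (t : zterm) : bool :=
  match t with
  | ZVar j => (j < n)%N
  | ZAdd a b => zclosed n a && zclosed n b
  | ZOpp a => zclosed n a
  | ZZero => true
  end.

Lemma zevalE (V : zmodType) (e : seq V) t : zclosed (size e) t ->
  zeval e t = \sum_(i < size e) e`_i *~ zcoef t i.
Proof.
elim: t => [j|a IHa b IHb|a IHa|] /=.
- move=> je; rewrite (bigD1 (Ordinal je)) //= eqxx mulr1z big1 ?addr0// => i.
  by rewrite -val_eqE /= => /negPf ->; rewrite mulr0z.
- move=> /andP[/IHa -> /IHb ->]; rewrite -big_split /=.
  by apply: eq_bigr => i _; rewrite mulrzDr.
- by move=> /IHa ->; rewrite -sumrN; apply: eq_bigr => i _; rewrite mulrNz.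
- by move=> _; rewrite big1// => i _; rewrite mulr0z.
Qed.

(** Agreement of the integer coefficients of all atoms is decided by computation, so a proof by
    reflection ends with [isT]. *)
Definition zcheck (n : nat) (a b : zterm) : bool :=
  [&& zclosed n a, zclosed n b & all (fun i => zcoef a i == zcoef b i) (iota 0 n)].

Lemma zcheckP (V : zmodType) (e : seq V) a b :
  zcheck (size e) a b -> zeval e a = zeval e b.
Proof.
move=> /and3P[ca cb /allP h]; rewrite !zevalE//; apply: eq_bigr => i _.
by congr (_ *~ _); apply/eqP/h; rewrite mem_iota /= add0n.
Qed.

(** Two subterms are the same atom if they are syntactically equal, for [zmod], or if they unify,
    for [zmodc]. The second is needed for atoms which rewriting has left in convertible but
    different forms. *)
Ltac zsame_syn x y := constr_eq_strict x y.
Ltac zsame_conv x y := unify x y with typeclass_instances.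
Ltac zmem same x e :=
  lazymatch e with
  | @nil _ => constr:(false)
  | @cons _ ?y ?e' => match constr:(Set) with
     | _ => let _ := match constr:(Set) with _ => same x y end in constr:(true)
     | _ => zmem same x e'
     end
  end.
Ltac zadd same x e := let b := zmem same x e in
  lazymatch b with true => e | false => constr:(@cons _ x e) end.
Ltac zatoms same t e :=
  lazymatch t with
  | (?a + ?b)%R => let e1 := zatoms same a e in zatoms same b e1
  | (- ?a)%R => zatoms same a e
  | 0%R => e
  | ?a => zadd same a e
  end.
Ltac zidx same x e :=
  lazymatch e with
  | @cons _ ?y ?e' => match constr:(Set) with
     | _ => let _ := match constr:(Set) with _ => same x y end in constr:(O)
     | _ => let n := zidx same x e' in constr:(S n)
     end
  end.
Ltac zreify same t e :=
  lazymatch t with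
  | (?a + ?b)%R => let x := zreify same a e in let y := zreify same b e in constr:(ZAdd x y)
  | (- ?a)%R => let x := zreify same a e in constr:(ZOpp x)
  | 0%R => constr:(ZZero)
  | ?a => let n := zidx same a e in constr:(ZVar n)
  end.
Ltac zmod_gen same :=
  lazymatch goal with
  | |- @eq ?T ?a ?b =>
    let e0 := constr:(@nil T) in
    let e1 := zatoms same a e0 in
    let e := zatoms same b e1 in
    let x := zreify same a e in
    let y := zreify same b e in
    exact (@zcheckP _ e x y isT)
  end.
Ltac zmod := zmod_gen zsame_syn.
Ltac zmodc := zmod_gen zsame_conv.

(** * Integration without measurability and Lipschitz functions *)

Lemma clamp_le (R : realDomainType) (a b x y : R) : x <= y ->
  Num.max a (Num.min x b) <= Num.max a (Num.min y b) /\
  Num.max a (Num.min y b) - Num.max a (Num.min x b) <= y - x.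
Proof.
by move=> xy; rewrite /Num.max /Num.min; do 4!(case: ifPn; rewrite -?leNgt); split; lra.
Qed.

Lemma point_rV (R : realType) (m n : nat) : (point : 'M[R]_(m, n)) = 0.
Proof. by apply/matrixP => i j; rewrite !mxE; cbv. Qed.

(** A limit that does not exist evaluates to [point], which is the zero matrix here; a missing
    derivative thus makes the jacobian vanish rather than become arbitrary. *)
Lemma derive_dvg (R : realType) (V : normedModType R) (m n : nat)
    (f : V -> 'M[R]_(m, n)) (x v : V) : ~ derivable f x v -> 'D_v f x = 0.
Proof.
move=> ndf; rewrite -point_rV /derive /lim /lim_in getPN// => l fl.
by apply: ndf; apply/cvg_ex; exists l.
Qed.

(* The integral of a nonnegative function is a supremum over simple functions,
   so monotonicity needs no measurability. *)
Lemma le_integral_nonmeas d (T : measurableType d) (R : realType)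
    (mu : {measure set T -> \bar R}) (D : set T) (f g : T -> \bar R) :
  (forall x, D x -> 0 <= f x)%E -> (forall x, D x -> f x <= g x)%E ->
  (\int[mu]_(x in D) f x <= \int[mu]_(x in D) g x)%E.
Proof.
move=> f0 fg; have g0 x : D x -> (0 <= g x)%E.
  by move=> Dx; apply: le_trans (fg _ Dx); exact: f0.
rewrite !ge0_integralE//; apply: le_ereal_sup => _ [h /= hf <-].
exists h => //= x; apply: le_trans (hf x) _.
by rewrite /patch; case: ifPn => // /set_mem; exact: fg.
Qed.

Section lipschitz_ftc.
Variable R : realType.
Notation leb := (@lebesgue_measure R).

(** Both measures are infima over the same covers by half-open intervals, and on a single such
    interval the inequality is the Lipschitz bound. *)
Lemma LS_lipschitz (g : cumulative R R) (K : R) : 0 < K ->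
  (forall x y, x <= y -> g y - g x <= K * (y - x)) ->
  forall A, (lebesgue_stieltjes_measure g A <= K%:E * leb A)%E.
Proof.
move=> K0 gK A.
rewrite /lebesgue_measure /lebesgue_stieltjes_measure /measure_extension /mu_ext.
rewrite -ereal_inf_pZl//; apply: le_ereal_inf_tmp => _ /= [_ [C mC <-] <-].
apply: (@le_trans _ _ (\sum_(k <oo) wlength g (C k))%E).
  by apply: ereal_inf_lbound; exists C.
rewrite -nneseriesZl; last by move=> *; exact: wlength_ge0.
apply: lee_nneseries => [i _ _|k _]; first exact: wlength_ge0.
have [/(_ k) /ocitvP [->|[[x y] /= xy ->]] _] := mC.
  by rewrite !wlength0 mule0.
rewrite !wlength_itv_bnd ?(ltW xy)//= lee_fin; exact: gK (ltW xy).
Qed.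

(** For large [L] the function [F x + L * x] is nondecreasing, and its Stieltjes measure is at most
    [2 * L] times Lebesgue measure. Its Radon-Nikodym density minus [L] is the derivative of [F]
    almost everywhere by Lebesgue differentiation, and integrates to the increment of [F]. *)
Lemma lipschitz_ftc (F : R -> R) (K a b : R) : a < b ->
  (forall x y, `|F x - F y| <= K * `|x - y|) ->
  exists phi : R -> R, [/\ leb.-integrable `[a, b] (EFin \o phi),
    {ae leb, forall x, x \in `]a, b[ -> derivable F x 1 /\ 'D_1 F x = phi x} &
    F b - F a = (\int[leb]_(x in `[a, b]) phi x)%R].
Proof.
move=> ab FK.
have K0 : 0 <= K.
  rewrite -(pmulr_lge0 _ (_ : 0 < `|a - b|)).
    by apply: le_trans (FK a b).
  by rewrite normr_gt0 subr_eq0 lt_eqF.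
pose L := K + 1.
have L0 : 0 < L by rewrite /L; lra.
have FL x y : x <= y -> `|F y - F x| <= L * (y - x).
  move=> xy; apply: le_trans (FK _ _) _; rewrite ger0_norm ?subr_ge0//.
  by rewrite ler_wpM2r ?subr_ge0// /L; lra.
pose G x := F x + L * x.
have Gnd : {homo G : x y / x <= y}.
  move=> x y xy; have := FL _ _ xy; rewrite ler_norml => /andP[+ _].
  by rewrite /G; lra.
have cF : continuous F.
  move=> x; apply/cvgrPdist_le => e e0.
  near=> y; apply: le_trans (FK _ _) _.
  have : `|x - y| <= e / L.
    near: y; apply: cvgr_dist_le; first exact: cvg_id.
    by rewrite divr_gt0.
  rewrite ler_pdivlMr// mulrC; apply: le_trans.
  by rewrite ler_wpM2r// /L; lra.
have cG : continuous G.
  move=> x; apply: continuousD; first exact: cF.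
  by apply: continuousM; [exact: cst_continuous|move=> ?; exact: cvg_id].
have Grc : right_continuous G by move=> x; exact/cvg_at_right_filter/cG.
pose g : cumulative R R := HB.pack G (isCumulative.Build R _ R G Gnd Grc).
have gL : forall x y, x <= y -> g y - g x <= (2 * L) * (y - x).
  move=> x y xy; have := FL _ _ xy; rewrite ler_norml => /andP[_].
  by rewrite /g /= /G; lra.
have nule := LS_lipschitz (mulr_gt0 (ltr0n _ 2) L0) gL.
pose D : set (measurableTypeR R) := `]a, b]%classic.
have mD : measurable D by exact: measurable_itv.
have nuD : (lebesgue_stieltjes_measure g D < +oo)%E.
  apply: le_lt_trans (nule D) _.
  by rewrite /D lebesgue_measure_itv /= lte_fin ab -EFinB -EFinM ltry.
(* The density is taken of a finite measure, hence the restriction to []a, b]]. *)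
pose nu := mfrestr mD nuD.
have nuleb : (nu `<< leb).
  apply/null_content_dominatesP => A mA A0.
  apply/eqP; rewrite eq_le measure_ge0 andbT.
  apply: (@le_trans _ _ (lebesgue_stieltjes_measure g A)).
    by apply: le_measure; rewrite ?inE//; exact: measurableI.
  by apply: le_trans (nule A) _; rewrite A0 mule0.
pose psi x := fine (Radon_Nikodym (charge_of_finite_measure nu) leb x).
have fpsi x : (psi x)%:E = Radon_Nikodym (charge_of_finite_measure nu) leb x.
  by rewrite /psi fineK//; exact: Radon_Nikodym_fin_num.
have ipsi : leb.-integrable setT (EFin \o psi).
  rewrite (_ : EFin \o psi = Radon_Nikodym (charge_of_finite_measure nu) leb).
    exact: Radon_Nikodym_integrable.
  by apply/funext => x /=; rewrite fpsi.
have iS (A : set (measurableTypeR R)) : measurable A ->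
    leb.-integrable A (EFin \o psi).
  by move=> mA; exact: (integrableS measurableT mA (@subsetT _ _) ipsi).
have nuE A : measurable A -> nu A = (\int[leb]_(x in A) (psi x)%:E)%E.
  move=> mA; rewrite -[LHS]/(charge_of_finite_measure nu A).
  rewrite (@Radon_Nikodym_integral _ _ _ (charge_of_finite_measure nu) leb A nuleb mA).
  by apply: eq_integral => x _; rewrite fpsi.
have Gint t : a <= t <= b -> G t = G a + \int[leb]_(x in `]a, t]) psi x.
  move=> /andP[at_ tb].
  have mt : measurable (`]a, t]%classic : set (measurableTypeR R)).
    exact: measurable_itv.
  have : nu `]a, t]%classic = (G t - G a)%:E.
    rewrite /nu /mfrestr /mrestr /= (_ : `]a, t] `&` D = `]a, t]%classic).
      rewrite /lebesgue_stieltjes_measure /measure_extension measurable_mu_extE/=.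
        by rewrite wlength_itv_bnd.
      exact: is_ocitv.
    apply/seteqP; split => x /=; first by case.
    rewrite /D /= !in_itv /= => /andP[ax xt]; rewrite ax xt.
    by split => //; exact: le_trans tb.
  rewrite nuE// /Rintegral => -> /=.
  by rewrite addrC subrK.
have locpsi : locally_integrable setT psi.
  split => //; first by apply/measurable_realfun.measurable_EFinP; exact: measurable_int ipsi.
    exact: openT.
  move=> C _ cC.
  have mC : measurable C by apply: measurable_realfun.compact_measurable.
  by have /integrableP[_] := iS _ mC.
have ftc := @FTC1 R psi (BRight a)
  (fun y => iS _ (measurable_itv _)) locpsi.
have mab : measurable (`[a, b]%classic : set (measurableTypeR R)).
  exact: measurable_itv.
have icst : leb.-integrable `[a, b] (EFin \o (fun=> L)).
  apply/integrableP; split.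
    by apply/measurable_realfun.measurable_EFinP; exact: measurable_cst.
  rewrite (_ : (fun x => _) = cst `|L|%:E)//.
  rewrite integral_cst; last exact: measurable_itv.
  change (`|L|%:E * leb `[a, b]%classic < +oo)%E.
  by rewrite lebesgue_measure_itv /= lte_fin ab -EFinB -EFinM ltry.
exists (fun x => psi x - L); split.
- rewrite (_ : EFin \o _ = ((EFin \o psi) \- (EFin \o (fun=> L)))%E)//.
  exact: (integrableB mab (iS _ mab) icst).
- apply: (@filterS _ _ (ae_filter_ringOfSetsType leb) _ _ _ ftc) => x /= H; rewrite in_itv /= => /andP[ax xb].
  have [dP] : _ /\ _ := H ax; rewrite derive1E => PE.
  have nearF : \forall y \near x,
      G a + \int[leb]_(t in `]a, y]) psi t - L * y = F y.
    near=> y; rewrite -Gint; last first.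
      apply/andP; split; apply/ltW; near: y.
        exact: lt_nbhsr. 
      exact: lt_nbhsl.
    by rewrite /G; ring.
  have dF : is_derive x 1 F (psi x - L).
    apply: near_eq_is_derive nearF _.
    have -> : psi x - L = 0 + psi x - L * 1 by ring.
    apply: is_deriveB.
    apply: is_deriveD.
    apply: DeriveDef => //.
  by split; [exact: ex_derive|apply: derive_val].
- have ipab := iS _ (measurable_itv `[a, b]).
  rewrite (RintegralB mab ipab icst).
  rewrite Rintegral_cst; last exact: measurable_itv.
  rewrite -Rintegral_itv_obnd_cbnd; last first.
    exact: iS (measurable_itv _).
  have := Gint b; rewrite (ltW ab) lexx => /(_ isT).
  rewrite -[X in fine X]/(leb `[a, b]%classic).
  rewrite lebesgue_measure_itv /= lte_fin ab /= /G => GE.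
  by move: GE; lra.
Unshelve. all: by end_near. Qed.

Lemma lipschitz_extend (F : R -> R) (K a b : R) : a < b ->
  (forall x y, a <= x <= b -> a <= y <= b -> `|F x - F y| <= K * `|x - y|) ->
  exists2 F' : R -> R, (forall x y, `|F' x - F' y| <= K * `|x - y|) &
    forall x, a <= x <= b -> F' x = F x.
Proof.
move=> ab FK.
pose c x := Num.max a (Num.min b x).
have cab x : a <= c x <= b.
  by rewrite /c le_max lexx /= ge_max (ltW ab) ge_min lexx.
have c1 x y : `|c x - c y| <= `|x - y|.
  wlog xy : x y / x <= y.
    move=> h; have [|/ltW yx] := leP x y; first exact: h.
    by rewrite distrC [leRHS]distrC; exact: h.
  rewrite [leRHS]distrC [leLHS]distrC [leRHS]ger0_norm ?subr_ge0//.
  have [cxy h] := clamp_le a b xy; rewrite ![Num.min _ b]minC in cxy h.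
  by rewrite ger0_norm ?subr_ge0.
have K0 : 0 <= K.
  rewrite -(pmulr_lge0 _ (_ : 0 < `|a - b|)).
    by apply: le_trans (FK a b _ _) => //; rewrite lexx (ltW ab).
  by rewrite normr_gt0 subr_eq0 lt_eqF.
exists (F \o c) => [x y|x /andP[ax xb]].
  by apply: le_trans (FK _ _ _ _) _ => //; rewrite ler_wpM2l.
by rewrite /= /c (min_r xb) max_r.
Qed.

Lemma near_itv (a b x : R) : a < x < b -> \forall y \near x, a <= y <= b.
Proof.
move=> /andP[ax xb]; near=> y; apply/andP; split; apply/ltW; near: y.
  exact: lt_nbhsr.
exact: lt_nbhsl.
Unshelve. all: by end_near. Qed.

Lemma lipschitz_ae_derivable (F : R -> R) (K a b : R) : a < b ->
  (forall x y, a <= x <= b -> a <= y <= b -> `|F x - F y| <= K * `|x - y|) ->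
  leb.-negligible [set x | a < x < b /\ ~ derivable F x 1].
Proof.
move=> ab /(lipschitz_extend ab)[F' F'K F'F].
have [phi [_ [N [mN N0 Nsub]] _]] := lipschitz_ftc ab F'K.
exists N; split => // x /= [xab nd]; apply: Nsub => /= h; apply: nd.
have [] := h; first by rewrite in_itv.
move=> dF' _.
have nF : \forall y \near x, F' y = F y by apply: filterS (near_itv xab) => y /F'F.
exact: near_eq_derivable dF'.
Qed.

(** The bound [s] need not be measurable. The null set is therefore removed from the integral of the
    measurable density [|phi|], and [s] enters afterwards, by monotonicity alone. *)
Lemma lipschitz_ftc_le (F : R -> R) (K a b : R) (s : R -> R) (N1 : set R) : a < b ->
  (forall x y, a <= x <= b -> a <= y <= b -> `|F x - F y| <= K * `|x - y|) ->
  leb.-negligible N1 ->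
  (forall x, a < x < b -> ~ N1 x -> derivable F x 1 -> `|'D_1 F x| <= s x) ->
  (forall x, 0 <= s x) ->
  (`|F b - F a|%:E <= \int[leb]_(x in `]a, b[) (s x)%:E)%E.
Proof.
move=> ab FK [M [mM M0 M1]] Fs s0.
have [F' F'K F'F] := lipschitz_extend ab FK.
have [phi [iphi aephi Fphi]] := lipschitz_ftc ab F'K.
move: Fphi; rewrite !F'F ?lexx ?(ltW ab)// => ->.
have mab : measurable (`[a, b]%classic : set (measurableTypeR R)).
  exact: measurable_itv.
apply: (@le_trans _ _ (\int[leb]_(x in `[a, b]) `|phi x|%:E)%E).
  rewrite /Rintegral -abse_EFin fineK; last first.
    by apply: integrable_fin_num iphi; exact: measurable_itv.
  exact: le_trans (le_abse_integral _ mab (measurable_int _ iphi)) _.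
have [N2 [mN2 N20 Nsub]] := aephi.
pose N := N2 `|` M.
have mN : measurable N by exact: measurableU.
have N0 : leb N = 0.
  apply/eqP; rewrite eq_le measure_ge0 andbT.
  apply: (le_trans (measureU2 leb mN2 mM)).
  have -> : (leb N2 + leb M = 0)%E by rewrite N20 M0 adde0.
  by [].
have mphi := measurable_int _ (integrable_abse iphi).
pose N' := N `|` [set a; b].
have mN' : measurable N' by apply: measurableU => //; exact: measurableU.
have N'0 : leb N' = 0.
  apply/eqP; rewrite eq_le measure_ge0 andbT.
  have m2 : measurable ([set a; b] : set (measurableTypeR R)).
    exact: measurableU.
  have E2 : (leb [set a; b] <= 0)%E.
    apply: (le_trans (measureU2 leb (measurable_set1 a) (measurable_set1 b))).
    have -> : (leb [set a] + leb [set b] = 0)%E.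
      by rewrite !lebesgue_measure_set1 adde0.
    by [].
  apply: (le_trans (measureU2 leb mN m2)).
  have -> : (leb N + leb [set a; b] = leb [set a; b])%E by rewrite N0 add0e.
  exact: E2.
have -> : (\int[leb]_(x in `[a, b]) `|phi x|%:E =
    \int[leb]_(x in `[a, b] `\` N') `|phi x|%:E)%E.
  exact: (ge0_negligible_integral mN' mab mphi (fun x _ => abse_ge0 _) N'0).
apply: (@le_trans _ _ (\int[leb]_(x in `[a, b] `\` N') (s x)%:E)%E).
  apply: le_integral_nonmeas => // x [xab xN']; rewrite ?lee_fin//.
  have {}xab : a < x < b.
    move: xab; rewrite /= in_itv /= => /andP[].
    rewrite !le_eqVlt => /orP[/eqP ax|->]; first by case: xN'; right; left.
    by move=> /orP[/eqP xb|->]//; case: xN'; right; right.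
  have [dF FE] : derivable F' x 1 /\ 'D_1 F' x = phi x.
    by apply: contrapT => h; apply: xN'; left; left; apply: Nsub => /=; move/(_ _); apply/not_implyP; split.
  have nF : \forall y \near x, F' y = F y.
    by apply: filterS (near_itv xab) => y /F'F.
  have xM : ~ N1 x by move=> /M1 h; apply: xN'; left; right.
  rewrite -FE (near_eq_derive _ nF); apply: Fs => //.
  exact: near_eq_derivable dF.
rewrite [leLHS]integral_mkcond [leRHS]integral_mkcond.
apply: le_integral_nonmeas => x _.
  by rewrite /patch; case: ifP => // _; rewrite lee_fin.
rewrite /patch; case: ifPn => [|_].
  move=> /set_mem[xab xN']; rewrite ifT//; apply/mem_set.
  move: xab; rewrite /= !in_itv /= => /andP[].
  rewrite !le_eqVlt => /orP[/eqP ax|->]; first by case: xN'; right; left.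
  by move=> /orP[/eqP xb|->]//; case: xN'; right; right.
by case: ifP => // _; rewrite lee_fin.
Unshelve. all: by end_near. Qed.
End lipschitz_ftc.

(** * Strict derivatives *)

Section mx_norm_entries.
Variables (R : realType) (m n : nat).
Implicit Type M : 'M[R]_(m, n).

Lemma mx_entry_le M i j : `|M i j| <= `|M|.
Proof.
rewrite [leRHS]mx_normrE.
by apply: (le_bigmax_cond _ (fun ij : 'I_m * 'I_n => `|M ij.1 ij.2|) (j := (i, j))).
Qed.

Lemma mx_norm_leP M (e : R) : 0 <= e ->
  (forall i j, `|M i j| <= e) <-> `|M| <= e.
Proof.
move=> e0; split => [h|h i j]; last exact: le_trans (mx_entry_le _ _ _) h.
rewrite [leLHS]mx_normrE; apply: bigmax_le => // -[i j] _; exact: h.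
Qed.

Lemma delta_mx_norm (i : 'I_m) (j : 'I_n) : `|delta_mx i j : 'M[R]_(m, n)| <= 1.
Proof.
apply/mx_norm_leP => // a b; rewrite mxE.
by case: (_ && _); rewrite ?normr1 ?normr0.
Qed.
End mx_norm_entries.

Section eps_derivative.
Variable R : realType.

(** The derivative of a curve as a relation: no default value interferes, and the increment [h = 0]
    may be included, which makes changes of parameter painless. *)
Definition dv (W : normedModType R) (c : R -> W) (t : R) (u : W) :=
  forall e, 0 < e -> exists2 d, 0 < d &
    forall h, `|h| < d -> `|c (t + h) - c t - h *: u| <= e * `|h|.

Lemma derive_dvP (V W : normedModType R) (f : V -> W) (p v : V) (u : W) :
  dv (fun s => f (s *: v + p)) 0 u <-> derivable f p v /\ 'D_v f p = u.
Proof.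
split=> [du|[df <-] e e0].
  suff cv : h^-1 *: ((f \o shift p) (h *: v) - f p) @[h --> 0^'] --> u.
    by split; [apply/cvg_ex; exists u|exact: cvg_lim cv].
  apply/cvgrPdist_le => e e0; have [d d0 dP] := du _ e0.
  near=> h; have h0 : h != 0 by near: h; exact: nbhs_dnbhs_neq.
  have hd : `|h| < d.
    near: h; apply: dnbhs0_lt => //.
  have := dP _ hd; rewrite add0r scale0r add0r => H.
  rewrite /= distrC -(ler_pM2l (_ : 0 < `|h|)) ?normr_gt0//.
  rewrite -normrZ scalerBr scalerA mulfV// scale1r (mulrC _ e).
  exact: H.
have : h^-1 *: ((f \o shift p) (h *: v) - f p) @[h --> 0^'] --> 'D_v f p by [].
move=> /cvgrPdist_le /(_ e e0) -[d /= d0 dP]; exists d => // h hd.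
have [->|h0] := eqVneq h 0.
  by rewrite addr0 subrr scale0r subr0 !normr0 mulr0.
have := dP h; rewrite /= sub0r normrN => /(_ hd h0).
rewrite distrC -(ler_pM2l (_ : 0 < `|h|)) ?normr_gt0//.
rewrite -normrZ scalerBr scalerA mulfV// scale1r (mulrC _ e).
by rewrite add0r scale0r add0r.
Unshelve. all: by end_near. Qed.

Lemma dv_derive (W : normedModType R) (c : R -> W) (t : R) (u : W) :
  dv c t u <-> derivable c t 1 /\ 'D_1 c t = u.
Proof.
have E (z : R) : (z *: (1 : R^o) + t) = t + z.
  by rewrite /GRing.scale/= mulr1 addrC.
rewrite -derive_dvP; split => h e e0; have [d d0 dP] := h e e0; exists d => // s /dP.
  by rewrite !E add0r addr0.
by rewrite !E add0r addr0.
Qed.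

Lemma dv_unique (W : normedModType R) (c : R -> W) t u v :
  dv c t u -> dv c t v -> u = v.
Proof. by move=> /dv_derive[_ <-] /dv_derive[_ <-]. Qed.

Lemma dv_cont (W : normedModType R) (c : R -> W) t u : dv c t u ->
  forall e, 0 < e -> exists2 d, 0 < d & forall h, `|h| < d ->
    `|c (t + h) - c t| <= e.
Proof.
move=> du e e0; have [d d0 dP] := du 1 ltr01.
exists (Num.min d (e / (1 + `|u|))).
  by rewrite lt_min d0 divr_gt0// ltr_pwDl.
move=> h; rewrite lt_min => /andP[hd]; rewrite ltr_pdivlMr ?ltr_pwDl// => he.
rewrite -[_ - _](subrK (h *: u)); apply: le_trans (ler_normD _ _) _.
apply: le_trans (lerD (dP _ hd) (lexx _)) _.
by rewrite normrZ mul1r -{1}[`|h|]mulr1 -mulrDr ltW.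
Qed.

Lemma dv_eq (W : normedModType R) (c c' : R -> W) t u :
  (\forall s \near t, c s = c' s) -> dv c t u -> dv c' t u.
Proof.
move=> [d /= d0 dP] du e e0; have [d1 d10 d1P] := du e e0.
exists (Num.min d d1); first by rewrite lt_min d0.
move=> h; rewrite lt_min => /andP[hd hd1].
rewrite -!dP /= ?subrr ?normr0//; first exact: d1P.
by rewrite opprD addNKr normrN.
Qed.

Lemma dv_shift (W : normedModType R) (c : R -> W) t u :
  dv c t u <-> dv (fun s => c (t + s)) 0 u.
Proof.
by split => h e e0; have [d d0 dP] := h e e0; exists d => // s /dP;
  rewrite add0r addr0.
Qed.

Lemma dv_mxP m n (c : R -> 'M[R]_(m, n)) t u :
  dv c t u <-> forall i j, dv (fun s => c s i j) t (u i j).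
Proof.
split=> [h i j e e0|h e e0].
  have [d d0 dP] := h e e0; exists d => // s /dP; apply: le_trans.
  by have := mx_entry_le (c (t + s) - c t - s *: u) i j; rewrite !mxE.
have /choice[d dP] : forall ij : 'I_m * 'I_n, exists d : R, 0 < d /\
    forall s, `|s| < d -> `|c (t + s) ij.1 ij.2 - c t ij.1 ij.2 - s *: u ij.1 ij.2|
       <= e * `|s|.
  by move=> [i j]; have [d d0 dP] := h i j e e0; exists d; split.
exists (\big[Num.min/1]_ij d ij).
  by apply: lt_bigmin => // ij _; have [] := dP ij.
move=> s sd; apply/mx_norm_leP; first by rewrite mulr_ge0// ltW.
move=> i j; rewrite !mxE; have [_] := dP (i, j); apply.
by apply: lt_le_trans sd _; exact: bigmin_le_cond.
Qed.

End eps_derivative.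

Section mvt.
Variable R : realType.

Lemma mvt_scalar (c dc : R -> R) (w e a b : R) : a <= b ->
  (forall t, a <= t <= b -> dv c t (dc t)) ->
  (forall t, a <= t <= b -> `|dc t - w| <= e) ->
  `|c b - c a - (b - a) * w| <= e * (b - a).
Proof.
move=> ab cd ce.
have h1 x : x \in `]a, b[ -> is_derive x 1 c (dc x).
  rewrite in_itv /= => /andP[ax xb].
  have /cd/dv_derive[dx <-] : a <= x <= b by rewrite !ltW.
  exact: DeriveDef.
have h2 : {within `[a, b], continuous c}.
  apply: derivable_within_continuous => x; rewrite in_itv /= => xab.
  by have /dv_derive[] := cd x xab.
have [x xab E] := MVT_segment ab h1 h2.
rewrite E (mulrC (b - a)) -mulrBl normrM (ger0_norm (_ : 0 <= b - a)) ?subr_ge0//.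
rewrite ler_wpM2r ?subr_ge0// ce//.
Qed.

Lemma mvt_vec m n (c dc : R -> 'M[R]_(m, n)) (w : 'M[R]_(m, n)) (e a b : R) : a <= b ->
  (forall t, a <= t <= b -> dv c t (dc t)) ->
  (forall t, a <= t <= b -> `|dc t - w| <= e) ->
  `|c b - c a - (b - a) *: w| <= e * (b - a).
Proof.
move=> ab cd ce; have e0 : 0 <= e.
  by apply: le_trans (normr_ge0 (dc a - w)) _; apply: ce; rewrite lexx ab.
apply/mx_norm_leP; first by rewrite mulr_ge0// subr_ge0.
move=> i j; rewrite !mxE.
apply: (@mvt_scalar (fun t => c t i j) (fun t => dc t i j)) => //.
  by move=> t /cd/dv_mxP.
move=> t /ce; apply: le_trans.
by have := mx_entry_le (dc t - w) i j; rewrite !mxE.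
Qed.

Lemma mvt_dir (V : normedModType R) m n (f : V -> 'M[R]_(m, n)) (x v : V)
    (w : 'M[R]_(m, n)) (e : R) :
  (forall t, 0 <= t <= 1 -> derivable f (x + t *: v) v) ->
  (forall t, 0 <= t <= 1 -> `|'D_v f (x + t *: v) - w| <= e) ->
  `|f (x + v) - f x - w| <= e.
Proof.
move=> df De.
have := @mvt_vec m n (fun t => f (x + t *: v)) (fun t => 'D_v f (x + t *: v)) w e 0 1 ler01.
rewrite scale1r scale0r addr0 subr0 scale1r mulr1; apply => //.
move=> t /df dt; apply/dv_shift.
have /derive_dvP : derivable f (x + t *: v) v /\ 'D_v f (x + t *: v) = 'D_v f (x + t *: v) by [].
move=> h e1 e10; have [d d0 dP] := h e1 e10; exists d => // s /dP.
have E z : x + (t + z) *: v = z *: v + (x + t *: v).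
  by rewrite scalerDl addrA addrC.
by rewrite !E !add0r scale0r !add0r.
Qed.
End mvt.

Section partial_derivatives.
Variable R : realType.

Lemma dv_scale (W : normedModType R) (c : R -> W) (a : R) (u : W) :
  dv c 0 u -> dv (fun s => c (a * s)) 0 (a *: u).
Proof.
move=> cu e e0; have [d d0 dP] := cu (e / (1 + `|a|)) (divr_gt0 e0 (ltr_pwDl ltr01 (normr_ge0 _))).
have a1 : 0 < 1 + `|a| by rewrite ltr_pwDl.
exists (d / (1 + `|a|)); first exact: divr_gt0.
move=> h; rewrite ltr_pdivlMr// => hd.
have := dP (a * h); rewrite !add0r mulr0 scalerA [h * a]mulrC => H.
apply: (le_trans (H _)).
  rewrite normrM mulrC; apply: le_lt_trans hd; rewrite ler_wpM2l//; lra.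
rewrite normrM -mulrA ler_wpM2l ?(ltW e0)// mulrA ler_piMl//.
by rewrite mulrC ler_pdivrMr// mul1r; lra.
Qed.

Lemma derive_scale (V W : normedModType R) (f : V -> W) (p v : V) (a : R) :
  derivable f p v -> derivable f p (a *: v) /\ 'D_(a *: v) f p = a *: 'D_v f p.
Proof.
move=> df; apply/derive_dvP.
have /derive_dvP/(dv_scale a) : derivable f p v /\ 'D_v f p = 'D_v f p by [].
move=> h e e0; have [d d0 dP] := h e e0; exists d => // s /dP.
by rewrite !scalerA ![_ * a]mulrC.
Qed.

Variables (V : normedModType R) (I : finType) (b : I -> V) (c : I -> V -> R).
Hypothesis cb : forall v, v = \sum_i c i v *: b i.
Hypothesis c_le : forall i v, `|c i v| <= `|v|.
Hypothesis b_le : forall i, `|b i| <= 1.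

Lemma partial_bound m n (f : V -> 'M[R]_(m, n)) (D : I -> 'M[R]_(m, n)) (x0 : V)
    (r e : R) : 0 <= e ->
  (forall x, `|x - x0| < r -> forall i,
     derivable f x (b i) /\ `|'D_(b i) f x - D i| <= e) ->
  forall x y, `|x - x0| < r / (1 + 2 * #|I|%:R) ->
    `|y - x0| < r / (1 + 2 * #|I|%:R) ->
    `|f y - f x - \sum_i c i (y - x) *: D i| <= e * #|I|%:R * `|y - x|.
Proof.
move=> e0 fD x y; set N : R := #|I|%:R; have N0 : 0 <= N by exact: ler0n.
set r' := r / _ => xr yr.
have rr' : r = r' + 2 * N * r'.
  by rewrite /r'; field; lra.
have yx : `|y - x| < 2 * r'.
  rewrite -(subrKA x0); apply: le_lt_trans (ler_normD _ _) _.
  by rewrite [`|x0 - x|]distrC; lra.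
suff H (s : seq I) : (size s <= #|I|)%N ->
    `|f (x + \sum_(i <- s) c i (y - x) *: b i) - f x - \sum_(i <- s) c i (y - x) *: D i|
      <= e * (size s)%:R * `|y - x| /\
    `|\sum_(i <- s) c i (y - x) *: b i| <= (size s)%:R * `|y - x|.
  have [] := H (enum I); first by rewrite cardE.
  rewrite -cardE !big_enum /= -cb => + _.
  by have -> : x + (y - x) = y by zmod.
elim: s => [_|i s IH sI].
  by split; rewrite /= !big_nil ?addr0 ?subr0 ?subrr normr0 ?mulr0 mul0r.
have [IH1 IH2] := IH (ltnW sI).
have sN : (size s).+1%:R <= N by rewrite ler_nat.
have ciy t : 0 <= t <= 1 -> `|t *: (c i (y - x) *: b i)| <= `|y - x|.
  move=> /andP[t0 t1]; rewrite !normrZ (ger0_norm t0).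
  have : `|c i (y - x)| * `|b i| <= `|y - x| * 1.
    exact: (ler_pM (normr_ge0 _) (normr_ge0 _) (c_le _ _) (b_le _)).
  rewrite mulr1; apply: le_trans; rewrite ler_piMl ?mulr_ge0//.
have IH2' : `|\sum_(j <- i :: s) c j (y - x) *: b j| <= (size (i :: s))%:R * `|y - x|.
  rewrite big_cons; apply: le_trans (ler_normD _ _) _.
  have := ciy 1; rewrite ler01 lexx scale1r => /(_ isT) h.
  by rewrite /= -natr1 mulrDl mul1r addrC lerD.
split => //.
set z := x + \sum_(j <- s) c j (y - x) *: b j.
have Hz t : 0 <= t <= 1 -> `|z + t *: (c i (y - x) *: b i) - x0| < r.
  move=> t01; have -> : z + t *: (c i (y - x) *: b i) - x0 =
     (x - x0) + (\sum_(j <- s) c j (y - x) *: b j + t *: (c i (y - x) *: b i)).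
    by rewrite /z; zmod.
  apply: le_lt_trans (ler_normD _ _) _; rewrite rr'; apply: ltr_leD => //.
  apply: le_trans (ler_normD _ _) _.
  apply: le_trans (lerD IH2 (ciy _ t01)) _.
  rewrite -[X in _ + X]mul1r -mulrDl natr1 -mulrA mulrCA mulrC [leRHS]mulrC.
  by rewrite [leRHS]mulrAC; have := ler_pM (normr_ge0 _) (ler0n _ _) (ltW yx) sN; rewrite mulrAC.
have := @mvt_dir R V m n f z (c i (y - x) *: b i) (c i (y - x) *: D i) (e * `|y - x|).
have -> : x + \sum_(j <- i :: s) c j (y - x) *: b j = z + c i (y - x) *: b i.
  by rewrite big_cons /z; zmodc.
move=> H.
have -> : f (z + c i (y - x) *: b i) - f x - \sum_(j <- i :: s) c j (y - x) *: D j
   = (f (z + c i (y - x) *: b i) - f z - c i (y - x) *: D i) +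
     (f z - f x - \sum_(j <- s) c j (y - x) *: D j).
  by rewrite big_cons; zmodc.
apply: le_trans (ler_normD _ _) _.
rewrite /= -natr1 mulrDr mulr1 mulrDl addrC; apply: lerD => //.
apply: H => t t01.
  by have [dz _] := fD _ (Hz _ t01) i; have [] := derive_scale (c i (y - x)) dz.
have [dz Dz] := fD _ (Hz _ t01) i; have [_ ->] := derive_scale (c i (y - x)) dz.
by rewrite -scalerBr normrZ mulrC ler_pM.
Qed.

End partial_derivatives.

Section strict_derivative.
Variable R : realType.

Definition blin (V W : normedModType R) (L : V -> W) :=
  (forall a u v, L (a *: u + v) = a *: L u + L v) /\
  exists2 C, 0 < C & forall v, `|L v| <= C * `|v|.

Lemma blinD (V W : normedModType R) (L : V -> W) : blin L ->
  forall u v, L (u + v) = L u + L v.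
Proof. by move=> [h _] u v; rewrite -[u in LHS]scale1r h scale1r. Qed.

Lemma blin0 (V W : normedModType R) (L : V -> W) : blin L -> L 0 = 0.
Proof.
by move=> bL; apply: (addrI (L 0)); rewrite -(blinD bL) !addr0.
Qed.

Lemma blinZ (V W : normedModType R) (L : V -> W) : blin L ->
  forall a u, L (a *: u) = a *: L u.
Proof. by move=> bL a u; rewrite -[a *: u]addr0 bL.1 (blin0 bL) addr0. Qed.

Lemma blinN (V W : normedModType R) (L : V -> W) : blin L ->
  forall u, L (- u) = - L u.
Proof. by move=> bL u; rewrite -scaleN1r (blinZ bL) scaleN1r. Qed.

Lemma blinB (V W : normedModType R) (L : V -> W) : blin L ->
  forall u v, L (u - v) = L u - L v.
Proof. by move=> bL u v; rewrite (blinD bL) (blinN bL). Qed.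

Lemma blin_comp (U V W : normedModType R) (L : V -> W) (M : U -> V) :
  blin L -> blin M -> blin (L \o M).
Proof.
move=> bL bM; split=> [a u v|] /=; first by rewrite bM.1 bL.1.
have [[_ [C C0 CP]] [_ [D D0 DP]]] := (bL, bM).
exists (C * D); first exact: mulr_gt0.
by move=> v; apply: le_trans (CP _) _; rewrite -mulrA ler_pM2l.
Qed.

(** Strict differentiability: both points vary. Unlike differentiability at a point it gives a
    Lipschitz bound nearby, and with an injective derivative a lower bound on increments, which
    replaces the inverse function theorem. *)
Definition sdiff (V W : normedModType R) (f : V -> W) (x0 : V) (L : V -> W) :=
  forall e, 0 < e -> exists2 d, 0 < d & forall x y, `|x - x0| < d ->
    `|y - x0| < d -> `|f y - f x - L (y - x)| <= e * `|y - x|.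

Lemma sdiff_lip (V W : normedModType R) (f : V -> W) x0 L : blin L -> sdiff f x0 L ->
  exists K d, [/\ 0 < K, 0 < d & forall x y, `|x - x0| < d ->
    `|y - x0| < d -> `|f y - f x| <= K * `|y - x|].
Proof.
move=> [_ [C C0 CP]] /(_ 1 ltr01)[d d0 dP]; exists (1 + C), d; split => //.
  exact: addr_gt0.
move=> x y xd yd; have := dP _ _ xd yd; rewrite mul1r => H.
rewrite -[f y - f x](subrK (L (y - x))); apply: le_trans (ler_normD _ _) _.
by rewrite mulrDl mul1r lerD.
Qed.

Lemma sdiff_comp (U V W : normedModType R) (f : V -> W) (g : U -> V) x0 L M :
  blin L -> blin M -> sdiff f (g x0) L -> sdiff g x0 M ->
  sdiff (f \o g) x0 (L \o M).
Proof.
move=> bL bM sf sg e e0.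
have [K [d [K0 d0 Kd]]] := sdiff_lip bM sg.
have [C C0 CP] := bL.2.
have [d1 d10 d1P] := sf (e / (2 * K)) (divr_gt0 e0 (mulr_gt0 (ltr0n _ 2) K0)).
have [d2 d20 d2P] := sg (e / (2 * C)) (divr_gt0 e0 (mulr_gt0 (ltr0n _ 2) C0)).
exists (Num.min d (Num.min d2 (d1 / K))); first by rewrite !lt_min d0 d20 divr_gt0.
move=> x y; rewrite !lt_min => /and3P[xd xd2 xd1] /and3P[yd yd2 yd1].
have x0d : `|x0 - x0| < d by rewrite subrr normr0.
have gx : `|g x - g x0| < d1.
  apply: le_lt_trans (Kd _ _ x0d xd) _; by rewrite mulrC -ltr_pdivlMr.
have gy : `|g y - g x0| < d1.
  apply: le_lt_trans (Kd _ _ x0d yd) _; by rewrite mulrC -ltr_pdivlMr.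
rewrite /=; have -> : f (g y) - f (g x) - L (M (y - x)) =
    (f (g y) - f (g x) - L (g y - g x)) + L (g y - g x - M (y - x)).
  by rewrite (blinB bL (g y - g x)); zmod.
apply: le_trans (ler_normD _ _) _.
have -> : e * `|y - x| = e / (2 * K) * (K * `|y - x|) + C * (e / (2 * C) * `|y - x|).
  by field; rewrite !gt_eqF.
apply: lerD.
  apply: le_trans (d1P _ _ gx gy) _; rewrite ler_wpM2l ?Kd//.
  by rewrite ltW// divr_gt0// mulr_gt0.
by apply: le_trans (CP _) _; rewrite ler_pM2l// d2P.
Qed.

Lemma sdiff_dv (V W : normedModType R) (f : V -> W) (c : R -> V) t u L :
  blin L -> sdiff f (c t) L -> dv c t u -> dv (f \o c) t (L u).
Proof.
move=> bL sf cu e e0.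
have [C C0 CP] := bL.2.
have u1 : 0 < 1 + `|u| by rewrite ltr_pwDl.
have [d d0 dP] := sf (e / (2 * (1 + `|u|))) (divr_gt0 e0 (mulr_gt0 (ltr0n _ 2) u1)).
have [d1 d10 d1P] := dv_cont cu (divr_gt0 d0 (ltr0n _ 2)).
have [d2 d20 d2P] := cu _ (divr_gt0 e0 (mulr_gt0 (ltr0n _ 2) C0)).
have [d3 d30 d3P] := cu 1 ltr01.
exists (Num.min d1 (Num.min d2 d3)); first by rewrite !lt_min d10 d20.
move=> h; rewrite !lt_min => /and3P[hd1 hd2 hd3].
have ch : `|c (t + h) - c t| < d by apply: le_lt_trans (d1P _ hd1) _; lra.
have c0 : `|c t - c t| < d by rewrite subrr normr0.
have cl : `|c (t + h) - c t| <= (1 + `|u|) * `|h|.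
  rewrite -[_ - _](subrK (h *: u)); apply: le_trans (ler_normD _ _) _.
  by rewrite mulrDl lerD// ?d3P// normrZ mulrC.
rewrite /=; have -> : f (c (t + h)) - f (c t) - h *: L u =
    (f (c (t + h)) - f (c t) - L (c (t + h) - c t)) +
   L (c (t + h) - c t - h *: u).
  by rewrite (blinB bL (c (t + h) - c t)) (blinZ bL); zmodc.
apply: le_trans (ler_normD _ _) _.
have -> : e * `|h| = e / (2 * (1 + `|u|)) * ((1 + `|u|) * `|h|) + C * (e / (2 * C) * `|h|).
  by field; rewrite !gt_eqF.
apply: lerD.
  apply: le_trans (dP _ _ c0 ch) _; rewrite ler_wpM2l//.
  by rewrite ltW// divr_gt0// mulr_gt0.
by apply: le_trans (CP _) _; rewrite ler_pM2l// d2P.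
Qed.

Lemma sdiff_derive (V W : normedModType R) (f : V -> W) (x v : V) L :
  blin L -> sdiff f x L -> derivable f x v /\ 'D_v f x = L v.
Proof.
move=> bL sf; apply/derive_dvP.
apply: (@sdiff_dv _ _ f (fun s => s *: v + x)) => //; first by rewrite scale0r add0r.
move=> e e0; exists 1 => // h _; rewrite add0r scale0r add0r addrK subrr normr0.
by rewrite mulr_ge0// ltW.
Qed.

(** A basis with coordinate functionals of norm at most 1, so that matrices and the real line are
    treated at once. *)
Definition frame (V : normedModType R) (I : finType) (b : I -> V) (c : I -> V -> R) :=
  [/\ forall v, v = \sum_i c i v *: b i, forall i v, `|c i v| <= `|v|,
     forall i, `|b i| <= 1 & forall i a u v, c i (a *: u + v) = a * c i u + c i v].

(** [Ck_on 1] provides continuous directional derivatives, with no linearity in the direction. Near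
    [x0] the partial derivatives are almost constant, so [partial_bound] yields a strict linear
    approximation, and linearity follows from it. *)
Lemma Ck1_sdiff (V : normedModType R) (I : finType) (b : I -> V) (c : I -> V -> R)
    m n (f : V -> 'M[R]_(m, n)) (U : set V) (x0 : V) : frame b c ->
  open U -> U x0 -> Ck_on 1 U f ->
  exists L : V -> 'M[R]_(m, n), [/\ blin L, sdiff f x0 L &
    forall v, derivable f x0 v /\ 'D_v f x0 = L v].
Proof.
move=> [cb cl bl clin] oU Ux0 [_ fC].
pose L v := \sum_i c i v *: 'D_(b i) f x0.
have bL : blin L.
  split=> [a u v|].
    rewrite /L scaler_sumr -big_split; apply: eq_bigr => i _ /=.
    by rewrite clin scalerDl scalerA.
  exists (1 + \sum_i `|'D_(b i) f x0|).
    by rewrite ltr_pwDl// sumr_ge0.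
  move=> v; rewrite mulrDl mul1r mulr_suml.
  apply: le_trans (ler_norm_sum _ _ _) _.
  apply: ler_wpDl => //; apply: ler_sum => i _.
  by rewrite normrZ mulrC ler_wpM2l.
have sf : sdiff f x0 L.
  move=> e e0.
  have e1 : 0 < e / (1 + #|I|%:R) by rewrite divr_gt0// ltr_pwDl.
  have : \forall x \near x0, U x /\ forall i, `|'D_(b i) f x - 'D_(b i) f x0| <= e / (1 + #|I|%:R).
    near=> x; split; first by near: x; exact: open_nbhs_nbhs.
    near: x; apply: filter_forall => i.
    have [_ [+ _]] := fC (b i); move=> /(_ _ Ux0) /cvgrPdistC_le /(_ _ e1).
    exact.
  move=> /nbhs_ballP[r /= r0 rP].
  exists (r / (1 + 2 * #|I|%:R)).
    by rewrite divr_gt0// ltr_pwDl// mulr_ge0.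
  move=> x y xr yr.
  have := @partial_bound R V I b c cb cl bl m n f (fun i => 'D_(b i) f x0) x0 r _ (ltW e1) _ x y xr yr.
  move=> H; apply: le_trans (H _) _.
    move=> z zr i; have [Uz Hz] : U z /\ forall i, `|'D_(b i) f z - 'D_(b i) f x0| <= e / (1 + #|I|%:R).
      by apply: rP; rewrite -ball_normE /= distrC.
    by split; [have [+ _] := fC (b i); apply|exact: Hz].
  rewrite ler_wpM2r// -mulrA ler_piMr ?(ltW e0)// mulrC ler_pdivrMr ?ltr_pwDl//.
  by rewrite mul1r; lra.
by exists L; split => // v; exact: sdiff_derive.
Unshelve. all: by end_near. Qed.

Lemma mx_frame m n : frame (fun ij : 'I_m * 'I_n => delta_mx ij.1 ij.2 : 'M[R]_(m, n))
  (fun ij v => v ij.1 ij.2).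
Proof.
split=> [v|[i j] v|[i j]|[i j] a u v] /=.
- rewrite [LHS]matrix_sum_delta pair_big /=; by [].
- exact: mx_entry_le.
- exact: delta_mx_norm.
- by rewrite !mxE.
Qed.

Lemma mx_Ck1_sdiff p q m n (f : 'M[R]_(p, q) -> 'M[R]_(m, n)) U x0 :
  open U -> U x0 -> Ck_on 1 U f ->
  exists L : 'M[R]_(p, q) -> 'M[R]_(m, n), [/\ blin L, sdiff f x0 L &
    forall v, derivable f x0 v /\ 'D_v f x0 = L v].
Proof. exact: Ck1_sdiff (mx_frame p q). Qed.

End strict_derivative.

(** * Local coordinates of a Lie group *)

Lemma near_ball_forall (R : realType) (V : normedModType R) (I : finType)
    (P : I -> V -> Prop) (x : V) : (forall i, \forall z \near x, P i z) ->
  exists2 d : R, 0 < d & forall z, `|x - z| < d -> forall i, P i z.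
Proof.
move=> H; have /choice[d dP] : forall i, exists d : R, 0 < d /\
    forall z, `|x - z| < d -> P i z.
  move=> i; have /nbhs_ballP[d /= d0 dP] := H i; exists d; split => // z xz.
  by apply: dP; rewrite -ball_normE.
exists (\big[Num.min/1]_i d i).
  by apply: lt_bigmin => // i _; have [] := dP i.
move=> z zd i; have [_] := dP i; apply.
by apply: lt_le_trans zd _; exact: bigmin_le_cond.
Qed.

Lemma dv_line (R : realType) (V W : normedModType R) (g : V -> W) (v p : V)
    (q : R -> V) (u : W) : (forall s, q s = s *: v + p) ->
  dv (fun s => g (s *: v + p)) 0 u -> dv (fun s => g (q s)) 0 u.
Proof. by move=> E h e e0; have [d d0 dP] := h e e0; exists d => // s /dP; rewrite !E. Qed.

Section mixed_partials.
Variables (R : realType) (m : nat).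
Notation V := 'rV[R]_m.

Lemma sum_delta_rV (v : V) : \sum_(ij : 'I_1 * 'I_m) v ij.1 ij.2 *: delta_mx ij.1 ij.2 = v.
Proof. by have [h _ _ _] := mx_frame R 1 m; rewrite -h. Qed.

(** At [y = 0] the derivative of [F] in [x] is the identity since [F x 0 = x]; bounded mixed
    derivatives keep it within [O(|y|)] of the identity. Integrating in [x] gives the estimate. *)
Lemma mixed_bound (F : V -> V -> V) (D : 'I_1 * 'I_m -> V -> V -> V) (K r : R) :
  0 <= K ->
  (forall x y ij, `|x| < r -> `|y| < r ->
    derivable (F ^~ y) x (delta_mx ij.1 ij.2) /\
    'D_(delta_mx ij.1 ij.2) (F ^~ y) x = D ij x y) ->
  (forall x y ij kl, `|x| < r -> `|y| < r ->
    derivable (D ij x) y (delta_mx kl.1 kl.2) /\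
    `|'D_(delta_mx kl.1 kl.2) (D ij x) y| <= K) ->
  (forall x, `|x| < r -> F x 0 = x) ->
  exists2 K', 0 <= K' & forall x x' y, `|x| < r / (1 + 2 * (1 * m)%N%:R) ->
     `|x'| < r / (1 + 2 * (1 * m)%N%:R) -> `|y| < r / (1 + 2 * (1 * m)%N%:R) ->
     `|F x y - F x' y - (x - x')| <= K' * `|x - x'| * `|y|.
Proof.
move=> K0 h1 h2 h3; have [f1 f2 f3 f4] := mx_frame R 1 m.
set N := (1 * m)%N%:R; set r' := r / _.
have N0 : 0 <= N :> R by exact: ler0n.
have cI : #|{: 'I_1 * 'I_m}|%:R = N :> R by rewrite card_prod !card_ord.
exists (K * N * N); first by rewrite !mulr_ge0.
move=> x x' y xr xr' yr.
have r'r : r' <= r.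
  rewrite ler_pdivrMr ?ltr_pwDl ?mulr_ge0// ler_peMr ?lerDl ?mulr_ge0//.
  by have := le_lt_trans (normr_ge0 x) xr; rewrite pmulr_lgt0 ?invr_gt0 ?ltr_pwDl ?mulr_ge0// => /ltW.
have Db z ij : `|z| < r -> `|D ij z y - delta_mx ij.1 ij.2| <= K * N * `|y|.
  move=> zr.
  have := @partial_bound R V _ _ _ f1 f2 f3 1 m (D ij z) (fun=> 0) 0 r K K0.
  move=> /(_ _ 0 y); rewrite cI -/N -/r' !subr0 normr0.
  rewrite big1 ?subr0; last by move=> *; rewrite scaler0.
  have -> : D ij z 0 = delta_mx ij.1 ij.2.
    have zr0 : `|0 : V| < r by rewrite normr0; exact: le_lt_trans zr.
    have [_ <-] := h1 z 0 ij zr zr0.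
    apply: (proj2 (proj1 (derive_dvP _ _ _ _) _)).
    apply: (@dv_eq R _ (fun s => s *: delta_mx ij.1 ij.2 + z)).
      have : \forall w \near z, `|w| < r.
        by have := @norm_continuous _ V z; move/cvgr_lt; apply.
      move=> /nbhs_ballP[d /= d0 dP]; exists (d / 2) => /=; first by rewrite divr_gt0.
      move=> s; rewrite /= sub0r normrN => sd; rewrite h3//; apply: dP.
      rewrite -ball_normE /= opprD addrCA subrr addr0 normrN.
      rewrite normrZ; apply: le_lt_trans (_ : `|s| * 1 < d).
        by rewrite ler_wpM2l// delta_mx_norm.
      by lra.
    move=> e e0; exists 1 => // h _; rewrite add0r scale0r add0r addrK subrr normr0.
    by rewrite mulr_ge0// ltW.
  apply.
  - move=> w wr kl; rewrite subr0 in wr; rewrite subr0; exact: h2.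
  - by rewrite (le_lt_trans _ xr).
  - exact: yr.
have := @partial_bound R V _ _ _ f1 f2 f3 1 m (F ^~ y)
   (fun ij => delta_mx ij.1 ij.2) 0 r (K * N * `|y|).
rewrite mulr_ge0 ?mulr_ge0// => /(_ isT _ x' x).
rewrite cI -/N -/r' !subr0 -f1 => H.
apply: le_trans (H _ _ _) _ => //.
  move=> w; rewrite subr0 => wr ij.
  have yr1 : `|y| < r by exact: lt_le_trans yr r'r.
  by have [dF ->] := h1 w y ij wr yr1; split => //; exact: Db.
by rewrite le_eqVlt; apply/orP; left; apply/eqP; ring.
Qed.
End mixed_partials.

(** The chart at the identity, recentred at 0. By [lc_B1] and [lc_B2], right and left translation by
    [y] differ from the identity by a [C * |y|]-Lipschitz map, and [lc_rC] makes every such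
    correction at most one eighth of the main term. *)
Record local_chart (R : realType) (G : groupTopType) (m : nat)
    (e : 'rV[R]_m -> G) (lg : G -> 'rV[R]_m) (r C : R) : Prop := LocalChart {
  lc_r : 0 < r; lc_C : 0 < C; lc_rC : r * C <= 1 / 8;
  lc_e0 : e 0 = 1%g;
  lc_le : forall x, `|x| < r -> lg (e x) = x;
  lc_mul : forall x y, `|x| < r -> `|y| < r -> e (lg (e x * e y)%g) = (e x * e y)%g;
  lc_B1 : forall x x' y, `|x| < r -> `|x'| < r -> `|y| < r ->
    `|lg (e x * e y)%g - lg (e x' * e y)%g - (x - x')| <= C * `|x - x'| * `|y|;
  lc_B2 : forall x x' y, `|x| < r -> `|x'| < r -> `|y| < r ->
    `|lg (e y * e x)%g - lg (e y * e x')%g - (x - x')| <= C * `|x - x'| * `|y|;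
  lc_near : forall d : R, 0 < d -> nbhs (1%g : G) [set g | `|lg g| < d /\ e (lg g) = g];
  lc_cont : forall W : set G, nbhs (1%g : G) W ->
    exists2 d : R, 0 < d & forall x, `|x| < d -> W (e x);
}.

Section lie_local_chart.
Variables (R : realType) (G : groupTopType) (m : nat) (A : atlas G 'rV[R]_m).
Hypothesis lieG : lie_group A.
Notation V := 'rV[R]_m.

Let i0 := prefc A (1%g : G).
Let c := achart i0.
Let p0 := chart_to c (1%g : G).

Definition lie_e (x : V) : G := chart_of c (x + p0).
Definition lie_lg (g : G) : V := chart_to c g - p0.

Let ch : is_chart c := sm_chart (lie_manifold lieG) i0.
Let dom1 : chart_dom c 1%g := sm_prefc (lie_manifold lieG) 1%g.

Lemma lie_mul_cont : continuous (fun xy : G * G => (xy.1 * xy.2)%g).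
Proof. by have [] := lie_mul lieG. Qed.

Lemma lie_inv_cont : continuous (fun x : G => (x^-1)%g).
Proof. by have [] := lie_inv lieG. Qed.

Lemma chart_cod_of (p : V) : chart_cod c p ->
  chart_dom c (chart_of c p) /\ chart_to c (chart_of c p) = p.
Proof.
case: ch => _ _ K _ _ [x dx <-]; split; first by rewrite K.
by rewrite K.
Qed.

Lemma lie_e0 : lie_e 0 = 1%g.
Proof. by rewrite /lie_e add0r; have [_ _ K _ _] := ch; exact: K. Qed.

Lemma lie_e_cont (W : set G) : nbhs (1%g : G) W ->
  exists2 d : R, 0 < d & forall x, `|x| < d -> W (lie_e x).
Proof.
have [_ _ K _ cof] := ch => nW.
have cp0 : chart_cod c p0 by exists 1%g.
have : nbhs p0 (chart_of c @^-1` W) by apply: (cof _ cp0); rewrite K.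
move=> /nbhs_ballP[d /= d0 dP]; exists d => // x xd; apply: dP.
by rewrite -ball_normE /= opprD addrCA subrr addr0 normrN.
Qed.

Lemma cod_ball : exists2 d : R, 0 < d & forall x, `|x| < d -> chart_cod c (x + p0).
Proof.
have [_ oc _ _ _] := ch.
have : nbhs p0 (chart_cod c) by apply: open_nbhs_nbhs; split => //; exists 1%g.
move=> /nbhs_ballP[d /= d0 dP]; exists d => // x xd; apply: dP.
by rewrite -ball_normE /= opprD addrCA subrr addr0 normrN.
Qed.

Lemma lie_near (d : R) : 0 < d ->
  nbhs (1%g : G) [set g | `|lie_lg g| < d /\ lie_e (lie_lg g) = g].
Proof.
move=> d0; have [od _ K cto _] := ch.
have n1 : nbhs (1%g : G) (chart_dom c) by apply: open_nbhs_nbhs; split.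
have n2 : nbhs (1%g : G) [set g | `|p0 - chart_to c g| < d].
  by have /cvgrPdist_lt /(_ d d0) := cto _ dom1.
apply: filterS (filterI n1 n2) => g [dg /=]; rewrite distrC => gd; split => //.
by rewrite /lie_e /lie_lg subrK K.
Qed.

Lemma mult_ball (W : set G) : nbhs (1%g : G) W ->
  exists2 d : R, 0 < d & forall x y, `|x| < d -> `|y| < d -> W (lie_e x * lie_e y)%g.
Proof.
move=> nW.
have : nbhs ((1, 1)%g : G * G) [set xy | W (xy.1 * xy.2)%g].
  by apply: lie_mul_cont; rewrite /= mulg1.
move=> [[B1 B2] /= [nB1 nB2] sub].
have [d1 d10 h1] := lie_e_cont nB1; have [d2 d20 h2] := lie_e_cont nB2.
exists (Num.min d1 d2); first by rewrite lt_min d10.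
move=> x y; rewrite !lt_min => /andP[x1 _] /andP[_ y2].
by apply: (sub (_, _)); split; [exact: h1|exact: h2].
Qed.

Let mult := fun xy : G * G => (xy.1 * xy.2)%g.
Let f := fun p : V * V => chart_to c (mult (chart_of c p.1, chart_of c p.2)).
Let ii : aidx (atlas_prod A A) := (i0, i0).
Let U := chart_to (achart ii) @` (chart_dom (achart ii) `&` mult @^-1` chart_dom c).

(** The map [j] inserts the two arguments in either order, so the same proof gives the estimates for
    right and for left translations. The mixed second derivatives are bounded near the origin
    because the multiplication is of class C^2. *)
Lemma B_core (j : V -> V -> V * V) (v1 v2 : V -> V * V) (d : R) : 0 < d ->
  (forall s u x y, s *: v1 u + j x y = j (s *: u + x) y) ->
  (forall s u x y, s *: v2 u + j x y = j x (s *: u + y)) ->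
  (forall x y, `|x| < d -> `|y| < d -> U (j x y)) ->
  (forall x, `|x| < d -> f (j x 0) = x + p0) ->
  (forall r, 0 < r -> exists2 r', 0 < r' & forall x y, `|x| < r' -> `|y| < r' -> `|j 0 0 - j x y| < r) ->
  exists r C, [/\ 0 < r, 0 < C & forall x x' y, `|x| < r -> `|x'| < r -> `|y| < r ->
     `|f (j x y) - f (j x' y) - (x - x')| <= C * `|x - x'| * `|y| ].
Proof.
move=> d0 jv1 jv2 jU j0 jc.
have fU : smooth_on U f by have [_ /(_ ii i0)] := lie_mul lieG.
pose b (ij : 'I_1 * 'I_m) : V := delta_mx ij.1 ij.2.
pose K := 1 + \sum_(p : ('I_1 * 'I_m) * ('I_1 * 'I_m))
  `|'D_(v2 (b p.2)) (fun x => 'D_(v1 (b p.1)) f x) (j 0 0)|.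
have K0 : 0 <= K by rewrite addr_ge0// sumr_ge0.
have U00 : U (j 0 0) by apply: jU; rewrite normr0.
have [_ f2] := fU 2%N.
have [r1 r10 r1P] : exists2 d : R, 0 < d & forall z, `|j 0 0 - z| < d ->
   forall p : ('I_1 * 'I_m) * ('I_1 * 'I_m),
   `|'D_(v2 (b p.2)) (fun x => 'D_(v1 (b p.1)) f x) z| <= K.
  apply: near_ball_forall => -[ij kl] /=; have [_ [_ /(_ (v2 (b kl)))[_ [+ _]]]] := f2 (v1 (b ij)).
  move=> /(_ _ U00) /cvgrPdist_le /(_ 1 ltr01); apply: filterS => z zP.
  have -> : 'D_(v2 (b kl)) (fun x => 'D_(v1 (b ij)) f x) z = 'D_(v2 (b kl)) (fun x => 'D_(v1 (b ij)) f x) (j 0 0) - ('D_(v2 (b kl)) (fun x => 'D_(v1 (b ij)) f x) (j 0 0) - 'D_(v2 (b kl)) (fun x => 'D_(v1 (b ij)) f x) z) by zmod.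
  apply: le_trans (ler_normB _ _) _; rewrite addrC; apply: lerD => //.
  rewrite (bigD1 (ij, kl)) //= lerDl; exact: sumr_ge0.
have [r2 r20 r2P] := jc _ r10.
pose r := Num.min d r2.
have r0 : 0 < r by rewrite lt_min d0.
have rd (x : V) : `|x| < r -> `|x| < d by rewrite lt_min => /andP[].
have rr2 (x : V) : `|x| < r -> `|x| < r2 by rewrite lt_min => /andP[].
have dvc (c' : R -> V) t u k : dv c' t u -> dv (fun s => c' s - k) t u.
  move=> h e e0; have [q q0 qP] := h e e0; exists q => // w /qP.
  by have -> : c' (t + w) - k - (c' t - k) = c' (t + w) - c' t by zmod.
have := @mixed_bound R m (fun x y => f (j x y) - p0)
  (fun ij x y => 'D_(v1 (b ij)) f (j x y)) K r K0.
case.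
- move=> x y ij xr yr; apply/derive_dvP; apply: dvc.
  have dfj := (f2 (v1 (b ij))).1 _ (jU _ _ (rd _ xr) (rd _ yr)).
  have /derive_dvP h := conj dfj (erefl ('D_(v1 (b ij)) f (j x y))).
  by move=> e e0; have [q q0 qP] := h e e0; exists q => // s /qP; rewrite !jv1.
- move=> x y ij kl xr yr.
  have [_ [_ /(_ (v2 (b kl)))[dd _]]] := f2 (v1 (b ij)).
  have dfj := dd _ (jU _ _ (rd _ xr) (rd _ yr)).
  have /derive_dvP h := conj dfj (erefl ('D_(v2 (b kl)) (fun x => 'D_(v1 (b ij)) f x) (j x y))).
  have h' : dv (fun s => 'D_(v1 (b ij)) f (j x (s *: b kl + y))) 0 ('D_(v2 (b kl)) (fun x => 'D_(v1 (b ij)) f x) (j x y)).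
    apply: (@dv_line R (V * V)%type V ('D_(v1 (b ij)) f) (v2 (b kl)) (j x y)
      (fun s => j x (s *: b kl + y)) _ _ h) => s; symmetry; exact: jv2.
  have [h1 h2] := (derive_dvP (fun y0 => 'D_(v1 (b ij)) f (j x y0)) y (b kl) _).1 h'.
  split; first exact: h1.
  rewrite [X in `|X|]h2; apply: (r1P (j x y) _ (ij, kl)); exact: r2P (rr2 _ xr) (rr2 _ yr).
- by move=> x xr; rewrite j0 ?addrK// rd.
move=> K' K'0 H; exists (r / (1 + 2 * (1 * m)%N%:R)), (1 + K'); split.
- by rewrite divr_gt0// ltr_pwDl// mulr_ge0.
- by rewrite ltr_pwDl.
move=> x x' y xr xr' yr; have := H x x' y xr xr' yr.
have -> : f (j x y) - p0 - (f (j x' y) - p0) = f (j x y) - f (j x' y) by zmod.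
move=> h; apply: le_trans h _; rewrite -!mulrA ler_wpM2r ?mulr_ge0//; lra.
Qed.

Lemma lie_local_chart : exists r C, local_chart lie_e lie_lg r C.
Proof.
have [od oc K cto cof] := ch.
have [d1 d10 d1P] := cod_ball.
have [d2 d20 d2P] := mult_ball (open_nbhs_nbhs (conj od dom1)).
pose d := Num.min d1 d2.
have d0 : 0 < d by rewrite lt_min d10.
have dd1 (x : V) : `|x| < d -> `|x| < d1 by rewrite lt_min => /andP[].
have dd2 (x : V) : `|x| < d -> `|x| < d2 by rewrite lt_min => /andP[].
have lgK x : `|x| < d -> lie_lg (lie_e x) = x.
  move=> xd; rewrite /lie_lg /lie_e.
  by have [_ ->] := chart_cod_of (d1P _ (dd1 _ xd)); rewrite addrK.
have dU x y : `|x| < d -> `|y| < d -> U (x + p0, y + p0).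
  move=> xd yd; exists (lie_e x, lie_e y).
    split => /=; last exact: d2P (dd2 _ xd) (dd2 _ yd).
    by split => /=; [have [] := chart_cod_of (d1P _ (dd1 _ xd))|
                     have [] := chart_cod_of (d1P _ (dd1 _ yd))].
  rewrite /= /lie_e; have [_ ->] := chart_cod_of (d1P _ (dd1 _ xd)).
  by have [_ ->] := chart_cod_of (d1P _ (dd1 _ yd)).
have fE x y : f (x + p0, y + p0) = lie_lg (lie_e x * lie_e y)%g + p0.
  by rewrite /lie_lg subrK.
have jnear (j : V -> V -> V * V) : (forall x y, `|j 0 0 - j x y| <= Num.max `|x| `|y|) ->
   forall r, 0 < r -> exists2 r', 0 < r' & forall x y, `|x| < r' -> `|y| < r' -> `|j 0 0 - j x y| < r.
  move=> h r r0; exists r => // x y xr yr; apply: le_lt_trans (h _ _) _.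
  by rewrite gt_max xr.
have jmax (a a' b' : V) : a' + p0 - (b' + p0) = a' - b' by zmod.
have [r1 [C1 [r10 C10 H1]]] : exists r C, [/\ 0 < r, 0 < C &
    forall x x' y : V, `|x| < r -> `|x'| < r -> `|y| < r ->
     `|f (x + p0, y + p0) - f (x' + p0, y + p0) - (x - x')| <= C * `|x - x'| * `|y| ].
  apply: (@B_core (fun x y : V => (x + p0, y + p0)) (fun u : V => (u, 0 : V))
    (fun u : V => (0 : V, u)) d d0 _ _ dU).
  - by move=> s u x y; congr pair; rewrite /= ?scaler0 ?add0r ?addrA.
  - by move=> s u x y; congr pair; rewrite /= ?scaler0 ?add0r ?addrA.
  - by move=> x xd; rewrite fE lie_e0 mulg1 lgK.
  - apply: jnear => x y; rewrite prod_normE /= !(jmax 0) !sub0r !normrN; exact: lexx.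
have [r2 [C2 [r20 C20 H2]]] : exists r C, [/\ 0 < r, 0 < C &
    forall x x' y : V, `|x| < r -> `|x'| < r -> `|y| < r ->
     `|f (y + p0, x + p0) - f (y + p0, x' + p0) - (x - x')| <= C * `|x - x'| * `|y| ].
  apply: (@B_core (fun x y : V => (y + p0, x + p0)) (fun u : V => (0 : V, u))
    (fun u : V => (u, 0 : V)) d d0 _ _ (fun x y xd yd => dU y x yd xd)).
  - by move=> s u x y; congr pair; rewrite /= ?scaler0 ?add0r ?addrA.
  - by move=> s u x y; congr pair; rewrite /= ?scaler0 ?add0r ?addrA.
  - by move=> x xd; rewrite fE lie_e0 mul1g lgK.
  - apply: jnear => x y; rewrite prod_normE /= !(jmax 0) !sub0r !normrN maxC; exact: lexx.
pose C := C1 + C2.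
have C0 : 0 < C by rewrite addr_gt0.
pose r := Num.min d (Num.min r1 (Num.min r2 (1 / (8 * C)))).
have r0 : 0 < r by rewrite lt_min d0 !lt_min r10 r20 divr_gt0 ?mulr_gt0.
have rd (x : V) : `|x| < r -> `|x| < d by rewrite lt_min => /andP[].
have rr1 (x : V) : `|x| < r -> `|x| < r1 by rewrite !lt_min => /and4P[].
have rr2 (x : V) : `|x| < r -> `|x| < r2 by rewrite !lt_min => /and4P[].
exists r, C; split => //.
- rewrite -ler_pdivlMr//; apply: (@le_trans _ _ (1 / (8 * C))).
    by rewrite /r !ge_min lexx !orbT.
  by rewrite le_eqVlt; apply/orP; left; apply/eqP; field; rewrite gt_eqF.
- exact: lie_e0.
- by move=> x /rd; exact: lgK.
- move=> x y xr yr; rewrite /lie_lg /lie_e subrK K//.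
  exact: d2P (dd2 _ (rd _ xr)) (dd2 _ (rd _ yr)).
- move=> x x' y xr xr' yr.
  have := H1 x x' y (rr1 _ xr) (rr1 _ xr') (rr1 _ yr); rewrite !fE.
  have -> : forall a b : V, a + p0 - (b + p0) = a - b by move=> a b; zmod.
  move=> h; apply: le_trans h _; rewrite -!mulrA ler_wpM2r ?mulr_ge0//.
  by rewrite lerDl ltW.
- move=> x x' y xr xr' yr.
  have := H2 x x' y (rr2 _ xr) (rr2 _ xr') (rr2 _ yr); rewrite !fE.
  have -> : forall a b : V, a + p0 - (b + p0) = a - b by move=> a b; zmod.
  move=> h; apply: le_trans h _; rewrite -!mulrA ler_wpM2r ?mulr_ge0//.
  by rewrite lerDr ltW.
- exact: lie_near.
- exact: lie_e_cont.
Qed.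
End lie_local_chart.

(** * One-parameter subgroups *)

Lemma nat_two_cases (a b : nat) : (a <= b < a.+2)%N -> b = a \/ b = a.+1.
Proof. by lia. Qed.

Section geometric_sequences.
Variable R : realType.

Lemma geo_le0 (a K : R) : (forall n, a <= K / 2 ^+ n) -> a <= 0.
Proof.
move=> h; rewrite leNgt; apply/negP => a0.
have K0 : 0 < K by have := h 0%N; rewrite expr0 divr1; exact: lt_le_trans.
have := h (Num.truncn (K / a)).+1; rewrite ler_pdivlMr ?exprn_gt0// mulrC -ler_pdivlMr//.
apply/negP; rewrite -ltNge; apply: lt_trans (truncnS_gt _) _.
by rewrite -natrX ltr_nat ltn_expl.
Qed.

Lemma geo_cauchy m (u : nat -> 'rV[R]_m) (K : R) :
  (forall n, `|u n.+1 - u n| <= K / 2 ^+ n) ->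
  exists l, forall n, `|u n - l| <= 2 * K / 2 ^+ n.
Proof.
move=> h.
have K0 : 0 <= K by have := h 0%N; rewrite expr0 divr1; exact: le_trans.
have hk n k : `|u (n + k)%N - u n| <= 2 * K / 2 ^+ n - 2 * K / 2 ^+ (n + k).
  elim: k => [|k IH]; first by rewrite addn0 !subrr normr0.
  rewrite addnS; have -> : u (n + k).+1 - u n = (u (n + k).+1 - u (n + k)%N) + (u (n + k)%N - u n) by zmod.
  apply: le_trans (ler_normD _ _) _; apply: le_trans (lerD (h _) IH) _.
  rewrite le_eqVlt; apply/orP; left; apply/eqP; rewrite exprS; field.
  by rewrite !expf_neq0.
have cu : cauchy_ex (u n @[n --> \oo]).
  move=> e e0; have [N HN] : exists N, 2 * K / 2 ^+ N < e.
    apply: contrapT => /forallNP H; have := @geo_le0 e (2 * K) (fun n => ltac:(by rewrite leNgt; apply/negP/H)).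
    by rewrite leNgt e0.
  exists (u N); exists N => //= n nN.
  rewrite -ball_normE /= distrC -(subnKC nN); apply: le_lt_trans HN.
  apply: le_trans (hk _ _) _; rewrite gerBl// divr_ge0 ?mulr_ge0//.
have /cvg_ex[l ul] : cvgn u by apply/cauchy_cvgP/cauchy_exP.
exists l => n.
apply/ler_addgt0Pr => e e0.
have /cvgrPdist_le /(_ e e0) [N _ HN] := ul.
have := HN (maxn N n) (leq_maxl _ _) => /= hl.
have -> : u n - l = - (l - u (maxn N n)) + (- (u (maxn N n) - u n)) by zmod.
apply: le_trans (ler_normD _ _) _; rewrite !normrN addrC; apply: lerD => //.
rewrite -[in leLHS](subnKC (leq_maxr N n)); apply: le_trans (hk _ _) _.
by rewrite gerBl// divr_ge0 ?mulr_ge0.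
Qed.
End geometric_sequences.

(** The extension is [g (t / N) ^+ N] for any [N >= t]. Two exponents [N] and [M] give the same
    element because both agree with the power [N * M] of [g (t / (N * M))]; negative times are
    inverted. *)
Lemma hom_ext (R : realType) (G : groupType) (g : R -> G) :
  (forall s t, 0 <= s -> 0 <= t -> s + t <= 1 -> g (s + t) = (g s * g t)%g) ->
  exists h : R -> G, (forall s t, h (s + t) = (h s * h t)%g) /\
    forall t : R, 0 <= t <= 1 -> h t = g t.
Proof.
move=> gD.
have g0 : g 0 = 1%g.
  have := gD 0 0 (lexx _) (lexx _); rewrite addr0 ler01 => /(_ isT) E.
  by apply: (mulgI (g 0)); rewrite mulg1 -E.
have gn n (u : R) : 0 <= u -> n%:R * u <= 1 -> g (n%:R * u) = (g u ^+ n)%g.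
  move=> u0; elim: n => [|n IH]; first by rewrite mul0r g0 expg0.
  rewrite -natr1 mulrDl mul1r => h.
  rewrite gD//; last by rewrite mulr_ge0.
  by rewrite IH ?expgSr//; apply: le_trans h; rewrite lerDl.
have gc (a b : R) : 0 <= a -> 0 <= b -> a + b <= 1 -> commute (g a) (g b).
  by move=> a0 b0 ab; rewrite /commute -!gD// addrC.
have gM (t : R) N M : 0 <= t -> t <= N%:R -> t <= M%:R -> (0 < N)%N -> (0 < M)%N ->
    (g (t / N%:R)%R ^+ N)%g = (g (t / M%:R)%R ^+ M)%g.
  move=> t0 tN tM N0 M0.
  have h (a b : nat) : (0 < a)%N -> (0 < b)%N -> t <= a%:R ->
      g (t / a%:R) = (g (t / (a * b)%N%:R)%R ^+ b)%g.
    move=> a0 b0 ta; rewrite -gn.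
    - by congr g; rewrite natrM; field; rewrite !pnatr_eq0 -!lt0n a0 b0.
    - by rewrite divr_ge0.
    - have -> : b%:R * (t / (a * b)%N%:R) = t / a%:R.
        by rewrite natrM; field; rewrite !pnatr_eq0 -!lt0n a0 b0.
      by rewrite ler_pdivrMr ?mul1r ?ltr0n.
  by rewrite (h N M)// (h M N)// -!expgnA mulnC.
pose h0 (t : R) := (g (t / (Num.truncn t).+1%:R)%R ^+ (Num.truncn t).+1)%g.
have h0E (t : R) N : 0 <= t -> t <= N%:R -> (0 < N)%N -> h0 t = (g (t / N%:R)%R ^+ N)%g.
  by move=> t0 tN N0; apply: gM => //; apply: ltW; exact: truncnS_gt.
have h0D (s t : R) : 0 <= s -> 0 <= t -> h0 (s + t) = (h0 s * h0 t)%g.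
  move=> s0 t0; set N := (Num.truncn (s + t)).+1.
  have stN : s + t <= N%:R by apply: ltW; exact: truncnS_gt.
  have sN : s <= N%:R by apply: le_trans stN; rewrite lerDl.
  have tN : t <= N%:R by apply: le_trans stN; rewrite lerDr.
  rewrite (h0E _ N) ?addr_ge0// (h0E _ N s0 sN)// (h0E _ N t0 tN)// -expgMn.
    by rewrite mulrDl gD ?divr_ge0// -mulrDl ler_pdivrMr ?mul1r// ltr0n.
  by apply: gc; rewrite ?divr_ge0// -mulrDl ler_pdivrMr ?mul1r// ltr0n.
pose h (t : R) := if 0 <= t then h0 t else ((h0 (- t))^-1)%g.
have hp (t : R) : 0 <= t -> h t = h0 t by rewrite /h => ->.
have hN (t : R) : 0 <= t -> h (- t) = ((h0 t)^-1)%g.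
  rewrite /h => t0; case: ifPn => [|_]; last by rewrite opprK.
  rewrite oppr_ge0 => t0'; have -> : t = 0 by apply/eqP; rewrite eq_le t0 t0'.
  by rewrite oppr0 (h0E 0 1%N)// mul0r g0 invg1.
have hc (s t : R) : 0 <= s -> 0 <= t -> commute (h0 s) (h0 t).
  by move=> s0 t0; rewrite /commute -!h0D// addrC.
have hB (s t : R) : 0 <= s -> 0 <= t -> h (s - t) = (h0 s * (h0 t)^-1)%g.
  move=> s0 t0; have [ts|/ltW st] := leP t s.
    rewrite hp ?subr_ge0//; apply: (mulIg (h0 t)).
    by rewrite -h0D ?subr_ge0// subrK mulgVK.
  rewrite -opprB hN ?subr_ge0//; apply: (mulIg (h0 t)); rewrite mulgVK.
  by apply: (mulgI (h0 (t - s))); rewrite mulVKg -h0D ?subr_ge0// subrK.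
exists h; split=> [s t|t /andP[t0 t1]].
  pose p (x : R) := if 0 <= x then x else 0; pose n (x : R) := if 0 <= x then 0 else - x.
  have pE x : [/\ 0 <= p x, 0 <= n x & x = p x - n x].
    rewrite /p /n; case: ifPn => [x0|]; first by rewrite subr0.
    by rewrite -ltNge => /ltW x0; rewrite oppr_ge0 sub0r opprK.
  have [ps ns ->] := pE s; have [pt nt ->] := pE t.
  rewrite addrACA -opprD !hB ?addr_ge0// !h0D// invgM.
  have c1 := hc _ _ ps pt; have c2 := hc _ _ ps ns; have c3 := hc _ _ pt ns.
  have c4 := hc _ _ pt nt; have c5 := hc _ _ ns nt.
  rewrite -!mulgA; congr (_ * _)%g.
  have E1 : ((h0 (n t))^-1 * (h0 (n s))^-1 = (h0 (n s))^-1 * (h0 (n t))^-1)%g.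
    by rewrite -!invgM c5.
  have E2 : (h0 (p t) * (h0 (n s))^-1 = (h0 (n s))^-1 * h0 (p t))%g.
    exact: commuteV c3.
  by rewrite E1 !mulgA E2.
by rewrite hp// (h0E _ 1%N)// divr1 expg1.
Qed.

Section local_powers.
Variables (R : realType) (G : groupTopType) (m : nat).
Variables (e : 'rV[R]_m -> G) (lg : G -> 'rV[R]_m) (r C : R).
Hypothesis lc : local_chart e lg r C.
Notation V := 'rV[R]_m.
Let mu (x y : V) := lg (e x * e y)%g.

Let r0 := lc_r lc.
Let C0 := lc_C lc.

Lemma lc_lg1 : lg 1%g = 0.
Proof. by rewrite -(lc_e0 lc) (lc_le lc)// normr0. Qed.

Lemma lc_mu0 x : `|x| < r -> mu x 0 = x.
Proof. by move=> xr; rewrite /mu (lc_e0 lc) mulg1 (lc_le lc). Qed.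

Lemma lc_0mu x : `|x| < r -> mu 0 x = x.
Proof. by move=> xr; rewrite /mu (lc_e0 lc) mul1g (lc_le lc). Qed.

Lemma lc_crx (x : V) : `|x| < r -> C * `|x| <= 1 / 8.
Proof.
move=> xr; apply: le_trans (lc_rC lc); rewrite mulrC ler_wpM2r ?(ltW C0)//; exact: ltW.
Qed.

Lemma lc_mu x y : `|x| < r -> `|y| < r -> `|mu x y - (x + y)| <= C * `|x| * `|y|.
Proof.
move=> xr yr; have := lc_B1 lc xr (_ : `|0 : V| < r) yr; rewrite normr0 => /(_ r0).
rewrite subr0 -/(mu x y) -/(mu 0 y) lc_0mu//.
by have -> : mu x y - y - x = mu x y - (x + y) by zmod.
Qed.

Lemma lc_mulip x x' y : `|x| < r -> `|x'| < r -> `|y| < r ->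
  `|mu x y - mu x' y| <= 2 * `|x - x'|.
Proof.
move=> xr xr' yr; rewrite -[mu x y - _](subrK (x - x')).
apply: le_trans (ler_normD _ _) _; have := lc_B1 lc xr xr' yr; rewrite -!/(mu _ _) => H.
apply: le_trans (lerD H (lexx _)) _.
have := ler_wpM2r (normr_ge0 (x - x')) (lc_crx yr).
by rewrite mulrAC; have := normr_ge0 (x - x'); lra.
Qed.

Lemma lc_mulip2 x x' y : `|x| < r -> `|x'| < r -> `|y| < r ->
  `|mu y x - mu y x'| <= 2 * `|x - x'|.
Proof.
move=> xr xr' yr; rewrite -[mu y x - _](subrK (x - x')).
apply: le_trans (ler_normD _ _) _; have := lc_B2 lc xr xr' yr; rewrite -!/(mu _ _) => H.
apply: le_trans (lerD H (lexx _)) _.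
have := ler_wpM2r (normr_ge0 (x - x')) (lc_crx yr).
by rewrite mulrAC; have := normr_ge0 (x - x'); lra.
Qed.

(** The quadratic error reproduces itself: one more factor adds at most [2 * C * k * |x| ^+ 2],
    while [C * (k * |x|) ^+ 2] grows by [C * (2 * k + 1) * |x| ^+ 2]. *)
Lemma lc_pow_aux k x : k%:R * `|x| <= r / 4 ->
  e (lg (e x ^+ k)%g) = (e x ^+ k)%g /\
  `|lg (e x ^+ k)%g - k%:R *: x| <= C * (k%:R * `|x|) ^+ 2.
Proof.
elim: k => [_|k IH].
  rewrite expg0 lc_lg1 (lc_e0 lc) scale0r subr0 normr0; split => //.
  by rewrite mul0r expr2 !mulr0.
rewrite -natr1 mulrDl mul1r => kr.
have x0 := normr_ge0 x.
have kx0 : 0 <= k%:R * `|x| by rewrite mulr_ge0.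
have [IH1 IH2] := IH (ltac:(lra)).
set p := lg (e x ^+ k)%g in IH1 IH2.
have Ck : C * (k%:R * `|x|) <= 1 / 32.
  have h1 : C * (k%:R * `|x|) <= C * (r / 4).
    by apply: ler_wpM2l; [exact: ltW|lra].
  by have := lc_rC lc; lra.
have np : `|p| <= 2 * (k%:R * `|x|).
  rewrite -[p](subrK (k%:R *: x)); apply: le_trans (ler_normD _ _) _.
  rewrite normrZ (ger0_norm (ler0n _ k)).
  by have := ler_wpM2r kx0 Ck; rewrite -mulrA -expr2; lra.
have pr : `|p| < r by have := r0; lra.
have xr : `|x| < r by have := r0; lra.
rewrite expgSr -IH1; split; first exact: (lc_mul lc).
rewrite -/(mu p x).
have -> : mu p x - (k%:R + 1) *: x = (mu p x - (p + x)) + (p - k%:R *: x).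
  by rewrite scalerDl scale1r; zmod.
apply: le_trans (ler_normD _ _) _.
apply: le_trans (lerD (lc_mu pr xr) IH2) _.
have h1 : C * `|p| * `|x| <= C * (2 * (k%:R * `|x|)) * `|x|.
  by apply: ler_wpM2r => //; apply: ler_wpM2l => //; exact: ltW.
have h2 : 0 <= C * `|x| * `|x| by rewrite !mulr_ge0 ?(ltW C0).
apply: le_trans (lerD h1 (lexx _)) _.
rewrite -subr_ge0.
have -> : C * (k%:R * `|x| + `|x|) ^+ 2 - (C * (2 * (k%:R * `|x|)) * `|x| + C * (k%:R * `|x|) ^+ 2)
  = C * `|x| * `|x| by ring.
by [].
Qed.

Lemma lc_pow k x : k%:R * `|x| <= r / 4 ->
  [/\ e (lg (e x ^+ k)%g) = (e x ^+ k)%g,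
  `|lg (e x ^+ k)%g - k%:R *: x| <= C * (k%:R * `|x|) ^+ 2,
  `|lg (e x ^+ k)%g| <= 2 * (k%:R * `|x|) & `|lg (e x ^+ k)%g| < r].
Proof.
move=> kr; have [h1 h2] := lc_pow_aux kr; split => //.
- rewrite -[lg _](subrK (k%:R *: x)); apply: le_trans (ler_normD _ _) _.
  rewrite normrZ (ger0_norm (ler0n _ k)).
  have kx0 : 0 <= k%:R * `|x| by rewrite mulr_ge0.
  have Ck : C * (k%:R * `|x|) <= 1 / 32.
    have h3 : C * (k%:R * `|x|) <= C * (r / 4) by apply: ler_wpM2l => //; exact: ltW.
    by have := lc_rC lc; lra.
  by have := ler_wpM2r kx0 Ck; rewrite -mulrA -expr2; lra.
- rewrite -[lg _](subrK (k%:R *: x)); apply: le_lt_trans (ler_normD _ _) _.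
  rewrite normrZ (ger0_norm (ler0n _ k)).
  have kx0 : 0 <= k%:R * `|x| by rewrite mulr_ge0.
  have Ck : C * (k%:R * `|x|) <= 1 / 32.
    have h3 : C * (k%:R * `|x|) <= C * (r / 4) by apply: ler_wpM2l => //; exact: ltW.
    by have := lc_rC lc; lra.
  by have := ler_wpM2r kx0 Ck; rewrite -mulrA -expr2; have := r0; lra.
Qed.

(** Each factor adds [|x - y|] and two corrections. The first is [C * (4 * k * |x - y|) * |x|], at
    most [|x - y| / 8] because the total length [k * |x|] stays below [r / 4]; so the constant does
    not deteriorate with [k]. *)
Lemma lc_pow_diff k x y : k%:R * `|x| <= r / 4 -> k%:R * `|y| <= r / 4 ->
  `|lg (e x ^+ k)%g - lg (e y ^+ k)%g| <= 4 * k%:R * `|x - y|.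
Proof.
elim: k => [_ _|k IH]; first by rewrite !expg0 subrr normr0 mulr0 mul0r.
rewrite -natr1 => kx ky.
have x0 := normr_ge0 x; have y0 := normr_ge0 y.
rewrite mulrDl mul1r in kx; rewrite mulrDl mul1r in ky.
have kx0 : 0 <= k%:R * `|x| by rewrite mulr_ge0.
have ky0 : 0 <= k%:R * `|y| by rewrite mulr_ge0.
have kxr : k%:R * `|x| <= r / 4 by lra.
have kyr : k%:R * `|y| <= r / 4 by lra.
have IH' := IH kxr kyr.
have [ep _ _ pr] := lc_pow kxr; have [eq _ nq qr] := lc_pow kyr.
set p := lg (e x ^+ k)%g in IH' ep pr *; set q := lg (e y ^+ k)%g in IH' eq nq qr *.
have xr : `|x| < r by have := r0; lra.
have yr : `|y| < r by have := r0; lra.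
rewrite !expgSr -ep -eq -!/(mu _ _).
have -> : mu p x - mu q y = (mu p x - mu q x - (p - q)) + (mu q x - mu q y - (x - y))
   + (p - q) + (x - y) by zmod.
set d := `|x - y|; have d0 : 0 <= d by exact: normr_ge0.
have h1 : `|mu p x - mu q x - (p - q)| <= d / 8.
  apply: le_trans (lc_B1 lc pr qr xr) _.
  have Ckx : C * (k%:R * `|x|) <= 1 / 32.
    have h3 : C * (k%:R * `|x|) <= C * (r / 4) by apply: ler_wpM2l => //; exact: ltW.
    by have := lc_rC lc; lra.
  have := ler_wpM2r (mulr_ge0 (ltW C0) x0) IH'.
  have := ler_wpM2l d0 Ckx.
  have -> : C * `|p - q| * `|x| = `|p - q| * (C * `|x|) by ring.
  have -> : 4 * k%:R * d * (C * `|x|) = 4 * (d * (C * (k%:R * `|x|))) by ring.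
  by lra.
have h2 : `|mu q x - mu q y - (x - y)| <= d / 8.
  apply: le_trans (lc_B2 lc xr yr qr) _.
  by have := ler_wpM2r d0 (lc_crx qr); rewrite mulrAC -/d; lra.
apply: le_trans (ler_normD _ _) _; apply: le_trans (lerD (ler_normD _ _) (lexx _)) _.
apply: le_trans (lerD (lerD (ler_normD _ _) (lexx _)) (lexx _)) _.
by move: IH'; rewrite -/d; lra.
Qed.

(** The curve is the limit of [e (v / 2^n) ^+ k], with [k] the integer part of [2^n * t]. Passing
    from [n] to [n + 1] replaces [e (v / 2^n)] by a square that differs from it by [O(4^-n)]; after
    at most [2^n] factors the change is [O(2^-n)], hence summable. *)
Lemma lc_psg_loc (v : V) : `|v| <= r / 8 -> exists q : R -> V,
  (forall t, 0 <= t <= 1 -> `|q t| < r /\ `|q t - t *: v| <= C * (t * `|v|) ^+ 2) /\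
  (forall s t, 0 <= s -> 0 <= t -> s + t <= 1 -> e (q (s + t)) = (e (q s) * e (q t))%g).
Proof.
move=> vr.
have v0 := normr_ge0 v.
pose x n : V := (2 ^+ n)^-1 *: v.
have p20 n : 0 < 2 ^+ n :> R by rewrite exprn_gt0.
have nx n : `|x n| = `|v| / 2 ^+ n.
  by rewrite normrZ ger0_norm ?invr_ge0 ?ltW// mulrC.
pose k n (t : R) := Num.truncn (2 ^+ n * t).
pose p n t := lg (e (x n) ^+ k n t)%g.
have kP n (t : R) : 0 <= t -> (k n t)%:R <= 2 ^+ n * t /\ 2 ^+ n * t < (k n t).+1%:R.
  move=> t0.
  have := @truncn_itv R (2 ^+ n * t); rewrite mulr_ge0 ?(ltW (p20 _))//.
  by move=> /(_ isT) /andP[].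
have kx n (t : R) : 0 <= t <= 1 -> (k n t)%:R * `|x n| <= t * `|v|.
  move=> /andP[t0 t1]; have [h _] := kP n t t0.
  rewrite nx mulrA ler_pdivrMr// mulrAC ler_wpM2r// mulrC; exact: h.
have kxr n (t : R) : 0 <= t <= 1 -> (k n t)%:R * `|x n| <= r / 4.
  move=> /andP[t0 t1]; apply: le_trans (kx n t _) _; first by rewrite t0.
  by have := ler_wpM2r v0 t1; have := r0; lra.
have xr n : `|x n| < r.
  apply: le_lt_trans (_ : `|v| < r); last by have := r0; lra.
  rewrite nx ler_pdivrMr// ler_peMr// exprn_ege1//; lra.
pose K := 4 * C * `|v| ^+ 2 + `|v|.
have K0 : 0 <= K by rewrite addr_ge0// !mulr_ge0 ?(ltW C0)// exprn_ge0.
have step (t : R) : 0 <= t <= 1 -> forall n, `|p n.+1 t - p n t| <= K / 2 ^+ n.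
  move=> t01 n; have /andP[t0 t1] := t01.
  have [a1 a2] := kP n t t0; have [b1 b2] := kP n.+1 t t0.
  (* The next binary digit of [t] is 0 or 1; in the second case the additional factor moves the
     product by at most [2 * |x n.+1| = |v| / 2 ^+ n]. *)
  have Ek : k n.+1 t = (k n t).*2 \/ k n.+1 t = (k n t).*2.+1.
    move: a1 a2 b1 b2; rewrite exprS -mulrA => a1 a2 b1 b2.
    apply: nat_two_cases; move: (k n t) (k n.+1 t) a1 a2 b1 b2 => A B a1 a2 b1 b2.
    apply/andP; split.
      by rewrite -ltnS -(ltr_nat R) -muln2 natrM; lra.
    by rewrite -(ltr_nat R) -!natr1 -muln2 natrM; move: a2; rewrite -natr1; lra.
  set kk := k n t in Ek a1 a2 *.
  have x2 : 2%:R * `|x n.+1| <= r / 4.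
    have -> : 2%:R * `|x n.+1| = `|x n| by rewrite !nx exprS; field; rewrite gt_eqF.
    rewrite nx ler_pdivrMr//; have : `|v| * 1 <= r / 4 * 2 ^+ n.
      by apply: ler_pM => //; [have := r0; lra|rewrite exprn_ege1//; lra].
    by rewrite mulr1.
  have [e2 d2 n2 r2] := lc_pow x2; set y := lg (e (x n.+1) ^+ 2)%g in e2 d2 n2 r2.
  have xx : 2%:R *: x n.+1 = x n.
    by rewrite /x exprS scalerA; congr (_ *: _); field; rewrite gt_eqF.
  have nxx : 2%:R * `|x n.+1| = `|x n| by rewrite !nx exprS; field; rewrite gt_eqF.
  have dy : `|y - x n| <= C * `|x n| ^+ 2 by move: d2; rewrite xx nxx.
  have ky : kk%:R * `|y| <= r / 4.
    have h := ler_wpM2l (ler0n R kk) n2; apply: le_trans h _.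
    rewrite nxx mulrCA; have := kx n t t01; rewrite -/kk.
    by have := ler_wpM2r v0 t1; lra.
  have Dk : `|lg (e y ^+ kk)%g - p n t| <= 4 * C * `|v| ^+ 2 / 2 ^+ n.
    apply: le_trans (lc_pow_diff ky (kxr n t t01)) _.
    have h1 : kk%:R <= 2 ^+ n :> R by have := ler_wpM2l (ltW (p20 n)) t1; lra.
    have := ler_pM (ler0n R kk) (normr_ge0 _) h1 dy.
    rewrite nx => H; rewrite -mulrA.
    have -> : 4 * C * `|v| ^+ 2 / 2 ^+ n = 4 * (2 ^+ n * (C * (`|v| / 2 ^+ n) ^+ 2)).
      by field; rewrite gt_eqF.
    by rewrite ler_pM2l.
  have Ep : (e (x n.+1) ^+ kk.*2 = e y ^+ kk)%g by rewrite e2 -expgnA mul2n.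
  have [pe _ _ pr] := lc_pow ky.
  have Dn : `|v| / 2 ^+ n <= K / 2 ^+ n.
    by rewrite ler_pM2r ?invr_gt0// lerDr !mulr_ge0 ?(ltW C0)// exprn_ge0.
  rewrite /p; case: Ek => ->.
    rewrite Ep; apply: le_trans Dk _; rewrite ler_pM2r ?invr_gt0// lerDl//.
  rewrite expgSr Ep -pe -/(mu _ _).
  set w := lg (e y ^+ kk)%g in pe pr Dk *.
  have -> : mu w (x n.+1) - p n t = (mu w (x n.+1) - mu w 0) + (w - p n t).
    by rewrite lc_mu0//; zmod.
  apply: le_trans (ler_normD _ _) _.
  have z0 : `|0 : V| < r by rewrite normr0.
  have := lc_mulip2 (xr n.+1) z0 pr; rewrite subr0 nxx nx => h.
  by rewrite /K mulrDl addrC; apply: lerD.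
have /choice[q' q'P] : forall t, exists l, 0 <= t <= 1 -> forall n, `|p n t - l| <= 2 * K / 2 ^+ n.
  move=> t; have [t01|] := boolP (0 <= t <= 1); last by exists 0.
  by have [l lP] := geo_cauchy (step t t01); exists l.
have key (t : R) : 0 <= t <= 1 -> `|q' t - t *: v| <= C * (t * `|v|) ^+ 2.
  move=> t01; rewrite -subr_le0; have /andP[t0 t1] := t01.
  apply: (@geo_le0 _ _ (2 * K + `|v|)) => n.
  rewrite lerBlDr.
  have -> : q' t - t *: v = - (p n t - q' t) + (p n t - (k n t)%:R *: x n) + ((k n t)%:R *: x n - t *: v) by zmod.
  apply: le_trans (ler_normD _ _) _; apply: le_trans (lerD (ler_normD _ _) (lexx _)) _.
  rewrite normrN.
  have [_ h2 _ _] := lc_pow (kxr n t t01).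
  have h3 : C * ((k n t)%:R * `|x n|) ^+ 2 <= C * (t * `|v|) ^+ 2.
    rewrite ler_wpM2l ?(ltW C0)// lerXn2r ?nnegrE ?mulr_ge0//; exact: kx.
  have h4 : `|(k n t)%:R *: x n - t *: v| <= `|v| / 2 ^+ n.
    rewrite /x scalerA -scalerBl normrZ mulrC ler_wpM2l//.
    have [a1 a2] := kP n t t0.
    have -> : (k n t)%:R / 2 ^+ n - t = - ((2 ^+ n * t - (k n t)%:R) / 2 ^+ n).
      by field; rewrite gt_eqF.
    rewrite normrN ger0_norm; last by rewrite divr_ge0 ?subr_ge0// ltW.
    rewrite -[leRHS]mul1r ler_pM2r ?invr_gt0//.
    by move: a2; rewrite -natr1; lra.
  have := q'P t t01 n; rewrite mulrDl.
  have : `|p n t - (k n t)%:R *: x n| <= C * (t * `|v|) ^+ 2 by apply: le_trans h3.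
  by lra.
have qr (t : R) : 0 <= t <= 1 -> `|q' t| < r.
  move=> t01; have := key t t01; have /andP[t0 t1] := t01.
  have tv : t * `|v| <= `|v| by rewrite -[leRHS]mul1r ler_wpM2r.
  have tv0 : 0 <= t * `|v| by rewrite mulr_ge0.
  have vr' : `|v| < r by have := r0; lra.
  have h := lc_crx vr'.
  have h1 : C * (t * `|v|) ^+ 2 <= 1 / 8 * `|v|.
    have : C * (t * `|v|) * (t * `|v|) <= 1 / 8 * `|v|.
      apply: ler_pM => //; first by rewrite mulr_ge0// ltW.
      by apply: le_trans h; rewrite ler_wpM2l// ltW.
    by have -> : C * (t * `|v|) ^+ 2 = C * (t * `|v|) * (t * `|v|) by ring.
  move=> H; rewrite -[q' t](subrK (t *: v)).
  apply: le_lt_trans (ler_normD _ _) _; rewrite normrZ (ger0_norm t0).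
  by have := r0; lra.
exists q'; split; first by move=> t t01; split; [exact: qr|exact: key].
move=> s t s0 t0 st1.
have s01 : 0 <= s <= 1 by rewrite s0 /=; apply: le_trans st1; rewrite lerDl.
have t01 : 0 <= t <= 1 by rewrite t0 /=; apply: le_trans st1; rewrite lerDr.
have st01 : 0 <= s + t <= 1 by rewrite addr_ge0.
rewrite -(lc_mul lc) ?qr//; congr e; apply/eqP; rewrite -subr_eq0 -normr_le0.
apply: (@geo_le0 _ _ (2 * K + (2 * `|v| + 2 * (2 * K) + 2 * (2 * K)))) => n.
rewrite -/(mu _ _).
have [ps _ _ psr] := lc_pow (kxr n s s01); rewrite -/(p n s) in ps psr.
have [pt _ _ ptr] := lc_pow (kxr n t t01); rewrite -/(p n t) in pt ptr.
(* The integer part of a sum exceeds the sum of the integer parts by at most 1, so the homomorphism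
   property holds at level [n] up to one factor [e (x n)], which disappears in the limit. *)
have H : `|p n (s + t) - mu (p n s) (p n t)| <= 2 * `|v| / 2 ^+ n.
  have [a1 a2] := kP n s s0; have [b1 b2] := kP n t t0.
  have [c1 c2] := kP n (s + t) (addr_ge0 s0 t0).
  have : k n (s + t) = (k n s + k n t)%N \/ k n (s + t) = (k n s + k n t).+1%N.
    rewrite mulrDr in c1 c2.
    apply: nat_two_cases.
    move: (k n s) (k n t) (k n (s + t)) a1 a2 b1 b2 c1 c2 => A B D a1 a2 b1 b2 c1 c2.
    apply/andP; split.
      by rewrite -ltnS -(ltr_nat R) natrD; lra.
    rewrite -[X in (_ < X)%N]addn2.
    rewrite -natr1 in a2; rewrite -natr1 in b2.
    by rewrite -(ltr_nat R) !natrD; lra.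
  have pst : e (mu (p n s) (p n t)) = (e (x n) ^+ (k n s + k n t))%g.
    by rewrite expgnDr -ps -pt (lc_mul lc).
  case => E.
    have -> : p n (s + t) = mu (p n s) (p n t) by rewrite {1}/p E expgnDr -ps -pt.
    by rewrite subrr normr0 divr_ge0 ?mulr_ge0// ltW.
  rewrite /p E expgSr -pst -/(p n s) -/(p n t) -/(mu _ _).
  set w := mu (p n s) (p n t).
  have wr : `|w| < r.
    have : (k n s + k n t)%:R * `|x n| <= r / 4.
      rewrite natrD mulrDl; have := kx n s s01; have := kx n t t01.
      by have := ler_wpM2r v0 st1; have := r0; lra.
    move=> /lc_pow[_ _ _]; congr (_ < _); congr `|_|.
    by rewrite expgnDr -ps -pt.
  have z0 : `|0 : V| < r by rewrite normr0.
  have := lc_mulip2 (xr n) z0 wr; rewrite subr0 lc_mu0// nx => h.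
  by rewrite -mulrA.
have -> : q' (s + t) - mu (q' s) (q' t) = - (p n (s + t) - q' (s + t)) +
   (p n (s + t) - mu (p n s) (p n t)) + (mu (p n s) (p n t) - mu (q' s) (p n t))
   + (mu (q' s) (p n t) - mu (q' s) (q' t)) by zmod.
apply: le_trans (ler_normD _ _) _; apply: le_trans (lerD (ler_normD _ _) (lexx _)) _.
apply: le_trans (lerD (lerD (ler_normD _ _) (lexx _)) (lexx _)) _; rewrite normrN.
have h1 := lc_mulip psr (qr s s01) ptr.
have h2 := lc_mulip2 ptr (qr t t01) (qr s s01).
have := q'P s s01 n; have := q'P t t01 n; have := q'P _ st01 n.
by rewrite !mulrDl; move: h1 h2 H; lra.
Qed.
End local_powers.

Section psg.
Variables (R : realType) (G : groupTopType) (m : nat).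
Variables (e : 'rV[R]_m -> G) (lg : G -> 'rV[R]_m) (r C : R).
Hypothesis lc : local_chart e lg r C.
Notation V := 'rV[R]_m.
Hypothesis invC : continuous (fun x : G => (x^-1)%g).
Let r0 := lc_r lc.
Let C0 := lc_C lc.

Lemma lc_inv : exists2 d : R, 0 < d & forall x : V, `|x| < d ->
  [/\ `|lg ((e x)^-1)%g| < r, e (lg ((e x)^-1)%g) = ((e x)^-1)%g &
      `|lg ((e x)^-1)%g + x| <= 2 * C * `|x| ^+ 2].
Proof.
have n1 := lc_near lc r0.
have n2 : nbhs (1%g : G) [set g | `|lg (g^-1)%g| < r /\ e (lg (g^-1)%g) = (g^-1)%g].
  have := @invC 1%g [set g | `|lg g| < r /\ e (lg g) = g].
  by rewrite /= invg1 => /(_ n1).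
have [d d0 dP] := lc_cont lc n2.
exists (Num.min d r); first by rewrite lt_min d0 r0.
move=> x; rewrite lt_min => /andP[xd xr]; have [h1 h2] := dP _ xd; split => //.
set y := lg ((e x)^-1)%g in h1 h2 *.
have := lc_mu lc xr h1; rewrite h2 mulgV (lc_lg1 lc) sub0r normrN => h.
rewrite addrC; apply: le_trans h _.
have y2 : `|y| <= 2 * `|x|.
  have := lc_mu lc xr h1; rewrite h2 mulgV (lc_lg1 lc) sub0r normrN => h.
  have := ler_wpM2r (normr_ge0 y) (lc_crx lc xr).
  have : `|y| <= `|x + y| + `|x|.
    by rewrite -[y in `|y|](addKr x) addrC -[`|x| in leRHS]normrN; exact: ler_normD.
  by have := normr_ge0 x; have := normr_ge0 y; lra.
have : C * `|x| * `|y| <= C * `|x| * (2 * `|x|).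
  by apply: ler_wpM2l => //; rewrite mulr_ge0// ltW.
by have -> : C * `|x| * (2 * `|x|) = 2 * C * `|x| ^+ 2 by ring.
Qed.

(** Second-order contact with the line [t *: v]. A remainder [O(t^2)] instead of [o(t)] makes the
    comparison of large powers quantitative. *)
Definition tangent (g : R -> G) (v : V) := exists K d, [/\ 0 < K, 0 < d &
  forall t, `|t| <= d -> [/\ e (lg (g t)) = g t, `|lg (g t)| < r & `|lg (g t) - t *: v| <= K * t ^+ 2]].

Definition ghom (g : R -> G) := forall s t, g (s + t) = (g s * g t)%g.

Lemma hom0 g : ghom g -> g 0 = 1%g.
Proof. by move=> h; apply: (mulgI (g 0)); rewrite -h addr0 mulg1. Qed.

Lemma homN g t : ghom g -> g (- t) = ((g t)^-1)%g.
Proof. by move=> h; apply: (mulIg (g t)); rewrite -h addNr mulVg hom0. Qed.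

Lemma homX g t n : ghom g -> g (n%:R * t) = (g t ^+ n)%g.
Proof.
move=> h; elim: n => [|n IH]; first by rewrite mul0r hom0.
by rewrite -natr1 mulrDl mul1r h IH expgSr.
Qed.

Lemma psg_ex : exists rho K : R, [/\ 0 < rho, 0 < K & forall v : V, exists g : R -> G,
  ghom g /\ forall t, `|t| * `|v| <= rho ->
   [/\ e (lg (g t)) = g t, `|lg (g t)| < r & `|lg (g t) - t *: v| <= K * (t * `|v|) ^+ 2]].
Proof.
have [d d0 dP] := lc_inv.
pose rho := Num.min (r / 8) (d / 4).
have rho0 : 0 < rho by rewrite lt_min !divr_gt0.
(* Negative times are reached by inversion, which costs [2 * C * (2 * |t| * |v|) ^+ 2] in addition
   to [C * (t * |v|) ^+ 2]. *)
exists rho, (9 * C); split => //; first by rewrite mulr_gt0.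
move=> v; have [->|v0] := eqVneq v 0.
  exists (fun=> 1%g); split=> [s t|t _]; first by rewrite mulg1.
  rewrite (lc_lg1 lc) (lc_e0 lc) scaler0 subrr normr0 mulr0 expr2 !mulr0.
  by split => //; exact: r0.
have nv : 0 < `|v| by rewrite normr_gt0.
pose a := r / 8 / `|v|.
have a0 : 0 < a by rewrite !divr_gt0.
have av : `|a *: v| = r / 8.
  by rewrite normrZ gtr0_norm// /a mulfVK// gt_eqF.
have [q [qP qD]] := lc_psg_loc lc (ltac:(by rewrite av) : `|a *: v| <= r / 8).
have [h [hD hE]] := @hom_ext R G (fun t => e (q t)) qD.
have H t : 0 <= t -> t * `|v| <= rho -> [/\ h (t / a) = e (q (t / a)), `|q (t / a)| < r,
    `|q (t / a)| <= 2 * (t * `|v|) & `|q (t / a) - t *: v| <= C * (t * `|v|) ^+ 2].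
  move=> t0 tv; have ta : 0 <= t / a <= 1.
    rewrite divr_ge0 ?(ltW a0)//= ler_pdivrMr// mul1r /a ler_pdivlMr//.
    by apply: le_trans tv _; rewrite /rho ge_min lexx.
  have [q1 q2] := qP _ ta; rewrite av in q2.
  have E1 : t / a * (r / 8) = t * `|v| by rewrite /a; field; rewrite !gt_eqF.
  have E2 : t / a *: (a *: v) = t *: v by rewrite scalerA mulfVK// gt_eqF.
  rewrite E1 E2 in q2.
  split => //; first exact: hE.
  rewrite -[q _](subrK (t *: v)); apply: le_trans (ler_normD _ _) _.
  rewrite normrZ (ger0_norm t0).
  have tv0 : 0 <= t * `|v| by rewrite mulr_ge0// ltW.
  have : C * (t * `|v|) <= 1 / 8.
    apply: le_trans (_ : C * r <= _); last by rewrite mulrC; exact: lc_rC lc.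
    rewrite ler_wpM2l ?(ltW C0)//; apply: le_trans tv _.
    by rewrite /rho ge_min; apply/orP; left; have := r0; lra.
  by move=> /(ler_wpM2r tv0); rewrite -mulrA -expr2; lra.
exists (fun t => h (t / a)); split=> [s t|t].
  by rewrite mulrDl hD.
have [t0|t0] := leP 0 t.
  rewrite (ger0_norm t0) => tv; have [-> h2 h3 h4] := H t t0 tv.
  rewrite (lc_le lc)//; split => //; apply: le_trans h4 _.
  apply: ler_wpM2r; first by rewrite exprn_ge0// mulr_ge0// ltW.
  by have := C0; lra.
rewrite (ltr0_norm t0) => tv; have nt0 : 0 <= - t by rewrite oppr_ge0 ltW.
have [h1 h2 h3 h4] := H _ nt0 tv.
have -> : h (t / a) = ((e (q (- t / a)%R))^-1)%g.
  by rewrite -h1 -(@homN (fun s => h s)) ?mulNr ?opprK.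
have qd : `|q (- t / a)| < d.
  apply: le_lt_trans h3 _; have : rho <= d / 4 by rewrite /rho ge_min lexx orbT.
  by have := d0; lra.
have [i1 i2 i3] := dP _ qd; split => //.
set y := lg _ in i1 i2 i3 *; set z := q _ in h1 h2 h3 h4 qd i1 i2 i3 *.
have -> : y - t *: v = (y + z) - (z - (- t) *: v) by rewrite scaleNr; zmodc.
apply: le_trans (ler_normB _ _) _; apply: le_trans (lerD i3 h4) _.
have : `|z| ^+ 2 <= (2 * (- t * `|v|)) ^+ 2.
  by rewrite lerXn2r ?nnegrE// mulr_ge0// mulr_ge0// ltW.
move=> /(ler_wpM2l (ltW C0)) hz.
have -> : 9 * C * (t * `|v|) ^+ 2 = 2 * (C * (2 * (- t * `|v|)) ^+ 2) + C * (- t * `|v|) ^+ 2 by ring.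
by rewrite -mulrA lerD2r ler_pM2l.
Qed.

(* Lipschitz curves through the origin which agree to second order are compared
   by writing each as a large power: errors of order 4^-n are multiplied by 2^n. *)
Lemma hom_unique g h K d : ghom g -> ghom h -> 0 < d ->
  (forall t, `|t| <= d -> [/\ e (lg (g t)) = g t, e (lg (h t)) = h t,
     `|lg (g t)| <= K * `|t|, `|lg (h t)| <= K * `|t| & `|lg (g t) - lg (h t)| <= K * t ^+ 2]) ->
  forall t, g t = h t.
Proof.
move=> hg hh d0 H.
have K0 : 0 <= K.
  have [_ _ + _ _] := H d (ltac:(by rewrite ger0_norm// ltW)).
  by move=> /(le_trans (normr_ge0 _)); rewrite pmulr_lge0// normr_gt0 gt_eqF.
pose d' := Num.min d (r / 4 / (1 + K)).
have d'0 : 0 < d' by rewrite lt_min d0 !divr_gt0// ltr_pwDl.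
have loc t : `|t| <= d' -> g t = h t.
  rewrite le_min => /andP[td tK]; rewrite ler_pdivlMr ?ltr_pwDl// in tK.
  have Kt : K * `|t| <= r / 4 by have := normr_ge0 t; lra.
  have [eg eh _ _ _] := H t td.
  suff E : lg (g t) = lg (h t) by rewrite -eg -eh E.
  apply/eqP; rewrite -subr_eq0 -normr_le0.
  apply: (@geo_le0 _ _ (4 * K * t ^+ 2)) => n.
  pose s := t / 2 ^+ n.
  have p2 : 0 < 2 ^+ n :> R by rewrite exprn_gt0.
  have tE : t = (2 ^ n)%N%:R * s by rewrite natrX /s; field; rewrite gt_eqF.
  have ns : `|s| = `|t| / 2 ^+ n by rewrite /s normrM normfV (gtr0_norm p2).
  have sd : `|s| <= d.
    apply: le_trans td; rewrite ns ler_pdivrMr// ler_peMr// exprn_ege1//; lra.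
  have [e1 e2 n1 n2 n3] := H s sd.
  have b (x : V) : `|x| <= K * `|s| -> (2 ^ n)%N%:R * `|x| <= r / 4.
    move=> xs; apply: le_trans (ler_wpM2l (ler0n _ _) xs) _.
    by rewrite natrX ns mulrCA [2 ^+ n * _]mulrC divfK// gt_eqF.
  rewrite tE !homX// -e1 -e2; apply: le_trans (lc_pow_diff lc (b _ n1) (b _ n2)) _.
  have -> : 4 * K * ((2 ^ n)%N%:R * s) ^+ 2 / 2 ^+ n = 4 * (2 ^ n)%N%:R * (K * s ^+ 2).
    by rewrite natrX; field; rewrite gt_eqF.
  by rewrite ler_wpM2l ?mulr_ge0.
move=> t; pose N := (Num.truncn (`|t| / d')).+1.
have -> : t = N%:R * (t / N%:R) by field; rewrite pnatr_eq0.
rewrite !homX// loc// normrM normfV (ger0_norm (ler0n _ N)) ler_pdivrMr ?ltr0n//.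
by rewrite mulrC -ler_pdivrMr// ltW// truncnS_gt.
Qed.
End psg.

(** * The exponential map of a two-step nilpotent Lie group *)

Section two_step_groups.
Variables (G : groupType).
Hypothesis nilG : two_step_nilpotent G.
Local Open Scope group_scope.

Lemma nil_central (x y z : G) : [~ x, y] * z = z * [~ x, y].
Proof.
by have /eqP/commgP := nilG x y z.
Qed.

Lemma comm_swap (x y : G) : x * y = y * x * [~ x, y].
Proof. by rewrite commgC. Qed.

Lemma comm_invl (x y : G) : [~ y, x] = [~ x, y]^-1.
Proof. by rewrite /commg /conjg !invgM !invgK !mulgA. Qed.

Lemma comm_Ml (x y z : G) : [~ x * y, z] = [~ x, z] * [~ y, z].
Proof.
apply: (mulgI (z * (x * y))); rewrite -comm_swap.
rewrite -mulgA (comm_swap y z) !mulgA (comm_swap x z).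
by rewrite -(mulgA (z * x)) (nil_central x z y) !mulgA.
Qed.

Lemma comm_Mr (x y z : G) : [~ x, y * z] = [~ x, y] * [~ x, z].
Proof. by rewrite comm_invl comm_Ml invgM -!comm_invl nil_central. Qed.

Lemma comm_Xr (x y : G) n : [~ x, y ^+ n] = [~ x, y] ^+ n.
Proof.
elim: n => [|n IH]; last by rewrite !expgSr comm_Mr IH.
by rewrite !expg0 /commg /conjg invg1 mul1g mulg1 mulVg.
Qed.
End two_step_groups.

Section tangents.
Variables (R : realType) (G : groupTopType) (m : nat).
Variables (e : 'rV[R]_m -> G) (lg : G -> 'rV[R]_m) (r C : R).
Hypothesis lc : local_chart e lg r C.
Notation V := 'rV[R]_m.
Hypothesis invC : continuous (fun x : G => (x^-1)%g).
Let r0 := lc_r lc.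
Let C0 := lc_C lc.
Notation tangent := (tangent e lg r).

Definition lip0 (g : R -> G) := exists K d, [/\ 0 < K, 0 < d &
  forall t, `|t| <= d -> [/\ e (lg (g t)) = g t, `|lg (g t)| < r & `|lg (g t)| <= K * `|t|]].

Lemma lip0_small g c : lip0 g -> 0 < c -> exists K d, [/\ 0 < K, 0 < d &
  forall t, `|t| <= d -> [/\ e (lg (g t)) = g t, `|lg (g t)| < c & `|lg (g t)| <= K * `|t|]].
Proof.
move=> [K [d [K0 d0 H]]] c0; exists K, (Num.min d (c / (2 * K))); split => //.
  by rewrite lt_min d0 divr_gt0// mulr_gt0.
move=> t; rewrite le_min => /andP[td tc]; have [h1 h2 h3] := H t td; split => //.
apply: le_lt_trans h3 _; rewrite ler_pdivlMr ?mulr_gt0// in tc.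
by rewrite mulrC; move: tc; have := c0; lra.
Qed.

Lemma tangent_lip0 g v : tangent g v -> lip0 g.
Proof.
move=> [K [d [K0 d0 H]]]; exists (`|v| + K * d), d; split => //.
  by rewrite ltr_wpDl// mulr_gt0.
move=> t td; have [h1 h2 h3] := H t td; split => //.
rewrite -[lg _](subrK (t *: v)); apply: le_trans (ler_normD _ _) _.
rewrite normrZ mulrDl addrC [`|v| * _]mulrC lerD2l; apply: le_trans h3 _.
rewrite -mulrA ler_pM2l// -real_normK ?num_real// expr2 ler_wpM2r//.
Qed.

Lemma tangent_mul g h v w : tangent g v -> tangent h w ->
  tangent (fun t => (g t * h t)%g) (v + w).
Proof.
move=> tg th.
have [K1 [d1 [K10 d10 H1]]] := lip0_small (tangent_lip0 tg) (divr_gt0 r0 (ltr0n _ 4)).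
have [K2 [d2 [K20 d20 H2]]] := lip0_small (tangent_lip0 th) (divr_gt0 r0 (ltr0n _ 4)).
have [K3 [d3 [K30 d30 H3]]] := tg; have [K4 [d4 [K40 d40 H4]]] := th.
exists (C * K1 * K2 + K3 + K4), (Num.min (Num.min d1 d2) (Num.min d3 d4)); split.
- by rewrite !addr_gt0// !mulr_gt0.
- by rewrite !lt_min d10 d20 d30.
move=> t; rewrite !le_min => /andP[/andP[t1 t2] /andP[t3 t4]].
have [e1 x4 xK] := H1 t t1; have [e2 y4 yK] := H2 t t2.
have [_ _ xt] := H3 t t3; have [_ _ yt] := H4 t t4.
set x := lg (g t) in e1 x4 xK xt *; set y := lg (h t) in e2 y4 yK yt *.
have xr : `|x| < r by have := r0; lra.
have yr : `|y| < r by have := r0; lra.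
have M := lc_mu lc xr yr.
have Mxy : `|lg (e x * e y)%g| < r.
  rewrite -[lg _](subrK (x + y)); apply: le_lt_trans (ler_normD _ _) _.
  apply: le_lt_trans (lerD M (ler_normD _ _)) _.
  by have := ler_wpM2r (normr_ge0 y) (lc_crx lc xr); have := r0; lra.
rewrite -e1 -e2; split => //; first exact: (lc_mul lc).
have -> : lg (e x * e y)%g - t *: (v + w) = (lg (e x * e y)%g - (x + y)) + (x - t *: v) + (y - t *: w).
  by rewrite scalerDr; zmodc.
apply: le_trans (ler_normD _ _) _; apply: le_trans (lerD (ler_normD _ _) (lexx _)) _.
rewrite !mulrDl; apply: lerD => //; apply: lerD => //; apply: le_trans M _.
rewrite -!mulrA ler_pM2l//.
have -> : K1 * (K2 * t ^+ 2) = (K1 * `|t|) * (K2 * `|t|).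
  by rewrite -real_normK ?num_real//; ring.
exact: ler_pM.
Qed.

Lemma tangent_scale g v c : tangent g v -> tangent (fun t => g (c * t)) (c *: v).
Proof.
move=> [K [d [K0 d0 H]]].
have c1 : 0 < 1 + `|c| by rewrite ltr_pwDl.
exists (K * (1 + c ^+ 2)), (d / (1 + `|c|)); split.
- by rewrite mulr_gt0// ltr_pwDl// sqr_ge0.
- exact: divr_gt0.
move=> t; rewrite ler_pdivlMr// => td.
have ctd : `|c * t| <= d.
  by rewrite normrM; have := normr_ge0 t; have := normr_ge0 c; lra.
have [h1 h2 h3] := H _ ctd; split => //.
rewrite scalerA [t * c]mulrC; apply: le_trans h3 _.
rewrite exprMn -mulrA ler_pM2l// ler_wpM2r ?sqr_ge0//; lra.
Qed.

Lemma tangent_sq g v c : tangent g v -> tangent (fun t => g (c * t ^+ 2)) 0.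
Proof.
move=> /tangent_lip0[K [d [K0 d0 H]]].
have c1 : 0 < 1 + `|c| by rewrite ltr_pwDl.
exists (K * (1 + `|c|)), (Num.min 1 (d / (1 + `|c|))); split.
- exact: mulr_gt0.
- by rewrite lt_min ltr01 divr_gt0.
move=> t; rewrite le_min ler_pdivlMr// => /andP[t1 td].
have t2 : t ^+ 2 = `|t| * `|t| by rewrite -expr2 real_normK ?num_real.
have tt : `|t| * `|t| <= `|t| by rewrite ler_piMl.
have ctd : `|c * t ^+ 2| <= d.
  rewrite normrM t2 normrM !normr_id.
  have := ler_wpM2l (normr_ge0 c) tt; have := normr_ge0 t; lra.
have [h1 h2 h3] := H _ ctd; split => //.
rewrite scaler0 subr0; apply: le_trans h3 _.
rewrite -mulrA ler_pM2l// normrM t2 normrM !normr_id ler_wpM2r ?mulr_ge0//; lra.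
Qed.

Lemma tangent_unique g h v : ghom g -> ghom h -> tangent g v -> tangent h v ->
  forall t, g t = h t.
Proof.
move=> hg hh tg th.
have [K1 [d1 [K10 d10 H1]]] := tangent_lip0 tg.
have [K2 [d2 [K20 d20 H2]]] := tangent_lip0 th.
have [K3 [d3 [K30 d30 H3]]] := tg; have [K4 [d4 [K40 d40 H4]]] := th.
apply: (@hom_unique R G m e lg r C lc g h (K1 + K2 + K3 + K4)
   (Num.min (Num.min d1 d2) (Num.min d3 d4))) => //.
  by rewrite !lt_min d10 d20 d30.
move=> t; rewrite !le_min => /andP[/andP[t1 t2] /andP[t3 t4]].
have [e1 _ xK] := H1 t t1; have [e2 _ yK] := H2 t t2.
have [_ _ xt] := H3 t t3; have [_ _ yt] := H4 t t4.
have t0 := normr_ge0 t; have tt0 := sqr_ge0 t; split => //.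
- by apply: le_trans xK _; rewrite ler_wpM2r//; lra.
- by apply: le_trans yK _; rewrite ler_wpM2r//; lra.
- have -> : lg (g t) - lg (h t) = (lg (g t) - t *: v) - (lg (h t) - t *: v) by zmod.
  apply: le_trans (ler_normB _ _) _; apply: le_trans (lerD xt yt) _.
  by rewrite -mulrDl ler_wpM2r//; lra.
Qed.

Lemma tangent_fun_unique g v w : tangent g v -> tangent g w -> v = w.
Proof.
move=> [K1 [d1 [K10 d10 H1]]] [K2 [d2 [K20 d20 H2]]].
apply/eqP; rewrite -subr_eq0 -normr_le0.
pose d := Num.min d1 d2; have d0 : 0 < d by rewrite lt_min d10.
apply: (@geo_le0 _ _ ((K1 + K2) * d)) => n.
have p2 : 0 < 2 ^+ n :> R by rewrite exprn_gt0.
pose t := d / 2 ^+ n; have t0 : 0 < t by rewrite divr_gt0.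
have td : `|t| <= d.
  by rewrite gtr0_norm// ler_pdivrMr// ler_peMr ?(ltW d0)// exprn_ege1//; lra.
have [_ _ h1] := H1 t (le_trans td (ltac:(by rewrite ge_min lexx) : d <= d1)).
have [_ _ h2] := H2 t (le_trans td (ltac:(by rewrite ge_min lexx orbT) : d <= d2)).
rewrite -(ler_pM2l t0) -{1}(gtr0_norm t0) -normrZ.
have -> : t *: (v - w) = (lg (g t) - t *: w) - (lg (g t) - t *: v).
  by rewrite scalerBr; zmodc.
apply: le_trans (ler_normB _ _) _; apply: le_trans (lerD h2 h1) _.
by rewrite le_eqVlt /t; apply/orP; left; apply/eqP; field; rewrite gt_eqF.
Qed.

Lemma hom_lg_lip g K d s t : ghom g -> 0 < d ->
  (forall t, `|t| <= d -> [/\ e (lg (g t)) = g t, `|lg (g t)| < r & `|lg (g t)| <= K * `|t|]) ->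
  `|s| <= d -> `|t| <= d -> `|t - s| <= d -> `|lg (g t) - lg (g s)| <= 2 * K * `|t - s|.
Proof.
move=> hg d0 H sd td tsd.
have [e1 r1 _] := H s sd; have [e2 r2 k2] := H _ tsd.
have -> : g t = (g s * g (t - s))%g by rewrite -hg addrC subrK.
rewrite -{1}e1 -e2 -[X in _ - X](lc_mu0 lc)// -mulrA.
have z0 : `|0 : V| < r by rewrite normr0.
have := lc_mulip2 lc r2 z0 r1; rewrite subr0 => h; apply: le_trans h _.
by rewrite ler_pM2l.
Qed.

(** A homomorphism that is Lipschitz at 0 is differentiable there: doubling the time changes the
    logarithm by a factor 2 up to second order, so [2^n *: lg (g (dd / 2^n))] is a Cauchy sequence.
    This produces the bracket without computing a derivative. *)
Lemma lip0_tangent g : ghom g -> lip0 g -> exists v, tangent g v.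
Proof.
move=> hg lg0.
have [dI dI0 dIP] := lc_inv lc invC.
have rr : 0 < Num.min (r / 8) dI by rewrite lt_min dI0 divr_gt0.
have [K [d [K0 d0 H0]]] := lip0_small lg0 rr.
pose dd := Num.min d (r / 4 / K).
have dd0 : 0 < dd by rewrite lt_min d0 !divr_gt0.
have H t : `|t| <= dd -> [/\ e (lg (g t)) = g t, `|lg (g t)| < r & `|lg (g t)| <= K * `|t|].
  rewrite le_min => /andP[td _]; have [h1 h2 h3] := H0 t td; split => //.
  by apply: lt_trans h2 _; rewrite gt_min; apply/orP; left; have := r0; lra.
have Kdd : K * dd <= r / 4 by rewrite mulrC -ler_pdivlMr// ge_min lexx orbT.
have p2 n : 0 < 2 ^+ n :> R by rewrite exprn_gt0.
pose s n : R := dd / 2 ^+ n.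
have s0 n : 0 < s n by rewrite divr_gt0.
have sd n : `|s n| <= dd.
  by rewrite gtr0_norm// ler_pdivrMr// ler_peMr ?(ltW dd0)// exprn_ege1//; lra.
pose w n : V := 2 ^+ n *: lg (g (s n)).
have kpow n k : k%:R * s n <= dd ->
    `|lg (g (k%:R * s n)) - k%:R *: lg (g (s n))| <= C * K ^+ 2 * (k%:R * s n) ^+ 2.
  move=> ks; have [h1 h2 h3] := H _ (sd n); rewrite (gtr0_norm (s0 n)) in h3.
  have kx : k%:R * `|lg (g (s n))| <= K * (k%:R * s n).
    by rewrite mulrCA ler_wpM2l.
  have kr : k%:R * `|lg (g (s n))| <= r / 4.
    apply: le_trans kx _; apply: le_trans Kdd; by rewrite ler_pM2l.
  have [_ + _ _] := lc_pow lc kr; rewrite h1 -homX// => h; apply: le_trans h _.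
  rewrite -mulrA ler_pM2l// -exprMn lerXn2r ?nnegrE ?mulr_ge0 ?(ltW K0) ?(ltW (s0 n)) ?(ltW dd0)//.
have wstep n : `|w n.+1 - w n| <= C * K ^+ 2 * dd ^+ 2 / 2 ^+ n.
  have E : 2%:R * s n.+1 = s n by rewrite /s exprS; field; rewrite gt_eqF.
  have := kpow n.+1 2%N; rewrite E => /(_ (le_trans (ler_norm _) (sd n))) h.
  rewrite /w exprSr -scalerA -scalerBr normrZ (gtr0_norm (p2 n)) distrC.
  apply: le_trans (ler_wpM2l (ltW (p2 n)) h) _.
  by rewrite le_eqVlt /s; apply/orP; left; apply/eqP; field; rewrite gt_eqF.
have [wl wP] := geo_cauchy wstep.
pose v := dd^-1 *: wl.
have key t : 0 <= t <= dd -> `|lg (g t) - t *: v| <= C * K ^+ 2 * t ^+ 2.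
  move=> /andP[t0 td]; rewrite -subr_le0.
  pose A := C * K ^+ 2 * dd ^+ 2.
  have A0 : 0 < A by rewrite !mulr_gt0// exprn_gt0.
  apply: (@geo_le0 _ _ (2 * K * dd + 2 * A + `|wl|)) => n.
  rewrite lerBlDr.
  pose k := Num.truncn (t / s n).
  have /andP[k1 k2] : k%:R <= t / s n < k.+1%:R by apply: truncn_itv; rewrite divr_ge0// ltW.
  rewrite ler_pdivlMr// in k1; rewrite ltr_pdivrMr// -natr1 mulrDl mul1r in k2.
  have ks0 : 0 <= k%:R * s n by rewrite mulr_ge0// ltW.
  have ksd : k%:R * s n <= dd by apply: le_trans td.
  have tks : `|t - k%:R * s n| <= s n by rewrite ger0_norm; lra.
  have h1 : `|lg (g t) - lg (g (k%:R * s n))| <= 2 * K * s n.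
    apply: (le_trans (@hom_lg_lip g K dd (k%:R * s n) t hg dd0 H _ _ _)).
    - by rewrite ger0_norm.
    - by rewrite ger0_norm.
    - by apply: le_trans tks _; exact: le_trans (ler_norm _) (sd n).
    - by rewrite ler_pM2l// mulr_gt0.
  have h2 := kpow n k ksd.
  have h3 : C * K ^+ 2 * (k%:R * s n) ^+ 2 <= C * K ^+ 2 * t ^+ 2.
    by rewrite ler_pM2l ?mulr_gt0 ?exprn_gt0// lerXn2r ?nnegrE.
  have ksdd : k%:R * s n / dd <= 1 by rewrite ler_pdivrMr// mul1r.
  have ksdd0 : 0 <= k%:R * s n / dd by rewrite divr_ge0// ltW.
  have h4 : `|k%:R *: lg (g (s n)) - (k%:R * s n / dd) *: wl| <= 2 * A / 2 ^+ n.
    have -> : k%:R *: lg (g (s n)) = (k%:R * s n / dd) *: w n.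
      rewrite /w scalerA; congr (_ *: _); rewrite /s; field.
      by rewrite !gt_eqF.
    rewrite -scalerBr normrZ ger0_norm//; apply: le_trans (_ : 1 * `|w n - wl| <= _).
      by rewrite ler_wpM2r.
    by rewrite mul1r wP.
  have h5 : `|(k%:R * s n / dd) *: wl - t *: v| <= `|wl| / 2 ^+ n.
    rewrite /v scalerA -scalerBl normrZ mulrC ler_wpM2l// -mulrBl normrM.
    rewrite normfV (gtr0_norm dd0) ler_pdivrMr// distrC; apply: le_trans tks _.
    by rewrite /s mulrC.
  have -> : lg (g t) - t *: v = (lg (g t) - lg (g (k%:R * s n))) +
     (lg (g (k%:R * s n)) - k%:R *: lg (g (s n))) +
     (k%:R *: lg (g (s n)) - (k%:R * s n / dd) *: wl) + ((k%:R * s n / dd) *: wl - t *: v) by zmod.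
  apply: le_trans (ler_normD _ _) _; apply: le_trans (lerD (ler_normD _ _) (lexx _)) _.
  apply: le_trans (lerD (lerD (ler_normD _ _) (lexx _)) (lexx _)) _.
  have -> : (2 * K * dd + 2 * A + `|wl|) / 2 ^+ n = 2 * K * s n + 2 * A / 2 ^+ n + `|wl| / 2 ^+ n.
    by rewrite /s; ring.
  by move: h1 h2 h3 h4 h5; lra.
(* For negative [t], inversion contributes [2 * C * K ^+ 2 * t ^+ 2] on top of the estimate for
   [- t]. *)
exists v, (3 * C * K ^+ 2), dd; split => //; first by rewrite !mulr_gt0// exprn_gt0.
move=> t td; have [h1 h2 h3] := H t td; split => //.
have [t0|t0] := leP 0 t.
  rewrite (ger0_norm t0) in td; apply: le_trans (key t _) _; first by rewrite t0.
  by rewrite -!mulrA ler_peMl//; [rewrite !mulr_ge0 ?(ltW C0)// ?exprn_ge0 ?(ltW K0)// sqr_ge0|lra].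
rewrite (ltr0_norm t0) in td.
have nt : 0 <= - t by rewrite oppr_ge0 ltW.
have := key (- t); rewrite nt td => /(_ isT) hk.
have [] := H0 (- t).
  by rewrite ger0_norm//; apply: le_trans td _; rewrite ge_min lexx.
rewrite lt_min => i1 /andP[_ i2] i3.
have [j1 j2 j3] := dIP _ i2.
have E : g t = ((e (lg (g (- t))))^-1)%g by rewrite i1 -homN// opprK.
rewrite E; have -> : lg ((e (lg (g (- t))))^-1)%g - t *: v =
  (lg ((e (lg (g (- t))))^-1)%g + lg (g (- t))) - (lg (g (- t)) - (- t) *: v).
  by rewrite scaleNr; zmodc.
apply: le_trans (ler_normB _ _) _; apply: le_trans (lerD j3 hk) _.
have : `|lg (g (- t))| ^+ 2 <= (K * - t) ^+ 2.
  rewrite (ger0_norm nt) in i3.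
  by rewrite lerXn2r ?nnegrE// mulr_ge0// ltW.
move=> /(ler_wpM2l (ltW C0)) hz.
have -> : 3 * C * K ^+ 2 * t ^+ 2 = 2 * (C * (K * - t) ^+ 2) + C * K ^+ 2 * (- t) ^+ 2 by ring.
by rewrite -mulrA lerD2r ler_pM2l.
Qed.
End tangents.

Record nilexp (R : realType) (G : groupTopType) (m : nat)
    (e : 'rV[R]_m -> G) (lg : G -> 'rV[R]_m) (r : R)
    (ex : 'rV[R]_m -> G) (b : 'rV[R]_m -> 'rV[R]_m -> 'rV[R]_m) (K d : R) : Prop := NilExp {
  ne_K : 0 < K; ne_d : 0 < d;
  ne_bl : forall a u v w, b (a *: u + v) w = a *: b u w + b v w;
  ne_alt : forall v w, b v w = - b w v;
  ne_nil : forall u v w, b (b u v) w = 0;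
  ne_mul : forall v w, (ex v * ex w)%g = ex (v + w + 2^-1 *: b v w);
  ne_comm : forall v w, ([~ ex v, ex w])%g = ex (b v w);
  ne_loc : forall v, `|v| <= d -> [/\ e (lg (ex v)) = ex v, `|lg (ex v)| < r &
      `|lg (ex v) - v| <= K * `|v| ^+ 2];
  ne_line : forall u v, (forall t, ex (t *: u) = ex (t *: v)) -> u = v
}.

Section exponential.
Variables (R : realType) (G : groupTopType) (m : nat).
Variables (e : 'rV[R]_m -> G) (lg : G -> 'rV[R]_m) (r C : R).
Hypothesis lc : local_chart e lg r C.
Hypothesis invC : continuous (fun x : G => (x^-1)%g).
Hypothesis nilG : two_step_nilpotent G.
Notation V := 'rV[R]_m.
Let mu (x y : V) := lg (e x * e y)%g.
Let r0 := lc_r lc.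
Notation tangent := (tangent e lg r).

Lemma psg_family : exists (ga : V -> R -> G) (rho K : R), [/\ 0 < rho, 0 < K &
  forall v, [/\ ghom (ga v), tangent (ga v) v &
   forall t, `|t| * `|v| <= rho ->
   [/\ e (lg (ga v t)) = ga v t, `|lg (ga v t)| < r & `|lg (ga v t) - t *: v| <= K * (t * `|v|) ^+ 2]]].
Proof.
have [rho [K [rho0 K0 H]]] := psg_ex lc invC.
have /choice[ga gaP] := H.
exists ga, rho, K; split => // v; have [h1 h2] := gaP v; split => //.
have v1 : 0 < 1 + `|v| by rewrite ltr_pwDl.
exists (K * (1 + `|v| ^+ 2)), (rho / (1 + `|v|)); split.
- by rewrite mulr_gt0// ltr_pwDl// exprn_ge0.
- exact: divr_gt0.
move=> t; rewrite ler_pdivlMr// => tr.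
have [] := h2 t; first by move: tr; have := normr_ge0 t; lra.
move=> k1 k2 k3; split => //; apply: le_trans k3 _.
rewrite -mulrA ler_pM2l// exprMn mulrC ler_wpM2r ?sqr_ge0//; lra.
Qed.

Let ga := projT1 (cid psg_family).
Let gaP := projT2 (cid psg_family).

Lemma ga_hom v : ghom (ga v).
Proof. by have [rho [K [_ _ /(_ v)[]]]] := gaP. Qed.

Lemma ga_tan v : tangent (ga v) v.
Proof. by have [rho [K [_ _ /(_ v)[]]]] := gaP. Qed.

Lemma ga_unique g v : ghom g -> tangent g v -> forall t, g t = ga v t.
Proof. by move=> hg tg; apply: (tangent_unique lc hg (ga_hom v) tg (ga_tan v)). Qed.

Lemma gaZ c v t : ga (c *: v) t = ga v (c * t).
Proof.
symmetry; apply: (@ga_unique (fun t => ga v (c * t))).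
  by move=> s u; rewrite mulrDr ga_hom.
exact: tangent_scale (ga_tan v).
Qed.

Lemma ga_inj v w : (forall t, ga v t = ga w t) -> v = w.
Proof.
move=> h; apply: (tangent_fun_unique (ga_tan v)).
by rewrite (_ : ga v = ga w)//; [exact: ga_tan|exact/funext].
Qed.

(** By nilpotency [t |-> [ga v t, g]] is a homomorphism, so it has a tangent once it is Lipschitz.
    The estimate needs [g] in the chart; hence [g = ga w (1 / N)], and the full commutator is
    recovered as an [N]-th power. *)
Lemma bracket_ex v w : exists b, forall t, ([~ ga v t, ga w 1])%g = ga b t.
Proof.
have [dI dI0 dIP] := lc_inv lc invC.
have d8 : 0 < Num.min (r / 8) (dI / 2) by rewrite lt_min !divr_gt0.
have [K [d [K0 d0 H]]] := lip0_small (tangent_lip0 (ga_tan w)) d8.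
pose N := (Num.truncn (d^-1)).+1.
have Nd : `|N%:R^-1 : R| <= d.
  rewrite ger0_norm ?invr_ge0// -[d]invrK lef_pV2 ?posrE ?invr_gt0 ?ltr0n//.
  exact/ltW/truncnS_gt.
have [] := H _ Nd; set g := ga w N%:R^-1; set z := lg g => eg.
rewrite lt_min => /andP[z8 zI] _.
have [|yr ey yz] := dIP z; first by lra.
set y := lg ((e z)^-1)%g in yr ey yz.
have z1 : `|z| < r by have := r0; lra.
have yr4 : `|y| <= r / 4.
  have := lc_crx lc z1; have := ler_wpM2r (normr_ge0 z) (lc_crx lc z1).
  rewrite -[y](addrK z) => h1 h2; apply: le_trans (ler_normB _ _) _.
  have E : 2 * C * `|z| ^+ 2 = 2 * (C * `|z| * `|z|) by ring.
  by rewrite E in yz; lra.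
have [Kv [dv [Kv0 dv0 Hv]]] := lip0_small (tangent_lip0 (ga_tan v)) (divr_gt0 r0 (ltr0n _ 16)).
pose kap t := ([~ ga v t, g])%g.
have khom : ghom kap by move=> s t; rewrite /kap ga_hom comm_Ml.
have klip : lip0 e lg r kap.
  exists (10 * Kv), dv; split => //; first exact: mulr_gt0.
  move=> t tv; have [e1 x16 xK] := Hv t tv.
  have tv' : `|- t| <= dv by rewrite normrN.
  have [e2 u16 uK] := Hv _ tv'; rewrite normrN in uK.
  set x := lg (ga v t) in e1 x16 xK; set u := lg (ga v (- t)) in e2 u16 uK.
  have xr : `|x| < r by have := r0; lra.
  have ur : `|u| < r by have := r0; lra.
  have y1 : `|y| < r by have := r0; lra.
  have Eyx : `|mu y x| < r.
    rewrite -[mu y x](subrK (y + x)); apply: le_lt_trans (ler_normD _ _) _.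
    apply: le_lt_trans (lerD (lc_mu lc y1 xr) (ler_normD _ _)) _.
    by have := ler_wpM2r (normr_ge0 x) (lc_crx lc y1); have := r0; lra.
  (* This is the logarithm of the conjugate of [ga v t] by [g]. It is Lipschitz in [x] and vanishes
     for [x = 0], hence is bounded by a multiple of [|x|]. *)
  set c := mu (mu y x) z.
  have c4 : `|c| <= 4 * `|x|.
    have -> : c = c - mu (mu y 0) z.
      rewrite [mu y 0](lc_mu0 lc)// /mu ey mulVg (lc_lg1 lc) subr0//.
    apply: le_trans (lc_mulip lc Eyx _ z1) _; first by rewrite [mu y 0](lc_mu0 lc).
    have z0 : `|0 : V| < r by rewrite normr0.
    have := lc_mulip2 lc xr z0 y1; rewrite subr0 -!/(mu _ _); lra.
  have cr : `|c| < r by lra.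
  have kE : kap t = (e u * e c)%g.
    rewrite /kap /commg /conjg -homN; last exact: ga_hom.
    rewrite e2 (lc_mul lc)// (lc_mul lc)// ey e1 eg !mulgA.
    by [].
  have uc : `|mu u c| <= 2 * (`|u| + `|c|).
    rewrite -[mu u c](subrK (u + c)); apply: le_trans (ler_normD _ _) _.
    apply: le_trans (lerD (lc_mu lc ur cr) (ler_normD _ _)) _.
    have := ler_wpM2r (normr_ge0 c) (lc_crx lc ur).
    by have := normr_ge0 u; have := normr_ge0 c; lra.
  rewrite kE; split.
  - exact: (lc_mul lc).
  - by apply: le_lt_trans uc _; have := r0; lra.
  - by apply: le_trans uc _; rewrite -mulrA; move: c4 uK xK; lra.
have [b0 tb0] := lip0_tangent lc invC khom klip.
exists (N%:R *: b0) => t; rewrite gaZ.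
have -> : ga w 1 = (g ^+ N)%g.
  by rewrite /g -homX ?divff ?pnatr_eq0//; exact: ga_hom.
by rewrite comm_Xr// -/(kap t) (ga_unique khom tb0) -homX//; exact: ga_hom.
Qed.

Let br v w := projT1 (cid (bracket_ex v w)).
Let brP v w t : ([~ ga v t, ga w 1])%g = ga (br v w) t.
Proof. exact: projT2 (cid (bracket_ex v w)) t. Qed.

Lemma tangent_dyadic g h v w : tangent g v -> tangent h w ->
  (forall n, g (2 ^+ n)^-1 = h (2 ^+ n)^-1) -> v = w.
Proof.
move=> [K1 [d1 [K10 d10 H1]]] [K2 [d2 [K20 d20 H2]]] gh.
apply/eqP; rewrite -subr_eq0 -normr_le0.
pose d := Num.min d1 d2; have d0 : 0 < d by rewrite lt_min d10.
have p2 n : 0 < 2 ^+ n :> R by rewrite exprn_gt0.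
pose N := (Num.truncn d^-1).+1.
have Nd n : `|(2 ^+ (n + N))^-1 : R| <= d.
  rewrite gtr0_norm ?invr_gt0// -[d]invrK lef_pV2 ?posrE ?invr_gt0//.
  apply: le_trans (ltW (truncnS_gt _)) _; rewrite -natrX ler_nat.
  by apply: leq_trans (ltnW (ltn_expl N (ltnSn 1))) _; rewrite leq_exp2l// leq_addl.
apply: (@geo_le0 _ _ (K1 + K2)) => n.
pose t : R := (2 ^+ (n + N))^-1; have td : `|t| <= d := Nd n.
have t0 : 0 < t by rewrite invr_gt0.
have [_ _ h1] := H1 t (le_trans td (ltac:(by rewrite ge_min lexx) : d <= d1)).
have [_ _ h2] := H2 t (le_trans td (ltac:(by rewrite ge_min lexx orbT) : d <= d2)).
have tn : t <= (2 ^+ n)^-1.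
  by rewrite lef_pV2 ?posrE// ler_eXn2l ?ltr1n// leq_addr.
rewrite -(ler_pM2l t0) -{1}(gtr0_norm t0) -normrZ.
have -> : t *: (v - w) = (lg (h t) - t *: w) - (lg (g t) - t *: v).
  by rewrite /t gh scalerBr; zmodc.
apply: le_trans (ler_normB _ _) _; apply: le_trans (lerD h2 h1) _.
rewrite -mulrDl addrC [leRHS]mulrC -mulrA ler_pM2l ?addr_gt0//.
by rewrite expr2 [leRHS]mulrC ler_pM2l.
Qed.

Lemma brNat v w k : br v (k%:R *: w) = k%:R *: br v w.
Proof.
apply: ga_inj => t; rewrite -brP !gaZ homX; last exact: ga_hom.
by rewrite comm_Xr// brP -homX//; exact: ga_hom.
Qed.

Lemma brZl c v w : br (c *: v) w = c *: br v w.
Proof. by apply: ga_inj => t; rewrite -brP !gaZ brP. Qed.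

Lemma brdyad v w n : br v ((2 ^+ n)^-1 *: w) = (2 ^+ n)^-1 *: br v w.
Proof.
have p2 : 2 ^+ n != 0 :> R by rewrite gt_eqF// exprn_gt0.
have := brNat v ((2 ^+ n)^-1 *: w) (2 ^ n)%N; rewrite natrX scalerA divff// scale1r => ->.
by rewrite scalerA mulVf// scale1r.
Qed.

(** Real scalars are free in the first slot, where they reparametrize the homomorphism, but only
    dyadic ones are available in the second. Comparing at dyadic times and exchanging the slots by
    antisymmetry of the group commutator moves the real factor to the first slot. *)
Lemma brZN v w t : br v (t *: w) = - (t *: br w v).
Proof.
rewrite -scaleNr; apply: (tangent_dyadic (ga_tan _) (ga_tan _)) => n.
set s := (2 ^+ n)^-1.
rewrite -brP !gaZ mulr1 mulNr homN; last exact: ga_hom.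
rewrite comm_invl; congr (_^-1)%g.
have -> : ga v s = ga (s *: v) 1 by rewrite gaZ mulr1.
by rewrite brP brdyad gaZ mulrC.
Qed.

Lemma brC v w : br v w = - br w v.
Proof. by have := brZN v w 1; rewrite !scale1r. Qed.

Lemma brst v w s t : ([~ ga v s, ga w t])%g = ga (br v w) (s * t).
Proof.
have -> : ga w t = ga (t *: w) 1 by rewrite gaZ mulr1.
by rewrite brP brZN -scaleNr gaZ brC -scaleN1r gaZ; congr (ga _ _); ring.
Qed.

Lemma br_central v w s x : (ga (br v w) s * x = x * ga (br v w) s)%g.
Proof. by rewrite -brP nil_central. Qed.

Lemma ga_commute v c : (forall s t, (ga v s * ga c t = ga c t * ga v s)%g) ->
  forall t, (ga v t * ga c t)%g = ga (v + c) t.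
Proof.
move=> h t; apply: (@ga_unique (fun t => (ga v t * ga c t)%g)); last first.
  by apply: (tangent_mul lc); exact: ga_tan.
by move=> s u /=; rewrite !ga_hom -!mulgA (mulgA (ga v u)) (h u s) -!mulgA.
Qed.

(** The left side is a homomorphism in [t]: exchanging [ga v t] with [ga w s] produces the central
    factor of exponent [s * t], which the polarization of [t ^+ 2 / 2] cancels. It is tangent to
    [v + w], so uniqueness applies. *)
Lemma ga_mul v w t : (ga v t * ga w t * ga (br v w) (- 2^-1 * t ^+ 2)%R)%g = ga (v + w) t.
Proof.
apply: (@ga_unique (fun t => (ga v t * ga w t * ga (br v w) (- 2^-1 * t ^+ 2)%R)%g)).
  move=> s {}t.
  have -> : - 2^-1 * (s + t) ^+ 2 = - (s * t) + (- 2^-1 * s ^+ 2 + - 2^-1 * t ^+ 2) :> R.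
    by field.
  rewrite !ga_hom homN; last exact: ga_hom.
  set k := ga (br v w) (s * t); set c1 := ga _ (_ * s ^+ 2); set c2 := ga _ (_ * t ^+ 2).
  have ck x : (k * x = x * k)%g := br_central v w (s * t) x.
  have cc x : (c1 * x = x * c1)%g := br_central v w _ x.
  have E : (ga v t * ga w s = ga w s * ga v t * k)%g by rewrite comm_swap brst mulrC.
  transitivity (ga v s * (ga v t * ga w s) * ga w t * k^-1 * c1 * c2)%g.
    by rewrite !mulgA.
  rewrite E -!mulgA (mulgA k (ga w t)) ck -!mulgA (mulgA k k^-1%g) mulgV mul1g.
  by rewrite (mulgA c1 (ga v t)) (cc (ga v t)) -!mulgA (mulgA c1 (ga w t)) (cc (ga w t)) -!mulgA.
rewrite -[v + w]addr0; apply: (tangent_mul lc).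
  by apply: (tangent_mul lc); exact: ga_tan.
exact: (tangent_sq (- 2^-1) (ga_tan (br v w))).
Qed.

Lemma ga_1 t : ga 0 t = 1%g.
Proof. by have := gaZ 0 0 t; rewrite scale0r => ->; rewrite mul0r (hom0 (ga_hom _)). Qed.

Lemma br_nil u v w : br (br u v) w = 0.
Proof.
apply: ga_inj => t; rewrite -brP ga_1.
by apply/eqP/commgP; rewrite /commute br_central.
Qed.

Lemma brDl u v w : br (u + v) w = br u w + br v w.
Proof.
apply: ga_inj => t; rewrite -brP -ga_mul !comm_Ml// !brP.
rewrite br_nil ga_1 mulg1; apply: ga_commute => s s'; exact: br_central.
Qed.

Lemma lie_exp : exists (ex : V -> G) (b : V -> V -> V) (K d : R), nilexp e lg r ex b K d.
Proof.
have [rho [K [rho0 K0 H]]] := gaP.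
exists (fun v => ga v 1), br, K, rho; split => //.
- by move=> a u v w; rewrite brDl brZl.
- by move=> v w; rewrite brC.
- exact: br_nil.
- move=> v w; have := ga_mul v w 1; rewrite expr1n mulr1 => E.
  rewrite -(@ga_commute (v + w)); last first.
    by move=> s t; rewrite gaZ br_central.
  rewrite -E gaZ mulr1 -!mulgA -ga_hom addrC subrr (hom0 (ga_hom _)) mulg1//.
- move=> v vr; have [_ _ h] := H v; have [] := h 1; first by rewrite normr1 mul1r.
  by rewrite mul1r scale1r => h1 h2 h3; split => //; rewrite h1.
- by move=> u v h; apply: ga_inj => t; have := h t; rewrite !gaZ mulr1.
Qed.
End exponential.

(** * Global exponential coordinates *)

Record nilform (R : realType) (V : lmodType R) (b : V -> V -> V) : Prop := NilForm {
  nf_lin : forall a u v w, b (a *: u + v) w = a *: b u w + b v w;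
  nf_alt : forall v w, b v w = - b w v;
  nf_nil : forall u v w, b (b u v) w = 0 }.

Definition bch (R : realType) (V : lmodType R) (b : V -> V -> V) (x y : V) : V :=
  x + y + 2^-1 *: b x y.

Section nilform_theory.
Variables (R : realType) (V : lmodType R) (b : V -> V -> V).
Hypothesis nf : nilform b.
Notation "x ** y" := (bch b x y) (at level 40, left associativity).

Lemma nfDl u v w : b (u + v) w = b u w + b v w.
Proof. by have := nf_lin nf 1 u v w; rewrite !scale1r. Qed.
Lemma nf0l w : b 0 w = 0.
Proof. by apply: (addrI (b 0 w)); rewrite -nfDl !addr0. Qed.
Lemma nfZl a u w : b (a *: u) w = a *: b u w.
Proof. by have := nf_lin nf a u 0 w; rewrite nf0l !addr0. Qed.
Lemma nfNl u w : b (- u) w = - b u w.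
Proof. by rewrite -scaleN1r nfZl scaleN1r. Qed.
Lemma nfDr u v w : b w (u + v) = b w u + b w v.
Proof. by rewrite !(nf_alt nf w) nfDl opprD. Qed.
Lemma nf0r w : b w 0 = 0.
Proof. by rewrite (nf_alt nf) nf0l oppr0. Qed.
Lemma nfZr a u w : b w (a *: u) = a *: b w u.
Proof. by rewrite !(nf_alt nf w) nfZl scalerN. Qed.
Lemma nfNr u w : b w (- u) = - b w u.
Proof. by rewrite -scaleN1r nfZr scaleN1r. Qed.
Lemma nfBl u v w : b (u - v) w = b u w - b v w.
Proof. by rewrite nfDl nfNl. Qed.
Lemma nfBr u v w : b w (u - v) = b w u - b w v.
Proof. by rewrite nfDr nfNr. Qed.
Lemma nfxx u : b u u = 0.
Proof.
have := nf_alt nf u u => /eqP; rewrite -addr_eq0 -mulr2n -scaler_nat scaler_eq0 pnatr_eq0.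
by move=> /eqP.
Qed.
Lemma nf_nilr u v w : b w (b u v) = 0.
Proof. by rewrite (nf_alt nf) nf_nil ?oppr0. Qed.
Lemma nf_suml I (s : seq I) P (F : I -> V) w :
  b (\sum_(i <- s | P i) F i) w = \sum_(i <- s | P i) b (F i) w.
Proof. by apply: (big_morph (b ^~ w)) => [u v|]; [exact: nfDl|exact: nf0l]. Qed.
Lemma nf_sumr I (s : seq I) P (F : I -> V) w :
  b w (\sum_(i <- s | P i) F i) = \sum_(i <- s | P i) b w (F i).
Proof. by apply: (big_morph (b w)) => [u v|]; [exact: nfDr|exact: nf0r]. Qed.

Definition nfE := (nfDl, nfDr, nfZl, nfZr, nfNl, nfNr, nf0l, nf0r, nf_nil nf, nf_nilr, nfxx).

Lemma bchA x y z : x ** (y ** z) = x ** y ** z.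
Proof.
rewrite /bch !nfE scaler0 !addr0 !scalerDr; zmodc.
Qed.
Lemma bch0 x : x ** 0 = x.
Proof. by rewrite /bch nfE scaler0 !addr0. Qed.
Lemma bch0l x : 0 ** x = x.
Proof. by rewrite /bch nfE scaler0 add0r !addr0. Qed.
Lemma bchN x : x ** (- x) = 0.
Proof. by rewrite /bch !nfE oppr0 scaler0 addr0 subrr. Qed.
Lemma bchNl x : (- x) ** x = 0.
Proof. by rewrite /bch !nfE oppr0 scaler0 addr0 addNr. Qed.
Lemma bchZ s t x : (s *: x) ** (t *: x) = (s + t) *: x.
Proof. by rewrite /bch !nfE !scaler0 addr0 scalerDl. Qed.
Lemma bchK x y : (- x) ** (x ** y) = y.
Proof. by rewrite bchA bchNl bch0l. Qed.
Lemma bchKr x y : x ** ((- x) ** y) = y.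
Proof. by rewrite bchA bchN bch0l. Qed.
Lemma bchI x y z : x ** y = x ** z -> y = z.
Proof. by move=> h; rewrite -(bchK x y) h bchK. Qed.
Lemma bch_opp x y : - (x ** y) = (- y) ** (- x).
Proof.
by rewrite /bch !nfE opprK (nf_alt nf y x) scalerN !opprD; zmodc.
Qed.
Lemma bch_flat x y : b x y = 0 -> x ** y = x + y.
Proof. by move=> h; rewrite /bch h scaler0 addr0. Qed.
Lemma bch_divE x y : (- x) ** y = y - x - 2^-1 *: b x (y - x).
Proof. by rewrite /bch !nfE oppr0 addr0 scalerN [- x + y]addrC. Qed.
End nilform_theory.

Section nilform_norm.
Variables (R : realType) (m : nat).
Notation V := 'rV[R]_m.
Variable b : V -> V -> V.
Hypothesis nf : nilform b.

Lemma nf_bound : exists2 Kb : R, 0 < Kb & forall v w, `|b v w| <= Kb * `|v| * `|w|.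
Proof.
pose D (ij : 'I_1 * 'I_m) : V := delta_mx ij.1 ij.2.
pose S := \sum_ij \sum_kl `|b (D ij) (D kl)|.
have S0 : 0 <= S by rewrite sumr_ge0// => ij _; rewrite sumr_ge0.
exists (S + 1); first by rewrite ltr_wpDl.
move=> v w; rewrite -{1}(sum_delta_rV v) -{1}(sum_delta_rV w).
rewrite (nf_suml nf); apply: le_trans (ler_norm_sum _ _ _) _.
apply: (@le_trans _ _ (S * `|v| * `|w|)); last first.
  by rewrite -!mulrA ler_wpM2r ?mulr_ge0// lerDl.
rewrite /S !mulr_suml; apply: ler_sum => ij _.
rewrite (nf_sumr nf); apply: le_trans (ler_norm_sum _ _ _) _.
rewrite !mulr_suml; apply: ler_sum => kl _.
rewrite (nfZl nf) (nfZr nf) !normrZ mulrA mulrC -mulrA ler_wpM2l//.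
by apply: ler_pM => //; exact: mx_entry_le.
Qed.
End nilform_norm.

Section uniform_continuity.
Variables (R : realType) (G : groupTopType).
Hypothesis mulC : continuous (fun xy : G * G => (xy.1 * xy.2)%g).
Hypothesis invC : continuous (fun x : G => (x^-1)%g).

Lemma div_nbhs (g : G) (W : set G) : nbhs (1%g : G) W ->
  exists2 U, nbhs g U & forall a c, U a -> U c -> W (a^-1 * c)%g.
Proof.
move=> W1.
have divC : {for (g, g), continuous (fun ac : G * G => (ac.1^-1 * ac.2)%g)}.
  apply: (@continuous_comp _ _ _ (fun ac : G * G => ((ac.1^-1)%g, ac.2)) (fun xy : G * G => (xy.1 * xy.2)%g)); last exact: mulC.
  apply: cvg_pair => /=; last exact: cvg_snd.
  by apply: (cvg_comp _ _ cvg_fst); exact: invC.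
have := divC W; rewrite /= mulVg => /(_ W1) [[A B] /= [gA gB] AB].
exists (A `&` B); first exact: filterI.
by move=> a c [Aa _] [_ Bc]; apply: (AB (a, c)).
Qed.

(** The Heine-Cantor theorem, with closeness of values measured by the quotient [(f p)^-1 * f q]. *)
Lemma unif_div (V : normedModType R) (K : set V) (f : V -> G) (W : set G) :
  compact K -> {within K, continuous f} -> nbhs (1%g : G) W ->
  exists2 d : R, 0 < d & forall p q, K p -> K q -> `|p - q| < d -> W ((f p)^-1 * f q)%g.
Proof.
move=> cK cf W1.
pose P (d : R) (p : V) := K p -> forall q, K q -> `|p - q| < d -> W ((f p)^-1 * f q)%g.
have /compact_near_coveringP nc := cK.
have : \forall d \near 0^'+, K `<=` P d.
  apply: nc => x Kx.
  have [U Ux UW] := div_nbhs (f x) W1.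
  have : (\forall p \near within K (nbhs x), U (f p)).
    have /subspace_continuousP/(_ x Kx) := cf; exact.
  rewrite near_withinE => /nbhs_normP[rho /= rho0 H].
  near=> p d => /= Kp q Kq pqd.
  have px : `|x - p| < rho / 2.
    by near: p; apply: cvgr_dist_lt; [exact: cvg_id|rewrite divr_gt0].
  have dr : d < rho / 2 by near: d; apply: nbhs_right_lt; rewrite divr_gt0.
  have Up : U (f p) by apply: H => //=; lra.
  have Uq : U (f q).
    apply: H => //=; have -> : x - q = (x - p) + (p - q) by zmod.
    by apply: le_lt_trans (ler_normD _ _) _; lra.
  exact: UW.
move=> nP.
near (0 : R)^'+ => d.
exists d; first by [].
move=> p q Kp Kq pq.
have : K `<=` P d by near: d.
by move=> /(_ p Kp); apply.
Unshelve. all: by end_near. Qed.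
End uniform_continuity.

Section exp_local.
Variables (R : realType) (G : groupTopType) (m : nat).
Variables (e : 'rV[R]_m -> G) (lg : G -> 'rV[R]_m) (r C : R).
Hypothesis lc : local_chart e lg r C.
Notation V := 'rV[R]_m.
Variables (ex : V -> G) (b : V -> V -> V) (K d : R).
Hypothesis ne : nilexp e lg r ex b K d.

Lemma ne_nf : nilform b.
Proof. by split; [exact: (ne_bl ne)|exact: (ne_alt ne)|exact: (ne_nil ne)]. Qed.
Let nf := ne_nf.

Lemma ex_mul v w : (ex v * ex w)%g = ex (bch b v w).
Proof. exact: (ne_mul ne). Qed.
Lemma ex0 : ex 0 = 1%g.
Proof. by apply: (mulgI (ex 0)); rewrite ex_mul (bch0 nf) mulg1. Qed.
Lemma exN v : ex (- v) = ((ex v)^-1)%g.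
Proof. by apply: (mulgI (ex v)); rewrite ex_mul (bchN nf) ex0 mulgV. Qed.

(** Write [v' = v ** w], where [w] is [v' - v] up to a bilinear error. Then [ex v'] is the left
    translate of [ex w] by [ex v], and [lc_B2] shows that this translation hardly changes
    differences when [v] is small. *)
Lemma ex_sdiff : sdiff (fun v => lg (ex v)) 0 id.
Proof.
move=> eps eps0.
have [Kb Kb0 bP] := nf_bound nf.
have [K0 d0 C0] := And3 (ne_K ne) (ne_d ne) (lc_C lc).
pose W := 1 + Kb; have W0 : 0 < W by rewrite /W; lra.
pose D := K * W ^+ 2 * 2 + C * (1 + K) * (W + 2 * K * W ^+ 2) + Kb.
have D0 : 0 < D.
  by rewrite addr_gt0// addr_gt0 ?mulr_gt0// ?addr_gt0 ?mulr_gt0// ?exprn_gt0.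
exists (Num.min (Num.min 1 (d / (2 * (1 + Kb)))) (eps / D)).
  by rewrite !lt_min ltr01 !divr_gt0// ?mulr_gt0//.
move=> v v'; rewrite !subr0 !lt_min => /andP[/andP[v1 vd] ve] /andP[/andP[v'1 v'd] v'e].
pose w := bch b (- v) v'.
have wE : w - (v' - v) = - (2^-1 *: b v (v' - v)) by rewrite /w (bch_divE nf); zmodc.
have wn : `|w - (v' - v)| <= Kb * `|v| * `|v' - v|.
  rewrite wE normrN normrZ ger0_norm ?invr_ge0//.
  by have := bP v (v' - v); have := normr_ge0 (b v (v' - v)); lra.
have wn2 : `|w| <= (1 + Kb) * `|v' - v|.
  rewrite -[w](subrK (v' - v)); apply: le_trans (ler_normD _ _) _.
  rewrite mulrDl mul1r addrC lerD2l; apply: le_trans wn _.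
  by rewrite ler_wpM2r// ler_piMr// ltW.
have vv : `|v' - v| <= `|v'| + `|v| by exact: ler_normB.
have vle : `|v| <= d.
  move: vd; rewrite ltr_pdivlMr; last lra.
  by have := mulr_ge0 (ltW Kb0) (normr_ge0 v); have := normr_ge0 v; lra.
rewrite ltr_pdivlMr in vd; last lra.
rewrite ltr_pdivlMr in v'd; last lra.
have wd : `|w| <= d.
  apply: le_trans wn2 _; have Kb1 : 0 <= 1 + Kb by lra.
  by have := ler_wpM2l Kb1 vv; lra.
have [xE xr xv] := ne_loc ne vle; have [yE yr yw] := ne_loc ne wd.
have z0 : `|0 : V| < r by rewrite normr0; exact: lc_r lc.
have vE : v' = bch b v w by rewrite (bchKr nf).
have := lc_B2 lc yr z0 xr; rewrite -[lg (e _ * e 0)%g]/(lg (e (lg (ex v)) * e 0)%g) (lc_mu0 lc)// subr0.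
rewrite xE yE ex_mul -vE => h.
set x := lg (ex v) in h xv *; set y := lg (ex w) in h yw *.
have -> : lg (ex v') - x - (v' - v) = (lg (ex v') - x - y) + (y - w) + (w - (v' - v)) by zmod.
apply: le_trans (ler_normD _ _) _; apply: le_trans (lerD (ler_normD _ _) (lexx _)) _.
set n := `|v' - v| in wn wn2 vv *.
have n0 : 0 <= n by exact: normr_ge0.
have n2 : n <= 2 by lra.
set q := eps / D in ve v'e.
have t2 : K * `|w| ^+ 2 <= K * W ^+ 2 * (n * n).
  rewrite -mulrA ler_pM2l// -!expr2 -exprMn lerXn2r ?nnegrE// mulr_ge0// ltW//.
have KW : 0 <= K * W ^+ 2 by rewrite mulr_ge0 ?exprn_ge0// ltW.
have t2' : K * `|w| ^+ 2 <= K * W ^+ 2 * 2 * n.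
  apply: le_trans t2 _; have -> : K * W ^+ 2 * 2 * n = K * W ^+ 2 * (2 * n) by ring.
  by rewrite ler_wpM2l// ler_wpM2r.
have t2'' : K * `|w| ^+ 2 <= K * W ^+ 2 * 2 * q * n.
  apply: le_trans t2 _; have -> : K * W ^+ 2 * 2 * q * n = K * W ^+ 2 * (2 * q * n) by ring.
  by rewrite ler_wpM2l// ler_wpM2r//; lra.
have yn : `|y| <= (W + 2 * K * W ^+ 2) * n.
  rewrite -[y](subrK w); apply: le_trans (ler_normD _ _) _.
  by apply: le_trans (lerD (le_trans yw t2') wn2) _; rewrite /W; lra.
have xn : `|x| <= (1 + K) * q.
  rewrite -[x](subrK v); apply: le_trans (ler_normD _ _) _.
  apply: (@le_trans _ _ ((1 + K) * `|v|)); last by rewrite ler_wpM2l//; lra.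
  have : K * `|v| ^+ 2 <= K * `|v| by rewrite ler_pM2l// expr2 ler_piMr// ltW.
  by move: xv; lra.
have t1 : C * `|y| * `|x| <= C * (1 + K) * (W + 2 * K * W ^+ 2) * q * n.
  have -> : C * (1 + K) * (W + 2 * K * W ^+ 2) * q * n = C * ((W + 2 * K * W ^+ 2) * n) * ((1 + K) * q) by ring.
  by apply: ler_pM => //; [rewrite mulr_ge0// ltW|rewrite ler_pM2l].
have t3 : Kb * `|v| * n <= Kb * q * n by rewrite ler_wpM2r// ler_pM2l// ltW.
have -> : eps * n = K * W ^+ 2 * 2 * q * n + C * (1 + K) * (W + 2 * K * W ^+ 2) * q * n + Kb * q * n.
  by rewrite /q /D; field; rewrite gt_eqF.
by move: h wn yw t1 t2'' t3; lra.
Qed.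

Lemma ex_half : exists2 d1 : R, 0 < d1 & forall v v', `|v| < d1 -> `|v'| < d1 ->
  [/\ e (lg (ex v)) = ex v, e (lg (ex v')) = ex v' &
   `|lg (ex v') - lg (ex v) - (v' - v)| <= 2^-1 * `|v' - v|].
Proof.
have [d1 d10 H] := ex_sdiff (ltac:(by rewrite invr_gt0) : 0 < (2^-1 : R)).
exists (Num.min d1 d); first by rewrite lt_min d10 (ne_d ne).
move=> v v'; rewrite !lt_min => /andP[v1 vd] /andP[v'1 v'd].
have [h1 _ _] := ne_loc ne (ltW vd); have [h2 _ _] := ne_loc ne (ltW v'd).
by split => //; apply: H; rewrite subr0.
Qed.

Lemma ex_inj_small : exists2 d1 : R, 0 < d1 & forall v v', `|v| < d1 -> `|v'| < d1 ->
  ex v = ex v' -> v = v'.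
Proof.
have [d1 d10 H] := ex_half; exists d1 => // v v' v1 v'1 E.
have [_ _] := H _ _ v1 v'1; rewrite E subrr sub0r normrN => h.
by apply/eqP; rewrite eq_sym -subr_eq0 -normr_le0; have := normr_ge0 (v' - v); lra.
Qed.

(* [v] is found as the fixed point of the contraction v |-> v + y - lg (ex v). *)
Lemma ex_nbhs (d1 : R) : 0 < d1 -> nbhs (1%g : G) [set g | exists2 v, `|v| < d1 & ex v = g].
Proof.
move=> d10; have [d2 d20 H] := ex_half.
pose c := Num.min d1 d2; have c0 : 0 < c by rewrite lt_min d10.
have c4 : 0 < c / 4 by rewrite divr_gt0.
apply: filterS (lc_near lc c4) => g /= [gs ge].
set y := lg g in gs ge.
have lc0 : lg (ex 0) = 0 by rewrite ex0 (lc_lg1 lc).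
pose v := fix v n := if n is k.+1 then v k + y - lg (ex (v k)) else 0.
have z0 : `|0 : V| < d2 by rewrite normr0.
have cd : c <= d2 by rewrite ge_min lexx orbT.
have vP n : `|v n.+1 - v n| <= `|y| / 2 ^+ n /\ `|v n.+1| <= 2 * `|y| - `|y| / 2 ^+ n.
  elim: n => [|n [IH1 IH2]].
    by rewrite /= lc0 add0r !subr0 expr0 divr1; split => //; lra.
  have p2 : 0 <= `|y| / 2 ^+ n by rewrite divr_ge0// exprn_ge0.
  have p3 : `|y| / 2 ^+ n.+1 = 2^-1 * (`|y| / 2 ^+ n).
    by rewrite exprS; field; rewrite expf_neq0.
  have vn : `|v n| < d2.
    have : `|v n| <= 2 * `|y|.
      have -> : v n = v n.+1 - (v n.+1 - v n) by zmod.
      by apply: le_trans (ler_normB _ _) _; lra.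
    by move: gs cd; lra.
  have vn1 : `|v n.+1| < d2 by move: gs cd; lra.
  have E : `|v n.+2 - v n.+1| <= `|y| / 2 ^+ n.+1.
    have [_ _ h] := H _ _ vn vn1.
    have -> : v n.+2 - v n.+1 = - (lg (ex (v n.+1)) - lg (ex (v n)) - (v n.+1 - v n)).
      rewrite -[v n.+2]/(v n.+1 + y - lg (ex (v n.+1))).
      rewrite -[v n.+1 in X in X = _]/(v n + y - lg (ex (v n))).
      have -> : v n.+1 = v n + y - lg (ex (v n)) by [].
      zmod.
    by rewrite normrN p3; apply: le_trans h _; rewrite ler_pM2l// invr_gt0.
  split => //; have -> : v n.+2 = (v n.+2 - v n.+1) + v n.+1 by zmod.
  by apply: le_trans (ler_normD _ _) _; lra.
have [l lP] := geo_cauchy (fun n => (vP n).1).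
have ln : `|l| <= 2 * `|y|.
  have := lP 0; rewrite expr0 divr1 /= sub0r normrN//.
have ld : `|l| < c by lra.
exists l; first by apply: lt_le_trans ld _; rewrite ge_min lexx.
have ld2 : `|l| < d2 by apply: lt_le_trans cd.
suff E : lg (ex l) = y by have [<- _ _] := H l l ld2 ld2; rewrite E.
apply/eqP; rewrite -subr_eq0 -normr_le0.
apply: (@geo_le0 _ _ (4 * `|y|)) => n.
have vn : `|v n| < d2.
  case: n => [|n]; first by rewrite /= normr0.
  have [_ h] := vP n; have p2 : 0 <= `|y| / 2 ^+ n by rewrite divr_ge0// exprn_ge0.
  by move: gs cd; lra.
have [_ _ h] := H _ _ vn ld2.
have -> : lg (ex l) - y = (lg (ex l) - lg (ex (v n)) - (l - v n)) + (l - v n) - (v n.+1 - v n).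
  by rewrite /=; zmod.
apply: le_trans (ler_normB _ _) _; apply: le_trans (lerD (ler_normD _ _) (lexx _)) _.
have := lP n; rewrite distrC => h'; have [h'' _] := vP n.
by move: h h' h''; rewrite -!mulrA; lra.
Qed.

Lemma ex_cont0 (W : set G) : nbhs (1%g : G) W -> exists2 d1 : R, 0 < d1 & forall v, `|v| < d1 -> W (ex v).
Proof.
move=> /(lc_cont lc)[d1 d10 H]; have [K0 d0] := (ne_K ne, ne_d ne).
exists (Num.min d (d1 / (1 + K * d))).
  by rewrite lt_min d0 divr_gt0// ltr_pwDl// mulr_ge0// ltW.
move=> v; rewrite lt_min ltr_pdivlMr; last by rewrite ltr_pwDl// mulr_ge0// ltW.
move=> /andP[vd v1]; have [E _ h] := ne_loc ne (ltW vd); rewrite -E; apply: H.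
rewrite -[lg _](subrK v); apply: le_lt_trans (ler_normD _ _) _.
have : K * `|v| ^+ 2 <= K * d * `|v|.
  by rewrite -mulrA ler_pM2l// expr2 ler_wpM2r// ltW.
by move: h v1; lra.
Qed.
End exp_local.

Section exp_global.
Variables (R : realType) (G : groupTopType) (m : nat).
Variables (e : 'rV[R]_m -> G) (lg : G -> 'rV[R]_m) (r C : R).
Hypothesis lc : local_chart e lg r C.
Notation V := 'rV[R]_m.
Variables (ex : V -> G) (b : V -> V -> V) (K d : R).
Hypothesis ne : nilexp e lg r ex b K d.
Hypothesis mulC : continuous (fun xy : G * G => (xy.1 * xy.2)%g).
Hypothesis invC : continuous (fun x : G => (x^-1)%g).
Hypothesis sc : simply_connected R G.
Let nf := ne_nf ne.

(** A path from 1 to [g] is cut into steps lying in the neighbourhood of 1 covered by [ex]; the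
    image of [ex] is closed under products. *)
Lemma ex_surj g : exists v, ex v = g.
Proof.
have [gam [cg g0 g1]] := sc.1 1%g g.
have cK : compact `[0 : R, 1] by exact: segment_compact.
have [d1 d10 H] := @unif_div R G mulC invC R _ gam _ cK cg (ex_nbhs lc ne (ltr01)).
pose N := (Num.truncn (d1^-1)).+1.
have Nd : (N%:R^-1 : R) < d1.
  by rewrite -[d1]invrK ltf_pV2 ?posrE ?invr_gt0 ?ltr0n//; exact: truncnS_gt.
have S k : (k <= N)%N -> exists v, ex v = gam (k%:R / N%:R).
  elim: k => [|k IH] kN; first by exists 0; rewrite mul0r g0 (ex0 ne).
  have [v vE] := IH (ltnW kN).
  have I j : (j <= N)%N -> (`[0 : R, 1]%classic) (j%:R / N%:R).
    by move=> jN; rewrite /= in_itv /= divr_ge0//= ler_pdivrMr ?ltr0n// mul1r ler_nat.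
  have [|w _ wE] := H _ _ (I k (ltnW kN)) (I _ kN).
    rewrite -mulrBl -natr1; have -> : k%:R - (k%:R + 1) = -1 :> R by ring.
    by rewrite mulN1r normrN ger0_norm ?invr_ge0.
  by exists (bch b v w); rewrite -(ex_mul ne) wE vE mulgA mulgV mul1g.
by have := S N (leqnn N); rewrite divff ?pnatr_eq0// g1.
Qed.

(* Edges of a fine grid in the homotopy lift to short vectors whose products
   around each cell agree; hence all rows of the grid have the same product. *)
Lemma ex_grid (d1 d2 : R) (N : nat) (h : nat -> nat -> G) (hl vl : nat -> nat -> V) (u : V) :
  (forall v v', `|v| < d1 -> `|v'| < d1 -> ex v = ex v' -> v = v') ->
  (forall v v', `|v| < d2 -> `|v'| < d2 -> `|bch b v v'| < d1) ->
  0 < d2 -> d2 <= d1 -> (0 < N)%N ->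
  (forall i j, (i <= N)%N -> (j < N)%N -> `|hl i j| < d2 /\ ex (hl i j) = ((h i j)^-1 * h i j.+1)%g) ->
  (forall i j, (i < N)%N -> (j <= N)%N -> `|vl i j| < d2 /\ ex (vl i j) = ((h i j)^-1 * h i.+1 j)%g) ->
  (forall i, (i <= N)%N -> h i 0 = 1%g /\ h i N = 1%g) ->
  (forall j, (j <= N)%N -> h N j = 1%g) ->
  (forall j, (j <= N)%N -> h 0 j = ex ((j%:R / N%:R) *: u)) ->
  `|N%:R^-1 *: u| < d2 -> u = 0.
Proof.
move=> inj bs d20 d21 N0 hlP vlP h0 hN hu uN.
have z2 : `|0 : V| < d2 by rewrite normr0.
have is0 x : `|x| < d2 -> ex x = 1%g -> x = 0.
  by move=> xd xE; apply: inj; [exact: lt_le_trans d21|rewrite normr0; exact: lt_le_trans d21|rewrite xE (ex0 ne)].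
pose P i := fix P j := if j is k.+1 then bch b (P k) (hl i k) else 0.
have cell i j : (i < N)%N -> (j < N)%N ->
    bch b (hl i j) (vl i j.+1) = bch b (vl i j) (hl i.+1 j).
  move=> iN jN; have [a1 a2] := hlP i j (ltnW iN) jN; have [b1 b2] := vlP i j.+1 iN jN.
  have [c1 c2] := vlP i j iN (ltnW jN); have [e1 e2] := hlP i.+1 j iN jN.
  apply: inj; [exact: bs|exact: bs|]; rewrite -!(ex_mul ne) a2 b2 c2 e2.
  by rewrite !mulgA -(mulgA (h i j)^-1%g) mulgV mulg1 -(mulgA (h i j)^-1%g (h i.+1 j)) mulgV mulg1.
have chain i j : (i < N)%N -> (j <= N)%N -> bch b (P i j) (vl i j) = bch b (vl i 0) (P i.+1 j).
  move=> iN; elim: j => [|j IH] jN; first by rewrite /= (bch0 nf) (bch0l nf).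
  rewrite /= -(bchA nf) cell// (bchA nf) IH ?(ltnW jN)// (bchA nf)//.
have vl0 i : (i < N)%N -> vl i 0 = 0 /\ vl i N = 0.
  move=> iN; have [a1 a2] := vlP i 0 iN (leq0n _); have [b1 b2] := vlP i N iN (leqnn _).
  have [c1 c2] := h0 _ iN; have [c3 c4] := h0 _ (ltnW iN).
  by split; apply: is0 => //; [rewrite a2 c1 c3 mulVg|rewrite b2 c2 c4 mulVg].
have PN i : (i <= N)%N -> P i N = P 0 N.
  elim: i => [//|i IH] iN; rewrite -IH ?(ltnW iN)//.
  have [a1 a2] := vl0 i iN; have := chain i N iN (leqnn _).
  by rewrite a1 a2 (bch0 nf) (bch0l nf).
have PN0 j : (j <= N)%N -> P N j = 0.
  elim: j => [//|j IH] jN; rewrite /= IH ?(ltnW jN)// (bch0l nf).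
  have [a1 a2] := hlP N j (leqnn _) jN; apply: is0 => //.
  by rewrite a2 !hN ?(ltnW jN)// mulVg.
have P0 j : (j <= N)%N -> P 0%N j = (j%:R / N%:R) *: u.
  elim: j => [|j IH] jN; first by rewrite mul0r scale0r.
  rewrite /= IH ?(ltnW jN)//.
  have -> : hl 0 j = N%:R^-1 *: u.
    have [a1 a2] := hlP 0 j (leq0n _) jN.
    apply: inj; [exact: lt_le_trans d21|exact: lt_le_trans d21|].
    rewrite a2 !hu ?(ltnW jN)// -(exN ne) (ex_mul ne) -scaleNr (bchZ nf).
    by congr (ex (_ *: _)); rewrite -natr1; ring.
  by rewrite (bchZ nf) -natr1 mulrDl mul1r.
have := P0 N (leqnn _); rewrite divff ?pnatr_eq0 -?lt0n// scale1r => <-.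
by rewrite -(PN N)// PN0.
Qed.

Lemma ex_cont_line u : continuous (fun t : R => ex (t *: u)).
Proof.
move=> t W Wt.
have mc : {for (ex (t *: u), 1%g), continuous (fun xy : G * G => (xy.1 * xy.2)%g)} := @mulC _.
have := mc W; rewrite /= mulg1 => /(_ Wt)[[A B] /= [At B1] AB].
have [d1 d10 H] := ex_cont0 lc ne B1.
have u1 : 0 < 1 + `|u| by rewrite ltr_pwDl.
apply/nbhs_ballP; exists (d1 / (1 + `|u|)); first exact: divr_gt0.
move=> s /=; rewrite /ball /= ltr_pdivlMr// => ts.
have -> : ex (s *: u) = (ex (t *: u) * ex ((s - t) *: u))%g.
  by rewrite (ex_mul ne) (bchZ nf) addrC subrK.
apply: (AB (_, _)); split; first exact: nbhs_singleton.
apply: H; rewrite normrZ distrC; apply: le_lt_trans ts.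
by rewrite ler_wpM2l// lerDr.
Qed.

(** If [ex u = 1], the curve [t |-> ex (t *: u)] is a loop, and a null-homotopy is lifted on a fine
    grid. The radius [d2] is such that the product of two lifted edges stays in the ball [d1] where
    [ex] is injective. *)
Lemma ex_eq1 u : ex u = 1%g -> u = 0.
Proof.
move=> u1.
have [Kb Kb0 bP] := nf_bound nf.
have [d1 d10 inj] := ex_inj_small lc ne.
pose d2 := Num.min (Num.min 1 d1) (d1 / (2 + Kb)).
have Kb2 : 0 < 2 + Kb by lra.
have d20 : 0 < d2 by rewrite !lt_min ltr01 d10 divr_gt0.
have d21 : d2 <= d1 by rewrite !ge_min lexx orbT.
have bs v v' : `|v| < d2 -> `|v'| < d2 -> `|bch b v v'| < d1.
  move=> vd v'd; apply: le_lt_trans (ler_normD _ _) _.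
  apply: le_lt_trans (lerD (ler_normD _ _) (lexx _)) _.
  have := bP v v'; rewrite normrZ ger0_norm ?invr_ge0//.
  have d2' : d2 * (2 + Kb) <= d1 by rewrite -ler_pdivlMr// ge_min lexx orbT.
  have v1 : Kb * `|v| * `|v'| <= Kb * `|v'|.
    rewrite ler_wpM2r// ler_piMr// ?(ltW Kb0)//; apply/ltW/(lt_le_trans vd).
    by rewrite !ge_min lexx.
  have := ler_wpM2l (ltW Kb0) (ltW v'd); have := normr_ge0 (b v v'); lra.
have cg : {within `[0 : R, 1], continuous (fun t : R => ex (t *: u))}.
  exact/continuous_subspaceT/ex_cont_line.
have [H [cH HP]] := sc.2 _ cg (ltac:(by rewrite scale0r scale1r (ex0 ne) u1) : ex ((0 : R) *: u) = ex ((1 : R) *: u)).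
have cK : compact (`[0 : R, 1]%classic `*` `[0 : R, 1]%classic).
  by apply: compact_setX; exact: segment_compact.
have [d3 d30 HU] := @unif_div R G mulC invC (R * R)%type _ H _ cK cH (ex_nbhs lc ne d20).
(* A lift is chosen for every pair of points at once, but is constrained only when the points are
   close. *)
have /choice[L LP] : forall pq : (R * R) * (R * R), exists v : V,
    (`[0 : R, 1]%classic `*` `[0 : R, 1]%classic) pq.1 -> (`[0 : R, 1]%classic `*` `[0 : R, 1]%classic) pq.2 ->
    `|pq.1 - pq.2| < d3 -> `|v| < d2 /\ ex v = ((H pq.1)^-1 * H pq.2)%g.
  move=> [p q] /=; have [h|h] := pselect ((`[0 : R, 1]%classic `*` `[0 : R, 1]%classic) p /\
     (`[0 : R, 1]%classic `*` `[0 : R, 1]%classic) q /\ `|p - q| < d3); last first.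
    by exists 0 => hp hq pq; case: h.
  by case: h => hp [hq pq]; have [v v1 v2] := HU p q hp hq pq; exists v.
pose N := (Num.truncn (d3^-1 + (1 + `|u|) / d2)).+1.
have N0 : 0 < N%:R :> R by rewrite ltr0n.
have NB : d3^-1 + (1 + `|u|) / d2 < N%:R by exact: truncnS_gt.
have uu : 0 < (1 + `|u|) / d2 by rewrite divr_gt0// ltr_pwDl.
have Nd : (N%:R^-1 : R) < d3.
  rewrite -[d3]invrK ltf_pV2 ?posrE ?invr_gt0//; lra.
have Nu : `|N%:R^-1 *: u| < d2.
  rewrite normrZ ger0_norm ?invr_ge0// mulrC ltr_pdivrMr// mulrC.
  rewrite -ltr_pdivrMr//; have : 0 < d3^-1 by rewrite invr_gt0.
  have : `|u| / d2 <= (1 + `|u|) / d2 by rewrite ler_pM2r ?invr_gt0// lerDr.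
  lra.
pose p i j : R * R := (i%:R / N%:R, j%:R / N%:R).
have I j : (j <= N)%N -> 0 <= (j%:R / N%:R : R) <= 1.
  by move=> jN; rewrite divr_ge0//= ler_pdivrMr ?ltr0n// mul1r ler_nat.
have pK i j : (i <= N)%N -> (j <= N)%N -> (`[0 : R, 1]%classic `*` `[0 : R, 1]%classic) (p i j).
  by move=> iN jN; split; rewrite /= in_itv /= I.
have st j : j%:R / N%:R - j.+1%:R / N%:R = - N%:R^-1 :> R by rewrite -natr1; ring.
have nst j : `|j%:R / N%:R - j.+1%:R / N%:R : R| < d3.
  by rewrite st normrN ger0_norm ?invr_ge0.
apply: (@ex_grid d1 d2 N (fun i j => H (p i j)) (fun i j => L (p i j, p i j.+1)) (fun i j => L (p i j, p i.+1 j))) => //.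
- move=> i j iN jN; apply: LP; [by apply: pK => //; exact: ltnW|exact: pK|].
  by rewrite /= prod_normE /= subrr normr0 gt_max d30 nst.
- move=> i j iN jN; apply: LP; [by apply: pK => //; exact: ltnW|exact: pK|].
  by rewrite /= prod_normE /= subrr normr0 gt_max d30 nst.
- move=> i iN; have [_ _ h1 h2] := HP _ (I i iN); rewrite /p mul0r divff ?gt_eqF//.
  by rewrite h1 h2 scale0r (ex0 ne).
- move=> j jN; have [_ h1 _ _] := HP _ (I j jN); rewrite /p divff ?gt_eqF//.
  by rewrite h1 scale0r (ex0 ne).
- by move=> j jN; have [h1 _ _ _] := HP _ (I j jN); rewrite /p mul0r h1.
Qed.

Lemma ex_inj v w : ex v = ex w -> v = w.
Proof.
move=> E; have : ex (bch b (- v) w) = 1%g by rewrite -(ex_mul ne) (exN ne) E mulVg.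
move=> /ex_eq1 h; have := bchKr nf v w.
by rewrite h (bch0 nf).
Qed.
End exp_global.

(** * The central product in exponential coordinates *)

Lemma mulmx_bound (R : realType) p q s (A : 'M[R]_(q, s)) :
  exists2 K : R, 0 < K & forall B : 'M[R]_(p, q), `|B *m A| <= K * `|B|.
Proof.
exists (q%:R * `|A| + 1); first by rewrite ltr_wpDl// mulr_ge0.
move=> B; apply/mx_norm_leP; first by rewrite mulr_ge0// addr_ge0// mulr_ge0.
move=> i j; rewrite mxE; apply: le_trans (ler_norm_sum _ _ _) _.
apply: (@le_trans _ _ (\sum_(k < q) `|B| * `|A|)).
  by apply: ler_sum => k _; rewrite normrM ler_pM// mx_entry_le.
rewrite sumr_const card_ord -[leLHS]mulr_natr.
have -> : `|B| * `|A| * q%:R = q%:R * `|A| * `|B| by ring.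
by rewrite ler_wpM2r// lerDl.
Qed.

Lemma linear_mx (R : realType) p s (L : 'rV[R]_p -> 'rV[R]_s) :
  (forall a u v, L (a *: u + v) = a *: L u + L v) ->
  forall v, L v = v *m (\matrix_(i, j) L (delta_mx 0 i) 0 j).
Proof.
move=> LL v.
have L0 : L 0 = 0 by apply: (addIr (L 0)); rewrite -{1}[L 0]scale1r -LL scaler0 !add0r.
have LD u w : L (u + w) = L u + L w by rewrite -{1}[u]scale1r LL scale1r.
have LZ a u : L (a *: u) = a *: L u by rewrite -[a *: u]addr0 LL L0 addr0.
rewrite {1}[v]row_sum_delta (big_morph _ LD L0); apply/rowP => j.
by rewrite summxE mxE; apply: eq_bigr => i _; rewrite LZ !mxE.
Qed.

Section power_form.
Variables (R : realType) (m n : nat) (b : 'rV[R]_m -> 'rV[R]_m -> 'rV[R]_m).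
Hypothesis nf : nilform b.
Notation V := 'rV[R]_m.
Notation M := 'M[R]_(n, m).

Definition bpow (X Y : M) : M := \matrix_(c, k) b (row c X) (row c Y) 0 k.

Lemma row_bpow c X Y : row c (bpow X Y) = b (row c X) (row c Y).
Proof. by apply/rowP => k; rewrite !mxE. Qed.

Lemma bpow_nf : nilform bpow.
Proof.
split=> [a u v w|v w|u v w]; apply/row_matrixP => c.
- by rewrite row_bpow !linearP /= !row_bpow (nf_lin nf).
- by rewrite linearN /= !row_bpow (nf_alt nf).
- by rewrite !row_bpow (nf_nil nf) linear0.
Qed.

(** The kernel of the projection in coordinates: all components lie in the radical of [b], that is
    in the centre, and their sum vanishes. *)
Definition ker_pow : set M :=
  [set X | (forall c w, b (row c X) w = 0) /\ \sum_c row c X = 0].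

Definition rad_mx : 'M[R]_(m, m * m) :=
  \matrix_(k, l) mxvec (\matrix_(i, j) b (delta_mx 0 k) (delta_mx 0 i) 0 j) 0 l.

Lemma rad_mxP (v : V) : v *m rad_mx = mxvec (\matrix_(i, j) b v (delta_mx 0 i) 0 j).
Proof.
rewrite [v in RHS]row_sum_delta; apply/rowP => l; case/mxvec_indexP: l => i j.
rewrite [in RHS]mxvecE [in RHS]mxE (nf_suml nf) mxE summxE; apply: eq_bigr => k _.
by rewrite (nfZl nf) !mxE mxvecE !mxE.
Qed.

(** A linear map whose kernel is [ker_pow]: one block lists the brackets of every row with the basis
    vectors, the other the sum of the rows. *)
Definition ker_mx : 'M[R]_(n * m, n * (m * m) + 1 * m) :=
  row_mx (lin_mulmxr rad_mx) (lin_mulmx (const_mx 1)).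

Lemma ker_mxP (X : M) : mxvec X *m ker_mx = 0 <-> ker_pow X.
Proof.
rewrite /ker_mx mul_mx_row !mul_vec_lin /=.
have sumE : const_mx 1 *m X = \sum_c row c X.
  apply/rowP => k; rewrite mxE summxE; apply: eq_bigr => c _.
  by rewrite !mxE mul1r.
rewrite -[0 in X in X <-> _]row_mx0; split.
  move=> /eq_row_mx[/eqP h1 /eqP h2].
  move: h1 h2; rewrite !mxvec_eq0 => /eqP h1 /eqP h2; split; last by rewrite -sumE.
  move=> c w; have : row c X *m rad_mx = 0 by rewrite -row_mul h1 linear0.
  rewrite rad_mxP => /eqP; rewrite mxvec_eq0 => /eqP/matrixP h.
  rewrite [w]row_sum_delta (nf_sumr nf) big1// => i _; rewrite (nfZr nf).
  have -> : b (row c X) (delta_mx 0 i) = 0 by apply/rowP => j; have := h i j; rewrite !mxE.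
  by rewrite scaler0.
move=> [h1 h2]; congr row_mx; apply/eqP; rewrite mxvec_eq0; last by rewrite sumE h2.
apply/eqP/row_matrixP => c; rewrite row_mul rad_mxP linear0; apply/eqP.
by rewrite mxvec_eq0; apply/eqP/matrixP => i j; rewrite !mxE h1 mxE.
Qed.

Notation N := (\rank ker_mx).
Notation E := 'rV[R]_N.
(** [ker_mx] factors as [col_base] times [row_base] with an injective second factor. The first
    factor is then a surjection with the same kernel, which realizes the quotient as a space of row
    vectors. *)
Definition quo (X : M) : E := mxvec X *m col_base ker_mx.
Definition sec (x : E) : M := vec_mx (x *m pinvmx (col_base ker_mx)).

Lemma quo_lin a X Y : quo (a *: X + Y) = a *: quo X + quo Y.
Proof. by rewrite /quo linearP mulmxDl scalemxAl. Qed.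
Lemma sec_lin a x y : sec (a *: x + y) = a *: sec x + sec y.
Proof. by rewrite /sec mulmxDl linearD /= -scalemxAl linearZ. Qed.
Lemma quo_sec x : quo (sec x) = x.
Proof. by rewrite /quo /sec vec_mxK mulmxKpV// submx_full// col_base_full. Qed.
Lemma quo_eq0 X : quo X = 0 <-> ker_pow X.
Proof.
rewrite -ker_mxP; have -> : mxvec X *m ker_mx = quo X *m row_base ker_mx.
  by rewrite /quo -mulmxA mulmx_base.
split=> [->|h]; first by rewrite mul0mx.
by apply: (row_free_inj (row_base_free ker_mx)); rewrite h mul0mx.
Qed.
Lemma quo0 : quo 0 = 0.
Proof. by rewrite /quo linear0 mul0mx. Qed.
Lemma quoD X Y : quo (X + Y) = quo X + quo Y.
Proof. by rewrite /quo linearD mulmxDl. Qed.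
Lemma quoZ a X : quo (a *: X) = a *: quo X.
Proof. by rewrite /quo linearZ /= scalemxAl. Qed.
Lemma sec_quo X : ker_pow (X - sec (quo X)).
Proof. by apply/quo_eq0; rewrite quoD -scaleN1r quoZ quo_sec scaleN1r subrr. Qed.

Definition beta (x y : E) : E := quo (bpow (sec x) (sec y)).
Let pf := bpow_nf.

Lemma bpow_ker X Y Z : ker_pow (X - Y) -> bpow X Z = bpow Y Z.
Proof.
move=> [h _]; apply/row_matrixP => c; rewrite !row_bpow.
by apply/eqP; rewrite -subr_eq0 -(nfBl nf) -linearB /= h.
Qed.

Lemma quo_bpow X Y : quo (bpow X Y) = beta (quo X) (quo Y).
Proof.
rewrite /beta (bpow_ker _ (sec_quo X)) (nf_alt pf) (bpow_ker _ (sec_quo Y)).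
by rewrite -(nf_alt pf).
Qed.

Lemma beta_nf : nilform beta.
Proof.
split=> [a u v w|v w|u v w].
- by rewrite /beta sec_lin (nf_lin pf) quo_lin.
- by rewrite /beta (nf_alt pf) -scaleN1r quoZ scaleN1r.
- by rewrite -(quo_sec w) -quo_bpow (nf_nil pf) quo0.
Qed.

Definition incl (c : 'I_n) (t : V) : M := delta_mx c 0 *m t.
Definition copy (c : 'I_n) (t : V) : E := quo (incl c t).

Lemma row_incl c d t : row d (incl c t) = if d == c then t else 0.
Proof.
apply/rowP => k; rewrite !mxE big_ord1 !mxE eqxx andbT.
by case: eqP => _; rewrite ?mul1r// mul0r mxE.
Qed.

Lemma copy_lin c a t u : copy c (a *: t + u) = a *: copy c t + copy c u.
Proof. by rewrite /copy /incl mulmxDr -scalemxAr quo_lin. Qed.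

Lemma beta_copy_neq c d t u : c != d -> beta (copy c t) (copy d u) = 0.
Proof.
move=> cd; rewrite /copy -quo_bpow (_ : bpow _ _ = 0) ?quo0//.
apply/row_matrixP => k; rewrite row_bpow !row_incl linear0.
by case: eqP => [->|_]; rewrite ?(nf0l nf)// (negPf cd) (nf0r nf).
Qed.

(** A bracket [b t u] lies in the radical, so placing it in copy [c] or in copy [d] differs by an
    element with radical rows and zero sum, which is killed by [quo]. *)
Lemma beta_copy c d t u : beta (copy c t) (copy c u) = copy d (b t u).
Proof.
have -> : beta (copy c t) (copy c u) = copy c (b t u).
  rewrite /copy -quo_bpow; congr quo; apply/row_matrixP => k.
  by rewrite row_bpow !row_incl; case: eqP => // _; rewrite (nf0l nf).
apply/eqP; rewrite -subr_eq0 -scaleN1r /copy -quoZ -quoD; apply/eqP/quo_eq0; split=> [k w|].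
  rewrite linearD linearZ /= !row_incl (nfDl nf) (nfZl nf).
  by case: eqP; case: eqP; rewrite ?(nf_nil nf) ?(nf0l nf) ?scaler0 ?addr0.
under eq_bigr => k _ do rewrite linearD linearZ /= !row_incl.
rewrite big_split /= -scaler_sumr -!big_mkcond /= !big_pred1_eq scaleN1r subrr//.
Qed.

Lemma span_copy x : x = \sum_c copy c (row c (sec x)).
Proof.
rewrite -{1}(quo_sec x) /copy -(big_morph _ quoD quo0); congr quo.
apply/row_matrixP => d; rewrite linear_sum /= (bigD1 d)//= row_incl eqxx big1 ?addr0//.
by move=> c; rewrite row_incl eq_sym => /negPf ->.
Qed.
End power_form.

Section central_product.
Variables (R : realType) (G : groupTopType) (m : nat) (A : atlas G 'rV[R]_m).
Hypothesis lieG : lie_group A.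
Variables (n : nat) (G' : groupTopType) (m' : nat) (A' : atlas G' 'rV[R]_m').
Hypothesis lieG' : lie_group A'.
Variable proj : {ptws 'I_n -> G} -> G'.
Hypothesis cpG' : is_central_product A A' proj.
Variables (r C K d : R) (ex : 'rV[R]_m -> G) (b : 'rV[R]_m -> 'rV[R]_m -> 'rV[R]_m).
Hypothesis lc : local_chart (lie_e A) (lie_lg A) r C.
Hypothesis ne : nilexp (lie_e A) (lie_lg A) r ex b K d.
Hypothesis ex_surj : forall g, exists v, ex v = g.
Hypothesis ex_inj : forall v w, ex v = ex w -> v = w.
Variable c0 : 'I_n.
Notation V := 'rV[R]_m.
Notation M := 'M[R]_(n, m).
Let nf := ne_nf ne.
Let pf := bpow_nf n nf.

Definition powex (X : M) : 'I_n -> G := fun c => ex (row c X).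
Definition sig (X : M) : G' := proj (powex X).

Lemma powex_mul X Y : pow_mul (powex X) (powex Y) = powex (bch (@bpow R m n b) X Y).
Proof.
apply/funext => c; rewrite /pow_mul /powex (ex_mul ne); congr ex.
by rewrite /bch linearD linearD linearZ /= row_bpow.
Qed.

Lemma sig_mul X Y : (sig X * sig Y)%g = sig (bch (@bpow R m n b) X Y).
Proof. by rewrite /sig -(cp_morph cpG') powex_mul. Qed.

Lemma powex_surj (x : 'I_n -> G) : exists X, powex X = x.
Proof.
have /choice[f fP] : forall c, exists v, ex v = x c by move=> c; exact: ex_surj.
exists (\matrix_(c, k) f c 0 k); apply/funext => c; rewrite /powex -fP; congr ex.
by apply/rowP => k; rewrite !mxE.
Qed.

Lemma center_rad z : Defs.center (ex z) -> forall w, b z w = 0.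
Proof.
move=> cz w; apply: ex_inj; rewrite -(ne_comm ne) (ex0 ne).
by apply/eqP/commgP; exact: cz.
Qed.

Lemma rad_center z : (forall w, b z w = 0) -> Defs.center (ex z).
Proof.
move=> h x; have [w <-] := ex_surj x.
by rewrite !(ex_mul ne) /bch (nf_alt nf w) h oppr0 scaler0 !addr0 addrC.
Qed.

(** The relations generate the smallest normal subgroup, so they are tested against the set [T] of
    elements whose coordinates are in [ker_pow]. It is normal because such elements are central. *)
Lemma sig_ker X : sig X = 1%g -> ker_pow b X.
Proof.
move=> /(cp_ker cpG'); rewrite /central_relations /=.
pose T : set ('I_n -> G) := [set x | exists2 Z, powex Z = x & ker_pow b Z].
move=> /(_ T) h.
suff [Z ZX kZ] : T (powex X).
  have -> // : X = Z; apply/row_matrixP => c; apply: ex_inj.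
  by have := congr1 (fun f => f c) ZX.
apply: h.
- have conj (Z : M) y : ker_pow b Z -> pow_mul (pow_inv y) (pow_mul (powex Z) y) = powex Z.
    move=> [kZ _]; apply/funext => c; rewrite /pow_mul /pow_inv.
    by rewrite (rad_center (kZ c)) mulgA mulVg mul1g.
  split.
  + exists 0; last by split=> [c w|]; [rewrite linear0 (nf0l nf)|rewrite big1// => c _; rewrite linear0].
    by apply/funext => c; rewrite /powex linear0 (ex0 ne).
  + move=> _ _ [Z <- [kZ sZ]] [Y <- [kY sY]]; exists (Z + Y).
      rewrite powex_mul; congr powex; rewrite /bch (_ : bpow b Z Y = 0) ?scaler0 ?addr0//.
      by apply/row_matrixP => c; rewrite row_bpow kZ linear0.
    split=> [c w|]; first by rewrite linearD (nfDl nf) kZ kY addr0.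
    by under eq_bigr do rewrite linearD; rewrite big_split /= sZ sY addr0.
  + move=> _ [Z <- [kZ sZ]]; exists (- Z).
      by apply/funext => c; rewrite /powex linearN (exN ne).
    split=> [c w|]; first by rewrite linearN (nfNl nf) kZ oppr0.
    by under eq_bigr do rewrite linearN; rewrite sumrN sZ oppr0.
  + by move=> _ y [Z <- kZ]; exists Z => //; rewrite conj.
- move=> i j z; have [t <-] := ex_surj z => /center_rad ht.
  exists (incl i t - incl j t).
    apply/funext => c; rewrite /powex /pow_mul /pow_inv /pow_in linearB /= !row_incl.
    have flat x y : (forall w, b x w = 0) -> ex (x - y) = (ex x * (ex y)^-1)%g.
      by move=> hx; rewrite -(exN ne) (ex_mul ne) /bch hx scaler0 addr0.
    by rewrite flat; [case: eqP; case: eqP; rewrite ?(ex0 ne)|move=> w; case: eqP; rewrite ?(nf0l nf)].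
  split=> [c w|].
    by rewrite linearB /= !row_incl (nfBl nf); case: eqP; case: eqP; rewrite ?ht ?(nf0l nf) ?subrr.
  under eq_bigr => k _ do rewrite linearB /= !row_incl.
  by rewrite big_split /= sumrN -!big_mkcond /= !big_pred1_eq subrr.
Qed.

Lemma proj1 : proj (@pow_one G n) = 1%g.
Proof.
apply: (mulgI (proj (@pow_one G n))); rewrite -(cp_morph cpG') mulg1; congr proj.
by apply/funext => c; rewrite /pow_mul mulg1.
Qed.

(** Modulo the relations each central component can be moved to the position [c0]. There the
    components multiply to the exponential of their sum, which is 0. *)
Lemma ker_sig X : ker_pow b X -> sig X = 1%g.
Proof.
move=> [kX sX].
have swap (c : 'I_n) z : (forall w, b z w = 0) -> proj (pow_in c (ex z)) = proj (pow_in c0 (ex z)).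
  move=> hz; apply: (mulIg (proj (pow_inv (pow_in c0 (ex z))))).
  rewrite -!(cp_morph cpG'); transitivity (1%g : G').
    apply/(cp_ker cpG') => T _; apply; exact: rad_center.
  rewrite -proj1; congr proj; apply/funext => k.
  by rewrite /pow_mul /pow_inv mulgV.
have prodE (s : seq 'I_n) : uniq s -> proj (fun c => if c \in s then ex (row c X) else 1%g)
     = proj (pow_in c0 (ex (\sum_(c <- s) row c X))).
  elim: s => [_|c s IH].
    rewrite big_nil (ex0 ne); congr proj; apply/funext => k.
    by rewrite /pow_in; case: eqP.
  rewrite cons_uniq => /andP[cs us]; rewrite big_cons.
  transitivity (proj (pow_mul (pow_in c (ex (row c X))) (fun k => if k \in s then ex (row k X) else 1%g))).
    congr proj; apply/funext => k; rewrite /pow_mul /pow_in inE.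
    by case: eqP => [->|]; rewrite ?(negPf cs) ?mulg1//= mul1g.
  rewrite (cp_morph cpG') (IH us) swap; last exact: kX.
  rewrite -(cp_morph cpG'); congr proj; apply/funext => k; rewrite /pow_mul /pow_in.
  by case: eqP; rewrite ?mulg1// (ex_mul ne) /bch kX scaler0 addr0.
transitivity (proj (fun c => if c \in enum 'I_n then ex (row c X) else 1%g)).
  by congr proj; apply/funext => c; rewrite mem_enum.
rewrite prodE ?enum_uniq// big_enum /= sX (ex0 ne) -proj1; congr proj.
by apply/funext => k; rewrite /pow_in; case: eqP.
Qed.

Notation N := (\rank (ker_mx n b)).
Notation E := 'rV[R]_N.
Definition psi (x : E) : G' := sig (sec x).

Lemma sig_psi X : sig X = psi (quo b X).
Proof.
rewrite /psi; have k := sec_quo nf X.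
apply: (mulgI (sig (- sec (quo b X)))); rewrite !sig_mul (bchNl pf).
have -> : bch (bpow b (n:=n)) (- sec (quo b X)) X = X - sec (quo b X).
  rewrite /bch (nfNl pf) -(bpow_ker nf X k) (nfxx pf) oppr0 scaler0 addr0 addrC//.
by rewrite ker_sig// ker_sig//; split=> [c w|]; [rewrite linear0 (nf0l nf)|rewrite big1// => c _; rewrite linear0].
Qed.

Let be := @beta R m n b.
Let bnf : nilform be := beta_nf n nf.

Lemma psi_mul x y : (psi x * psi y)%g = psi (bch be x y).
Proof.
rewrite {1 2}/psi sig_mul sig_psi; congr psi.
by rewrite /bch !quoD quoZ !quo_sec.
Qed.

Lemma psi_surj g : exists x, psi x = g.
Proof.
have [x <-] := cp_surj cpG' g; have [X <-] := powex_surj x.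
by exists (quo b X); rewrite -sig_psi.
Qed.

Lemma psi0 : psi 0 = 1%g.
Proof. by apply: (mulgI (psi 0)); rewrite psi_mul (bch0 bnf) mulg1. Qed.

Lemma psiN x : psi (- x) = ((psi x)^-1)%g.
Proof. by apply: (mulgI (psi x)); rewrite psi_mul (bchN bnf) psi0 mulgV. Qed.

Lemma psi_eq1 x : psi x = 1%g -> x = 0.
Proof. by move=> /sig_ker h; rewrite -(quo_sec x); apply/quo_eq0. Qed.

Lemma psi_inj x y : psi x = psi y -> x = y.
Proof.
move=> h; have : psi (bch be (- x) y) = 1%g by rewrite -psi_mul psiN h mulVg.
by move=> /psi_eq1 h'; rewrite -(bchKr bnf x y) h' (bch0 bnf).
Qed.
End central_product.

Lemma nbhs0_normP (R : realType) (V : normedModType R) (P : set V) (d : R) : 0 < d ->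
  (forall x, `|x| < d -> P x) -> nbhs (0 : V) P.
Proof.
by move=> d0 H; apply/nbhs_normP; exists d => // x /=; rewrite sub0r normrN; exact: H.
Qed.

Section pointwise_topology.
Variables (I : finType) (T : topologicalType).

Lemma ptws_cvg (S : topologicalType) (x0 : S)
    (g : S -> {ptws I -> T}) (f : {ptws I -> T}) :
  (forall c, g x c @[x --> x0] --> f c) -> g x @[x --> x0] --> f.
Proof.
move=> h; apply/cvg_sup => c A /= [_ [[B Bop <-] Bfs sBfA]].
apply: filterS sBfA _; apply: (h c); exact: open_nbhs_nbhs.
Qed.

Lemma ptws_box (f : {ptws I -> T}) (U : I -> set T) :
  (forall c, nbhs (f c) (U c)) -> nbhs f [set x | forall c, U c (x c)].
Proof.
move=> h; apply: (@filter_forall _ _ (fun c => [set x : {ptws I -> T} | U c (x c)]) (nbhs f) (nbhs_filter f)) => c.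
by apply: (@proj_continuous I (fun=> T) c f); exact: h.
Qed.
End pointwise_topology.

(** The interface between the algebra of [G'] and its geometry: global coordinates in which the
    product is [bch], open at the identity, and strictly differentiable there with a derivative
    bounded from below. *)
Record model (R : realType) (G : groupTopType) (m : nat) (A : atlas G 'rV[R]_m) (N : nat)
    (be : 'rV[R]_N -> 'rV[R]_N -> 'rV[R]_N) (psi : 'rV[R]_N -> G) (L : 'rV[R]_N -> 'rV[R]_m) (c d : R) : Prop := Model {
  md_nf : nilform be;
  md_mul : forall x y, (psi x * psi y)%g = psi (bch be x y);
  md_surj : forall g, exists x, psi x = g;
  md_inj : forall x y, psi x = psi y -> x = y;
  md_nbhs : forall d : R, 0 < d -> nbhs (1%g : G) [set g | exists2 x, `|x| < d & psi x = g];
  md_d : 0 < d; md_c : 0 < c;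
  md_dom : forall x, `|x| < d -> chart_dom (achart (prefc A 1%g)) (psi x);
  md_blin : blin L;
  md_low : forall v, c * `|v| <= `|L v|;
  md_sdiff : sdiff (fun x => lie_lg A (psi x)) 0 L;
  md_bilip : forall x y, `|x| < d -> `|y| < d ->
    c / 2 * `|y - x| <= `|lie_lg A (psi y) - lie_lg A (psi x)|
}.

(** * Openness and differentiability of the coordinates on the central product *)

Section central_product.
Variables (R : realType) (G : groupTopType) (m : nat) (A : atlas G 'rV[R]_m).
Hypothesis lieG : lie_group A.
Variables (n : nat) (G' : groupTopType) (m' : nat) (A' : atlas G' 'rV[R]_m').
Hypothesis lieG' : lie_group A'.
Variable proj : {ptws 'I_n -> G} -> G'.
Hypothesis cpG' : is_central_product A A' proj.
Variables (r C K d : R) (ex : 'rV[R]_m -> G) (b : 'rV[R]_m -> 'rV[R]_m -> 'rV[R]_m).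
Hypothesis lc : local_chart (lie_e A) (lie_lg A) r C.
Hypothesis ne : nilexp (lie_e A) (lie_lg A) r ex b K d.
Hypothesis ex_surj : forall g, exists v, ex v = g.
Hypothesis ex_inj : forall v w, ex v = ex w -> v = w.
Variable c0 : 'I_n.
Notation V := 'rV[R]_m.
Notation M := 'M[R]_(n, m).
Notation N := (\rank (ker_mx n b)).
Notation E := 'rV[R]_N.
Let nf := ne_nf ne.
Let psi : E -> G' := psi proj ex (b:=b).
Let pj1 := proj1 cpG'.

Lemma sec_bound : exists2 K1 : R, 0 < K1 & forall x : E, `|sec x| <= K1 * `|x|.
Proof.
have [K1 K10 H] := @mulmx_bound R 1 _ _ (pinvmx (col_base (ker_mx n b))).
exists K1 => // x; apply: le_trans (H x).
apply/mx_norm_leP => // i j; rewrite /sec mxE; exact: mx_entry_le.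
Qed.

Lemma row_norm (X : M) c : `|row c X| <= `|X|.
Proof. by apply/mx_norm_leP => // i j; rewrite mxE; exact: mx_entry_le. Qed.

Lemma proj_cont : continuous proj.
Proof. exact: (cp_smooth cpG').1. Qed.

Lemma psi_cont0 (W : set G') : nbhs (1%g : G') W ->
  exists2 d1 : R, 0 < d1 & forall x, `|x| < d1 -> W (psi x).
Proof.
move=> W1; have : nbhs (0 : E) (psi @^-1` W).
  have cv : (powex ex (sec x) : {ptws 'I_n -> G}) @[x --> (0 : E)] --> (@pow_one G n : {ptws 'I_n -> G}).
    apply: ptws_cvg => c U /= U1; have [d1 d10 H] := ex_cont0 lc ne U1.
    have [K1 K10 sP] := sec_bound.
    change (nbhs (0 : E) [set x | U (powex ex (sec x) c)]).
    apply: (@nbhs0_normP R _ _ (d1 / K1)); first by rewrite divr_gt0.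
    move=> x /=; rewrite ltr_pdivlMr// => xd; apply: H.
    by apply: le_lt_trans (row_norm _ _) _; apply: le_lt_trans (sP x) _; rewrite mulrC.
  apply: (cv (proj @^-1` W)); apply: (@proj_cont (@pow_one G n)).
  by rewrite pj1.
move=> /nbhs_normP[d1 /= d10 H]; exists d1 => // x xd; apply: H.
by rewrite /= sub0r normrN.
Qed.

Lemma pow_mul_cont (a : 'I_n -> G) :
  continuous (fun y : {ptws 'I_n -> G} => (pow_mul a y : {ptws 'I_n -> G})).
Proof.
move=> y; apply: ptws_cvg => c.
apply: (@cvg_comp _ _ _ (fun y : {ptws 'I_n -> G} => y c) (fun z => (a c * z)%g)).
  exact: (@proj_continuous 'I_n (fun=> G) c y).
apply: (@continuous_comp _ _ _ (fun z : G => (a c, z)) (fun xy : G * G => (xy.1 * xy.2)%g)).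
  by apply: cvg_pair => /=; [exact: cvg_cst|exact: cvg_id].
exact: (lie_mul_cont lieG).
Qed.

(** In the quotient topology it suffices that the saturation of [O] is open. A point [y] with the
    same image as [y0] in [O] differs from [y0] by an element [a] of the kernel, and translation by
    [a] is continuous. *)
Lemma proj_open1 (O : set {ptws 'I_n -> G}) : open O -> O (@pow_one G n) ->
  nbhs (1%g : G') (proj @` O).
Proof.
move=> oO O1; apply: open_nbhs_nbhs; split; last by exists (@pow_one G n).
apply/(cp_quotient_topology cpG'); rewrite openE => y [y0 Oy0 yy0].
pose a := pow_mul y0 (pow_inv y).
have ay : pow_mul a y = y0.
  by apply/funext => c; rewrite /a /pow_mul /pow_inv -mulgA mulVg mulg1.
have pa : proj a = 1%g.
  by apply: (mulIg (proj y)); rewrite -(cp_morph cpG') ay yy0 mul1g.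
have := @pow_mul_cont a y O; rewrite ay => /(_ (open_nbhs_nbhs (conj oO Oy0))).
move=> h; apply: (@filterS _ _ (nbhs_filter (y : {ptws 'I_n -> G})) _ _ _ h) => z /= Oz; exists (pow_mul a z) => //.
by rewrite (cp_morph cpG') pa mul1g.
Qed.

Lemma psi_nbhs (d1 : R) : 0 < d1 -> nbhs (1%g : G') [set g | exists2 x, `|x| < d1 & psi x = g].
Proof.
move=> d10.
have [K1 K10 qP] := @mulmx_bound R 1 _ _ (col_base (ker_mx n b)).
have dK : 0 < d1 / (2 * K1) by rewrite divr_gt0// mulr_gt0.
have B : nbhs (@pow_one G n : {ptws 'I_n -> G}) [set y | forall c, exists2 v, `|v| < d1 / (2 * K1) & ex v = y c].
  by apply: (@ptws_box 'I_n G (@pow_one G n) (fun=> [set g | exists2 v, `|v| < d1 / (2 * K1) & ex v = g])) => c; exact: (ex_nbhs lc ne).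
move: B; rewrite nbhsE; case=> O [oO O1] OB.
apply: filterS (proj_open1 oO O1) => _ [y /OB/= yP <-].
have /choice[v vP] : forall c, exists v, `|v| < d1 / (2 * K1) /\ ex v = y c.
  by move=> c; have [v v1 v2] := yP c; exists v.
exists (quo b (\matrix_(c, k) v c 0 k)).
  apply: le_lt_trans (qP _) _.
  have h : `|mxvec (\matrix_(c, k) v c 0 k : M)| <= d1 / (2 * K1).
    apply/mx_norm_leP; first exact: ltW.
    move=> i j; rewrite ord1; case/mxvec_indexP: j => c k; rewrite mxvecE mxE.
    by apply: le_trans (mx_entry_le _ _ _) _; apply/ltW; case: (vP c).
  apply: le_lt_trans (ler_wpM2l (ltW K10) h) _.
  have -> : K1 * (d1 / (2 * K1)) = d1 / 2 by field; rewrite gt_eqF.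
  by lra.
rewrite /psi -(sig_psi cpG' ne ex_surj c0) /sig; congr proj; apply/funext => c.
have [_ <-] := vP c; rewrite /powex; congr ex; apply/rowP => k; by rewrite !mxE.
Qed.

Let i1' := prefc A' 1%g.
Let i1 := prefc A 1%g.
Let P0 : M := \matrix_(c, k) chart_to (achart i1) 1%g 0 k.
Let F (P : M) : 'rV[R]_m' :=
  chart_to (achart i1') (proj (fun c => chart_of (achart i1) (row c P))).

Lemma Ck_on_sub (V1 V2 : normedModType R) k (U U' : set V1) (f : V1 -> V2) :
  U' `<=` U -> Ck_on k U f -> Ck_on k U' f.
Proof.
elim: k U U' f => [|k IH] U U' f UU [cf h]; split => //; first by move=> x /UU; exact: cf.
  by move=> x /UU; exact: cf.
move=> v; have [h1 h2] := h v; split; first by move=> x /UU; exact: h1.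
exact: IH h2.
Qed.

Lemma chart_map_sdiff : exists2 L, blin L & sdiff F P0 L.
Proof.
have ch := sm_chart (lie_manifold lieG) i1.
have [d1 d10 hd1] := cod_ball lieG.
have [dom'o] := sm_chart (lie_manifold lieG') i1'; move=> _ _ _ _.
have dom'1 : chart_dom (achart i1') 1%g := sm_prefc (lie_manifold lieG') 1%g.
have W1 : nbhs (@pow_one G n : {ptws 'I_n -> G}) (proj @^-1` chart_dom (achart i1')).
  apply: (@proj_cont (@pow_one G n)); rewrite pj1; exact: open_nbhs_nbhs.
have cv : ((fun c => lie_e A (row c X)) : {ptws 'I_n -> G}) @[X --> (0 : M)] --> (@pow_one G n : {ptws 'I_n -> G}).
  apply: ptws_cvg => c U /= U1; have [d2 d20 H] := lie_e_cont lieG U1.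
  change (nbhs (0 : M) [set X | U (lie_e A (row c X))]).
  apply: (@nbhs0_normP R _ _ d2) => // X /= Xd.
  by apply: H; apply: le_lt_trans (row_norm _ _) Xd.
have : nbhs (0 : M) [set X | chart_dom (achart i1') (proj (fun c => lie_e A (row c X)))] by exact: (cv _ W1).
move=> /nbhs_normP[d3 /= d30 H3].
pose dd := Num.min d1 d3; have dd0 : 0 < dd by rewrite lt_min d10.
have [_ /(_ (fun=> i1) i1' 1%N) sm] := cp_smooth cpG'.
have rowP0 c (X : M) : row c X = row c (X - P0) + chart_to (achart i1) 1%g.
  by apply/rowP => k; rewrite !mxE subrK.
have := @mx_Ck1_sdiff R n m 1 m' F (ball P0 dd) P0.
case; [exact: ball_open|exact: ballxx| |by move=> L [bL sL _]; exists L].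
apply: Ck_on_sub sm => X; rewrite -ball_normE /= distrC lt_min => /andP[X1 X3].
exists (fun c => chart_of (achart i1) (row c X)).
  split => /=.
    move=> c; rewrite rowP0; have [] // := chart_cod_of lieG (hd1 _ (le_lt_trans (row_norm (X - P0) c) X1)).
  have -> : (fun c : 'I_n => chart_of (achart i1) (row c X)) = (fun c => lie_e A (row c (X - P0))).
    by apply/funext => c; rewrite rowP0.
  by apply: H3; rewrite /= sub0r normrN.
apply/matrixP => c k; rewrite mxE [row c X]rowP0.
have [_ ->] := chart_cod_of lieG (hd1 _ (le_lt_trans (row_norm (X - P0) c) X1)).
by rewrite !mxE subrK.
Qed.

(** In charts [psi] is the smooth map [F] composed with the componentwise exponential of [sec x],
    and both are strictly differentiable. *)
Lemma psi_sdiff0 : exists2 L, blin L & sdiff (fun x => lie_lg A' (psi x)) 0 L.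
Proof.
have [L bL sL] := chart_map_sdiff.
have [K1 K10 sP] := sec_bound.
have bsec : blin (@sec R m n b).
  split; [exact: sec_lin|by exists K1].
pose g (x : E) : M := P0 + \matrix_(c, k) lie_lg A (ex (row c (sec x))) 0 k.
have sec0 : sec (0 : E) = 0 :> M by rewrite /sec mul0mx linear0.
have g0 : g 0 = P0.
  rewrite /g sec0 -[RHS]addr0; congr (_ + _); apply/matrixP => c k.
  by rewrite [LHS]mxE linear0 (ex0 ne) (lc_lg1 lc) !mxE.
have sg : sdiff g 0 (@sec R m n b).
  move=> eps eps0; have eK : 0 < eps / K1 by exact: divr_gt0.
  have [d1 d10 H] := ex_sdiff lc ne eK.
  exists (d1 / K1); first exact: divr_gt0.
  move=> x y; rewrite !subr0 !ltr_pdivlMr// => xd yd.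
  apply/mx_norm_leP; first by rewrite mulr_ge0// ltW.
  move=> c k; have := H (row c (sec x)) (row c (sec y)).
  rewrite !subr0 => h.
  have {}h := h (le_lt_trans (le_trans (row_norm _ _) (sP _)) (ltac:(by rewrite mulrC) : K1 * `|x| < d1))
    (le_lt_trans (le_trans (row_norm _ _) (sP _)) (ltac:(by rewrite mulrC) : K1 * `|y| < d1)).
  apply: le_trans (_ : eps / K1 * `|sec (y - x)| <= _); last first.
    rewrite -mulrA ler_pM2l// mulrC ler_pdivrMr// mulrC; exact: sP.
  apply: le_trans (_ : eps / K1 * `|row c (sec (y - x))| <= _); last first.
    by rewrite ler_pM2l//; exact: row_norm.
  have Es : row c (sec y) - row c (sec x) = row c (sec (y - x)) by rewrite (blinB bsec) linearB.
  rewrite Es in h; apply: le_trans h.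
  apply: le_trans (mx_entry_le _ 0 k); rewrite !mxE.
  by rewrite le_eqVlt; apply/orP; left; apply/eqP; congr `|_|; ring.
exists (L \o (@sec R m n b)); first exact: blin_comp.
have sLg : sdiff F (g 0) L by rewrite g0.
have sFg := sdiff_comp bL bsec sLg sg.
move=> eps eps0; have [d1 d10 H] := sFg eps eps0.
have dK : 0 < d / (1 + K1) by rewrite divr_gt0 ?(ne_d ne)//; lra.
exists (Num.min d1 (d / (1 + K1))); first by rewrite lt_min d10.
have FE x : `|x| < d / (1 + K1) -> lie_lg A' (psi x) = F (g x) - chart_to (achart i1') 1%g.
  move=> xd; rewrite /lie_lg /F -/i1'; congr (chart_to _ _ - _); rewrite /psi /psi /sig.
  congr proj; apply/funext => c; rewrite /powex.
  have rd : `|row c (sec x)| <= d.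
    apply: le_trans (row_norm _ _) _; apply: le_trans (sP _) _.
    move: xd; rewrite ltr_pdivlMr; last lra.
    by have := normr_ge0 x; lra.
  have [<- _ _] := ne_loc ne rd; rewrite /lie_e -/i1; congr chart_of.
  rewrite addrC; apply/rowP => k; rewrite [LHS]mxE [RHS]mxE /g [RHS]mxE.
  by congr (_ + _); rewrite [RHS]mxE.
move=> x y; rewrite !subr0 !lt_min => /andP[x1 x2] /andP[y1 y2].
rewrite !FE//.
have := H x y; rewrite !subr0 => /(_ x1 y1); congr (_ <= _); congr `|_|.
by rewrite /=; zmod.
Qed.

Variables (r' C' : R).
Hypothesis lc' : local_chart (lie_e A') (lie_lg A') r' C'.
Let pinj := psi_inj cpG' ne ex_surj ex_inj c0.
Let pmul := psi_mul cpG' ne ex_surj c0.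
Let bnf := beta_nf n nf.
Let p0 : psi 0 = 1%g := psi0 cpG' ne ex_surj c0.

(* A zero of the derivative would make [psi (v / N)] tend to 1 faster than
   1 / N, hence [psi v = psi (v / N) ^+ N] would be trivial. *)
Lemma psi_sdiff_inj L : blin L -> sdiff (fun x => lie_lg A' (psi x)) 0 L ->
  forall v, L v = 0 -> v = 0.
Proof.
move=> bL sL v Lv.
have r0 := lc_r lc'.
have [d1 d10 H1] := psi_cont0 (lc_near lc' r0).
have v1 : 0 < 1 + `|v| by rewrite ltr_pwDl.
pose s := d1 / (1 + `|v|); have s0 : 0 < s by exact: divr_gt0.
have sv : `|s *: v| < d1.
  rewrite normrZ gtr0_norm// /s mulrAC ltr_pdivrMr// ltr_pM2l//; lra.
suff : s *: v = 0 by move=> /eqP; rewrite scaler_eq0 gt_eqF//= => /eqP.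
apply: pinj; rewrite -!/(psi _) p0.
have [_ <-] := H1 _ sv; rewrite -(lc_e0 lc'); congr (lie_e A' _).
apply/eqP; rewrite -normr_le0; apply/ler_addgt0Pl => eps eps0; rewrite addr0.
pose q := Num.min eps r' / (8 * (1 + `|s *: v|)).
have q0 : 0 < q by rewrite divr_gt0 ?lt_min ?eps0// mulr_gt0// ltr_pwDl.
have [d2 d20 H2] := sL q q0.
pose k := (Num.truncn (`|s *: v| / d2)).+1.
have k0 : 0 < k%:R :> R by rewrite ltr0n.
have kd : `|s *: v| / d2 < k%:R by exact: truncnS_gt.
pose x := k%:R^-1 *: (s *: v).
have nx : k%:R * `|x| = `|s *: v|.
  by rewrite normrZ ger0_norm ?invr_ge0 ?ler0n// mulrA divff ?gt_eqF// mul1r.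
have xd2 : `|x| < d2 by rewrite -(ltr_pM2l k0) nx -ltr_pdivrMr.
have xd1 : `|x| < d1.
  by apply: le_lt_trans sv; rewrite -nx ler_peMl// ler1n.
have Lx : L x = 0 by rewrite /x !(blinZ bL) Lv !scaler0.
have z2 : `|0 : E| < d2 by rewrite normr0.
have := H2 0 x; rewrite !subr0 => /(_ z2 xd2).
rewrite Lx subr0 p0 (lc_lg1 lc') subr0 => hx.
have [_ eX] := H1 _ xd1.
have kq : k%:R * `|lie_lg A' (psi x)| <= Num.min eps r' / 8.
  apply: le_trans (ler_wpM2l (ltW k0) hx) _; rewrite mulrCA nx /q.
  rewrite mulrAC ler_pdivrMr; last by rewrite mulr_gt0// ltr_pwDl.
  have -> : Num.min eps r' / 8 * (8 * (1 + `|s *: v|)) = Num.min eps r' * (1 + `|s *: v|) by field.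
  by rewrite ler_pM2l ?lt_min ?eps0// lerDr.
have mr : Num.min eps r' <= r' by rewrite ge_min lexx orbT.
have me : Num.min eps r' <= eps by rewrite ge_min lexx.
have kr : k%:R * `|lie_lg A' (psi x)| <= r' / 4 by lra.
have [_ _ + _] := lc_pow lc' kr; rewrite eX => h.
have -> : psi (s *: v) = (psi x ^+ k)%g.
  have P j : (psi x ^+ j)%g = psi (j%:R *: x).
    elim: j => [|j IH]; first by rewrite scale0r p0.
    by rewrite expgSr IH /psi pmul -{2}[x]scale1r (bchZ bnf) natr1.
  by rewrite P /x scalerA divff ?gt_eqF// scale1r.
by apply: le_trans h _; lra.
Qed.

(** An injective linear map satisfies [c * |v| <= |L v|]. Strict differentiability with error
    [c / 2] transfers half of this lower bound to [psi]. *)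
Lemma psi_model : exists L c d, model A' (@beta R m n b) psi L c d.
Proof.
have [L bL sL] := psi_sdiff0.
have Linj := psi_sdiff_inj bL sL.
pose Q := (\matrix_(i, j) L (delta_mx 0 i) 0 j).
have LQ v : L v = v *m Q by apply: linear_mx; case: bL.
have fQ : row_free Q.
  by rewrite -kermx_eq0; apply/rowV0P => v /sub_kermxP vQ; apply: Linj; rewrite LQ.
have [K1 K10 HK] := @mulmx_bound R 1 _ _ (pinvmx Q).
pose c := K1^-1; have cc0 : 0 < c by rewrite invr_gt0.
have low v : c * `|v| <= `|L v|.
  rewrite mulrC ler_pdivrMr// mulrC; apply: le_trans (HK _).
  by rewrite LQ mulmxKp.
have c2 : 0 < c / 2 by rewrite divr_gt0.
have [d1 d10 H1] := sL _ c2.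
have [domo _ _ _ _] := sm_chart (lie_manifold lieG') i1'.
have dom'1 : chart_dom (achart i1') 1%g := sm_prefc (lie_manifold lieG') 1%g.
have [d2 d20 H2] := psi_cont0 (open_nbhs_nbhs (conj domo dom'1)).
exists L, c, (Num.min d1 d2); split => //.
- exact: (psi_surj cpG' ne ex_surj c0).
- exact: psi_nbhs.
- by rewrite lt_min d10.
- by move=> x; rewrite lt_min => /andP[_ xd]; exact: H2.
- move=> x y; rewrite !lt_min => /andP[x1 _] /andP[y1 _].
  have := H1 x y; rewrite !subr0 => /(_ x1 y1) h.
  have := low (y - x).
  have : `|L (y - x)| <= `|lie_lg A' (psi y) - lie_lg A' (psi x) - L (y - x)| + `|lie_lg A' (psi y) - lie_lg A' (psi x)|.
    rewrite -[leLHS]normrN; set u := _ - lie_lg _ _.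
    have {1}-> : - L (y - x) = (u - L (y - x)) - u by zmod.
    exact: ler_normB.
  lra.
Qed.
End central_product.

(** * Left-invariant metrics *)

Lemma blin_linv (R : realType) N m (L : 'rV[R]_N -> 'rV[R]_m) : blin L ->
  (forall v, L v = 0 -> v = 0) -> exists2 P : 'rV[R]_m -> 'rV[R]_N, blin P & forall v, P (L v) = v.
Proof.
move=> bL Linj.
pose Q := (\matrix_(i, j) L (delta_mx 0 i) 0 j).
have LQ v : L v = v *m Q by apply: linear_mx; case: bL.
have fQ : row_free Q.
  by rewrite -kermx_eq0; apply/rowV0P => v /sub_kermxP vQ; apply: Linj; rewrite LQ.
exists (mulmxr (pinvmx Q)); last by move=> v; rewrite /= LQ mulmxKp.
split=> [a u v|]; first by rewrite linearP.
by have [K1 K10 HK] := @mulmx_bound R 1 _ _ (pinvmx Q); exists K1.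
Qed.

Lemma Ck1_slice (R : realType) (V1 V2 W : normedModType R) (f : V1 * V2 -> W)
    (U : set (V1 * V2)) (q : V1) (U2 : set V2) : (forall r, U2 r -> U (q, r)) ->
  Ck_on 1 U f -> Ck_on 1 U2 (fun r => f (q, r)).
Proof.
move=> UU [cf Df].
have slc (g : V1 * V2 -> W) r : {for (q, r), continuous g} -> {for r, continuous (fun r => g (q, r))}.
  move=> cg; apply: (@continuous_comp _ _ _ (fun r : V2 => (q, r)) g) => //.
  by apply: cvg_pair => /=; [exact: cvg_cst|exact: cvg_id].
have dE v r : (fun h : R => h^-1 *: (f (q, h *: v + r) - f (q, r))) =
    (fun h : R => h^-1 *: (f (h *: ((0, v) : V1 * V2) + (q, r)) - f (q, r))).
  apply/funext => h; congr (_ *: (f _ - _)).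
  by apply/pair_equal_spec; split; rewrite /= ?scaler0 ?add0r.
split; first by move=> r /UU; move/cf; exact: slc.
move=> v; have [D1 [D2 _]] := Df (0, v); split=> [r /UU/D1|].
  by rewrite /derivable dE.
have dD : (fun r => 'D_v (fun r => f (q, r)) r) = (fun r => 'D_(0, v) f (q, r)).
  by apply/funext => s; rewrite /derive dE.
split => // r Ur; have := slc _ _ (D2 _ (UU _ Ur)).
by rewrite -dD.
Qed.

Lemma sdiff_near (R : realType) (V W : normedModType R) (f g : V -> W) x L d : 0 < d ->
  (forall y, `|y - x| < d -> f y = g y) -> sdiff g x L -> sdiff f x L.
Proof.
move=> d0 fg sg e e0; have [d1 d10 H] := sg e e0.
exists (Num.min d d1); first by rewrite lt_min d0.
move=> u v; rewrite !lt_min => /andP[u1 u2] /andP[v1 v2].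
by rewrite !fg//; exact: H.
Qed.

Lemma sdiff_sub (R : realType) (V W : normedModType R) (f : V -> W) x L a :
  sdiff (fun y => f y - a) x L -> sdiff f x L.
Proof.
move=> sf e e0; have [d d0 H] := sf e e0; exists d => // u v ux vx.
have := H u v ux vx; congr (_ <= _); congr `|_|; zmodc.
Qed.

(** A chain rule read backwards: if [Gi] composed with [z] has a derivative and the strict
    derivative of [Gi] has a left inverse [P], then [z] has one. It converts derivatives in a chart
    into derivatives of group increments. *)
Lemma zdv (R : realType) N m (Gi : 'rV[R]_N -> 'rV[R]_m) (Li : 'rV[R]_N -> 'rV[R]_m)
    (P : 'rV[R]_m -> 'rV[R]_N) (z : R -> 'rV[R]_N) (u : 'rV[R]_m) (a dl : R) :
  blin Li -> blin P -> (forall v, P (Li v) = v) -> sdiff Gi 0 Li -> 0 < dl -> 0 <= a ->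
  (forall s, `|s| < dl -> `|z s| <= a * `|s|) ->
  dv (fun s => Gi (z s)) 0 u ->
  [/\ dv z 0 (P u), Li (P u) = u & `|P u| <= a].
Proof.
move=> bL bP PL sG dl0 a0 za du.
have z0 : z 0 = 0 by apply/eqP; rewrite -normr_le0; have := za 0; rewrite normr0 mulr0 => ->.
have dz : dv z 0 (P u).
  move=> e e0; have [Kp Kp0 PK] := bP.2.
  pose e1 := e / (Kp * (a + 1)).
  have a1 : 0 < a + 1 by rewrite ltr_wpDl.
  have e10 : 0 < e1 by rewrite divr_gt0// mulr_gt0.
  have [d1 d10 H1] := sG _ e10; have [d2 d20 H2] := du _ e10.
  exists (Num.min (Num.min dl d2) (d1 / (a + 1))); first by rewrite !lt_min dl0 d20 divr_gt0.
  move=> t; rewrite !lt_min ltr_pdivlMr// => /andP[/andP[t1 t2] t3].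
  have zt := za t t1; rewrite add0r z0 subr0.
  have zd : `|z t| < d1 by apply: le_lt_trans zt _; have := normr_ge0 t; lra.
  have -> : z t - t *: P u = P (Li (z t) - t *: u) by rewrite (blinB bP) (blinZ bP) PL.
  apply: le_trans (PK _) _.
  have -> : Li (z t) - t *: u = (Gi (z (0 + t)) - Gi (z 0) - t *: u) - (Gi (z t) - Gi 0 - Li (z t - 0)).
    by rewrite z0 add0r subr0; zmod.
  have := H1 0 (z t); rewrite !subr0 normr0 => /(_ d10 zd) h1; have h2 := H2 t t2.
  have h : `|Gi (z (0 + t)) - Gi (z 0) - t *: u - (Gi (z t) - Gi 0 - Li (z t - 0))| <= e1 * (a + 1) * `|t|.
    apply: le_trans (ler_normB _ _) _; rewrite subr0.
    by have := ler_wpM2l (ltW e10) zt; lra.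
  rewrite subr0 in h *; apply: le_trans (ler_wpM2l (ltW Kp0) h) _.
  by rewrite le_eqVlt /e1; apply/orP; left; apply/eqP; field; rewrite !gt_eqF.
split => //.
  have dG := sdiff_dv bL _ dz; apply: (dv_unique (dG Gi _) du); by rewrite z0.
apply/ler_addgt0Pl => e e0; have [d1 d10 H] := dz e e0.
pose t := Num.min dl d1 / 2.
have m0 : 0 < Num.min dl d1 by rewrite lt_min dl0.
have t0 : 0 < t by rewrite divr_gt0.
have nt : `|t| = t by rewrite gtr0_norm.
have tm : t < Num.min dl d1 by rewrite /t; lra.
have /andP[t1 t2] : (t < dl) && (t < d1) by rewrite -lt_min.
have := H t; have := za t; rewrite nt => /(_ t1) h1 /(_ t2); rewrite add0r z0 subr0 => h2.
rewrite -(ler_pM2l t0) -{1}nt -normrZ.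
have -> : t *: P u = z t - (z t - t *: P u) by zmod.
by apply: le_trans (ler_normB _ _) _; move: h1 h2; lra.
Qed.

Lemma loclip_cont (R : realType) (V : normedModType R) (f : V -> R) :
  (forall v, exists K : R, forall w, `|v - w| <= 1 -> `|f v - f w| <= K * `|v - w|) ->
  continuous f.
Proof.
move=> H v; have [K HK] := H v; apply/cvgrPdist_le => e e0; near=> w.
have vw1 : `|v - w| <= 1 by near: w; apply: cvgr_dist_le; [exact: cvg_id|].
have vwe : `|v - w| <= e / (1 + `|K|).
  by near: w; apply: cvgr_dist_le; [exact: cvg_id|rewrite divr_gt0// ltr_pwDl].
apply: le_trans (HK _ vw1) _; rewrite ler_pdivlMr ?ltr_pwDl// in vwe; apply: le_trans vwe.
rewrite mulrC ler_wpM2l//; have := ler_norm K; lra.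
Unshelve. all: by end_near. Qed.

Section metric.
Variables (R : realType) (G : groupTopType) (m : nat) (A : atlas G 'rV[R]_m).
Hypothesis lieG : lie_group A.
Variables (N : nat) (be : 'rV[R]_N -> 'rV[R]_N -> 'rV[R]_N) (psi : 'rV[R]_N -> G).
Variables (L : 'rV[R]_N -> 'rV[R]_m) (c d : R).
Hypothesis md : model A be psi L c d.
Variable h : metric A.
Hypotheses (riem_h : riemannian h) (linv_h : left_invariant h).
Notation E := 'rV[R]_N.
Let i1 := prefc A (1%g : G).
Let p0 := chart_to (achart i1) (1%g : G).
Let nf := md_nf md.

Lemma md_psi0 : psi 0 = 1%g.
Proof. by apply: (mulgI (psi 0)); rewrite (md_mul md) (bch0 nf) mulg1. Qed.

Definition ip (v w : E) : R := inner h i1 p0 (L v) (L w).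

Lemma inner_lin i (p v w x : 'rV[R]_m) a : inner h i p (a *: v + w) x = a * inner h i p v x + inner h i p w x.
Proof. by rewrite /inner !mulmxDl -!scalemxAl !mxE. Qed.

Let dom1 : chart_dom (achart i1) 1%g := sm_prefc (lie_manifold lieG) 1%g.
Let cod1 : chart_cod (achart i1) p0. Proof. by exists 1%g. Qed.

Lemma innerC i p v w : chart_cod (achart i) p -> inner h i p v w = inner h i p w v.
Proof.
move=> cp; rewrite /inner; transitivity ((v *m h i p *m w^T)^T 0 0); first by rewrite [RHS]mxE.
by rewrite !trmx_mul trmxK (riem_sym riem_h cp) mulmxA.
Qed.

Lemma ipC v w : ip v w = ip w v.
Proof. exact: innerC. Qed.
Lemma ip_lin a v w x : ip (a *: v + w) x = a * ip v x + ip w x.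
Proof. by rewrite /ip (md_blin md).1 inner_lin. Qed.
Lemma ip0 x : ip 0 x = 0.
Proof. by have := ip_lin 1 0 0 x; rewrite scaler0 addr0 mul1r; lra. Qed.
Lemma ipDl v w x : ip (v + w) x = ip v x + ip w x.
Proof. by have := ip_lin 1 v w x; rewrite scale1r mul1r. Qed.
Lemma ipZl a v x : ip (a *: v) x = a * ip v x.
Proof. by have := ip_lin a v 0 x; rewrite addr0 ip0 addr0. Qed.
Lemma ipDr v w x : ip x (v + w) = ip x v + ip x w.
Proof. by rewrite !(ipC x) ipDl. Qed.
Lemma ipZr a v x : ip x (a *: v) = a * ip x v.
Proof. by rewrite !(ipC x) ipZl. Qed.

Lemma L_inj v : L v = 0 -> v = 0.
Proof.
move=> Lv; apply/eqP; rewrite -normr_le0.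
have := md_low md v; rewrite Lv normr0 pmulr_rle0//; exact: md_c md.
Qed.

Lemma ip_gt0 v : v != 0 -> 0 < ip v v.
Proof. by move=> v0; apply: (riem_pos riem_h cod1); apply: contraNneq v0 => /L_inj ->. Qed.

Lemma ip_ge0 v : 0 <= ip v v.
Proof. by have [->|/ip_gt0/ltW//] := eqVneq v 0; rewrite ip0. Qed.

Lemma ip_bound : exists2 Ci : R, 0 < Ci & forall v w, `|ip v w| <= Ci * `|v| * `|w|.
Proof.
have [K1 K10 H1] := @mulmx_bound R 1 _ _ (h i1 p0).
have [K2 K20 H2] := (md_blin md).2.
exists (m%:R * K1 * K2 ^+ 2 + 1); first by rewrite ltr_wpDl// !mulr_ge0// ltW.
move=> v w; rewrite /ip /inner mxE; apply: le_trans (ler_norm_sum _ _ _) _.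
apply: (@le_trans _ _ (\sum_(k < m) (K1 * (K2 * `|v|)) * (K2 * `|w|))).
  apply: ler_sum => k _; rewrite normrM; apply: ler_pM => //.
    apply: le_trans (mx_entry_le _ _ _) _; apply: le_trans (H1 _) _.
    by rewrite ler_pM2l.
  by rewrite mxE; apply: le_trans (mx_entry_le _ _ _) _.
rewrite sumr_const card_ord -[leLHS]mulr_natr.
have -> : K1 * (K2 * `|v|) * (K2 * `|w|) * m%:R = m%:R * K1 * K2 ^+ 2 * (`|v| * `|w|) by ring.
by rewrite -[leRHS]mulrA ler_wpM2r ?mulr_ge0// lerDl.
Qed.

Lemma ip_lower : exists2 cl : R, 0 < cl & forall v, cl * `|v| ^+ 2 <= ip v v.
Proof.
have [Ci Ci0 HC] := ip_bound.
pose S : set E := [set v | `|v| = 1].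
(* The unit sphere is empty in dimension 0, and the minimum over it would not exist. *)
have [[v0 Sv0]|nS] := pselect (exists v, S v); last first.
  exists 1 => // v; have [->|v0] := eqVneq v 0; first by rewrite normr0 ip0 expr2 !mulr0.
  case: nS; exists (`|v|^-1 *: v); rewrite /S /= normrZ normfV normr_id mulVf// normr_eq0//.
have cS : compact S.
  apply: bounded_closed_compact.
    exists 1; split => // x x1 v /= ->; exact: ltW.
  have -> : S = (fun v : E => `|v|) @^-1` [set 1] by [].
  apply: closed_comp; last exact: closed_eq.
  by move=> v _; exact: norm_continuous.
have cip : continuous (fun v : E => ip v v).
  apply: (@loclip_cont R _ (fun v : E => ip v v)) => v.
  exists (Ci * (2 * `|v| + 1)) => w vw1.
  have -> : ip v v - ip w w = ip (v - w) (v + w).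
    by rewrite ipDl !ipDr -(scaleN1r w) !ipZl (ipC w v); ring.
  apply: le_trans (HC _ _) _.
  rewrite [leRHS]mulrAC ler_wpM2l ?mulr_ge0 ?(ltW Ci0)//.
  have -> : v + w = 2 *: v - (v - w).
    by rewrite -[2 in RHS]/(1 + 1) scalerDl scale1r; zmod.
  by apply: le_trans (ler_normB _ _) _; rewrite normrZ ger0_norm//; lra.
have [v1 Sv1 H] : exists2 v1, v1 \in S & forall v, v \in S -> ip v1 v1 <= ip v v.
  apply: (@EVT_min_rV R _ (fun v : E => ip v v) S); [by exists v0|exact: cS|exact: continuous_subspaceT].
have v10 : v1 != 0.
  by move: Sv1; rewrite inE /S /= => v1E; rewrite -normr_eq0 v1E oner_eq0.
exists (ip v1 v1); first exact: ip_gt0.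
move=> v; have [->|v00] := eqVneq v 0; first by rewrite normr0 ip0 expr2 !mulr0.
have nv : 0 < `|v| by rewrite normr_gt0.
have := H (`|v|^-1 *: v); rewrite inE /S /= normrZ normfV normr_id mulVf ?gt_eqF// => /(_ erefl).
rewrite ipZl ipZr => hh.
have -> : ip v v = `|v|^-1 * (`|v|^-1 * ip v v) * `|v| ^+ 2 by field; rewrite gt_eqF.
by rewrite ler_wpM2r ?sqr_ge0.
Qed.

(** The chart of [x * psi z] has at [z = 0] a derivative [Li] that carries [ip] to the inner product
    at [x], since left translations are isometries. All lengths and areas thereby reduce to the form
    [ip]. *)
Lemma transl (x : G) i : chart_dom (achart i) x ->
  exists Li, [/\ blin Li, sdiff (fun z => chart_to (achart i) (x * psi z)%g) 0 Li &
    forall v w, inner h i (chart_to (achart i) x) (Li v) (Li w) = ip v w].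
Proof.
move=> ix; pose F r := chart_to (achart i) (x * chart_of (achart i1) r)%g.
have [_ codi ofto _ _] := sm_chart (lie_manifold lieG) i1.
have [domo _ _ _ _] := sm_chart (lie_manifold lieG) i.
have [d1 d10 hd1] := cod_ball lieG.
have W : nbhs (x * 1)%g (chart_dom (achart i)) by rewrite mulg1; exact: open_nbhs_nbhs.
have [[Wa Wb] /= [Wax Wb1] WW] := @lie_mul_cont R G m A lieG (x, 1%g) _ W.
have [d2 d20 hd2] := lie_e_cont lieG Wb1.
pose dd := Num.min d1 d2; have dd0 : 0 < dd by rewrite lt_min d10.
pose ix' := prefc A x.
have domx : chart_dom (achart ix') x := sm_prefc (lie_manifold lieG) x.
have [_ _ ofx _ _] := sm_chart (lie_manifold lieG) ix'.
have [_ /(_ (ix', i1) i 1%N) sm] := lie_mul lieG.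
have eE r : chart_of (achart i1) r = lie_e A (r - p0) by rewrite /lie_e -/i1 -/p0 subrK.
have := @mx_Ck1_sdiff R 1 m 1 m F (ball p0 dd) p0.
case; [exact: ball_open|exact: ballxx| |].
  have -> : F = (fun r => (fun p : 'rV[R]_m * 'rV[R]_m => chart_to (achart i) (chart_of (achart ix') p.1 * chart_of (achart i1) p.2)%g) (chart_to (achart ix') x, r)).
    by apply/funext => r; rewrite /= ofx.
  apply: (Ck1_slice _ sm) => r; rewrite -ball_normE /= distrC lt_min => /andP[r1 r2].
  have := chart_cod_of lieG (hd1 _ r1); rewrite -/i1 -/p0 subrK => -[e1 e2].
  exists (x, chart_of (achart i1) r) => /=; last by rewrite e2.
  split => //=; apply: (WW (_, _)); split => /=; first exact: nbhs_singleton.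
  by rewrite eE; exact: hd2.
move=> LF [bLF sF DF].
exists (LF \o L); split; first exact: blin_comp bLF (md_blin md).
  have s0 : sdiff (fun z => chart_to (achart i1) (psi z)) 0 L by exact: sdiff_sub (md_sdiff md).
  have g0 : chart_to (achart i1) (psi 0) = p0 by rewrite md_psi0.
  have sF' : sdiff F (chart_to (achart i1) (psi 0)) LF by rewrite g0.
  have := sdiff_comp bLF (md_blin md) sF' s0; apply: (sdiff_near (md_d md)) => z; rewrite subr0 => zd.
  by rewrite /= /F ofto//; exact: (md_dom md).
move=> v w; have := @linv_h x 1%g i1 i dom1.
rewrite mulg1 => /(_ ix) /(_ (L v) (L w)); rewrite /ip /= mulg1 -/p0.
have [_ <-] := DF (L v); have [_ <-] := DF (L w); by [].
Qed.

Lemma transl_inv (x : G) i : chart_dom (achart i) x ->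
  exists Li P, [/\ blin Li, blin P, forall v, P (Li v) = v,
    sdiff (fun z => chart_to (achart i) (x * psi z)%g) 0 Li &
    forall v w, inner h i (chart_to (achart i) x) (Li v) (Li w) = ip v w].
Proof.
move=> ix; have [Li [bL sL iL]] := transl ix.
have [|P bP PL] := blin_linv bL; last by exists Li, P.
move=> v Lv; apply/eqP; apply: contraT => /ip_gt0; rewrite -iL Lv.
by rewrite /inner linear0 mulmx0 mxE ltxx.
Qed.

Lemma gram0l i p (u v : 'rV[R]_m) : u = 0 ->
  Num.sqrt (inner h i p u u * inner h i p v v - inner h i p u v ^+ 2) = 0.
Proof. by move=> ->; rewrite /inner !mul0mx mxE mul0r expr2 mul0r subrr sqrtr0. Qed.
Lemma gram0r i p (u v : 'rV[R]_m) : v = 0 ->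
  Num.sqrt (inner h i p u u * inner h i p v v - inner h i p u v ^+ 2) = 0.
Proof.
have E w : inner h i p w 0 = 0 by rewrite /inner linear0 mulmx0 mxE.
by move=> ->; rewrite !E mulr0 expr2 mul0r subrr sqrtr0.
Qed.

Lemma gramE i p (u v u' v' : 'rV[R]_m) (w1 w2 : E) : u' = u -> v' = v ->
  inner h i p u' u' = ip w1 w1 -> inner h i p v' v' = ip w2 w2 -> inner h i p u' v' = ip w1 w2 ->
  Num.sqrt (inner h i p u u * inner h i p v v - inner h i p u v ^+ 2) =
  Num.sqrt (ip w1 w1 * ip w2 w2 - ip w1 w2 ^+ 2).
Proof. by move=> -> -> -> -> ->. Qed.

(* Either side may fail to be differentiable, in which case the junk value 0 of
   the derivative makes the jacobian vanish. *)
Lemma jac_cases (g : R * R -> G) (p : R * R) (z1 z2 : R -> E) (a1 a2 dl : R) :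
  0 < dl -> 0 <= a1 -> 0 <= a2 ->
  (forall s, `|s| < dl -> g (s *: ((1 : R), (0 : R)) + p) = (g p * psi (z1 s))%g /\ `|z1 s| <= a1 * `|s|) ->
  (forall s, `|s| < dl -> g (s *: ((0 : R), (1 : R)) + p) = (g p * psi (z2 s))%g /\ `|z2 s| <= a2 * `|s|) ->
  Defs.jacobian h g p = 0 \/ exists w1 w2, [/\ dv z1 0 w1, dv z2 0 w2, `|w1| <= a1, `|w2| <= a2 &
    Defs.jacobian h g p = Num.sqrt (ip w1 w1 * ip w2 w2 - ip w1 w2 ^+ 2)].
Proof.
move=> dl0 a10 a20 h1 h2; rewrite /Defs.jacobian; set i := prefc A (g p).
have ix : chart_dom (achart i) (g p) := sm_prefc (lie_manifold lieG) (g p).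
have [Li [P [bL bP PL sL iL]]] := transl_inv ix.
set phi := chart_to (achart i) in sL iL *.
set u := 'D_(1, 0) _ p; set v := 'D_(0, 1) _ p.
have [d1|nd] := pselect (derivable (fun q : R * R => phi (g q)) p (1, 0)); last first.
  by left; apply: gram0l; exact: derive_dvg nd.
have [d2|nd] := pselect (derivable (fun q : R * R => phi (g q)) p (0, 1)); last first.
  by left; apply: gram0r; exact: derive_dvg nd.
right.
have /derive_dvP e1 : derivable (fun q : R * R => phi (g q)) p (1, 0) /\
   'D_(1, 0) (fun q : R * R => phi (g q)) p = u by [].
have /derive_dvP e2 : derivable (fun q : R * R => phi (g q)) p (0, 1) /\
   'D_(0, 1) (fun q : R * R => phi (g q)) p = v by [].
have nr (P' : R -> Prop) : (forall s, `|s| < dl -> P' s) -> \forall s \near (0 : R), P' s.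
  by move=> H; exact: (@nbhs0_normP R _ _ dl).
have {}e1 := @dv_eq R _ _ (fun s => phi (g p * psi (z1 s))%g) 0 _ (nr _ (fun s hs => congr1 phi (h1 s hs).1)) e1.
have {}e2 := @dv_eq R _ _ (fun s => phi (g p * psi (z2 s))%g) 0 _ (nr _ (fun s hs => congr1 phi (h2 s hs).1)) e2.
have [f1 g1 n1] := zdv bL bP PL sL dl0 a10 (fun s hs => (h1 s hs).2) e1.
have [f2 g2 n2] := zdv bL bP PL sL dl0 a20 (fun s hs => (h2 s hs).2) e2.
exists (P u), (P v); split => //.
exact: (gramE g1 g2 (iL _ _) (iL _ _) (iL _ _)).
Qed.

(** The speed depends on the left-invariant velocity, the derivative of [(- y t) ** y (t + s)] at
    [s = 0], which is [y' - be (y t) y' / 2]. *)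
Lemma speed_dv (y : R -> E) (t : R) (y' : E) : dv y t y' ->
  speed h (fun s => psi (y s)) t =
    Num.sqrt (ip (y' - 2^-1 *: be (y t) y') (y' - 2^-1 *: be (y t) y')).
Proof.
move=> dy; rewrite /speed; set i := prefc A (psi (y t)).
have ix : chart_dom (achart i) (psi (y t)) := sm_prefc (lie_manifold lieG) _.
have [Li [P [bL bP PL sL iL]]] := transl_inv ix.
pose z s := bch be (- y t) (y (t + s)).
have [Kb Kb0 HK] := nf_bound nf.
have dz : dv z 0 (y' - 2^-1 *: be (y t) y').
  move=> e e0; have K0 : 0 < 1 + 2^-1 * (Kb * `|y t|) by rewrite ltr_pwDl// !mulr_ge0// ltW.
  have [d1 d10 H] := dy (e / (1 + 2^-1 * (Kb * `|y t|))) (divr_gt0 e0 K0).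
  exists d1 => // s sd; rewrite add0r /z addr0 (bchNl nf) subr0 (bch_divE nf).
  have -> : y (t + s) - y t - 2^-1 *: be (y t) (y (t + s) - y t) - s *: (y' - 2^-1 *: be (y t) y') =
      (y (t + s) - y t - s *: y') - 2^-1 *: be (y t) (y (t + s) - y t - s *: y').
    rewrite (nfBr nf _ (s *: y')) (nfZr nf) !scalerBr !scalerA [s * 2^-1]mulrC; zmodc.
  apply: le_trans (ler_normB _ _) _; rewrite normrZ ger0_norm ?invr_ge0//.
  set w := y (t + s) - y t - s *: y'.
  have hw : `|w| * (1 + 2^-1 * (Kb * `|y t|)) <= e * `|s|.
    have := H s sd; rewrite -/w mulrAC ler_pdivlMr//.
  by have := HK (y t) w; lra.
have z0 : z 0 = 0 by rewrite /z addr0 (bchNl nf).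
have sLz : sdiff (fun w => chart_to (achart i) (psi (y t) * psi w)%g) (z 0) Li by rewrite z0.
have := sdiff_dv bL sLz dz.
rewrite /comp => /(@dv_eq R _ _ (fun s => chart_to (achart i) (psi (y (t + s)))) 0).
have nE : \forall s \near (0 : R), chart_to (achart i) (psi (y t) * psi (z s))%g = chart_to (achart i) (psi (y (t + s))).
  by apply: (@nbhs0_normP R _ _ 1) => // s _; rewrite (md_mul md) /z (bchKr nf).
move=> /(_ nE).
move=> D; have /dv_derive[_ ->] := (dv_shift (fun s => chart_to (achart i) (psi (y s))) t _).2 D.
by rewrite iL.
Qed.
End metric.

(** * Short curves have small logarithms *)

(** The strict estimates at two nearby points [s] and [t] both apply to the pair [s], [s + q * v];
    hence the two derivatives are close. It shows that one-parameter segments are admissible curves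
    for the distance. *)
Lemma sdiff_Ck1 (R : realType) n (f : R -> 'rV[R]_n) (U : set R) : open U ->
  (forall t, U t -> exists2 L : R -> 'rV[R]_n, blin L & sdiff f t L) -> Ck_on 1 U f.
Proof.
move=> oU H; split=> [t Ut|v].
  have [L bL sL] := H t Ut; have [K [d [K0 d0 HK]]] := sdiff_lip bL sL.
  apply/cvgrPdist_le => e e0; near=> s.
  have sd : `|t - s| < d by near: s; apply: cvgr_dist_lt; [exact: cvg_id|].
  have se : `|t - s| <= e / K by near: s; apply: cvgr_dist_le; [exact: cvg_id|rewrite divr_gt0].
  rewrite distrC; apply: le_trans (HK t s _ _) _.
  - by rewrite subrr normr0.
  - by rewrite distrC.
  - by rewrite distrC mulrC -ler_pdivlMr.
have DE t L : blin L -> sdiff f t L -> derivable f t v /\ 'D_v f t = L v.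
  exact: sdiff_derive.
split=> [t Ut|]; first by have [L bL sL] := H t Ut; have [] := DE t L bL sL.
split => // t Ut; have [L bL sL] := H t Ut.
apply/cvgrPdist_le => e e0.
have v1 : 0 < 2 * (1 + `|v|) by rewrite mulr_gt0// ltr_pwDl.
have e1 : 0 < e / (2 * (1 + `|v|)) by exact: divr_gt0.
have [d d0 Hd] := sL _ e1.
have [_ ->] := DE t L bL sL.
have H2 s : U s -> `|t - s| < d / 2 -> `|L v - 'D_v f s| <= e.
  move=> Us sd; have [L' bL' sL'] := H s Us; have [_ ->] := DE s L' bL' sL'.
  have [d' d'0 Hd'] := sL' _ e1.
  pose q := Num.min d' (d / 2) / (2 * (1 + `|v|)).
  have m0 : 0 < Num.min d' (d / 2) by rewrite lt_min d'0 divr_gt0.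
  have q0 : 0 < q by rewrite divr_gt0.
  have qv : `|q * v| < Num.min d' (d / 2).
    rewrite normrM (gtr0_norm q0) /q mulrAC ltr_pdivrMr// ltr_pM2l//.
    by have := normr_ge0 v; lra.
  move: (qv); rewrite lt_min => /andP[qv1 qv2].
  have qs : s + q * v - s = q * v by ring.
  have A1 := Hd' s (s + q * v); rewrite subrr normr0 qs in A1.
  have A2 := Hd s (s + q * v); rewrite qs in A2.
  have {}A1 := A1 d'0 qv1.
  have {}A2 : `|f (s + q * v) - f s - L (q * v)| <= e / (2 * (1 + `|v|)) * `|q * v|.
    apply: A2; first by rewrite distrC; lra.
    have -> : s + q * v - t = q * v - (t - s) by ring.
    by apply: le_lt_trans (ler_normB _ _) _; lra.
  rewrite -(ler_pM2l q0) -{1}(gtr0_norm q0) -normrZ scalerBr.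
  have LZ (M : R -> 'rV[R]_n) : blin M -> q *: M v = M (q * v).
    by move=> bM; rewrite -(blinZ bM).
  rewrite (LZ L)// (LZ L')//.
  have -> : L (q * v) - L' (q * v) = (f (s + q * v) - f s - L' (q * v)) - (f (s + q * v) - f s - L (q * v)) by zmod.
  apply: le_trans (ler_normB _ _) _; apply: le_trans (lerD A1 A2) _.
  rewrite normrM (gtr0_norm q0) -mulrDr.
  have -> : e / (2 * (1 + `|v|)) * (q * `|v| + q * `|v|) = q * (e * (`|v| / (1 + `|v|))).
    by field; rewrite gt_eqF// ltr_pwDl.
  rewrite ler_pM2l// ler_piMr ?(ltW e0)// ler_pdivrMr ?ltr_pwDl//; lra.
near=> s; apply: H2; near: s; first exact: (open_nbhs_nbhs (conj oU Ut)).
by apply: cvgr_dist_lt; [exact: cvg_id|rewrite divr_gt0].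
Unshelve. all: by end_near. Qed.

Section log_lipschitz.
Variables (R : realType) (G : groupTopType) (N : nat) (psi : 'rV[R]_N -> G).
Variable be : 'rV[R]_N -> 'rV[R]_N -> 'rV[R]_N.
Hypothesis nf : nilform be.
Hypothesis psiM : forall x y, (psi x * psi y)%g = psi (bch be x y).
Hypothesis psi_inj : forall x y, psi x = psi y -> x = y.
Notation E := 'rV[R]_N.

Let psi0 : psi 0 = 1%g.
Proof. by apply: (mulgI (psi 0)); rewrite psiM (bch0 nf) mulg1. Qed.

(** A left-invariant notion of distance at most [a], which avoids taking coordinate differences far
    from the origin. *)
Definition close (x y : G) (a : R) := exists2 q : E, y = (x * psi q)%g & `|q| <= a.

Lemma close_le x y a a' : close x y a -> a <= a' -> close x y a'.
Proof. by move=> [q -> qa] aa; exists q => //; apply: le_trans aa. Qed.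

Lemma close_refl x a : 0 <= a -> close x x a.
Proof. by exists 0; rewrite ?psi0 ?mulg1// normr0. Qed.

Definition loglip (f : R -> G) (a b : R) := exists K d, [/\ 0 < K, 0 < d &
  forall s t, a <= s <= b -> a <= t <= b -> `|s - t| <= d -> close (f s) (f t) (K * `|s - t|)].

Definition loglip_at (f : R -> G) (t0 : R) := exists K d, [/\ 0 < K, 0 < d &
  forall s t, `|s - t0| < d -> `|t - t0| < d -> close (f s) (f t) (K * `|s - t|)].

(** One parameter [k] serves as the radius while [k^-1] serves as the Lipschitz constant; letting
    [k] tend to 0 then weakens both requirements, and compactness applies. *)
Lemma loglip_compact f a b : (forall t, a <= t <= b -> loglip_at f t) -> loglip f a b.
Proof.
move=> H.
pose P (k s : R) := forall t, `|s - t| <= k -> close (f s) (f t) (k^-1 * `|s - t|).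
have /compact_near_coveringP nc := @segment_compact R a b.
have : \forall k \near 0^'+, `[a, b]%classic `<=` P k.
  apply: nc => t0 t0ab; rewrite /= in_itv /= in t0ab.
  have [K [d [K0 d0 HK]]] := H t0 t0ab.
  near=> s k => /= t stk.
  have sd : `|t0 - s| < d / 2 by near: s; apply: cvgr_dist_lt; [exact: cvg_id|rewrite divr_gt0].
  have kd : k < d / 2 by near: k; apply: nbhs_right_lt; rewrite divr_gt0.
  have kK : k < K^-1 by near: k; apply: nbhs_right_lt; rewrite invr_gt0.
  have k0 : 0 < k by near: k; exact: nbhs_right_gt.
  apply: close_le (HK s t _ _) _.
  - by rewrite distrC; lra.
  - have -> : t - t0 = - (s - t) - (t0 - s) by ring.
    by apply: le_lt_trans (ler_normB _ _) _; rewrite normrN; lra.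
  - rewrite ler_wpM2r// -[K]invrK lef_pV2 ?posrE ?invr_gt0//; exact: ltW.
move=> nP; near (0 : R)^'+ => k.
have k0 : 0 < k by [].
exists k^-1, k; split; rewrite ?invr_gt0// => s t sab tab st.
have Pk : `[a, b]%classic `<=` P k by near: k.
by apply: Pk => //=; rewrite in_itv.
Unshelve. all: by end_near. Qed.

(** A bound on the group increment from [w s] to [w t] bounds [w s - w t] up to the factor
    [1 + Kb * |w s|]. The curve is first bounded by advancing in steps of length [d]; then the
    factor is constant and short steps are chained. *)
Lemma loglip_model f a b (y0 : E) (w : R -> E) : a <= b -> loglip f a b ->
  (forall t, a <= t <= b -> f t = (psi y0 * psi (w t))%g) ->
  exists K, 0 < K /\ forall s t, a <= s <= b -> a <= t <= b -> `|w s - w t| <= K * `|s - t|.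
Proof.
move=> ab [K [d [K0 d0 H]]] fw.
have [Kb Kb0 HB] := nf_bound nf.
have step s t : a <= s <= b -> a <= t <= b -> `|s - t| <= d ->
    `|w s - w t| <= K * (1 + Kb * `|w s|) * `|s - t|.
  move=> sab tab st; have [q fq qK] := H s t sab tab st.
  have : w t = bch be (w s) q.
    apply: psi_inj; apply: (mulgI (psi y0)); rewrite -fw// fq -psiM fw// -mulgA//.
  rewrite /bch => ->.
  have -> : w s - (w s + q + 2^-1 *: be (w s) q) = - (q + 2^-1 *: be (w s) q) by zmod.
  rewrite normrN; apply: le_trans (ler_normD _ _) _; rewrite normrZ ger0_norm ?invr_ge0//.
  have := HB (w s) q; have := ler_wpM2l (mulr_ge0 (ltW Kb0) (normr_ge0 (w s))) qK.
  have := normr_ge0 q; have := mulr_ge0 (ltW Kb0) (normr_ge0 (w s)); nra.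
have bnd n : exists M, forall t, a <= t <= b -> t <= a + n%:R * d -> `|w t| <= M.
  elim: n => [|n [M HM]].
    exists `|w a| => t /andP[at_ _]; rewrite mul0r addr0 => ta.
    by have -> : t = a by apply/eqP; rewrite eq_le at_ ta.
  exists (M + K * (1 + Kb * M) * d) => t tab tn.
  have M0 : 0 <= M.
    apply: le_trans (HM a _ _); rewrite ?lexx ?ab//.
    by rewrite lerDl mulr_ge0// ltW.
  have KM : 0 <= K * (1 + Kb * M) * d.
    by apply: mulr_ge0 (ltW d0); apply: mulr_ge0; [exact: ltW|rewrite addr_ge0// mulr_ge0// ltW].
  have [tn'|tn'] := leP t (a + n%:R * d).
    by apply: le_trans (HM t tab tn') _; rewrite lerDl.
  have /andP[t1 t2] := tab.
  pose s := Num.max a (t - d).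
  have sab : a <= s <= b.
    by rewrite le_max lexx /= ge_max ab /=; have := ltW d0; lra.
  have std : `|s - t| <= d.
    by rewrite /s; case: (leP a (t - d)) => h; [rewrite ler_norml|rewrite ler_norml]; apply/andP; split; lra.
  have sn : s <= a + n%:R * d.
    rewrite ge_max lerDl mulr_ge0 ?(ltW d0)//=; move: tn; rewrite -natr1; lra.
  have ws := HM s sab sn; have h := step s t sab tab std.
  rewrite -[w t](subKr (w s)); apply: le_trans (ler_normB _ _) _; apply: lerD => //; apply: le_trans h _.
  apply: ler_pM => //; first by apply: mulr_ge0; [exact: ltW|rewrite addr_ge0// mulr_ge0// ltW].
  by rewrite ler_pM2l// lerD2l ler_pM2l.
have [M HM] : exists M, forall t, a <= t <= b -> `|w t| <= M.
  have [M HM] := bnd (Num.truncn ((b - a) / d)).+1; exists M => t tab; apply: HM => //.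
  have := truncnS_gt ((b - a) / d); rewrite ltr_pdivrMr//.
  by case/andP: tab; lra.
have M0 : 0 <= M by apply: le_trans (HM a _); rewrite ?lexx.
pose K' := K * (1 + Kb * M).
have K'0 : 0 < K' by rewrite mulr_gt0// ltr_pwDl// mulr_ge0// ltW.
exists K'; split => //.
have step' s t : a <= s <= b -> a <= t <= b -> `|s - t| <= d -> `|w s - w t| <= K' * `|s - t|.
  move=> sab tab st; apply: le_trans (step s t sab tab st) _.
  by rewrite ler_wpM2r// ler_pM2l// lerD2l ler_pM2l// HM.
have chain n : forall s t, a <= s <= b -> a <= t <= b -> s <= t -> t <= s + n%:R * d -> `|w s - w t| <= K' * (t - s).
  elim: n => [|n IH] s t sab tab st tn.
    have -> : s = t by apply/eqP; rewrite eq_le st; move: tn; rewrite mul0r addr0.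
    by rewrite !subrr normr0 mulr0.
  pose u := Num.min t (s + d).
  have /andP[s1 s2] := sab; have /andP[t1 t2] := tab.
  have su : s <= u by rewrite le_min st lerDl ltW.
  have ut : u <= t by rewrite ge_min lexx.
  have uab : a <= u <= b by lra.
  have us : `|s - u| <= d.
    rewrite distrC ger0_norm ?subr_ge0// lerBlDr addrC /u ge_min lexx orbT//.
  have un : t <= u + n%:R * d.
    by rewrite /u; case: (leP t (s + d)) => h; [rewrite lerDl mulr_ge0// ltW|move: tn; rewrite -natr1; lra].
  have h1 := IH u t uab tab ut un; have := step' s u sab uab us.
  rewrite distrC [in leRHS]distrC (ger0_norm (_ : 0 <= u - s)) ?subr_ge0// distrC => h2.
  have -> : w s - w t = (w s - w u) + (w u - w t) by zmod.
  by apply: le_trans (ler_normD _ _) _; lra.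
have all_ s t : a <= s <= b -> a <= t <= b -> s <= t -> `|w s - w t| <= K' * (t - s).
  move=> sab tab st; apply: (chain (Num.truncn ((t - s) / d)).+1) => //.
  by have := truncnS_gt ((t - s) / d); rewrite ltr_pdivrMr//; lra.
move=> s t sab tab; have [st|/ltW ts] := leP s t.
  by rewrite [X in K' * X]distrC ger0_norm ?subr_ge0//; exact: all_.
by rewrite distrC ger0_norm ?subr_ge0//; exact: all_.
Qed.
End log_lipschitz.

Lemma bch_vel (R : realType) (V : lmodType R) (b : V -> V -> V) (nf : nilform b) (x w u : V) :
  u + 2^-1 *: b x u - 2^-1 *: b (bch b x w) (u + 2^-1 *: b x u) = u - 2^-1 *: b w u.
Proof.
rewrite (nfDr nf) (nfZr nf) (nf_nilr nf) scaler0 addr0 /bch 2!(nfDl nf) (nfZl nf) (nf_nil nf) scaler0 addr0.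
by rewrite scalerDr; zmodc.
Qed.

Lemma dv_ext (R : realType) (W : normedModType R) (f g : R -> W) t u :
  (forall s, f s = g s) -> dv f t u -> dv g t u.
Proof. by move=> fg df e e0; have [d d0 H] := df e e0; exists d => // s sd; rewrite -!fg; exact: H. Qed.

Lemma dvZ (R : realType) (W : normedModType R) (f : R -> W) t u a :
  dv f t u -> dv (fun s => a *: f s) t (a *: u).
Proof.
move=> df e e0; have a1 : 0 < 1 + `|a| by rewrite ltr_pwDl.
have [d d0 H] := df _ (divr_gt0 e0 a1); exists d => // s sd.
have -> : a *: f (t + s) - a *: f t - s *: (a *: u) = a *: (f (t + s) - f t - s *: u).
  by rewrite !scalerBr !scalerA [s * a]mulrC.
rewrite normrZ; have := H s sd; rewrite mulrAC ler_pdivlMr//.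
by have := normr_ge0 (f (t + s) - f t - s *: u); lra.
Qed.

(** * Comparison of the Riemannian distance with the coordinates *)

Section riemannian_distance.
Variables (R : realType) (G : groupTopType) (m : nat) (A : atlas G 'rV[R]_m).
Hypothesis lieG : lie_group A.
Variables (N : nat) (be : 'rV[R]_N -> 'rV[R]_N -> 'rV[R]_N) (psi : 'rV[R]_N -> G).
Variables (L : 'rV[R]_N -> 'rV[R]_m) (c d : R).
Hypothesis md : model A be psi L c d.
Variable h : metric A.
Hypotheses (riem_h : riemannian h) (linv_h : left_invariant h).
Notation E := 'rV[R]_N.
Notation leb := (@lebesgue_measure R).
Let nf := md_nf md.
Let psiM := md_mul md.
Let psi0 := md_psi0 md.
Notation close := (close psi).
Notation loglip := (loglip psi).

Lemma speed_ge0 gam t : 0 <= speed h gam t.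
Proof. exact: sqrtr_ge0. Qed.

(** In coordinates centred at the start of the curve, [|w'|] is at most a multiple of the speed
    times [1 + Kb * |w| / 2]. For short curves this linear growth can be absorbed, which leaves a
    bound proportional to the length. *)
Lemma curve_bound : exists Cc ec : R, [/\ 0 < Cc, 0 < ec & forall (gam : R -> G) (a b l : R),
  a <= b -> loglip gam a b -> (\int[leb]_(t in `]a, b[) (speed h gam t)%:E <= l%:E)%E -> l <= ec ->
  close (gam a) (gam b) (Cc * l)].
Proof.
have [cl cl0 low] := ip_lower lieG md riem_h.
have [Kb Kb0 HB] := nf_bound nf.
pose C := (Num.sqrt cl)^-1; have C0 : 0 < C by rewrite invr_gt0 sqrtr_gt0.
exists (2 * C), ((C * Kb)^-1); split; [exact: mulr_gt0|by rewrite invr_gt0 mulr_gt0|].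
move=> gam a b l ab ll lenl lec.
have l0 : 0 <= l.
  rewrite -lee_fin; apply: le_trans lenl; apply: integral_ge0 => t _.
  by rewrite lee_fin speed_ge0.
have [y0 y0E] := md_surj md (gam a).
have /choice[w wP] : forall t, exists z, gam t = (psi y0 * psi z)%g.
  by move=> t; have [z zE] := md_surj md ((psi y0)^-1 * gam t)%g; exists z; rewrite zE mulgA mulgV mul1g.
move: ab; rewrite le_eqVlt => /orP[/eqP<-|ab].
  by apply: (close_refl nf psiM); rewrite !mulr_ge0// ltW.
have [K [K0 HK]] := @loglip_model R G N psi be nf psiM (md_inj md) gam a b y0 w (ltW ab) ll (fun t _ => wP t).
have w0 : w a = 0.
  apply: (md_inj md); rewrite psi0; apply: (mulgI (psi y0)).
  by rewrite -wP mulg1.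
have w_speed t w' : dv w t w' -> `|w'| <= C * speed h gam t * (1 + 2^-1 * Kb * `|w t|).
  move=> dw; pose y t := bch be y0 (w t).
  have dy : dv y t (w' + 2^-1 *: be y0 w').
    move=> e e0; have K1 : 0 < 1 + Kb * `|y0| by rewrite ltr_pwDl// mulr_ge0// ltW.
    have [d1 d10 H] := dw _ (divr_gt0 e0 K1); exists d1 => // s sd.
    have -> : y (t + s) - y t - s *: (w' + 2^-1 *: be y0 w') =
        (w (t + s) - w t - s *: w') + 2^-1 *: be y0 (w (t + s) - w t - s *: w').
      rewrite /y /bch !(nfBr nf) (nfZr nf) !scalerBr !scalerDr !scalerA [s * 2^-1]mulrC; zmodc.
    apply: le_trans (ler_normD _ _) _; rewrite normrZ ger0_norm ?invr_ge0//.
    have := H s sd; rewrite mulrAC ler_pdivlMr//; set q := _ - _ - _ => hq.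
    by have := HB y0 q; have := mulr_ge0 (mulr_ge0 (ltW Kb0) (normr_ge0 y0)) (normr_ge0 q); lra.
  have := speed_dv lieG md riem_h linv_h dy.
  have -> : (fun s => psi (y s)) = gam by apply/funext => s; rewrite /y -psiM -wP.
  set xi := _ - _.
  have xE : xi = w' - 2^-1 *: be (w t) w'.
    by rewrite /xi /y (bch_vel nf).
  have wE : w' = xi + 2^-1 *: be (w t) xi.
    by rewrite xE (nfBr nf) (nfZr nf) (nf_nilr nf) scaler0 subr0 subrK.
  move=> spE.
  have xs : `|xi| <= C * speed h gam t.
    rewrite spE /C -ler_pdivrMl ?invr_gt0 ?sqrtr_gt0// invrK.
    rewrite -[`|xi|]ger0_norm// -sqrtr_sqr -sqrtrM ?(ltW cl0)// ler_wsqrtr//.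
  rewrite wE; apply: le_trans (ler_normD _ _) _; rewrite normrZ ger0_norm ?invr_ge0//.
  have := HB (w t) xi; rewrite mulrDr mulr1.
  have := ler_wpM2r (mulr_ge0 (ltW Kb0) (normr_ge0 (w t))) xs.
  by move: xs; lra.
have [M0 HM0] : exists M, forall t, a <= t <= b -> `|w t| <= M.
  exists (K * (b - a)) => t tab; have := HK a t; rewrite lexx (ltW ab) => /(_ isT tab).
  rewrite w0 sub0r normrN => h'; apply: le_trans h' _; rewrite ler_pM2l//.
  by case/andP: tab => *; rewrite distrC ger0_norm; lra.
have M00 : 0 <= M0 by apply: le_trans (HM0 a _); rewrite ?lexx ?(ltW ab).
have impr M : 0 <= M -> (forall t, a <= t <= b -> `|w t| <= M) ->
    forall t, a <= t <= b -> `|w t| <= C * l * (1 + 2^-1 * Kb * M).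
  move=> M1 HM t /andP[at_ tb].
  have KM : 0 < 1 + 2^-1 * Kb * M by rewrite ltr_pwDl// !mulr_ge0// ltW.
  have B0 : 0 <= C * l * (1 + 2^-1 * Kb * M) by rewrite !mulr_ge0// ltW.
  move: at_; rewrite le_eqVlt => /orP[/eqP<-|at_]; first by rewrite w0 normr0.
  apply/mx_norm_leP => // i j; rewrite ord1.
  (* Dividing [w] by [D] makes its derivative bounded by the speed itself, so that no factor has to
     be moved through the integral of a function of unknown measurability. *)
  pose D := C * (1 + 2^-1 * Kb * M); have D0 : 0 < D by rewrite mulr_gt0.
  pose v x := D^-1 *: w x.
  have vw x : w x = D *: v x by rewrite /v scalerA divff ?gt_eqF// scale1r.
  have lipj k x y : a <= x <= t -> a <= y <= t -> `|v x 0 k - v y 0 k| <= (D^-1 * K) * `|x - y|.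
    move=> /andP[x1 x2] /andP[y1 y2].
    apply: (@le_trans _ _ (D^-1 * `|w x - w y|)); last first.
      by rewrite -mulrA ler_pM2l ?invr_gt0//; apply: HK; rewrite ?x1 ?y1 /=; [exact: le_trans x2 tb|exact: le_trans y2 tb].
    have := mx_entry_le (v x - v y) 0 k; rewrite -scalerBr normrZ gtr0_norm ?invr_gt0//.
    by rewrite !mxE -mulrBr.
  (* The sets are indexed by natural numbers in order to form a countable union; indices that are
     not coordinates give the empty set. *)
  pose N0 k := [set x | exists2 i : 'I_N, val i = k & a < x < t /\ ~ derivable (fun s => v s 0 i) x 1].
  pose N1 := \bigcup_k N0 k.
  have nN1 : leb.-negligible N1.
    apply: negligible_bigcup => k; have [kN|kN] := ltnP k N.
      apply: negligibleS (lipschitz_ae_derivable at_ (lipj (Ordinal kN))) => x /= [i0 ik hx].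
      by have <- : i0 = Ordinal kN by apply: val_inj.
    have -> : N0 k = set0 by apply/seteqP; split => // x [i0 ik _]; move: (ltn_ord i0); rewrite ik ltnNge kN.
    exact: negligible_set0.
  have hs x : a < x < t -> ~ N1 x -> derivable (fun s => v s 0 j) x 1 -> `|'D_1 (fun s => v s 0 j) x| <= speed h gam x.
    move=> axt nx _.
    pose v' : E := \row_k 'D_1 (fun s => v s 0 k) x.
    have dw : dv v x v'.
      apply/dv_mxP => i0 k; rewrite ord1 mxE; apply/dv_derive; split => //.
      by apply: contrapT => nd; apply: nx; exists (val k) => //; exists k.
    have dw' : dv w x (D *: v').
      exact: (dv_ext (fun s => esym (vw s)) (dvZ D dw)).
    have -> : 'D_1 (fun s => v s 0 j) x = v' 0 j by rewrite mxE.
    apply: le_trans (mx_entry_le _ _ _) _; have := w_speed x _ dw'.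
    rewrite normrZ (gtr0_norm D0) => h1; rewrite -(ler_pM2l D0); apply: le_trans h1 _.
    rewrite /D mulrAC ler_wpM2r ?speed_ge0// ler_pM2l// lerD2l.
    rewrite ler_wpM2l ?mulr_ge0 ?(ltW Kb0)//; apply: HM.
    by case/andP: axt => x1 x2; rewrite (ltW x1) (le_trans (ltW x2)).
  have := @lipschitz_ftc_le R (fun s => v s 0 j) (D^-1 * K) a t (speed h gam) N1 at_ (lipj j) nN1 hs (speed_ge0 gam).
  have -> : v a 0 j = 0 by rewrite /v w0 scaler0 mxE.
  rewrite subr0 => H1.
  have -> : C * l * (1 + 2^-1 * Kb * M) = D * l by rewrite /D; ring.
  rewrite vw mxE normrM (gtr0_norm D0) ler_pM2l// -lee_fin.
  apply: le_trans H1 _; apply: le_trans lenl.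
  rewrite [leLHS]integral_mkcond [leRHS]integral_mkcond.
  apply: le_integral_nonmeas => x _.
    by rewrite /patch; case: ifP => // _; rewrite lee_fin speed_ge0.
  rewrite /patch; case: ifPn => [|_].
    move=> /set_mem; rewrite /= in_itv /= => /andP[ax xt].
    by rewrite ifT// inE /= in_itv /= ax (lt_le_trans xt).
  by case: ifP => // _; rewrite lee_fin speed_ge0.
(* A bound [M] improves to [C * l + (C * l * Kb) * M / 2], and [C * l * Kb <= 1]; so the excess over
   [2 * C * l] is halved at each round. *)
have C2 n t : a <= t <= b -> `|w t| <= 2 * (C * l) + M0 / 2 ^+ n.
  elim: n t => [|n IH] t tab.
    rewrite expr0 divr1; by apply: le_trans (HM0 t tab) _; rewrite lerDr !mulr_ge0 ?(ltW C0).
  have M1 : 0 <= 2 * (C * l) + M0 / 2 ^+ n.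
    by rewrite addr_ge0 ?divr_ge0 ?exprn_ge0// !mulr_ge0// ltW.
  apply: le_trans (impr _ M1 IH t tab) _.
  have CK : C * l * Kb <= 1.
    have : l * (C * Kb) <= 1 by rewrite -ler_pdivlMr ?mulr_gt0// mul1r.
    by have -> : C * l * Kb = l * (C * Kb) by ring.
  have -> : M0 / 2 ^+ n.+1 = 2^-1 * (M0 / 2 ^+ n) by rewrite exprS; field; rewrite expf_neq0.
  have := ler_wpM2r M1 CK; lra.
have wb : `|w b| <= 2 * (C * l).
  rewrite -subr_le0; apply: (@geo_le0 _ _ M0) => n.
  by rewrite lerBlDl; apply: C2; rewrite lexx ltW.
exists (w b); last by rewrite -mulrA.
by rewrite wP (wP a) w0 psi0 mulg1.
Qed.

Lemma psi_cont (x : G) (z : E) : continuous (fun t : R => (x * psi (t *: z))%g).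
Proof.
have cont0 (W : set G) : nbhs (1%g : G) W -> exists2 d1 : R, 0 < d1 & forall z, `|z| < d1 -> W (psi z).
  move=> /(lie_e_cont lieG)[d1 d10 H].
  have [K [d2 [K0 d20 HK]]] := sdiff_lip (md_blin md) (md_sdiff md).
  have [_ _ ofto _ _] := sm_chart (lie_manifold lieG) (prefc A 1%g).
  exists (Num.min (Num.min d d2) (d1 / K)); first by rewrite !lt_min (md_d md) d20 divr_gt0.
  move=> w; rewrite !lt_min ltr_pdivlMr// => /andP[/andP[w1 w2] w3].
  have -> : psi w = lie_e A (lie_lg A (psi w)).
    by rewrite /lie_e /lie_lg subrK ofto//; exact: (md_dom md).
  apply: H; have := HK 0 w; rewrite !subr0 normr0 => /(_ d20 w2).
  have -> : lie_lg A (psi 0) = 0 by rewrite psi0 /lie_lg subrr.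
  by rewrite subr0 => h'; apply: le_lt_trans h' _; rewrite mulrC.
move=> t W Wt.
have := @lie_mul_cont R G m A lieG ((x * psi (t *: z))%g, 1%g) W.
rewrite /= mulg1 => /(_ Wt)[[Wa Wb] /= [Wa1 Wb1] WW].
have [d1 d10 H] := cont0 _ Wb1.
apply/nbhs_ballP; exists (d1 / (1 + `|z|)); first by rewrite /= divr_gt0// ltr_pwDl.
move=> s; rewrite /ball /= ltr_pdivlMr ?ltr_pwDl// => ts /=.
have -> : (x * psi (s *: z) = x * psi (t *: z) * psi ((s - t) *: z))%g.
  by rewrite -mulgA psiM (bchZ nf) addrC subrK.
apply: (WW (_, _)); split => /=; first exact: nbhs_singleton.
apply: H; rewrite normrZ distrC; apply: le_lt_trans ts.
by rewrite ler_wpM2l// lerDr.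
Qed.

(** The competitor is [t |-> x * psi (t *: z)], whose left-invariant velocity is constantly [z]. *)
Lemma riem_dist_le : exists2 Cd : R, 0 < Cd & forall x y a, close x y a -> (riem_dist h x y <= (Cd * a)%:E)%E.
Proof.
have [Ci Ci0 HC] := ip_bound md h.
exists (Num.sqrt Ci); first by rewrite sqrtr_gt0.
move=> x _ a [z -> za].
apply: (@le_trans _ _ (curve_length h 0 1 (fun t => (x * psi (t *: z))%g))).
  apply: ereal_inf_lbound; exists (fun t => (x * psi (t *: z))%g); split => //.
  - split; first exact: psi_cont.
    move=> i; apply: sdiff_Ck1.
      have [domo _ _ _ _] := sm_chart (lie_manifold lieG) i.
      by apply: open_comp domo => t0 _; exact: psi_cont.
    move=> t dt; have [Li [bL sL _]] := transl lieG md linv_h dt.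
    have bz : blin (fun s : R => s *: z).
      split=> [e u v|]; first by rewrite scalerDl scalerA.
      by exists (1 + `|z|); rewrite ?ltr_pwDl// => s; rewrite normrZ mulrC ler_wpM2r// lerDr.
    exists (fun s : R => Li (s *: z)); first exact: (blin_comp bL bz).
    move=> e e0; have e1 : 0 < e / (1 + `|z|) by rewrite divr_gt0// ltr_pwDl.
    have [d1 d10 H] := sL _ e1; exists (d1 / (1 + `|z|)); first by rewrite divr_gt0// ltr_pwDl.
    move=> u v; rewrite !ltr_pdivlMr ?ltr_pwDl// => ut vt.
    have sm s : `|s - t| * (1 + `|z|) < d1 -> `|(s - t) *: z - 0| < d1.
      by move=> h1; rewrite subr0 normrZ; apply: le_lt_trans h1; rewrite ler_wpM2l// lerDr.
    have := H ((u - t) *: z) ((v - t) *: z) (sm u ut) (sm v vt).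
    have E1 s : ((x * psi (t *: z)) * psi ((s - t) *: z) = x * psi (s *: z))%g.
      by rewrite -mulgA psiM (bchZ nf) addrC subrK.
    rewrite !E1 -scalerBl; have -> : v - t - (u - t) = v - u by ring.
    move=> h1; apply: le_trans h1 _; rewrite normrZ mulrAC ler_pdivrMr ?ltr_pwDl//.
    by rewrite -mulrA ler_pM2l// ler_wpM2l// lerDr.
  - by rewrite scale0r psi0 mulg1.
  - by rewrite scale1r.
have sp t : speed h (fun t => (x * psi (t *: z))%g) t = Num.sqrt (ip L h z z).
  have [y0 y0E] := md_surj md x.
  have dy : dv (fun t => bch be y0 (t *: z)) t (z + 2^-1 *: be y0 z).
    move=> e e0; exists 1 => // s _; rewrite /bch !(nfZr nf) !scalerDl !scalerDr !scalerA.
    rewrite (_ : _ - _ - _ = 0) ?normr0 ?mulr_ge0 ?(ltW e0)//.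
    by rewrite [s * 2^-1]mulrC; zmodc.
  have := speed_dv lieG md riem_h linv_h dy.
  have -> : (fun s => psi (bch be y0 (s *: z))) = (fun t => (x * psi (t *: z))%g).
    by apply/funext => s; rewrite -psiM y0E.
  by move=> ->; rewrite (bch_vel nf) (nfZl nf) (nfxx nf) !scaler0 subr0.
rewrite /curve_length; under eq_integral do rewrite sp.
rewrite integral_cst; last exact: measurable_itv.
have z0 : 0 <= `|z| := normr_ge0 z.
have le1 : Num.sqrt (ip L h z z) <= Num.sqrt Ci * a.
  apply: (@le_trans _ _ (Num.sqrt Ci * `|z|)); last by rewrite ler_pM2l ?sqrtr_gt0.
  rewrite -[`|z|]ger0_norm// -sqrtr_sqr -sqrtrM ?(ltW Ci0)// ler_wsqrtr//.
  by apply: le_trans (ler_norm _) _; apply: le_trans (HC _ _) _; rewrite expr2 mulrA.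
change ((Num.sqrt (ip L h z z))%:E * leb `[0%R, 1%R]%classic <= (Num.sqrt Ci * a)%:E)%E.
by rewrite lebesgue_measure_itv /= lte_fin ltr01 oppr0 adde0 mule1 lee_fin.
Qed.

Lemma close_of_diff : exists2 Kb : R, 0 < Kb & forall x z z', close (x * psi z)%g (x * psi z')%g ((1 + Kb * `|z|) * `|z' - z|).
Proof.
have [Kb Kb0 HB] := nf_bound nf; exists Kb => // x z z'.
exists (bch be (- z) z'); first by rewrite -mulgA psiM (bchKr nf).
rewrite (bch_divE nf); apply: le_trans (ler_normB _ _) _; rewrite normrZ ger0_norm ?invr_ge0//.
have := HB z (z' - z); have := normr_ge0 (be z (z' - z)).
rewrite mulrDl mul1r; lra.
Qed.

Lemma nbhs_close x (a : R) : 0 < a -> nbhs x [set y | exists2 z, y = (x * psi z)%g & `|z| < a].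
Proof.
move=> a0; have := @lie_mul_cont R G m A lieG ((x^-1)%g, x) _.
rewrite /= mulVg => /(_ _ (md_nbhs md a0))[[Wa Wb] /= [Wa1 Wb1] WW].
apply: filterS Wb1 => y Wy; have [] := WW ((x^-1)%g, y); first by split => //=; exact: nbhs_singleton.
by move=> z za /= zE; exists z => //; rewrite zE mulgA mulgV mul1g.
Qed.

Lemma R_frame : frame (fun _ : unit => (1 : R)) (fun _ v => v).
Proof.
split=> [v|_ v|_|_ a u v] //; last by rewrite normr1.
by rewrite (bigD1 tt) //= big1 ?addr0; [rewrite /GRing.scale /= mulr1|case].
Qed.

(** The chart coordinates of the curve are Lipschitz. The error of the strict derivative of the
    translated coordinates is taken as [(2 * Kp)^-1], so that after applying the left inverse [P] it
    is absorbed by half of the left side. *)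
Lemma C1_loglip gam : C1_curve A gam -> forall t0, loglip_at psi gam t0.
Proof.
move=> [cg Cg] t0; pose i := prefc A (gam t0).
have ix : chart_dom (achart i) (gam t0) := sm_prefc (lie_manifold lieG) _.
have [domo _ _ _ _] := sm_chart (lie_manifold lieG) i.
have [Li [P [bL bP PL sL iL]]] := transl_inv lieG md riem_h linv_h ix.
have [Kp Kp0 HP] := bP.2.
have e0 : 0 < (2 * Kp)^-1 by rewrite invr_gt0 mulr_gt0.
have [d1 d10 H1] := sL _ e0.
have oU : open (gam @^-1` chart_dom (achart i)) by apply: open_comp domo => t _; exact: cg.
have [M [bM sM _]] := Ck1_sdiff R_frame oU ix (Cg i).
have [Kf [d2 [Kf0 d20 H2]]] := sdiff_lip bM sM.
have [Kb Kb0 HB] := close_of_diff.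
have : nbhs t0 (gam @^-1` [set y | exists2 z, y = (gam t0 * psi z)%g & `|z| < d1]).
  by apply: cg; exact: nbhs_close.
move=> /nbhs_ballP[d3 /= d30 H3].
exists ((1 + Kb * d1) * (2 * Kp * Kf)), (Num.min d2 d3); split.
- by rewrite !mulr_gt0// ltr_pwDl// mulr_ge0// ltW.
- by rewrite lt_min d20.
move=> s t; rewrite !lt_min => /andP[s2 s3] /andP[t2 t3].
have [zs Es ns] : exists2 z, gam s = (gam t0 * psi z)%g & `|z| < d1 by apply: H3; rewrite /ball /= distrC.
have [zt Et nt] : exists2 z, gam t = (gam t0 * psi z)%g & `|z| < d1 by apply: H3; rewrite /ball /= distrC.
have := H2 s t s2 t2; rewrite Es Et => h2.
have := H1 zs zt; rewrite !subr0 => /(_ ns nt) h1.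
apply: (close_le (HB _ _ _)).
have key : `|zt - zs| <= 2 * Kp * Kf * `|s - t|.
  have h3 := HP (Li (zt - zs)); rewrite PL in h3.
  have h4 : `|Li (zt - zs)| <= Kf * `|t - s| + (2 * Kp)^-1 * `|zt - zs|.
    set u := Li _ in h1 *; rewrite -[u](subKr (chart_to (achart i) (gam t0 * psi zt)%g - chart_to (achart i) (gam t0 * psi zs)%g)).
    by apply: le_trans (ler_normB _ _) _; exact: lerD.
  have := ler_wpM2l (ltW Kp0) h4; rewrite mulrDr.
  have -> : Kp * ((2 * Kp)^-1 * `|zt - zs|) = 2^-1 * `|zt - zs| by field; rewrite gt_eqF.
  by rewrite [`|s - t|]distrC; move: h3; lra.
rewrite -[leRHS]mulrA; apply: ler_pM => //; first by rewrite addr_ge0// mulr_ge0// ltW.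
by rewrite lerD2l ler_pM2l// ltW.
Qed.

(** The distance is an infimum, so a curve slightly longer than [rho] is used. Its endpoint
    coordinate [q] does not depend on the curve, because [psi] is injective; the slack can therefore
    tend to 0. *)
Lemma riem_close : exists Cs es : R, [/\ 0 < Cs, 0 < es & forall x y rho,
  (riem_dist h x y <= rho%:E)%E -> rho < es -> close x y (Cs * rho)].
Proof.
have [Cc [ec [Cc0 ec0 H]]] := curve_bound.
exists Cc, ec; split => // x y rho xy rhoe.
have [q qE] := md_surj md (x^-1 * y)%g.
have yE : y = (x * psi q)%g by rewrite qE mulgA mulgV mul1g.
exists q => //; apply/ler_addgt0Pl => e e0.
pose rho' := rho + Num.min (ec - rho) (e / Cc).
have m0 : 0 < Num.min (ec - rho) (e / Cc) by rewrite lt_min subr_gt0 rhoe divr_gt0.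
have : (riem_dist h x y < rho'%:E)%E by apply: le_lt_trans xy _; rewrite lte_fin /rho'; lra.
move=> /ereal_inf_lt[_ [gam [Cg g0 g1 ->]] /ltW lg].
have lg' : (\int[leb]_(t in `]0%R, 1%R[) (speed h gam t)%:E <= rho'%:E)%E.
  apply: le_trans lg; rewrite /curve_length [leLHS]integral_mkcond [leRHS]integral_mkcond.
  apply: le_integral_nonmeas => t _.
    by rewrite /patch; case: ifP => // _; rewrite lee_fin speed_ge0.
  rewrite /patch; case: ifPn => [|_]; last by case: ifP => // _; rewrite lee_fin speed_ge0.
  by move=> /set_mem; rewrite /= in_itv /= => /andP[t0 t1]; rewrite ifT// inE /= in_itv /= !ltW.
have [|q' q'E nq'] := H gam 0 1 rho' ler01 (loglip_compact (fun t _ => C1_loglip Cg t)) lg'.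
  have : Num.min (ec - rho) (e / Cc) <= ec - rho by rewrite ge_min lexx.
  by rewrite /rho'; lra.
have -> : q = q'.
  by apply: (md_inj md); apply: (mulgI x); rewrite -yE -g1 q'E g0.
apply: le_trans nq' _; rewrite /rho' mulrDr addrC lerD2r mulrC -ler_pdivlMr//.
by rewrite ge_min lexx orbT.
Qed.

Lemma circle_close (f : R * R -> G) : riem_lipschitz h (@circle R) f ->
  exists K dl, [/\ 0 < K, 0 < dl & forall p q, circle p -> circle q -> plane_dist p q < dl ->
    close (f p) (f q) (K * plane_dist p q)].
Proof.
move=> [Kf HK]; have [Cs [es [Cs0 es0 H]]] := riem_close.
have K1 : 0 < 1 + `|Kf| by rewrite ltr_pwDl.
exists (Cs * (1 + `|Kf|)), (es / (1 + `|Kf|)); split; [exact: mulr_gt0|exact: divr_gt0|].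
move=> p q cp cq; rewrite ltr_pdivlMr// => pq.
have d0 : 0 <= plane_dist p q by exact: sqrtr_ge0.
rewrite -mulrA; apply: H; last by rewrite mulrC.
apply: le_trans (HK p q cp cq) _; rewrite lee_fin ler_wpM2r//.
by apply: le_trans (ler_norm _) _; rewrite lerDr.
Qed.
End riemannian_distance.

(** * Lipschitz estimates on the unit circle *)

Section circle.
Variable R : realType.

Lemma sin_lip (s t : R) : `|sin s - sin t| <= `|s - t|.
Proof.
wlog st : s t / t <= s.
  by move=> H; have [/H//|/ltW/H] := leP t s; rewrite distrC [leRHS]distrC.
have := @mvt_scalar R sin cos 0 1 t s st; rewrite mulr0 subr0 mul1r (ger0_norm (_ : 0 <= s - t)) ?subr_ge0//.
apply=> u _; first by apply/dv_derive; split; [exact: ex_derive|exact: derive_val].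
by rewrite subr0 ler_norml cos_geN1 cos_le1.
Qed.

Lemma cos_lip (s t : R) : `|cos s - cos t| <= `|s - t|.
Proof.
wlog st : s t / t <= s.
  by move=> H; have [/H//|/ltW/H] := leP t s; rewrite distrC [leRHS]distrC.
have := @mvt_scalar R cos (fun x => - sin x) 0 1 t s st; rewrite mulr0 subr0 mul1r (ger0_norm (_ : 0 <= s - t)) ?subr_ge0//.
apply=> u _; first by apply/dv_derive; split; [exact: ex_derive|exact: derive_val].
by rewrite subr0 normrN ler_norml sin_geN1 sin_le1.
Qed.

Lemma plane_dist_le (p q : R * R) : plane_dist p q <= `|p.1 - q.1| + `|p.2 - q.2|.
Proof.
rewrite /plane_dist -[leRHS]ger0_norm ?addr_ge0// -sqrtr_sqr ler_wsqrtr//.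
rewrite [leRHS]sqrrD !real_normK ?num_real// addrAC lerDl.
by rewrite mulrn_wge0// mulr_ge0.
Qed.

Lemma plane_dist_ge (p q : R * R) : `|p.1 - q.1| <= plane_dist p q /\ `|p.2 - q.2| <= plane_dist p q.
Proof.
by rewrite /plane_dist -!sqrtr_sqr; split; apply: ler_wsqrtr; rewrite ?lerDl ?lerDr sqr_ge0.
Qed.

Definition circ (t : R) : R * R := (cos t, sin t).

Lemma circ_circle t : circle (circ t).
Proof. by rewrite /circle /= cos2Dsin2. Qed.

Lemma circ_lip s t : plane_dist (circ s) (circ t) <= 2 * `|s - t|.
Proof. by apply: le_trans (plane_dist_le _ _) _; have := sin_lip s t; have := cos_lip s t; rewrite /=; lra. Qed.
End circle.

(** * Commutators in commuting copies *)

Section central_commutators.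
Variables (H : groupType) (F : numFieldType) (I : Type) (V : lmodType F) (Z : zmodType).
Variables (B : V -> V -> Z) (bd : V -> Prop) (L : I -> V -> H) (c d : I).
Hypothesis BDl : forall p q r, B (p + q) r = B p r + B q r.
Hypothesis Bxx : forall p, B p p = 0.
Hypothesis bdD : forall p q, bd p -> bd q -> bd (p + q).
Hypothesis bdZ : forall a p, bd p -> bd (a *: p).
Hypothesis LN : forall e p, bd p -> L e (- p) = (L e p)^-1%g.
(* If [B p q = B p' q'] then [p + p'] commutes with [q - q'], although [p] need
   not commute with [q]. *)
Definition indep e f := (forall p q, bd p -> bd q -> (L e p * L f q = L f q * L e p)%g) /\
  (forall p q p' q', bd p -> bd q -> bd p' -> bd q' -> B p q = B p' q' ->
    (L e p * L f p' * L e q * L f (- q') = L e (p + q) * L f (p' - q'))%g).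
Hypothesis cd : indep c d.

(** The defect of additivity of the letters in one copy; the commutator word [Kw] turns out to be
    its square. *)
Definition Xw e p q := ((L e (p + q))^-1 * L e p * L e q)%g.
Definition Kw e p q := (L e p * L e q * L e (- p)%R * L e (- q)%R)%g.

Let bdN p : bd p -> bd (- p).
Proof. by rewrite -scaleN1r; exact: bdZ. Qed.
(** Solving the relation of [indep] for the letters of the copy [e] expresses the defect by letters
    of the copy [f]. *)
Lemma XwE e f p q p' q' : indep e f -> bd p -> bd q -> bd p' -> bd q' -> B p q = B p' q' ->
  Xw e p q = (L f (p' - q')%R * L f q' * (L f p')^-1)%g.
Proof.
move=> [cm fl] bp bq bp' bq' E; have := fl _ _ _ _ bp bq bp' bq' E.
rewrite -!mulgA (mulgA (L f p')) -(cm q p') // -!mulgA LN// => h.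
apply: (mulIg (L f p' * (L f q')^-1)%g); rewrite /Xw.
rewrite -!mulgA mulKg mulgV mulg1; apply: (mulgI (L e (p + q))).
by rewrite mulVKg.
Qed.

(** By [XwE] the defect is a word in the other copy, whose letters commute with [L c t]. *)
Lemma Xw_comm_c p q t : bd p -> bd q -> bd t -> (Xw c p q * L c t = L c t * Xw c p q)%g.
Proof.
move=> bp bq bt; rewrite (XwE cd bp bq bp bq erefl).
have [cm _] := cd; have bpq : bd (p - q) by apply: bdD => //; exact: bdN.
rewrite -(LN d bp) -!mulgA -(cm t (- p)); [|by []|exact: bdN].
by rewrite !(mulgA (L d q)) -(cm t q) // !mulgA -(cm t (p - q)).
Qed.

Lemma Xw_comm_d p q t : bd p -> bd q -> bd t -> (Xw c p q * L d t = L d t * Xw c p q)%g.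
Proof.
move=> bp bq bt; have [cm _] := cd; have bpq : bd (p + q) by exact: bdD.
rewrite /Xw -(LN c bpq) -!mulgA (cm q t) // !(mulgA (L c p)) (cm p t) // -!mulgA.
by rewrite (mulgA (L c (- (p + q))) (L d t)) (cm _ t) ?mulgA//; exact: bdN.
Qed.

(** Since [B (a + b) b = B a b], the pair [(a + b, b)] may be used in [XwE], giving
    [L d a * L d b * (L d (a + b))^-1]. It commutes with [L d (a + b)], so the last factor can be
    moved to the front. *)
Lemma Xw_swap p q a b : bd p -> bd q -> bd a -> bd b -> B p q = B a b -> Xw c p q = Xw d a b.
Proof.
move=> bp bq ba bb E.
have E' : B p q = B (a + b) b by rewrite BDl Bxx addr0.
rewrite (XwE cd bp bq (bdD ba bb) bb E') addrK.
have bab : bd (a + b) by exact: bdD.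
have comm := Xw_comm_d bp bq bab.
rewrite (XwE cd bp bq bab bb E') addrK in comm.
apply: (mulgI (L d (a + b))); rewrite -comm /Xw -!mulgA mulVKg.
by rewrite mulVg mulg1.
Qed.
End central_commutators.

Section two_copies.
Variables (H : groupType) (F : numFieldType) (I : Type) (V : lmodType F) (Z : zmodType).
Variables (B : V -> V -> Z) (bd : V -> Prop) (L : I -> V -> H) (c d : I).
Hypothesis BDl : forall p q r, B (p + q) r = B p r + B q r.
Hypothesis BDr : forall p q r, B r (p + q) = B r p + B r q.
Hypothesis Bxx : forall p, B p p = 0.
Hypothesis bdD : forall p q, bd p -> bd q -> bd (p + q).
Hypothesis bdZ : forall a p, bd p -> bd (a *: p).
Hypothesis L0 : forall e, L e 0 = 1%g.
Hypothesis LN : forall e p, bd p -> L e (- p) = (L e p)^-1%g.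
Hypothesis cd : indep B bd L c d.
Notation Xw := (Xw L).
Notation Kw := (Kw L).

Let bdN p : bd p -> bd (- p).
Proof. by rewrite -scaleN1r; exact: bdZ. Qed.
Let B0l q : B 0 q = 0.
Proof. by apply: (addrI (B 0 q)); rewrite -BDl !addr0. Qed.
Let B0r q : B q 0 = 0.
Proof. by apply: (addrI (B q 0)); rewrite -BDr !addr0. Qed.
Let BNl p q : B (- p) q = - B p q.
Proof. by apply: (addrI (B p q)); rewrite -BDl !subrr B0l. Qed.
Let BNr p q : B q (- p) = - B q p.
Proof. by apply: (addrI (B q p)); rewrite -BDr !subrr B0r. Qed.
Let BC p q : B p q = - B q p.
Proof. by have := Bxx (p + q); rewrite BDl !BDr !Bxx add0r addr0 => /eqP; rewrite addr_eq0 => /eqP. Qed.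

Lemma Xw_eq p q a b : bd p -> bd q -> bd a -> bd b -> B p q = B a b -> Xw c p q = Xw c a b.
Proof.
move=> bp bq ba bb E; rewrite (Xw_swap BDl Bxx bdD bdZ LN cd bp bq bp bq erefl).
by rewrite (Xw_swap BDl Bxx bdD bdZ LN cd ba bb bp bq (esym E)).
Qed.

Let XC := Xw_comm_c bdD bdZ LN cd.

Lemma XwV p q : bd p -> bd q -> (Xw c p q)^-1%g = Xw c q p.
Proof.
move=> bp bq; have bpq : bd (p + q) by exact: bdD.
have -> : Xw c q p = Xw c (- q) (- p) by apply: Xw_eq => //; [exact: bdN|exact: bdN|rewrite BNl BNr opprK].
have comm := XC bp bq bpq; have {comm} : ((Xw c p q)^-1 * L c (p + q) = L c (p + q) * (Xw c p q)^-1)%g.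
  by apply: (mulgI (Xw c p q)); rewrite mulVKg mulgA comm -mulgA mulgV mulg1.
rewrite {2}/Xw !invgM invgK !mulgA => h.
rewrite {1}/Xw -opprD (LN c bq) (LN c bp) LN; last by rewrite addrC.
by rewrite invgK [q + p]addrC; apply: (mulIg (L c (p + q))).
Qed.

Lemma XXC p q t : bd p -> bd q -> bd t -> (Xw c p q * Xw c p q * L c t = L c t * (Xw c p q * Xw c p q))%g.
Proof. by move=> bp bq bt; rewrite -mulgA XC// (mulgA (Xw c p q) (L c t)) XC// !mulgA. Qed.

Lemma comm_split (x y z q k : H) : (z * q = q * z)%g -> (y * q * y^-1 * q^-1 = k)%g -> (k * x = x * k)%g ->
  (x * y * z * q * (x * y * z)^-1 * q^-1 = k * (x * q * x^-1 * q^-1))%g.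
Proof.
move=> zq yk kx; have yq : (y * q * y^-1 = k * q)%g by rewrite -yk -!mulgA mulVg mulg1.
transitivity (x * (y * q * y^-1) * x^-1 * q^-1)%g.
  rewrite !invgM -(mulgA (x * y)%g z q) zq -!mulgA; congr (_ * (_ * (_ * _)))%g.
  by rewrite mulVKg.
by rewrite yq !mulgA -kx.
Qed.

(** The two orders of multiplication give [L c (p + q)] times a defect, and the defects for [(p, q)]
    and [(q, p)] are inverse to each other. *)
Lemma KwE p q : bd p -> bd q -> Kw c p q = (Xw c p q * Xw c p q)%g.
Proof.
move=> bp bq; have bpq : bd (p + q) by exact: bdD.
have E1 : (L c p * L c q = L c (p + q) * Xw c p q)%g by rewrite /Xw -!mulgA mulVKg.
have E2 : (L c q * L c p = L c (p + q) * Xw c q p)%g by rewrite /Xw [q + p]addrC -!mulgA mulVKg.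
have -> : Kw c p q = (L c p * L c q * (L c q * L c p)^-1)%g by rewrite /Kw (LN c bp) (LN c bq) invgM !mulgA.
rewrite E1 E2 invgM XwV//.
by rewrite -(mulgA _ _ (_ * _)%g) (mulgA (Xw c p q)) mulgA -XXC// -mulgA mulgV mulg1.
Qed.

Lemma KwC p q t : bd p -> bd q -> bd t -> (Kw c p q * L c t = L c t * Kw c p q)%g.
Proof. by move=> bp bq bt; rewrite KwE// XXC. Qed.

Lemma Kw_eq p q a b : bd p -> bd q -> bd a -> bd b -> B p q = B a b -> Kw c p q = Kw c a b.
Proof. by move=> bp bq ba bb E; rewrite !KwE// (Xw_eq bp bq ba bb E). Qed.

Lemma KwDl p p' q : bd p -> bd p' -> bd q -> Kw c (p + p') q = (Kw c p q * Kw c p' q)%g.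
Proof.
move=> bp bp' bq; have bpp : bd (p' + p) by exact: bdD.
have E1 : L c (p' + p) = (L c p' * L c p * (Xw c p' p)^-1)%g.
  by apply: (mulIg (Xw c p' p)); rewrite -mulgA mulVg mulg1 /Xw -!mulgA mulVKg.
have K1 a : bd a -> Kw c a q = (L c a * L c q * (L c a)^-1 * (L c q)^-1)%g by move=> ba; rewrite /Kw !LN.
rewrite addrC K1// E1 (K1 p')//; apply: comm_split.
- by rewrite XwV// XC.
- by rewrite K1.
- exact: KwC.
Qed.

Lemma KwDr p q q' : bd p -> bd q -> bd q' -> Kw c p (q + q') = (Kw c p q * Kw c p q')%g.
Proof.
move=> bp bq bq'; have E a : bd a -> Kw c p a = Kw c (- a) p.
  by move=> ba; apply: Kw_eq => //; [exact: bdN|rewrite BNl -BC].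
rewrite !E// ?opprD ?KwDl//; [exact: bdN|exact: bdN|exact: bdD].
Qed.

(** With [p = r + r], associativity of the product of [r], [r], [q] gives
    [Xw p q = Xw r (r + q) * Xw r q], as [Xw r r] is trivial. Both factors equal [Xw r q] because
    they have the same value of [B], and the square is [Kw r q]. *)
Lemma Xw_half p q : bd p -> bd q -> Xw c p q = Kw c (2^-1 *: p) q.
Proof.
move=> bp bq; rewrite KwE//; last exact: bdZ.
set r := 2^-1 *: p; have br : bd r by exact: bdZ.
have rr : r + r = p by rewrite -scalerDl -mulr2n -(mulr_natr 2^-1) mulVf ?scale1r// pnatr_eq0.
have X0 : Xw c r r = 1%g.
  have b0 : bd 0 by rewrite -(scale0r r); exact: bdZ.
  by rewrite (Xw_eq br br b0 b0) ?Bxx// /Xw addr0 L0 invg1 !mulg1.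
have bqr : bd (r + q) by exact: bdD.
have e1 : (L c r * L c r * L c q = L c (p + q) * Xw c p q)%g.
  have -> : (L c r * L c r = L c p)%g by have := X0; rewrite /Xw rr => h; apply: (mulgI (L c p)^-1%g); rewrite mulVg mulgA.
  by rewrite /Xw -!mulgA mulVKg.
have e2 : (L c r * (L c r * L c q) = L c (p + q) * (Xw c r (r + q) * Xw c r q))%g.
  by rewrite /Xw addrA rr -!mulgA !mulVKg.
apply: (mulgI (L c (p + q))); rewrite -e1 -mulgA e2.
by rewrite (@Xw_eq r (r + q) r q)// BDr Bxx add0r.
Qed.

Lemma L_mul p q : bd p -> bd q -> (L c p * L c q = L c (p + q) * Kw c (2^-1 *: p) q)%g.
Proof. by move=> bp bq; rewrite -Xw_half// /Xw -!mulgA mulVKg. Qed.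

Lemma KwC_d p q t : bd p -> bd q -> bd t -> (Kw c p q * L d t = L d t * Kw c p q)%g.
Proof.
move=> bp bq bt; have [cm _] := cd.
have cmA x y : bd x -> (L c x * (L d t * y) = L d t * (L c x * y))%g.
  by move=> bx; rewrite !mulgA (cm x).
by rewrite /Kw -!mulgA (cm (- q)) ?cmA//; exact: bdN.
Qed.
End two_copies.

Section many_copies.
Variables (H : groupType) (F : numFieldType) (I : eqType) (V : lmodType F) (Z : zmodType).
Variables (B : V -> V -> Z) (bd : V -> Prop) (L : I -> V -> H).
Hypothesis BDl : forall p q r, B (p + q) r = B p r + B q r.
Hypothesis BDr : forall p q r, B r (p + q) = B r p + B r q.
Hypothesis Bxx : forall p, B p p = 0.
Hypothesis bdD : forall p q, bd p -> bd q -> bd (p + q).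
Hypothesis bdZ : forall a p, bd p -> bd (a *: p).
Hypothesis L0 : forall e, L e 0 = 1%g.
Hypothesis LN : forall e p, bd p -> L e (- p) = (L e p)^-1%g.
Hypothesis ind : forall c d, c != d -> indep B bd L c d.
Hypothesis other : forall c : I, exists d, c != d.
Notation Kw := (Kw L).

Lemma Kw_comm c e p q t : bd p -> bd q -> bd t -> commute (Kw c p q) (L e t).
Proof.
move=> bp bq bt; have [<-|ce] := eqVneq c e.
  have [d cd] := other c.
  exact: (KwC BDl BDr Bxx bdD bdZ LN (ind cd)).
exact: (KwC_d bdZ (ind ce)).
Qed.

Lemma Kw_copy c e p q : bd p -> bd q -> Kw c p q = Kw e p q.
Proof.
move=> bp bq; have [->//|ce] := eqVneq c e; have ec : e != c by rewrite eq_sym.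
rewrite (KwE BDl BDr Bxx bdD bdZ LN (ind ce))//.
rewrite (KwE BDl BDr Bxx bdD bdZ LN (ind ec))//.
by rewrite (Xw_swap BDl Bxx bdD bdZ LN (ind ce) bp bq bp bq erefl).
Qed.

Lemma commuteM (x y z : H) : commute x z -> commute y z -> commute (x * y)%g z.
Proof. by rewrite /commute => xz yz; rewrite -mulgA yz mulgA xz mulgA. Qed.

Lemma commuteMr (x y z : H) : commute z x -> commute z y -> commute z (x * y)%g.
Proof. by rewrite /commute => xz yz; rewrite mulgA xz -mulgA yz mulgA. Qed.

Lemma Kw_Kw c e p q p' q' : bd p -> bd q -> bd p' -> bd q' -> commute (Kw c p q) (Kw e p' q').
Proof.
have bdN u : bd u -> bd (- u) by rewrite -scaleN1r; exact: bdZ.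
move=> bp bq bp' bq'; rewrite {2}/Kw.
by do !apply: commuteMr; apply: Kw_comm => //; exact: bdN.
Qed.

Lemma Kw_add c p q : bd p -> bd q -> (L c p * L c q = L c (p + q) * Kw c (2^-1 *: p) q)%g.
Proof. by have [d cd] := other c; exact: (L_mul BDl BDr Bxx bdD bdZ L0 LN (ind cd)). Qed.

Lemma Kw_form c p q a b : bd p -> bd q -> bd a -> bd b -> B p q = B a b -> Kw c p q = Kw c a b.
Proof. by have [d cd] := other c; exact: (Kw_eq BDl BDr Bxx bdD bdZ LN (ind cd)). Qed.

Lemma Kw_addl c p p' q : bd p -> bd p' -> bd q -> Kw c (p + p') q = (Kw c p q * Kw c p' q)%g.
Proof. by have [d cd] := other c; exact: (KwDl BDl BDr Bxx bdD bdZ LN (ind cd)). Qed.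

Lemma Kw_addr c p q q' : bd p -> bd q -> bd q' -> Kw c p (q + q') = (Kw c p q * Kw c p q')%g.
Proof. by have [d cd] := other c; exact: (KwDr BDl BDr Bxx bdD bdZ LN (ind cd)). Qed.

Definition gprod (J : Type) (s : seq J) (f : J -> H) : H := foldr (fun j x => f j * x)%g 1%g s.

Lemma gprod_comm (J : Type) (s : seq J) f z : (forall j, commute (f j) z) -> commute (gprod s f) z.
Proof.
move=> fz; elim: s => [|j s IH] /=; first by rewrite /commute mul1g mulg1.
exact: commuteM.
Qed.

Lemma gprodM (J : eqType) (s : seq J) f g : uniq s -> (forall i j, i != j -> commute (f i) (g j)) ->
  gprod s (fun j => f j * g j)%g = (gprod s f * gprod s g)%g.
Proof.
move=> us fg; elim: s us => [|j s IH] /=; first by rewrite mulg1.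
move=> /andP[js us]; rewrite IH// -!mulgA; congr (_ * _)%g; rewrite !mulgA; congr (_ * _)%g.
have : {in s, forall i, i != j} by move=> i si; apply: contraNneq js => <-.
elim: {us IH js} s => [|i s IH] /= sj; first by rewrite mulg1 mul1g.
have ij : i != j by apply: sj; rewrite inE eqxx.
by rewrite mulgA (esym (fg i j ij)) -!mulgA IH// => k ks; apply: sj; rewrite inE ks orbT.
Qed.

Lemma eq_gprod (J : Type) (s : seq J) f g : f =1 g -> gprod s f = gprod s g.
Proof. by move=> fg; elim: s => [//|j s IH] /=; rewrite fg IH. Qed.
End many_copies.

(** * Homotopies of words and their areas *)

(** A rectangle carrying a constant bound [cJ] on the jacobian. It counts as open in [cval], which
    is harmless because lines are exceptional anyway. *)
Record cell (R : realType) := Cell { cxa : R; cxb : R; cya : R; cyb : R; cJ : R }.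
Definition cell_ok (R : realType) (r : cell R) :=
  [&& cxa r <= cxb r, cya r <= cyb r & 0 <= cJ r].
Definition cval (R : realType) (r : cell R) (x y : R) : R :=
  if [&& cxa r < x, x < cxb r, cya r < y & y < cyb r] then cJ r else 0.
Definition csum (R : realType) (l : seq (cell R)) (x y : R) : R := \sum_(r <- l) cval r x y.
Definition carea (R : realType) (l : seq (cell R)) : R :=
  \sum_(r <- l) cJ r * (cxb r - cxa r) * (cyb r - cya r).

Lemma cval_ge0 (R : realType) (r : cell R) x y : cell_ok r -> 0 <= cval r x y.
Proof. by move=> /and3P[_ _ h]; rewrite /cval; case: ifP. Qed.
Lemma csum_ge0 (R : realType) (l : seq (cell R)) x y : all (@cell_ok R) l -> 0 <= csum l x y.
Proof.
rewrite /csum; elim: l => [_|r l IH /= /andP[rk lk]]; first by rewrite big_nil.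
by rewrite big_cons addr_ge0 ?IH// cval_ge0.
Qed.

Lemma dv_at0 (R : realType) (W : normedModType R) (z z' : R -> W) (w : W) (d : R) : 0 < d ->
  (forall s, `|s| < d -> z s = z' s) -> dv z 0 w -> dv z' 0 w.
Proof.
move=> d0 zz dz e e0; have [d1 d10 H] := dz e e0.
exists (Num.min d d1); first by rewrite lt_min d0.
move=> s; rewrite lt_min add0r => /andP[sd s1].
by rewrite -!zz ?normr0//; have := H s s1; rewrite add0r.
Qed.

Lemma dv_le (R : realType) (W : normedModType R) (z : R -> W) (w : W) (a d : R) : 0 < d ->
  (forall s, `|s| < d -> `|z s| <= a * `|s|) -> dv z 0 w -> `|w| <= a.
Proof.
move=> d0 za dz; have z0 : z 0 = 0 by apply/eqP; rewrite -normr_le0; have := za 0; rewrite normr0 mulr0; exact.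
apply/ler_addgt0Pl => e e0; have [d1 d10 H] := dz e e0.
have m0 : 0 < Num.min d d1 by rewrite lt_min d0.
pose t := Num.min d d1 / 2; have t0 : 0 < t by rewrite divr_gt0.
have nt : `|t| = t by rewrite gtr0_norm.
have tm : t < Num.min d d1 by rewrite /t; lra.
have /andP[t1 t2] : (t < d) && (t < d1) by rewrite -lt_min.
have := H t; have := za t; rewrite nt => /(_ t1) h1 /(_ t2); rewrite add0r z0 subr0 => h2.
rewrite -(ler_pM2l t0) -{1}nt -normrZ.
have -> : t *: w = z t - (z t - t *: w) by zmod.
by apply: le_trans (ler_normB _ _) _; move: h1 h2; lra.
Qed.

Section gluing.
Variables (R : realType) (W : normedModType R).

Definition Lip1 (p : R -> W) K := forall s t, 0 <= s <= 1 -> 0 <= t <= 1 -> `|p s - p t| <= K * `|s - t|.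
Definition Lip2 (H : R -> R -> W) K := forall x y x' y', 0 <= x <= 1 -> 0 <= y <= 1 ->
  0 <= x' <= 1 -> 0 <= y' <= 1 -> `|H x y - H x' y'| <= K * (`|x - x'| + `|y - y'|).

Lemma Lip2_ge0 H K : Lip2 H K -> 0 <= K.
Proof.
move=> h; have := h 0 0 1 0; rewrite !lexx ler01 sub0r subr0 normrN normr0 addr0 normr1 mulr1.
by move=> /(_ isT isT isT isT); apply: le_trans.
Qed.

Definition glue (H1 H2 : R -> R -> W) x y := if y <= 2^-1 then H1 x (2 * y) else H2 x (2 * y - 1).

Lemma Lip2_glue H1 H2 K1 K2 : Lip2 H1 K1 -> Lip2 H2 K2 ->
  (forall x, 0 <= x <= 1 -> H1 x 1 = H2 x 0) -> Lip2 (glue H1 H2) (2 * (K1 + K2)).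
Proof.
move=> lip1 lip2 H12.
have K10 := Lip2_ge0 lip1; have K20 := Lip2_ge0 lip2.
have mix x y x' y' : 0 <= x <= 1 -> 0 <= y <= 1 -> 0 <= x' <= 1 -> 0 <= y' <= 1 -> y <= 2^-1 -> 2^-1 < y' ->
   `|H1 x (2 * y) - H2 x' (2 * y' - 1)| <= 2 * (K1 + K2) * (`|x - x'| + `|y - y'|).
  move=> x1 y1 x1' y1' yh yh'.
  have h1 := lip1 x (2 * y) x 1 x1 _ x1 _.
  have h2 := lip2 x 0 x' (2 * y' - 1) x1 _ x1' _.
  have -> : H1 x (2 * y) - H2 x' (2 * y' - 1) = (H1 x (2 * y) - H1 x 1) + (H2 x 0 - H2 x' (2 * y' - 1)).
    by rewrite H12//; zmod.
  apply: le_trans (ler_normD _ _) _.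
  have {}h1 : `|H1 x (2 * y) - H1 x 1| <= K1 * (1 - 2 * y).
    have e : `|2 * y - 1| = 1 - 2 * y by rewrite distrC ger0_norm//; lra.
    by move: h1; rewrite subrr normr0 add0r e; apply; lra.
  have {}h2 : `|H2 x 0 - H2 x' (2 * y' - 1)| <= K2 * (`|x - x'| + (2 * y' - 1)).
    have e : `|0 - (2 * y' - 1)| = 2 * y' - 1 by rewrite distrC subr0 ger0_norm//; lra.
    by move: h2; rewrite e; apply; lra.
  have -> : `|y - y'| = y' - y by rewrite distrC gtr0_norm//; lra.
  have := normr_ge0 (x - x').
  move: h1 h2; nra.
move=> x y x' y' x1 y1 x1' y1'; rewrite /glue.
case: (leP y 2^-1) => yh; case: (leP y' 2^-1) => yh'.
+ have := lip1 x (2 * y) x' (2 * y') x1 _ x1' _; rewrite -mulrBr normrM ger0_norm// => h.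
  apply: le_trans (h _ _) _; [lra|lra|].
  by have := normr_ge0 (x - x'); have := normr_ge0 (y - y'); nra.
+ exact: mix.
+ rewrite distrC; apply: le_trans (mix x' y' x y _ _ _ _ _ _) _ => //.
  by rewrite [`|x' - _|]distrC [`|y' - _|]distrC.
+ have := lip2 x (2 * y - 1) x' (2 * y' - 1) x1 _ x1' _.
  have -> : 2 * y - 1 - (2 * y' - 1) = 2 * (y - y') by ring.
  rewrite normrM ger0_norm// => h.
  apply: le_trans (h _ _) _; [lra|lra|].
  by have := normr_ge0 (x - x'); have := normr_ge0 (y - y'); nra.
Qed.

Definition cat (p q : R -> W) s := if s <= 2^-1 then p (2 * s) else q (2 * s - 1).

Lemma o01 : 0 <= (0 : R) <= 1. Proof. by rewrite lexx ler01. Qed.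
Lemma i01 : 0 <= (1 : R) <= 1. Proof. by rewrite lexx ler01. Qed.
Hint Resolve o01 i01 : core.

Lemma cat0 (p q : R -> W) : cat p q 0 = p 0.
Proof. by rewrite /cat invr_ge0 ler0n mulr0. Qed.
Lemma cat1 (p q : R -> W) : cat p q 1 = q 1.
Proof.
rewrite /cat (_ : (1 <= 2^-1 :> R) = false); first by congr q; ring.
by apply/negbTE; rewrite -ltNge; lra.
Qed.

Lemma Lip1_cat p q K1 K2 : Lip1 p K1 -> Lip1 q K2 -> p 1 = q 0 -> Lip1 (cat p q) (2 * (K1 + K2)).
Proof.
move=> h1 h2 pq.
have ge0 r K : Lip1 r K -> 0 <= K.
  by move=> rK; have := rK 1 0 i01 o01; rewrite subr0 normr1 mulr1; apply: le_trans.
have L r K : Lip1 r K -> Lip2 (fun=> r) K.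
  move=> rK x y x' y' _ y1 _ y1'; apply: le_trans (rK _ _ y1 y1') _.
  by rewrite ler_wpM2l ?(ge0 r)// lerDr.
move=> s t s1 t1; have := Lip2_glue (L _ _ h1) (L _ _ h2) (fun _ _ => pq) o01 s1 o01 t1.
by rewrite subrr normr0 add0r.
Qed.

End gluing.
Arguments o01 {R}.
Arguments i01 {R}.
#[local] Hint Resolve o01 i01 : core.

(** * Areas of Lipschitz homotopies and the calculus of words *)

Section fillings.
Variables (R : realType) (N : nat).
Notation E := 'rV[R]_N.
Variable be : E -> E -> E.
Hypothesis nf : nilform be.
(** [gram u v] stands for the area of the parallelogram spanned by [u] and [v]. Degeneracy is
    required in the approximate form [g0], since for non-smooth curves proportionality of two
    derivatives is only obtained up to arbitrarily small errors. *)
Variables (gram : E -> E -> R) (Ci : R).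
Hypothesis gC : forall u v, gram u v = gram v u.
Hypothesis gZ : forall a u v, gram (a *: u) v = `|a| * gram u v.
Hypothesis g0 : forall u v, (forall e, 0 < e -> exists l : R, `|v - l *: u| <= e) -> gram u v <= 0.
Hypothesis gB : forall u v, gram u v <= Ci * `|u| * `|v|.
Hypothesis Ci0 : 0 < Ci.

(* A bound on the jacobian; it says nothing where a partial derivative fails to
   exist. *)
Definition jb (H : R -> R -> E) x y J := forall w1 w2,
  dv (fun s => bch be (- H x y) (H (x + s) y)) 0 w1 ->
  dv (fun s => bch be (- H x y) (H x (y + s))) 0 w2 -> gram w1 w2 <= J.

(** A Lipschitz homotopy with jacobian bounded by finitely many cells off the lines [xs] and [ys].
    The class is stable under gluing, reflection and transposition, and its area is a finite sum. *)
Definition fil (H : R -> R -> E) (A : R) := exists (l : seq (cell R)) (xs ys : seq R) (K : R),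
  [/\ Lip2 H K, all (@cell_ok R) l,
    forall x y, 0 < x < 1 -> 0 < y < 1 -> x \notin xs -> y \notin ys -> jb H x y (csum l x y) &
    carea l <= A].

Lemma gZr a u v : gram u (a *: v) = `|a| * gram u v.
Proof. by rewrite gC gZ gC. Qed.

Let itv_ball (x : R) : 0 < x < 1 -> exists2 d : R, 0 < d & forall s, `|s| < d -> 0 < x + s < 1.
Proof.
move=> /andP[x0 x1]; exists (Num.min x (1 - x)); first by rewrite lt_min x0 subr_gt0.
by move=> s; rewrite lt_min !ltr_norml => /andP[/andP[a b] /andP[c d]]; apply/andP; split; lra.
Qed.

Lemma fil_ext H H' A : (forall x y, 0 <= x <= 1 -> 0 <= y <= 1 -> H x y = H' x y) ->
  fil H A -> fil H' A.
Proof.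
move=> HH [l [xs [ys [K [lip ok j ar]]]]]; exists l, xs, ys, K; split => //.
  by move=> x y x' y' *; rewrite -!HH//; exact: lip.
have le01 (t : R) : 0 < t < 1 -> 0 <= t <= 1 by move=> /andP[/ltW -> /ltW ->].
move=> x y x01 y01 xn yn w1 w2 d1 d2; apply: (j x y x01 y01 xn yn).
  have [dx dx0 dxP] := itv_ball x01; apply: dv_at0 dx0 _ d1 => s sd.
  by rewrite !HH ?le01// dxP.
have [dy dy0 dyP] := itv_ball y01; apply: dv_at0 dy0 _ d2 => s sd.
by rewrite !HH ?le01// dyP.
Qed.

Lemma fil_le H A A' : A <= A' -> fil H A -> fil H A'.
Proof. by move=> AA [l [xs [ys [K [h1 h2 h3 h4]]]]]; exists l, xs, ys, K; split => //; exact: le_trans AA. Qed.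

Lemma fil_tr H A : fil H A -> fil (fun x y => H y x) A.
Proof.
move=> [l [xs [ys [K [lip ok j ar]]]]].
exists [seq Cell (cya r) (cyb r) (cxa r) (cxb r) (cJ r) | r <- l], ys, xs, K; split.
- by move=> x y x' y' *; rewrite [X in K * X]addrC; exact: lip.
- by rewrite all_map; apply: sub_all ok => r /and3P[a b c]; apply/and3P.
- move=> x y x01 y01 xn yn w1 w2 d1 d2; rewrite gC.
  have -> : csum [seq Cell (cya r) (cyb r) (cxa r) (cxb r) (cJ r) | r <- l] x y = csum l y x.
    rewrite /csum big_map; apply: eq_bigr => r _; rewrite /cval /=; congr (if _ then _ else _).
    by case: (cxa r < y); case: (y < cxb r); rewrite ?andbF ?andbT.
  exact: (j y x).
- by rewrite /carea big_map /=; move: ar; congr (_ <= _); apply: eq_bigr => r _; rewrite mulrAC.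
Qed.

Lemma fil_rev H A : fil H A -> fil (fun x y => H x (1 - y)) A.
Proof.
move=> [l [xs [ys [K [lip ok j ar]]]]].
exists [seq Cell (cxa r) (cxb r) (1 - cyb r) (1 - cya r) (cJ r) | r <- l], xs, [seq 1 - y | y <- ys], K; split.
- move=> x y x' y' x1 y1 x1' y1'.
  have <- : `|(1 - y) - (1 - y')| = `|y - y'|.
    have -> : (1 - y) - (1 - y') = - (y - y') by ring.
    by rewrite normrN.
  by apply: lip => //; lra.
- by rewrite all_map; apply: sub_all ok => r /and3P[a b c]; rewrite /cell_ok /= a c andbT /=; lra.
- move=> x y x01 y01 xn yn w1 w2 d1 d2.
  have -> : csum [seq Cell (cxa r) (cxb r) (1 - cyb r) (1 - cya r) (cJ r) | r <- l] x y = csum l x (1 - y).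
    rewrite /csum big_map; apply: eq_bigr => r _; rewrite /cval /=; congr (if _ then _ else _).
    by rewrite ltrBlDr ltrBrDr ltrBlDr ltrBrDr (addrC (cyb r)) [X in _ && (_ && X)]andbC; congr [&& _, _ & _]; rewrite (addrC y (cya r)) // andbC.
  have yn' : 1 - y \notin ys.
    by apply: contra yn => yy; apply/mapP; exists (1 - y) => //; rewrite opprB addrC subrK.
  have := j x (1 - y) x01 _ xn yn' w1 (-1 *: w2) d1; rewrite gZr normrN normr1 mul1r.
  apply; first by lra.
  move=> e e0; have [d d0 Hd] := d2 e e0; exists d => // s sd.
  have := Hd (- s); rewrite normrN => /(_ sd); rewrite !add0r !addr0 scalerA mulrN1.
  by have -> : 1 - (y - s) = 1 - y + s by ring.
- rewrite /carea big_map /=; move: ar; congr (_ <= _); apply: eq_bigr => r _; congr (_ * _); ring.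
Qed.

Lemma fil_glue H1 H2 A B : fil H1 A -> fil H2 B ->
  (forall x, 0 <= x <= 1 -> H1 x 1 = H2 x 0) -> fil (glue H1 H2) (A + B).
Proof.
move=> [l1 [xs1 [ys1 [K1 [lip1 ok1 j1 ar1]]]]] [l2 [xs2 [ys2 [K2 [lip2 ok2 j2 ar2]]]]] H12.
(* Compressing to half the height doubles one partial derivative: the jacobian bound doubles, the
   cell becomes half as high, and the area is unchanged. The seam [y = 1 / 2] joins the exceptional
   lines. *)
pose m1 (r : cell R) := Cell (cxa r) (cxb r) (cya r / 2) (cyb r / 2) (2 * cJ r).
pose m2 (r : cell R) := Cell (cxa r) (cxb r) ((cya r + 1) / 2) ((cyb r + 1) / 2) (2 * cJ r).
exists ([seq m1 r | r <- l1] ++ [seq m2 r | r <- l2]), (xs1 ++ xs2),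
  (2^-1 :: [seq y / 2 | y <- ys1] ++ [seq (y + 1) / 2 | y <- ys2]), (2 * (K1 + K2)).
have okm : all (@cell_ok R) ([seq m1 r | r <- l1] ++ [seq m2 r | r <- l2]).
  rewrite all_cat !all_map; apply/andP; split.
    by apply: sub_all ok1 => r /and3P[a b c]; rewrite /cell_ok /=; apply/and3P; split; lra.
  by apply: sub_all ok2 => r /and3P[a b c]; rewrite /cell_ok /=; apply/and3P; split; lra.
split => //.
- exact: Lip2_glue.
- have sc (z : R -> E) w : dv z 0 w -> dv (fun s => z (2^-1 * s)) 0 (2^-1 *: w) by exact: dv_scale.
  move=> x y x01 y01; rewrite mem_cat negb_or => /andP[xn1 xn2].
  rewrite inE mem_cat !negb_or => /and3P[yh yn1 yn2].
  have sumE : csum ([seq m1 r | r <- l1] ++ [seq m2 r | r <- l2]) x y =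
     2 * csum l1 x (2 * y) + 2 * csum l2 x (2 * y - 1).
    rewrite /csum big_cat !big_map /= !mulr_sumr; congr (_ + _); apply: eq_bigr => r _.
      rewrite /cval /=.
      have -> : (cya r / 2 < y) = (cya r < 2 * y) by rewrite ltr_pdivrMr// mulrC.
      have -> : (y < cyb r / 2) = (2 * y < cyb r) by rewrite ltr_pdivlMr// mulrC.
      by case: ifP; rewrite ?mulr0.
    rewrite /cval /=.
    have -> : ((cya r + 1) / 2 < y) = (cya r < 2 * y - 1) by rewrite ltr_pdivrMr// ltrBrDr mulrC.
    have -> : (y < (cyb r + 1) / 2) = (2 * y - 1 < cyb r) by rewrite ltr_pdivlMr// ltrBlDr mulrC.
    by case: ifP; rewrite ?mulr0.
  move=> w1 w2 d1 d2; rewrite sumE.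
  have c1 := csum_ge0 x (2 * y) ok1; have c2 := csum_ge0 x (2 * y - 1) ok2.
  move: yh; rewrite neq_lt => /orP[yh|yh].
    have yl : y <= 2^-1 by exact: ltW.
    have yn' : 2 * y \notin ys1.
      by apply: contra yn1 => yy; apply/mapP; exists (2 * y) => //; field.
    have h := j1 x (2 * y) x01 _ xn1 yn' w1 (2^-1 *: w2).
    have {h} : gram w1 (2^-1 *: w2) <= csum l1 x (2 * y).
      apply: h; first lra.
        by move: d1; rewrite /glue yl.
      have hd : 0 < 2 * (2^-1 - y) by lra.
      apply: dv_at0 hd _ (sc _ _ d2) => s; rewrite ltr_norml => /andP[s1 s2].
      rewrite /glue yl (_ : (y + 2^-1 * s <= 2^-1) = true); last by apply/ltW; lra.
      by rewrite mulrDr mulrA divff// mul1r.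
    by rewrite gZr ger0_norm ?invr_ge0//; lra.
  have yl : (y <= 2^-1) = false by rewrite leNgt yh.
  have yn' : 2 * y - 1 \notin ys2.
    by apply: contra yn2 => yy; apply/mapP; exists (2 * y - 1) => //; field.
  have h := j2 x (2 * y - 1) x01 _ xn2 yn' w1 (2^-1 *: w2).
  have {h} : gram w1 (2^-1 *: w2) <= csum l2 x (2 * y - 1).
    apply: h; first lra.
      by move: d1; rewrite /glue yl.
    have hd : 0 < 2 * (y - 2^-1) by lra.
    apply: dv_at0 hd _ (sc _ _ d2) => s; rewrite ltr_norml => /andP[s1 s2].
    rewrite /glue yl (_ : (y + 2^-1 * s <= 2^-1) = false); last by apply/negbTE; rewrite -ltNge; lra.
    by congr (bch _ _ (H2 _ _)); field.
  by rewrite gZr ger0_norm ?invr_ge0//; lra.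
- rewrite /carea big_cat !big_map /=; apply: lerD.
    apply: le_trans ar1; rewrite /carea le_eqVlt; apply/orP; left; apply/eqP.
    by apply: eq_bigr => r _; field.
  apply: le_trans ar2; rewrite /carea le_eqVlt; apply/orP; left; apply/eqP.
  by apply: eq_bigr => r _; field.
Qed.

(** A map that factors through a curve has no area, even though [al] need not be differentiable. The
    parameter is affine in [y] with slope [c]; if [c != 0], moving [x] by [s] reaches the same point
    as moving [y] by some [sg], so the two partial derivatives are proportional up to small errors.
    If [c = 0], the map is constant in [y]. *)
Lemma fil0 (al : R -> E) (K Kt : R) (t0 t1 : R -> R) :
  (forall s t, `|al s - al t| <= K * `|s - t|) -> 
  (forall i : bool, forall s t, 0 <= s <= 1 -> 0 <= t <= 1 ->
     `|(if i then t1 else t0) s - (if i then t1 else t0) t| <= Kt * `|s - t|) ->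
  fil (fun x y => al ((1 - y) * t0 x + y * t1 x)) 0.
Proof.
move=> alK tK; pose tau x y := (1 - y) * t0 x + y * t1 x.
have K0 : 0 <= K by have := alK 0 1; rewrite sub0r normrN normr1 mulr1; apply: le_trans.
have Kt0 : 0 <= Kt by have := tK true 1 0; rewrite subr0 normr1 mulr1 !lexx ler01 => /(_ isT isT); apply: le_trans.
have t0K s t : 0 <= s <= 1 -> 0 <= t <= 1 -> `|t0 s - t0 t| <= Kt * `|s - t| := tK false s t.
have t1K s t : 0 <= s <= 1 -> 0 <= t <= 1 -> `|t1 s - t1 t| <= Kt * `|s - t| := tK true s t.
have tauK x y x' : 0 <= x <= 1 -> 0 <= y <= 1 -> 0 <= x' <= 1 -> `|tau x y - tau x' y| <= Kt * `|x - x'|.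
  move=> x1 /andP[y1 y2] x1'.
  have -> : tau x y - tau x' y = (1 - y) * (t0 x - t0 x') + y * (t1 x - t1 x') by rewrite /tau; ring.
  apply: le_trans (ler_normD _ _) _; rewrite !normrM (ger0_norm y1) ger0_norm ?subr_ge0//.
  have := ler_wpM2l y1 (t1K x x' x1 x1').
  have y3 : 0 <= 1 - y by rewrite subr_ge0.
  by have := ler_wpM2l y3 (t0K x x' x1 x1'); lra.
have tauy x y y' : tau x y - tau x y' = (y - y') * (t1 x - t0 x) by rewrite /tau; ring.
pose M := `|t0 0| + `|t1 0| + 2 * Kt.
have tb x : 0 <= x <= 1 -> `|t1 x - t0 x| <= M.
  move=> x1; have o01 : 0 <= (0 : R) <= 1 by rewrite lexx ler01.
  have h1 := t0K x 0 x1 o01; have h2 := t1K x 0 x1 o01.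
  have -> : t1 x - t0 x = (t1 x - t1 0) - (t0 x - t0 0) + t1 0 - t0 0 by ring.
  have h3 : Kt * `|x - 0| <= Kt by rewrite subr0 ler_piMr//; case/andP: x1 => a b; rewrite ger0_norm.
  apply: le_trans (ler_normB _ _) _; apply: le_trans (lerD (ler_normD _ _) (lexx _)) _.
  by have := ler_normB (t1 x - t1 0) (t0 x - t0 0); rewrite /M; lra.
have M0 : 0 <= M by rewrite !addr_ge0// mulr_ge0.
exists [::], [::], [::], (K * (Kt + M)); split => //.
- move=> x y x' y' x1 y1 x1' y1'; apply: le_trans (alK _ _) _.
  rewrite -mulrA ler_wpM2l// -/(tau x y) -/(tau x' y').
  have -> : tau x y - tau x' y' = (tau x y - tau x' y) + (tau x' y - tau x' y') by ring.
  apply: le_trans (ler_normD _ _) _; rewrite tauy normrM.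
  have := tauK x y x' x1 y1 x1'; have := ler_wpM2l (normr_ge0 (y - y')) (tb x' x1').
  by have := mulr_ge0 M0 (normr_ge0 (x - x')); have := mulr_ge0 Kt0 (normr_ge0 (y - y')); lra.
- move=> x y x01 y01 _ _ w1 w2; rewrite /csum big_nil -/(tau x y) => d1 d2.
  have le01 (t : R) : 0 < t < 1 -> 0 <= t <= 1 by move=> /andP[/ltW -> /ltW ->].
  set T := tau x y in d1 d2; set c := t1 x - t0 x.
  have z2E s : tau x (y + s) = T + c * s by rewrite /T /c /tau; ring.
  have [c0|c0] := eqVneq c 0.
    have -> : w2 = 0.
      apply: (dv_unique d2); move=> e e0; exists 1 => // s _.
      rewrite -/(tau x (y + (0 + s))) -/(tau x (y + 0)) !z2E c0 !mul0r addr0 (bchNl nf) scaler0 !subr0 normr0.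
      by rewrite mulr_ge0// ltW.
    by rewrite -(scale0r w2) gZr normr0 mul0r.
  rewrite gC; apply: g0 => e e0.
  have nc : 0 < `|c| by rewrite normr_gt0.
  have K1 : 0 < 1 + Kt / `|c| by rewrite ltr_pwDl// divr_ge0.
  have e1 : 0 < e / (1 + Kt / `|c|) by exact: divr_gt0.
  have [b1 b10 H1] := d1 _ e1; have [b2 b20 H2] := d2 _ e1.
  have [dx dx0 dxP] := itv_ball x01.
  have Kt1 : 0 < 1 + Kt by lra.
  pose m := Num.min (Num.min b1 dx) (b2 * `|c| / (1 + Kt)).
  have m0 : 0 < m by rewrite !lt_min b10 dx0 divr_gt0// mulr_gt0.
  pose s := m / 2; have s0 : 0 < s by rewrite divr_gt0.
  have ns : `|s| = s by rewrite gtr0_norm.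
  have : s < m by rewrite /s; lra.
  rewrite !lt_min ltr_pdivlMr// => /andP[/andP[s1 s2] s3].
  pose sg := (tau (x + s) y - T) / c.
  have sgs : `|sg| <= Kt * s / `|c|.
    rewrite /sg normrM normfV ler_pM2r ?invr_gt0// -{2}ns.
    have := tauK (x + s) y x; have -> : x + s - x = s by ring.
    by apply; rewrite ?le01// dxP// ns.
  have sgb : `|sg| < b2.
    by apply: le_lt_trans sgs _; rewrite ltr_pdivrMr//; lra.
  have := H1 s; rewrite ns => /(_ s1); have := H2 sg sgb.
  rewrite !add0r !addr0 -/(tau x (y + sg)) -/(tau (x + s) y) -/T z2E (bchNl nf) !subr0.
  have -> : T + c * sg = tau (x + s) y by rewrite /sg; field.
  set z := bch be _ _ => h2 h1.
  exists (sg / s); rewrite -(ler_pM2l s0) -{1}ns -normrZ.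
  have -> : s *: (w1 - (sg / s) *: w2) = (z - sg *: w2) - (z - s *: w1).
    rewrite scalerBr scalerA; have -> : s * (sg / s) = sg by field; rewrite gt_eqF.
    zmodc.
  apply: le_trans (ler_normB _ _) _; apply: le_trans (lerD h2 h1) _.
  rewrite -mulrDr; have : `|sg| + s <= s * (1 + Kt / `|c|).
    by rewrite (_ : s * (1 + Kt / `|c|) = s + Kt * s / `|c|); [lra|ring].
  move=> /(ler_wpM2l (ltW e1)); congr (_ <= _).
  by field; apply/andP; split; rewrite gt_eqF// ltr_pwDl.
- by rewrite /carea big_nil.
Qed.

(** The base point [x0] cancels from group increments, so the area of the straight homotopy is
    independent of it, although its coordinate Lipschitz constant is not. *)
Lemma fil_lin (x0 : E) (c0 c1 : R -> E) (K1 K2 ka : R) :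
  0 <= K1 -> 0 <= K2 -> 0 <= ka ->
  Lip1 c0 K1 -> Lip1 c1 K1 -> (forall s, 0 <= s <= 1 -> `|c1 s - c0 s| <= K2) ->
  (forall x y x' y', 0 <= x <= 1 -> 0 <= y <= 1 -> 0 <= x' <= 1 -> 0 <= y' <= 1 ->
    let h x y := (1 - y) *: c0 x + y *: c1 x in
    `|bch be (- h x y) (h x' y')| <= ka * `|h x' y' - h x y|) ->
  fil (fun x y => bch be x0 ((1 - y) *: c0 x + y *: c1 x)) (Ci * (ka * K1) * (ka * K2)).
Proof.
move=> K10 K20 ka0 L0 L1 L2 Hk; pose h x y := (1 - y) *: c0 x + y *: c1 x.
have [Kb Kb0 HB] := nf_bound nf.
have hx x y x' : 0 <= x <= 1 -> 0 <= y <= 1 -> 0 <= x' <= 1 -> `|h x' y - h x y| <= K1 * `|x' - x|.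
  move=> x1 /andP[y1 y2] x1'.
  have -> : h x' y - h x y = (1 - y) *: (c0 x' - c0 x) + y *: (c1 x' - c1 x).
    by rewrite /h !scalerBr; zmodc.
  apply: le_trans (ler_normD _ _) _; rewrite !normrZ (ger0_norm y1) ger0_norm ?subr_ge0//.
  have := ler_wpM2l y1 (L1 x' x x1' x1); have y3 : 0 <= 1 - y by rewrite subr_ge0.
  by have := ler_wpM2l y3 (L0 x' x x1' x1); lra.
have hy x y y' : 0 <= x <= 1 -> `|h x y' - h x y| <= K2 * `|y' - y|.
  move=> x1; have -> : h x y' - h x y = (y' - y) *: (c1 x - c0 x).
    by apply/matrixP => i j; rewrite !mxE; ring.
  by rewrite normrZ mulrC ler_wpM2r// L2.
have dec x y z : bch be (- bch be x0 (h x y)) (bch be x0 z) = bch be (- h x y) z.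
  by rewrite (bch_opp nf) -(bchA nf) (bchK nf).
pose KL := (1 + Kb * `|x0|) * (K1 + K2).
have KL0 : 0 <= 1 + Kb * `|x0| by rewrite addr_ge0// mulr_ge0// ltW.
exists [:: Cell 0 1 0 1 (Ci * (ka * K1) * (ka * K2))], [::], [::], KL; split => //.
- move=> x y x' y' x1 y1 x1' y1'.
  have hh : `|h x y - h x' y'| <= (K1 + K2) * (`|x - x'| + `|y - y'|).
    have -> : h x y - h x' y' = (h x y - h x' y) + (h x' y - h x' y') by zmod.
    apply: le_trans (ler_normD _ _) _.
    have := hx x' y x x1' y1 x1; have := hy x' y' y x1'.
    by have := mulr_ge0 K10 (normr_ge0 (y - y')); have := mulr_ge0 K20 (normr_ge0 (x - x')); lra.
  rewrite -/(h x y) -/(h x' y') /bch.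
  have -> : x0 + h x y + 2^-1 *: be x0 (h x y) - (x0 + h x' y' + 2^-1 *: be x0 (h x' y')) =
    (h x y - h x' y') + 2^-1 *: be x0 (h x y - h x' y').
    by rewrite (nfBr nf) scalerBr; zmodc.
  apply: le_trans (ler_normD _ _) _; rewrite normrZ ger0_norm ?invr_ge0//.
  have := HB x0 (h x y - h x' y'); have := ler_wpM2l KL0 hh; rewrite /KL.
  by have := mulr_ge0 (mulr_ge0 (ltW Kb0) (normr_ge0 x0)) (normr_ge0 (h x y - h x' y')); lra.
- rewrite /= andbT /cell_ok /= ler01 /= !mulr_ge0// ltW//.
- move=> x y x01 y01 _ _ w1 w2 d1 d2.
  have le01 (t : R) : 0 < t < 1 -> 0 <= t <= 1 by move=> /andP[/ltW -> /ltW ->].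
  have [x1 y1] := (le01 _ x01, le01 _ y01).
  have -> : csum [:: Cell 0 1 0 1 (Ci * (ka * K1) * (ka * K2))] x y = Ci * (ka * K1) * (ka * K2).
    rewrite /csum big_seq1 /cval /=; case/andP: x01 => -> ->; case/andP: y01 => -> ->; done.
  have [dx dx0 dxP] := itv_ball x01; have [dy dy0 dyP] := itv_ball y01.
  have n1 : `|w1| <= ka * K1.
    apply: (dv_le dx0 _ d1) => s sd; rewrite -/(h x y) -/(h (x + s) y) dec.
    apply: le_trans (Hk x y (x + s) y x1 y1 (le01 _ (dxP _ sd)) y1) _.
    rewrite -mulrA ler_wpM2l//; apply: le_trans (hx x y (x + s) x1 y1 (le01 _ (dxP _ sd))) _.
    by rewrite addrC addKr.
  have n2 : `|w2| <= ka * K2.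
    apply: (dv_le dy0 _ d2) => s sd; rewrite -/(h x y) -/(h x (y + s)) dec.
    apply: le_trans (Hk x y x (y + s) x1 y1 x1 (le01 _ (dyP _ sd))) _.
    rewrite -mulrA ler_wpM2l//; apply: le_trans (hy x y (y + s) x1) _.
    by rewrite addrC addKr.
  apply: le_trans (gB _ _) _; rewrite -!mulrA ler_pM2l//.
  by rewrite [leRHS]mulrA; exact: ler_pM.
- by rewrite /carea big_seq1 /= !subr0 !mulr1.
Qed.

Definition hom (p q : R -> E) A := exists H, [/\ fil H A,
  forall x, 0 <= x <= 1 -> H x 0 = p x /\ H x 1 = q x &
  forall y, 0 <= y <= 1 -> H 0 y = p 0 /\ H 1 y = p 1].

Lemma hom_ends p q A : hom p q A -> q 0 = p 0 /\ q 1 = p 1.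
Proof.
move=> [H [_ h1 h2]]; have [_ <-] := h1 0 o01; have [_ <-] := h1 1 i01.
by have [-> ->] := h2 1 i01.
Qed.

Lemma hom_le p q A A' : A <= A' -> hom p q A -> hom p q A'.
Proof. by move=> AA [H [f h1 h2]]; exists H; split => //; exact: fil_le f. Qed.

Lemma hom_eq p q p' q' A : (forall x, 0 <= x <= 1 -> p x = p' x) ->
  (forall x, 0 <= x <= 1 -> q x = q' x) -> hom p q A -> hom p' q' A.
Proof.
move=> pp qq [H [f h1 h2]]; exists H; split => // x x1.
  by rewrite -pp// -qq//; exact: h1.
by rewrite -(pp 0 o01) -(pp 1 i01); exact: h2.
Qed.

Lemma hom_sym p q A : hom p q A -> hom q p A.
Proof.
move=> h; have [e0 e1] := hom_ends h; case: h => H [f h1 h2].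
exists (fun x y => H x (1 - y)); split; first exact: fil_rev.
  by move=> x x1; rewrite subr0 subrr; have [-> ->] := h1 x x1.
by move=> y y1; rewrite e0 e1; apply: h2; lra.
Qed.

Lemma hom_trans p q r A B : hom p q A -> hom q r B -> hom p r (A + B).
Proof.
move=> h; have [e0 e1] := hom_ends h; case: h => H [f h1 h2] [H' [f' h1' h2']].
exists (glue H H'); split.
- apply: fil_glue => // x x1; have [_ ->] := h1 x x1; by have [-> _] := h1' x x1.
- move=> x x1; rewrite /glue invr_ge0 ler0n mulr0 (_ : (1 <= 2^-1 :> R) = false); last first.
    by apply/negbTE; rewrite -ltNge; lra.
  have -> : 2 * 1 - 1 = 1 :> R by ring.
  by have [-> _] := h1 x x1; have [_ ->] := h1' x x1.
- move=> y y1; rewrite /glue; case: (leP y 2^-1) => yh; first by apply: h2; lra.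
  by rewrite -e0 -e1; apply: h2'; lra.
Qed.

Lemma hom_cat p q p' q' A B : hom p p' A -> hom q q' B -> p 1 = q 0 ->
  hom (cat p q) (cat p' q') (A + B).
Proof.
move=> [H [f h1 h2]] [H' [f' h1' h2']] pq.
exists (fun x y => glue (fun x y => H y x) (fun x y => H' y x) y x); split.
- apply: (@fil_tr (glue (fun x y => H y x) (fun x y => H' y x))).
  apply: fil_glue; [exact: fil_tr|exact: fil_tr|move=> x x1].
  by have [_ ->] := h2 x x1; have [-> _] := h2' x x1.
- move=> x x1; rewrite /glue /cat; case: (leP x 2^-1) => yh; first by apply: h1; lra.
  by apply: h1'; lra.
- move=> y y1; rewrite /glue /cat invr_ge0 ler0n mulr0 (_ : (1 <= 2^-1 :> R) = false); last first.
    by apply/negbTE; rewrite -ltNge; lra.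
  have -> : 2 * 1 - 1 = 1 :> R by ring.
  by have [-> _] := h2 y y1; have [_ ->] := h2' y y1.
Qed.

Lemma minr_lip (f g : R -> R) K : (forall s t, `|f s - f t| <= K * `|s - t|) ->
  (forall s t, `|g s - g t| <= K * `|s - t|) ->
  (forall s t, `|Num.min (f s) (g s) - Num.min (f t) (g t)| <= K * `|s - t|).
Proof.
move=> hf hg s t; have := hf s t; have := hg s t; rewrite !ler_norml /Num.min.
by case: (ltP (f s) (g s)) => a; case: (ltP (f t) (g t)) => b /andP[c d] /andP[e h]; apply/andP; split; lra.
Qed.

Lemma maxr_lip (f g : R -> R) K : (forall s t, `|f s - f t| <= K * `|s - t|) ->
  (forall s t, `|g s - g t| <= K * `|s - t|) ->
  (forall s t, `|Num.max (f s) (g s) - Num.max (f t) (g t)| <= K * `|s - t|).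
Proof.
move=> hf hg s t; have := hf s t; have := hg s t; rewrite !ler_norml /Num.max.
by case: (ltP (f s) (g s)) => a; case: (ltP (f t) (g t)) => b /andP[c d] /andP[e h]; apply/andP; split; lra.
Qed.

Definition clamp (t : R) := Num.max 0 (Num.min t 1).
Lemma clamp01 t : 0 <= clamp t <= 1.
Proof. by rewrite /clamp le_max lexx /= ge_max ler01 ge_min lexx orbT. Qed.
Lemma clampE t : 0 <= t <= 1 -> clamp t = t.
Proof. by move=> /andP[a b]; rewrite /clamp min_l// max_r. Qed.
Lemma clamp_lip s t : `|clamp s - clamp t| <= `|s - t|.
Proof.
have h : forall x y : R, `|Num.min x 1 - Num.min y 1| <= 1 * `|x - y|.
  by apply: (@minr_lip id (fun=> 1)) => x y; rewrite mul1r// subrr normr0.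
have h0 : forall x y : R, `|(0 : R) - 0| <= 1 * `|x - y| by move=> x y; rewrite subrr normr0 mul1r.
by have := maxr_lip h0 h s t; rewrite mul1r.
Qed.

Lemma hom_repar_gl (al : R -> E) (t0 t1 : R -> R) K Kt :
  (forall s t, `|al s - al t| <= K * `|s - t|) ->
  (forall s t, `|t0 s - t0 t| <= Kt * `|s - t|) ->
  (forall s t, `|t1 s - t1 t| <= Kt * `|s - t|) ->
  t0 0 = t1 0 -> t0 1 = t1 1 -> hom (al \o t0) (al \o t1) 0.
Proof.
move=> alK k0 k1 e0 e1; exists (fun x y => al ((1 - y) * t0 x + y * t1 x)); split.
- by apply: (fil0 alK) => -[] s t _ _; [exact: k1|exact: k0].
- by move=> x _; rewrite subr0 subrr !mul1r !mul0r addr0 add0r.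
- by move=> y _; rewrite /= e0 e1 -!mulrDl subrK !mul1r.
Qed.

Lemma hom_repar (p : R -> E) (t0 t1 : R -> R) K Kt : Lip1 p K ->
  (forall s t, `|t0 s - t0 t| <= Kt * `|s - t|) ->
  (forall s t, `|t1 s - t1 t| <= Kt * `|s - t|) ->
  (forall s, 0 <= s <= 1 -> 0 <= t0 s <= 1 /\ 0 <= t1 s <= 1) ->
  t0 0 = t1 0 -> t0 1 = t1 1 -> hom (p \o t0) (p \o t1) 0.
Proof.
move=> pK k0 k1 r01 e0 e1.
have K0 : 0 <= K by have := pK 1 0 i01 o01; rewrite subr0 normr1 mulr1; apply: le_trans.
apply: (@hom_eq (p \o clamp \o t0) (p \o clamp \o t1)); last first.
- apply: (@hom_repar_gl _ _ _ K Kt) => // s t.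
  apply: le_trans (pK _ _ (clamp01 s) (clamp01 t)) _; rewrite ler_wpM2l//; exact: clamp_lip.
- by move=> x x1; rewrite /= clampE//; case: (r01 x x1).
- by move=> x x1; rewrite /= clampE//; case: (r01 x x1).
Qed.

Lemma hom_refl p K : Lip1 p K -> hom p p 0.
Proof. by move=> pK; apply: (@hom_repar p id id K 1) => // s t; rewrite mul1r. Qed.

Lemma hom_lin (x0 : E) (c0 c1 : R -> E) (K1 K2 ka : R) :
  0 <= K1 -> 0 <= K2 -> 0 <= ka ->
  Lip1 c0 K1 -> Lip1 c1 K1 -> (forall s, 0 <= s <= 1 -> `|c1 s - c0 s| <= K2) ->
  (forall x y x' y', 0 <= x <= 1 -> 0 <= y <= 1 -> 0 <= x' <= 1 -> 0 <= y' <= 1 ->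
    let h x y := (1 - y) *: c0 x + y *: c1 x in
    `|bch be (- h x y) (h x' y')| <= ka * `|h x' y' - h x y|) ->
  c0 0 = c1 0 -> c0 1 = c1 1 ->
  hom (fun s => bch be x0 (c0 s)) (fun s => bch be x0 (c1 s)) (Ci * (ka * K1) * (ka * K2)).
Proof.
move=> k1 k2 k3 l0 l1 l2 Hk e0 e1.
exists (fun x y => bch be x0 ((1 - y) *: c0 x + y *: c1 x)); split; first exact: fil_lin.
- by move=> x _; rewrite subr0 subrr !scale1r !scale0r addr0 add0r.
- by move=> y _; rewrite /= e0 e1 -!scalerDl subrK !scale1r.
Qed.

Definition seg x u s := bch be x (s *: u).
Fixpoint P x w := match w with [::] => fun=> x | u :: w => cat (seg x u) (P (bch be x u) w) end.
Definition wp (w : seq E) : E := foldr (bch be) 0 w.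

Lemma seg0 x u : seg x u 0 = x. Proof. by rewrite /seg scale0r (bch0 nf). Qed.
Lemma seg1 x u : seg x u 1 = bch be x u. Proof. by rewrite /seg scale1r. Qed.
Lemma P0 x w : P x w 0 = x.
Proof. by case: w => [//|u w] /=; rewrite cat0 seg0. Qed.
Lemma P1 x w : P x w 1 = bch be x (wp w).
Proof.
elim: w x => [|u w IH] x /=; first by rewrite (bch0 nf).
by rewrite cat1 IH (bchA nf).
Qed.
Lemma wp_cat a b : wp (a ++ b) = bch be (wp a) (wp b).
Proof. by elim: a => [|u a IH] /=; rewrite ?(bch0l nf)// IH (bchA nf). Qed.

Lemma P_tr y x w s : P (bch be y x) w s = bch be y (P x w s).
Proof.
elim: w x s => [//|u w IH] x s /=; rewrite /cat /seg -!(bchA nf); by case: ifP.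
Qed.

Lemma seg_lip : exists2 Kb, 0 < Kb &
  forall x u s t, `|seg x u s - seg x u t| <= (1 + Kb * `|x|) * `|u| * `|s - t|.
Proof.
have [Kb Kb0 HB] := nf_bound nf; exists Kb => // x u s t.
have -> : seg x u s - seg x u t = (s - t) *: (u + 2^-1 *: be x u).
  by rewrite /seg /bch !(nfZr nf); apply/matrixP => i j; rewrite !mxE; ring.
rewrite normrZ mulrC ler_wpM2r//; apply: le_trans (ler_normD _ _) _.
rewrite normrZ ger0_norm ?invr_ge0// mulrDl mul1r lerD2l.
by apply: le_trans (HB x u); rewrite ler_piMl// invf_le1// ler1n.
Qed.

Lemma P_lip (k : nat) (A X : R) : 0 <= A -> 0 <= X -> exists2 K, 0 <= K & forall w x, (size w <= k)%N ->
  (forall u, u \in w -> `|u| <= A) -> `|x| <= X -> Lip1 (P x w) K.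
Proof.
move=> A0; have [Kb Kb0 HB] := seg_lip; have [Kc Kc0 HC] := nf_bound nf.
elim: k X => [|k IH] X X0.
  exists 0 => // -[|//] x _ _ _ s t _ _ /=; by rewrite subrr normr0 mul0r.
have X1 : 0 <= X + A + Kc * X * A by rewrite !addr_ge0// !mulr_ge0// ltW.
have [K K0 HK] := IH _ X1.
have KA : 0 <= (1 + Kb * X) * A by rewrite mulr_ge0// addr_ge0// mulr_ge0// ltW.
exists (2 * ((1 + Kb * X) * A + K)) => [|[|u w] x sw wA xX].
- by rewrite mulr_ge0// addr_ge0.
- by move=> s t _ _ /=; rewrite subrr normr0 !mulr_ge0// addr_ge0.
have uA : `|u| <= A by apply: wA; rewrite inE eqxx.
apply: Lip1_cat.
- move=> s t s1 t1; apply: le_trans (HB x u s t) _; rewrite ler_wpM2r// ler_pM// ?addr_ge0// ?mulr_ge0// ?(ltW Kb0)//.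
  by rewrite lerD2l ler_pM2l.
- apply: HK => //; first by move=> v vw; apply: wA; rewrite inE vw orbT.
  apply: le_trans (ler_normD _ _) _; rewrite normrZ ger0_norm ?invr_ge0//.
  apply: lerD; first by apply: le_trans (ler_normD _ _) (lerD _ _).
  apply: le_trans (_ : Kc * `|x| * `|u| <= _).
    by apply: le_trans (HC x u); rewrite ler_piMl// invf_le1// ler1n.
  by rewrite ler_pM// ?mulr_ge0// ?(ltW Kc0)// ler_pM2l.
- by rewrite seg1 -/P P0.
Qed.

Lemma P_lipx x w : exists K, Lip1 (P x w) K.
Proof.
have [|K K0 HK] := @P_lip (size w) (\sum_(u <- w) `|u|) `|x| _ (normr_ge0 x).
  by apply: sumr_ge0.
exists K; apply: HK => // u uw; rewrite (big_rem u)//= lerDl; exact: sumr_ge0.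
Qed.

Lemma aff_lip (a b K : R) : `|a| <= K -> (forall s t, `|(a * s + b) - (a * t + b)| <= K * `|s - t|).
Proof. by move=> aK s t; rewrite opprD addrACA subrr addr0 -mulrBr normrM ler_wpM2r. Qed.

Lemma hom_assoc p q r K1 K2 K3 : Lip1 p K1 -> Lip1 q K2 -> Lip1 r K3 -> p 1 = q 0 -> q 1 = r 0 ->
  hom (cat (cat p q) r) (cat p (cat q r)) 0.
Proof.
move=> l1 l2 l3 pq qr.
(* The reparametrization of the bracketing has slopes 2, 1 and 1/2; being concave it is the minimum
   of three affine functions, hence Lipschitz. *)
pose t0 (s : R) : R := Num.min (Num.min (2 * s + 0) (1 * s + 4^-1)) (2^-1 * s + 2^-1).
pose al := cat p (cat q r).
have la : Lip1 al (2 * (K1 + 2 * (K2 + K3))) by apply: Lip1_cat => //; rewrite ?cat0//; apply: Lip1_cat.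
apply: (@hom_eq (al \o t0) (al \o id)) => //; last first.
  apply: (@hom_repar al t0 id _ 2 la).
  - apply: minr_lip; first apply: minr_lip; apply: aff_lip; rewrite ger0_norm//; lra.
  - by move=> s t; rewrite ler_peMl// ler1n.
  - move=> s s1; split => //; rewrite !le_min !ge_min; apply/andP; split; first by apply/andP; split; [apply/andP; split|]; lra.
    by apply/orP; right; lra.
  - by rewrite /t0 mulr0 addr0 min_l ?min_l//= ?le_min; lra.
  - by rewrite /t0 min_r; first (by rewrite mulr1; lra); rewrite le_min; apply/andP; split; lra.
move=> s s1; rewrite /= /al /cat; case: (leP s 2^-1) => s2; last first.
  have -> : t0 s = 2^-1 * s + 2^-1 by rewrite /t0 min_r// le_min; apply/andP; split; lra.
  have -> : (2^-1 * s + 2^-1 <= 2^-1) = false by apply/negbTE; rewrite -ltNge; lra.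
  have -> : (2 * (2^-1 * s + 2^-1) - 1 <= 2^-1) = false by apply/negbTE; rewrite -ltNge; lra.
  by congr r; field.
case: (leP (2 * s) 2^-1) => s3.
  have -> : t0 s = 2 * s by rewrite /t0 min_l ?addr0 ?min_l//; lra.
  by rewrite s3.
have -> : t0 s = s + 4^-1 by rewrite /t0 mul1r min_l min_r//; lra.
have -> : (s + 4^-1 <= 2^-1) = false by apply/negbTE; rewrite -ltNge; lra.
have -> : (2 * (s + 4^-1) - 1 <= 2^-1) by lra.
by congr q; field.
Qed.

Lemma hom_constl p K : Lip1 p K -> hom (cat (fun=> p 0) p) p 0.
Proof.
move=> pK; pose t0 (s : R) : R := Num.max ((0 : R) * s + 0) (2 * s + - 1).
apply: (@hom_eq (p \o t0) (p \o id)) => //; last first.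
  apply: (@hom_repar p t0 id _ 2 pK).
  - apply: maxr_lip; apply: aff_lip; rewrite ?normr0// ger0_norm//.
  - by move=> s t; rewrite ler_peMl// ler1n.
  - move=> s s1; split => //; rewrite le_max ge_max; apply/andP; split.
      by apply/orP; left; lra.
    by apply/andP; split; lra.
  - by rewrite /t0 mulr0 max_l//; lra.
  - by rewrite /t0 max_r; lra.
move=> s s1; rewrite /= /cat; case: (leP s 2^-1) => s2; congr p; rewrite /t0.
  by rewrite max_l; lra.
by rewrite max_r; lra.
Qed.

Lemma P_cat x a b : hom (P x (a ++ b)) (cat (P x a) (P (bch be x (wp a)) b)) 0.
Proof.
elim: a x => [|u a IH] x.
  apply: hom_sym; rewrite /= (bch0 nf); have [K HK] := P_lipx x b.
  by have := hom_constl HK; rewrite P0.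
have [K HK] := P_lipx (bch be x u) a.
have [K' HK'] := P_lipx (bch be x (wp (u :: a))) b.
have [Kb Kb0 HB] := seg_lip.
rewrite -[X in hom _ _ X](addr0 0); apply: hom_trans (hom_sym (hom_assoc (fun s t _ _ => HB x u s t) HK HK' _ _)).
- rewrite -[X in hom _ _ X](addr0 0) /=; apply: hom_cat; first exact: hom_refl (fun s t _ _ => HB x u s t).
    by rewrite (bchA nf); exact: IH.
  by rewrite seg1 P0.
- by rewrite seg1 P0.
- by rewrite P1 P0 /= (bchA nf).
Qed.

(** Uniformity in the base point [x] makes this relation compatible with concatenation. *)
Definition wr (w w' : seq E) A := wp w = wp w' /\ forall x, hom (P x w) (P x w') A.

Lemma wr_refl w : wr w w 0.
Proof. by split=> // x; have [K HK] := P_lipx x w; exact: hom_refl HK. Qed.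
Lemma wr_sym w w' A : wr w w' A -> wr w' w A.
Proof. by move=> [e h]; split=> // x; exact: hom_sym. Qed.
Lemma wr_trans w1 w2 w3 A B : wr w1 w2 A -> wr w2 w3 B -> wr w1 w3 (A + B).
Proof. by move=> [e h] [e' h']; split=> [|x]; [rewrite e|exact: hom_trans (h x) (h' x)]. Qed.
Lemma wr_le w w' A B : A <= B -> wr w w' A -> wr w w' B.
Proof. by move=> AB [e h]; split=> // x; exact: hom_le (h x). Qed.

Lemma wr_cat a a' b b' A B : wr a a' A -> wr b b' B -> wr (a ++ b) (a' ++ b') (A + B).
Proof.
move=> [e h] [e' h']; split=> [|x]; first by rewrite !wp_cat e e'.
rewrite -(add0r (A + B)) -(addr0 (0 + _)); apply: hom_trans (hom_sym (P_cat _ _ _)).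
apply: hom_trans (P_cat _ _ _) _; apply: hom_cat; rewrite ?P1 ?P0//; by rewrite e.
Qed.

Lemma wr0 : wr [:: 0] [::] 0.
Proof.
split=> [|x]; first by rewrite /wp /= (bch0 nf).
apply: (@hom_eq (fun=> x) (fun=> x)) => //; last first.
  by apply: (@hom_refl _ 0) => s t _ _; rewrite subrr normr0 mul0r.
by move=> s s1 /=; rewrite /cat /seg scaler0 (bch0 nf); case: ifP.
Qed.

Lemma wr_collinear a b u : wr [:: a *: u; b *: u] [:: (a + b) *: u] 0.
Proof.
have uu : be (a *: u) (b *: u) = 0 by rewrite (nfZl nf) (nfZr nf) (nfxx nf) !scaler0.
split=> [|x].
  by rewrite /wp /= !(bch0 nf) /bch uu scaler0 addr0 scalerDl.
have [Kb Kb0 HB] := seg_lip.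
(* Both paths move along a single line, so they differ by a change of parameter. The pauses come
   from the constant path that ends every word: [t1] reaches its end at time 1/2, and in [t0] the
   second letter occupies the times from 1/2 to 3/4. *)
pose t1 (s : R) : R := (a + b) * Num.min (2 * s + 0) ((0 : R) * s + 1).
pose t0 (s : R) : R := a * Num.min (2 * s + 0) ((0 : R) * s + 1) +
  b * Num.min (Num.max (4 * s + - 2) ((0 : R) * s + 0)) ((0 : R) * s + 1).
have l1 : forall s t : R, `|Num.min (2 * s + 0) ((0 : R) * s + 1) - Num.min (2 * t + 0) ((0 : R) * t + 1)| <= 4 * `|s - t|.
  by apply: minr_lip; apply: aff_lip; rewrite ?normr0// ger0_norm//; lra.
have l2 : forall s t : R, `|Num.min (Num.max (4 * s + - 2) ((0 : R) * s + 0)) ((0 : R) * s + 1) -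
   Num.min (Num.max (4 * t + - 2) ((0 : R) * t + 0)) ((0 : R) * t + 1)| <= 4 * `|s - t|.
  by apply: minr_lip; [apply: maxr_lip|]; apply: aff_lip; rewrite ?normr0// ger0_norm//.
have gl : forall s t, `|seg x u s - seg x u t| <= ((1 + Kb * `|x|) * `|u|) * `|s - t|.
  by move=> s t; exact: HB.
apply: (@hom_eq (seg x u \o t0) (seg x u \o t1)); last first.
- apply: (@hom_repar_gl _ _ _ _ (4 * (`|a| + `|b|)) gl).
  + move=> s t; rewrite /t0 [X in _ + X]opprD [X in `|X|]addrACA -!mulrBr; apply: le_trans (ler_normD _ _) _.
    rewrite !normrM mulrDr mulrDl -!mulrA; apply: lerD; rewrite [leRHS]mulrCA ler_wpM2l//.
  + move=> s t; rewrite /t1 -mulrBr normrM; apply: le_trans (ler_wpM2l (normr_ge0 (a + b)) (l1 s t)) _.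
    by rewrite mulrCA -mulrA ler_pM2l// ler_wpM2r// ler_normD.
  + rewrite /t0 /t1 !mulr0 !addr0 !add0r min_l// max_r; last lra.
    by rewrite min_l// !mulr0 addr0.
  + rewrite /t0 /t1 !mulr1 !addr0 !add0r min_r; last lra.
    by rewrite max_l; [rewrite min_r; lra|lra].
- move=> s s1; rewrite /= /cat /seg /t1; case: (leP s 2^-1) => s2.
    rewrite addr0 mul0r add0r min_l; last lra.
    by rewrite scalerA mulrC.
  by rewrite addr0 mul0r add0r min_r; [rewrite mulr1|lra].
move=> s s1; rewrite /= /cat /seg /t0 !mul0r !add0r !addr0; case: (leP s 2^-1) => s2.
  rewrite min_l; last lra.
  rewrite max_r; last lra.
  by rewrite min_l// mulr0 addr0 scalerA mulrC.
rewrite min_r; last lra.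
rewrite max_l; last lra.
have co c d : bch be (bch be x (c *: u)) (d *: u) = bch be x ((c + d) *: u).
  by rewrite -(bchA nf) [in RHS]scalerDl {2}/bch (nfZl nf) (nfZr nf) (nfxx nf) !scaler0 addr0.
case: (leP (2 * s - 1) 2^-1) => s3.
  rewrite min_l; last lra.
  by rewrite scalerA co mulr1; congr (bch _ _ (_ *: _)); ring.
by rewrite min_r; [rewrite co !mulr1|lra].
Qed.

Lemma bchN_ka : exists2 Kb, 0 < Kb & forall h h', `|bch be (- h) h'| <= (1 + Kb * `|h|) * `|h' - h|.
Proof.
have [Kb Kb0 HB] := nf_bound nf; exists Kb => // a b.
have -> : bch be (- a) b = (b - a) - 2^-1 *: be a (b - a).
  by rewrite /bch (nfBr nf) (nfxx nf) (nfNl nf) scalerN subr0 addrC [- a + b]addrC addrC.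
apply: le_trans (ler_normB _ _) _; rewrite normrZ ger0_norm ?invr_ge0// mulrDl mul1r lerD2l.
by apply: le_trans (HB a (b - a)); rewrite ler_piMl// invf_le1// ler1n.
Qed.

(** After left translation to the origin both paths stay in a ball determined by [k] and [A], where
    a straight homotopy has bounded area. *)
Lemma wr_bdd (k : nat) (A : R) : 0 <= A -> exists2 C, 0 <= C & forall w w',
  (size w <= k)%N -> (size w' <= k)%N -> (forall u, u \in w ++ w' -> `|u| <= A) -> wp w = wp w' ->
  wr w w' C.
Proof.
move=> A0; have [K K0 HK] := P_lip k A0 (lexx 0).
have [Kb Kb0 HB] := bchN_ka.
exists (Ci * ((1 + Kb * (2 * K)) * K) * ((1 + Kb * (2 * K)) * (2 * K))).
  by rewrite !mulr_ge0// ?(ltW Ci0)// addr_ge0// !mulr_ge0// ltW.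
move=> w w' sw sw' uA ww; split => // x.
have l1 : Lip1 (P 0 w) K by apply: HK; rewrite ?normr0// => u uw; apply: uA; rewrite mem_cat uw.
have l2 : Lip1 (P 0 w') K by apply: HK; rewrite ?normr0// => u uw; apply: uA; rewrite mem_cat uw orbT.
have bd v s : Lip1 (P 0 v) K -> 0 <= s <= 1 -> `|P 0 v s| <= K.
  move=> lv s1; have := lv s 0 s1 o01; rewrite P0 !subr0 => h; apply: le_trans h _.
  by rewrite ler_piMr//; case/andP: s1 => a b; rewrite ger0_norm.
have xE v s : P x v s = bch be x (P 0 v s) by rewrite -P_tr (bch0 nf).
apply: (@hom_eq (fun s => bch be x (P 0 w s)) (fun s => bch be x (P 0 w' s))) => [s _|s _|]; rewrite ?xE//.
apply: hom_lin => //.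
- by rewrite mulr_ge0.
- by rewrite addr_ge0// !mulr_ge0// ltW.
- move=> s s1; apply: le_trans (ler_normB _ _) _; have := bd _ _ l1 s1; have := bd _ _ l2 s1; lra.
- move=> s y s' y' s1 y1 s1' y1'; set h := fun x y => _ + _; cbv zeta; apply: le_trans (HB _ _) _; rewrite ler_wpM2r// lerD2l ler_pM2l//.
  rewrite /h; apply: le_trans (ler_normD _ _) _; rewrite !normrZ.
  have b1 := bd _ _ l1 s1; have b2 := bd _ _ l2 s1; case/andP: y1 => y0 y1.
  rewrite !ger0_norm ?subr_ge0//.
  have y2 : 0 <= 1 - y by rewrite subr_ge0.
  by have := ler_wpM2l y0 b2; have := ler_wpM2l y2 b1; lra.
- by rewrite !P0.
- by rewrite !P1 ww.
Qed.

(** The two letters span an abelian subgroup, in which group increments are ordinary differences.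
    The straight homotopy therefore has area quadratic in the size of the letters at every scale;
    each path is [8 * S]-Lipschitz, whence the constant 64. *)
Lemma wr_flat u u' : be u u' = 0 -> wr [:: u; u'] [:: u + u'] (64 * Ci * (`|u| + `|u'|) ^+ 2).
Proof.
move=> uu; pose S := `|u| + `|u'|.
have S0 : 0 <= S by rewrite addr_ge0.
have uu' : be u' u = 0 by rewrite -(oppr0 E) -uu -(nf_alt nf).
split=> [|x]; first by rewrite /wp /= !(bch0 nf) /bch uu scaler0 addr0.
have flat a b c d : be (a *: u + b *: u') (c *: u + d *: u') = 0.
  by rewrite (nfDl nf) !(nfDr nf) !(nfZl nf) !(nfZr nf) !(nfxx nf) uu uu' !scaler0 !addr0.
pose c0 s : E := cat (fun s => s *: u) (cat (fun s => u + s *: u') (fun=> u + u')) s.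
pose c1 s : E := cat (fun s => s *: (u + u')) (fun=> u + u') s.
have l0 : Lip1 c0 (8 * S).
  have -> : 8 * S = 2 * (S + 2 * (S + S / 2)) by field.
  apply: Lip1_cat; [|apply: Lip1_cat|].
  - move=> s t _ _; rewrite -scalerBl normrZ mulrC ler_wpM2r// /S lerDl//.
  - move=> s t _ _; rewrite opprD addrACA subrr add0r -scalerBl normrZ mulrC ler_wpM2r// /S lerDr//.
  - by move=> s t _ _; rewrite subrr normr0 !mulr_ge0.
  - by rewrite scale1r.
  - by rewrite cat0 scale0r scale1r addr0.
have l1 : Lip1 c1 (8 * S).
  have -> : 8 * S = 2 * (S + 3 * S) by ring.
  apply: Lip1_cat.
  - by move=> s t _ _; rewrite -scalerBl normrZ mulrC ler_wpM2r// ler_normD.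
  - by move=> s t _ _; rewrite subrr normr0 !mulr_ge0.
  - by rewrite scale1r.
have sp0 s : exists a b, c0 s = a *: u + b *: u'.
  rewrite /c0 /cat; case: ifP => _; first by exists (2 * s), 0; rewrite scale0r addr0.
  case: ifP => _; first by exists 1, (2 * (2 * s - 1)); rewrite scale1r.
  by exists 1, 1; rewrite !scale1r.
have sp1 s : exists a b, c1 s = a *: u + b *: u'.
  rewrite /c1 /cat; case: ifP => _; first by exists (2 * s), (2 * s); rewrite scalerDr.
  by exists 1, 1; rewrite !scale1r.
apply: (@hom_eq (fun s => bch be x (c0 s)) (fun s => bch be x (c1 s))).
- have f1 a : bch be (bch be x u) (a *: u') = bch be x (u + a *: u').
    by rewrite -(bchA nf) {2}/bch (nfZr nf) uu !scaler0 addr0.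
  move=> s s1; rewrite /= /c0 /cat /seg; case: ifP => // _; case: ifP => // _.
  by rewrite -[in RHS](scale1r u') f1 scale1r.
- by move=> s s1; rewrite /= /c1 /cat /seg; case: ifP.
apply: (@hom_le _ _ (Ci * (1 * (8 * S)) * (1 * (8 * S)))).
  by rewrite !mul1r -/S; rewrite le_eqVlt; apply/orP; left; apply/eqP; ring.
apply: hom_lin => //.
- by rewrite mulr_ge0.
- by rewrite mulr_ge0.
- move=> s s1.
  have b0 : `|c0 s| <= 2 * S.
    rewrite /c0 /cat; case: ifP => sh.
      rewrite normrZ ger0_norm; last lra.
      have := normr_ge0 u; have := normr_ge0 u'; rewrite /S; nra.
    case: ifP => sh'; last by apply: le_trans (ler_normD _ _) _; rewrite -/S; lra.
    apply: le_trans (ler_normD _ _) _; rewrite normrZ ger0_norm; last by move/negbT: sh; rewrite -ltNge => ?; lra.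
    by have := normr_ge0 u; have := normr_ge0 u'; rewrite /S; nra.
  have b1 : `|c1 s| <= 2 * S.
    rewrite /c1 /cat; case: ifP => sh; last by apply: le_trans (ler_normD _ _) _; rewrite -/S; lra.
    rewrite normrZ ger0_norm; last lra.
    by have := ler_normD u u'; rewrite -/S; have := normr_ge0 (u + u'); nra.
  by apply: le_trans (ler_normB _ _) _; lra.
- move=> s y s' y' _ _ _ _; set h := fun x y => _ + _; cbv zeta.
  have sp z v : exists a b, h z v = a *: u + b *: u'.
    have [a [b ab]] := sp0 z; have [c [d cd]] := sp1 z; rewrite /h ab cd.
    exists ((1 - v) * a + v * c), ((1 - v) * b + v * d).
    by apply/matrixP => i j; rewrite !mxE; ring.
  have [a [b ->]] := sp s y; have [c [d ->]] := sp s' y'.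
  by rewrite /bch (nfNl nf) flat oppr0 scaler0 addr0 mul1r addrC.
- by rewrite /c0 /c1 !cat0 !scale0r.
- by rewrite /c0 /c1 !cat1.
Qed.

Lemma hom_ka (x0 : E) (c0 c1 : R -> E) (K1 K2 M ka : R) :
  (forall h h', `|bch be (- h) h'| <= (1 + ka * `|h|) * `|h' - h|) -> 0 <= ka ->
  0 <= K1 -> 0 <= K2 -> 0 <= M -> Lip1 c0 K1 -> Lip1 c1 K1 ->
  (forall s, 0 <= s <= 1 -> `|c0 s| <= M /\ `|c1 s| <= M) ->
  (forall s, 0 <= s <= 1 -> `|c1 s - c0 s| <= K2) -> c0 0 = c1 0 -> c0 1 = c1 1 ->
  hom (fun s => bch be x0 (c0 s)) (fun s => bch be x0 (c1 s))
    (Ci * (1 + ka * M) ^+ 2 * (K1 * K2)).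
Proof.
move=> HB ka0 K10 K20 M0 l1 l2 bd dd e0 e1.
have kM : 0 <= 1 + ka * M by rewrite addr_ge0// mulr_ge0.
apply: (@hom_le _ _ (Ci * ((1 + ka * M) * K1) * ((1 + ka * M) * K2))).
  by rewrite le_eqVlt; apply/orP; left; apply/eqP; ring.
apply: hom_lin => //.
move=> s y s' y' s1 y1 s1' y1'; set h := fun x y => _ + _; cbv zeta.
apply: le_trans (HB _ _) _; rewrite ler_wpM2r// lerD2l ler_wpM2l//.
rewrite /h; apply: le_trans (ler_normD _ _) _; rewrite !normrZ.
have [b1 b2] := bd s s1; case/andP: y1 => y0 y1; rewrite !ger0_norm ?subr_ge0//.
have y2 : 0 <= 1 - y by rewrite subr_ge0.
by have := ler_wpM2l y0 b2; have := ler_wpM2l y2 b1; lra.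
Qed.

Lemma fil_al (al : R -> E) (A B K Kt : R) (t0 t1 : R -> R) : A <= B -> 0 <= K ->
  (forall s t, A <= s <= B -> A <= t <= B -> `|al s - al t| <= K * `|s - t|) ->
  (forall s t, 0 <= s <= 1 -> 0 <= t <= 1 -> `|t0 s - t0 t| <= Kt * `|s - t|) ->
  (forall s t, 0 <= s <= 1 -> 0 <= t <= 1 -> `|t1 s - t1 t| <= Kt * `|s - t|) ->
  (forall s, 0 <= s <= 1 -> A <= t0 s <= B /\ A <= t1 s <= B) ->
  fil (fun x y => al ((1 - y) * t0 x + y * t1 x)) 0.
Proof.
move=> AB K0 alK k0 k1 r01.
pose pr (t : R) := Num.max A (Num.min t B).
have prAB t : A <= pr t <= B by rewrite /pr le_max lexx /= ge_max AB ge_min lexx orbT.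
have prE t : A <= t <= B -> pr t = t by move=> /andP[a b]; rewrite /pr min_l// max_r.
have prK : forall s t, `|pr s - pr t| <= 1 * `|s - t|.
  apply: maxr_lip => [s t|]; first by rewrite subrr normr0 mul1r.
  by apply: minr_lip => s t; rewrite mul1r// subrr normr0.
apply: (@fil_ext (fun x y => (al \o pr) ((1 - y) * t0 x + y * t1 x))).
  move=> x y x1 /andP[y0 y1]; rewrite /= prE//; have [/andP[a b] /andP[c d]] := r01 x x1.
  have y2 : 0 <= 1 - y by rewrite subr_ge0.
  have := ler_wpM2l y0 c; have := ler_wpM2l y0 d; have := ler_wpM2l y2 a; have := ler_wpM2l y2 b.
  by move=> *; apply/andP; split; lra.
apply: (@fil0 _ K Kt).
  move=> s t; apply: le_trans (alK _ _ (prAB s) (prAB t)) _; rewrite ler_wpM2l//.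
  by have := prK s t; rewrite mul1r.
by move=> []; [exact: k1|exact: k0].
Qed.

Lemma hom_al (al : R -> E) (A B K Kt : R) (t0 t1 : R -> R) : A <= B -> 0 <= K ->
  (forall s t, A <= s <= B -> A <= t <= B -> `|al s - al t| <= K * `|s - t|) ->
  (forall s t, 0 <= s <= 1 -> 0 <= t <= 1 -> `|t0 s - t0 t| <= Kt * `|s - t|) ->
  (forall s t, 0 <= s <= 1 -> 0 <= t <= 1 -> `|t1 s - t1 t| <= Kt * `|s - t|) ->
  (forall s, 0 <= s <= 1 -> A <= t0 s <= B /\ A <= t1 s <= B) ->
  t0 0 = t1 0 -> t0 1 = t1 1 -> hom (al \o t0) (al \o t1) 0.
Proof.
move=> AB K0 alK k0 k1 r01 e0 e1; exists (fun x y => al ((1 - y) * t0 x + y * t1 x)); split.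
- exact: (fil_al AB K0 alK k0 k1 r01).
- by move=> x _; rewrite subr0 subrr !mul1r !mul0r addr0 add0r.
- by move=> y _; rewrite /= e0 e1 -!mulrDl subrK !mul1r.
Qed.

Lemma wr_intro w w' A : wp w = wp w' ->
  (forall x, hom (fun s => bch be x (P 0 w s)) (fun s => bch be x (P 0 w' s)) A) -> wr w w' A.
Proof.
move=> ww h; split=> // x; have xE v s : bch be x (P 0 v s) = P x v s by rewrite -P_tr (bch0 nf).
by apply: hom_eq (h x) => s _; exact: xE.
Qed.

(** The area is linear in [|v|]: the paths have bounded speed and are [O(|v|)] apart. A constant
    bound per triangle would depend on the number of letters instead of their total length. *)
Lemma wr_tri : exists2 C, 0 <= C & forall u v, `|u| <= 1 -> `|v| <= 1 ->
  wr [:: u; v] [:: bch be u v] (C * `|v|).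
Proof.
have [Kn Kn0 HKn] := nf_bound nf; have A0 : 0 <= 2 + Kn by rewrite addr_ge0// ltW.
have [K K0 HK] := P_lip 2 A0 (lexx 0).
have [Kb Kb0 HB] := bchN_ka.
exists (Ci * (1 + Kb * K) ^+ 2 * (K * (2 + 2 * Kn))).
  by rewrite !mulr_ge0// ?(ltW Ci0)// ?sqr_ge0// addr_ge0// mulr_ge0// ltW.
move=> u v u1 v1; set z := bch be u v.
have bv : `|be u v| <= Kn * `|v|.
  by apply: le_trans (HKn u v) _; rewrite ler_wpM2r// -[leRHS]mulr1 ler_pM2l.
have bv1 : `|be u v| <= Kn by apply: le_trans bv _; rewrite ler_piMr// ltW.
have h2 (w : E) : `|2^-1 *: w| <= `|w| by rewrite normrZ ger0_norm ?invr_ge0// ler_piMl// invf_le1// ler1n.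
have zb : `|z| <= 2 + Kn.
  apply: le_trans (ler_normD _ _) _; apply: lerD; last exact: le_trans (h2 _) bv1.
  by apply: le_trans (ler_normD _ _) _; lra.
have l1 : Lip1 (P 0 [:: u; v]) K.
  by apply: HK; rewrite ?normr0// => w; rewrite !inE => /orP[]/eqP->; have := ltW Kn0; lra.
have l2 : Lip1 (P 0 [:: z]) K by apply: HK; rewrite ?normr0// => w; rewrite !inE => /eqP->.
have bd w s : Lip1 (P 0 w) K -> 0 <= s <= 1 -> `|P 0 w s| <= K.
  move=> lv s1; have := lv s 0 s1 o01; rewrite P0 !subr0 => h; apply: le_trans h _.
  by rewrite ler_piMr//; case/andP: s1 => a b; rewrite ger0_norm.
apply: wr_intro => [|x]; first by rewrite /wp /= !(bch0 nf).
rewrite -[X in hom _ _ X]mulrA -(mulrA K).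
have K2 : 0 <= (2 + 2 * Kn) * `|v| by rewrite mulr_ge0// addr_ge0// mulr_ge0// ltW.
apply: hom_ka => //; first exact: ltW.
- by move=> s s1; split; exact: bd.
- move=> s s1 /=; rewrite /cat /seg !(bch0l nf); case: ifP => sh.
    have -> : (2 * s) *: z - (2 * s) *: u = (2 * s) *: (v + 2^-1 *: be u v).
      by rewrite -scalerBr /z /bch; congr (_ *: _); zmodc.
    rewrite normrZ ger0_norm; last by case/andP: s1 => a b; rewrite mulr_ge0.
    apply: (@le_trans _ _ (1 * `|v + 2^-1 *: be u v|)); first by rewrite ler_wpM2r//; lra.
    rewrite mul1r; apply: le_trans (ler_normD _ _) _; have := h2 (be u v).
    by have := normr_ge0 v; have := mulr_ge0 (ltW Kn0) (normr_ge0 v); lra.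
  case: ifP => sh'; last by rewrite subrr normr0.
  set a := 2 * (2 * s - 1).
  have a01 : 0 <= a <= 1 by rewrite /a; move/negbT: sh; rewrite -ltNge => ?; lra.
  have -> : z - bch be u (a *: v) = (1 - a) *: (v + 2^-1 *: be u v).
    by rewrite /z /bch (nfZr nf); apply/matrixP => i j; rewrite !mxE; ring.
  rewrite normrZ ger0_norm; last lra.
  apply: (@le_trans _ _ (1 * `|v + 2^-1 *: be u v|)); first by rewrite ler_wpM2r//; lra.
  rewrite mul1r; apply: le_trans (ler_normD _ _) _; have := h2 (be u v).
  by have := normr_ge0 v; have := mulr_ge0 (ltW Kn0) (normr_ge0 v); lra.
- by rewrite !P0.
- by rewrite !P1 /wp /= !(bch0 nf).
Qed.

Definition wlen (w : seq E) : R := \sum_(u <- w) `|u|.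

Lemma wlen_ge0 w : 0 <= wlen w. Proof. exact: sumr_ge0. Qed.
Lemma wlen_cons u w : wlen (u :: w) = `|u| + wlen w. Proof. by rewrite /wlen big_cons. Qed.
Lemma wlen_cat a b : wlen (a ++ b) = wlen a + wlen b. Proof. by rewrite /wlen big_cat. Qed.

(** The letters are absorbed one by one with [wr_tri]. The choice [Kn * d <= 1] keeps every partial
    product below twice the length used so far, hence below 1. *)
Lemma wr_short : exists C d, [/\ 0 <= C, 0 < d & forall w, wlen w <= d ->
  wr w [:: wp w] C /\ `|wp w| <= 1].
Proof.
have [Kn Kn0 HKn] := nf_bound nf; have [C C0 HC] := wr_tri.
pose d := Num.min 2^-1 Kn^-1; have d0 : 0 < d by rewrite lt_min !invr_gt0 Kn0 andbT.
have dh : d <= 2^-1 by rewrite ge_min lexx.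
have dK s : s <= d -> Kn * s <= 1.
  by move=> sd; rewrite -ler_pdivlMl// mulr1; apply: le_trans sd _; rewrite ge_min lexx orbT.
exists (C * d), d; split; [by rewrite mulr_ge0// ltW|by []|].
have main w : forall x s, 0 <= s -> `|x| <= 2 * s -> s + wlen w <= d ->
    wr (x :: w) [:: bch be x (wp w)] (C * wlen w) /\ `|bch be x (wp w)| <= 2 * (s + wlen w).
  elim: w => [|u w IH] x s s0 xs sd.
    by rewrite /wlen big_nil mulr0 addr0 /= (bch0 nf); split => //; exact: wr_refl.
  rewrite wlen_cons in sd *; have u0 := normr_ge0 u; have w0 := wlen_ge0 w.
  have s1 : s <= d by lra.
  have xu : `|bch be x u| <= 2 * (s + `|u|).
    apply: le_trans (ler_normD _ _) _; rewrite normrZ ger0_norm ?invr_ge0//.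
    have b1 := HKn x u.
    have b2 : Kn * `|x| * `|u| <= 2 * `|u|.
      rewrite ler_wpM2r//; apply: (@le_trans _ _ (2 * (Kn * s))); last by have := dK s s1; lra.
      by rewrite mulrCA ler_pM2l.
    by have := ler_normD x u; lra.
  have [|||h hb] := IH (bch be x u) (s + `|u|); [lra|exact: xu|lra|].
  split; last by rewrite /= (bchA nf) addrA.
  rewrite mulrDr /= (bchA nf); apply: wr_trans h.
  rewrite -[x :: _]/([:: x; u] ++ w) -[_ :: w]/([:: bch be x u] ++ w) -[C * _]addr0.
  apply: wr_cat (wr_refl _); apply: HC; lra.
move=> w wd; have [||| h hb] := main w 0 0; rewrite ?normr0 ?mulr0 ?add0r//.
rewrite (bch0l nf) in h hb; rewrite add0r in hb; split; last by have := wlen_ge0 w; lra.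
rewrite -(add0r (C * d)); apply: wr_trans (wr_le _ h); last by rewrite ler_wpM2l.
by rewrite -[0 :: w]/([:: 0] ++ w) -[w in wr w]cat0s -(addr0 0); apply: wr_cat (wr_refl _); exact: wr_sym wr0.
Qed.

(** Letters are collected greedily in a pending word [p] of length at most [d]. When the next letter
    would overflow, [p] is replaced by its product and the letter is kept: two letters for a length
    of more than [d], so [D = 2 / d]. The number of letters becomes proportional to length. *)
Lemma wr_group : exists C D, [/\ 0 <= C, 0 <= D & forall w, (forall u, u \in w -> `|u| <= 1) ->
  exists w', [/\ wr w w' (C * (wlen w + 1)), (size w')%:R <= D * wlen w + 1 &
    forall u, u \in w' -> `|u| <= 1]].
Proof.
have [C [d [C0 d0 H]]] := wr_short.
pose D := 2 / d; have D0 : 0 <= D by rewrite divr_ge0// ltW.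
exists (C * (1 + D)), D; split => //; first by rewrite mulr_ge0// addr_ge0.
have main w : (forall u, u \in w -> `|u| <= 1) -> forall p, wlen p <= d ->
    exists w', [/\ wr (p ++ w) w' (C * (size w')%:R), (size w')%:R <= D * (wlen p + wlen w) + 1 &
    forall u, u \in w' -> `|u| <= 1].
  elim: w => [|u w IH] wb p pd.
    have [h hb] := H p pd; exists [:: wp p]; split.
    - by rewrite cats0 mulr1.
    - by rewrite lerDr mulr_ge0// addr_ge0// wlen_ge0.
    - by move=> u; rewrite inE => /eqP->.
  have wb' v : v \in w -> `|v| <= 1 by move=> vw; apply: wb; rewrite inE vw orbT.
  have [pu|pu] := leP (wlen p + `|u|) d.
    have [|w' [h hs hb]] := IH wb' (p ++ [:: u]).
      by rewrite wlen_cat wlen_cons /wlen big_nil addr0.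
    exists w'; split => //; first by move: h; rewrite -catA.
    by move: hs; rewrite wlen_cat wlen_cons [wlen [::]]/wlen big_nil addr0 wlen_cons addrA.
  have [|w' [h hs hb]] := IH wb' [::]; first by rewrite /wlen big_nil ltW.
  have [hp hpb] := H p pd.
  exists (wp p :: u :: w'); split.
  - rewrite -[wp p :: _]/([:: wp p] ++ [:: u] ++ w') -[u :: w]/([:: u] ++ w).
    rewrite (_ : C * _ = C + (C + C * (size w')%:R)); last by rewrite -natr1 -natr1; ring.
    apply: wr_cat hp _; apply: wr_cat _ h; apply: wr_le C0 (wr_refl _).
  - rewrite -natr1 -natr1 wlen_cons; move: hs; rewrite [wlen [::]]/wlen big_nil add0r.
    have : 2 <= D * (wlen p + `|u|) by rewrite /D mulrAC ler_pdivlMr// ler_pM2l// ltW.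
    lra.
  - by move=> v; rewrite !inE => /or3P[/eqP->//|/eqP->|/hb//]; apply: wb; rewrite inE eqxx.
move=> w wb; have [|w' [h hs hb]] := main w wb [::]; first by rewrite /wlen big_nil ltW.
rewrite [wlen [::]]/wlen big_nil add0r in hs; exists w'; split => //.
apply: wr_le h; rewrite -mulrA ler_wpM2l//; apply: le_trans hs _.
by have w0 := wlen_ge0 w; have := mulr_ge0 D0 w0; lra.
Qed.

(** The curve and its inscribed polygon with [M] sides: on each side both paths have speed
    [O(1 / M)] and distance [O(1 / M)], so a side costs [O(1 / M^2)] and the total tends to 0. *)
Lemma hom_poly (c : R -> E) (K : R) : 0 <= K -> Lip1 c K -> exists2 D, 0 <= D & forall M : nat, (0 < M)%N ->
  hom c (P (c 0) [seq bch be (- c (i%:R / M%:R)) (c (i.+1%:R / M%:R)) | i <- iota 0 M]) (D / M%:R).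
Proof.
move=> K0 cK.
have [Kn Kn0 HKn] := nf_bound nf; have [Kb Kb0 HB] := bchN_ka.
pose X := `|c 0| + K; have X0 : 0 <= X by rewrite addr_ge0.
have cX s : 0 <= s <= 1 -> `|c s| <= X.
  move=> s1; have := cK s 0 s1 o01; rewrite subr0 => h.
  have -> : c s = c 0 + (c s - c 0) by zmod.
  apply: le_trans (ler_normD _ _) _; rewrite lerD2l; apply: le_trans h _.
  by rewrite ler_piMr//; case/andP: s1 => a b; rewrite ger0_norm.
pose K' := (1 + Kn * X) * K; have K'0 : 0 <= K' by rewrite mulr_ge0// addr_ge0// mulr_ge0// ltW.
pose D := Ci * (1 + Kb * K') ^+ 2 * (K' * (2 * K')).
have D0 : 0 <= D.
  by apply: mulr_ge0; [apply: mulr_ge0; [exact: ltW|exact: sqr_ge0]|apply: mulr_ge0 => //; exact: mulr_ge0].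
exists D => // M M0; have m0 : 0 < M%:R :> R by rewrite ltr0n.
have m1 : (M%:R)^-1 <= 1 :> R by rewrite invf_le1// ler1n.
pose t i : R := i%:R / M%:R; pose u i := bch be (- c (t i)) (c (t i.+1)).
have tS i : t i.+1 = t i + (M%:R)^-1 by rewrite /t -natr1 mulrDl mul1r.
have t01 i : (i <= M)%N -> 0 <= t i <= 1.
  by move=> iM; rewrite /t divr_ge0//= ler_pdivrMr// mul1r ler_nat.
have piece i : (i < M)%N -> hom (fun s => c (t i + s / M%:R)) (seg (c (t i)) (u i)) (D / M%:R ^+ 2).
  move=> iM; pose c0 s := bch be (- c (t i)) (c (t i + s / M%:R)).
  have ti := t01 i (ltnW iM).
  have ts s : 0 <= s <= 1 -> 0 <= t i + s / M%:R <= 1.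
    move=> /andP[s0 s1]; have := t01 i.+1 iM; rewrite tS => /andP[_ h].
    have : s / M%:R <= M%:R^-1 by rewrite ler_piMl// invr_ge0 ltW.
    by have : 0 <= s / M%:R by [rewrite divr_ge0// ltW]; case/andP: ti => a b *; lra.
  have L1 : Lip1 c0 (K' / M%:R).
    move=> s s' s1 s1'.
    have -> : c0 s - c0 s' = (c (t i + s / M%:R) - c (t i + s' / M%:R)) -
        2^-1 *: be (c (t i)) (c (t i + s / M%:R) - c (t i + s' / M%:R)).
      by rewrite /c0 /bch !(nfNl nf) (nfBr nf); apply/matrixP => k l; rewrite !mxE; ring.
    set dc := _ - c (t i + s' / M%:R).
    have dcb : `|dc| <= K / M%:R * `|s - s'|.
      apply: le_trans (cK _ _ (ts s s1) (ts s' s1')) _.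
      rewrite (_ : _ - _ = (s - s') / M%:R); last by ring.
      by rewrite normrM (gtr0_norm (_ : 0 < M%:R^-1)) ?invr_gt0// mulrA mulrAC.
    apply: le_trans (ler_normB _ _) _; rewrite normrZ ger0_norm ?invr_ge0//.
    have := HKn (c (t i)) dc.
    have h1 : Kn * `|c (t i)| * `|dc| <= Kn * X * `|dc| by rewrite ler_wpM2r// ler_pM2l// cX.
    have k1 : 0 <= 1 + Kn * X by rewrite addr_ge0// mulr_ge0// ltW.
    have := ler_wpM2l k1 dcb; have := normr_ge0 (be (c (t i)) dc).
    rewrite /K' (_ : (1 + Kn * X) * (K / M%:R * `|s - s'|) = (1 + Kn * X) * K / M%:R * `|s - s'|); last by ring.
    lra.
  have c00 : c0 0 = 0 by rewrite /c0 mul0r addr0 (bchNl nf).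
  have c01 : c0 1 = u i by rewrite /c0 mul1r /u tS.
  have KM0 : 0 <= K' / M%:R by rewrite divr_ge0// ltW.
  have b0 s : 0 <= s <= 1 -> `|c0 s| <= K' / M%:R.
    move=> s1; have := L1 s 0 s1 o01; rewrite c00 !subr0 => h; apply: le_trans h _.
    by rewrite ler_piMr//; case/andP: s1 => a b; rewrite ger0_norm.
  have ub : `|u i| <= K' / M%:R by rewrite -c01; exact: b0 i01.
  have b1 s : 0 <= s <= 1 -> `|s *: u i| <= K' / M%:R.
    move=> /andP[a b]; rewrite normrZ ger0_norm//; apply: le_trans ub; exact: ler_piMl.
  apply: (@hom_eq (fun s => bch be (c (t i)) (c0 s)) (fun s => bch be (c (t i)) (s *: u i))) => //.
    by move=> s _; rewrite /c0 (bchKr nf).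
  apply: (@hom_le _ _ (Ci * (1 + Kb * K') ^+ 2 * (K' / M%:R * (2 * (K' / M%:R))))).
    rewrite /D le_eqVlt; apply/orP; left; apply/eqP; field; exact: lt0r_neq0.
  apply: hom_ka => //; first exact: ltW.
  - exact: mulr_ge0.
  - by move=> s s' s1 s1'; rewrite -scalerBl normrZ mulrC ler_wpM2r.
  - by move=> s s1; split; [apply: le_trans (b0 s s1) _|apply: le_trans (b1 s s1) _]; rewrite ler_piMr.
  - by move=> s s1; apply: le_trans (ler_normB _ _) _; have := b0 s s1; have := b1 s s1; lra.
  - by rewrite c00 scale0r.
  - by rewrite scale1r.
(* The induction adds sides at the beginning, in accordance with the recursion of [P]; the remaining
   curve from [t (M - k)] to 1 is rescaled to the unit interval. *)
have main k : (k <= M)%N -> hom (fun s => c (t (M - k)%N + (1 - t (M - k)%N) * s))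
    (P (c (t (M - k)%N)) [seq u i | i <- iota (M - k) k]) (k%:R * (D / M%:R ^+ 2)).
  elim: k => [_|k IH kM].
    rewrite subn0 mul0r /=; have tM : t M = 1 by rewrite /t divff// gt_eqF.
    apply: (@hom_eq (fun=> c (t M)) (fun=> c (t M))) => //; last first.
      by apply: (@hom_refl _ 0) => s s' _ _; rewrite subrr normr0 mul0r.
    by move=> s _; rewrite tM subrr mul0r addr0.
  have kM' : (k <= M)%N by exact: ltnW.
  set j := (M - k.+1)%N; have jS : (M - k)%N = j.+1 by rewrite /j subnSK.
  have jM : (j < M)%N by rewrite -jS leq_subr.
  have {IH} := IH kM'; rewrite jS => IH.
  have tj := t01 j (ltnW jM); have tj' := t01 j.+1 jM.
  have tt : t j <= t j.+1 by rewrite tS lerDl invr_ge0 ltW.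
  rewrite /= -natr1 mulrDl mul1r [X in hom _ _ X]addrC.
  rewrite -[X in hom _ _ X]add0r.
  apply: (@hom_trans _ (cat (fun s => c (t j + s / M%:R)) (fun s => c (t j.+1 + (1 - t j.+1) * s)))).
    pose t1 := @cat R R^o (fun s => t j + s / M%:R) (fun s => t j.+1 + (1 - t j.+1) * s).
    have t1K : exists K, Lip1 t1 K.
      exists (2 * (M%:R^-1 + (1 - t j.+1))); apply: Lip1_cat.
      - move=> s s' _ _; rewrite opprD addrACA subrr add0r -mulrBl normrM mulrC ler_wpM2r//.
        by rewrite ger0_norm ?invr_ge0// ltW.
      - move=> s s' _ _; rewrite opprD addrACA subrr add0r -mulrBr normrM ler_wpM2r//.
        by rewrite ger0_norm// subr_ge0; case/andP: tj'.
      - by rewrite mul1r tS mulr0 addr0.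
    have [Kt HKt] := t1K.
    apply: (@hom_eq (c \o (fun s => t j + (1 - t j) * s)) (c \o t1)) => //.
      by move=> s _; rewrite /= /t1 /cat; case: ifP.
    apply: (@hom_al c 0 1 K (`|Kt| + 1)) => //.
    - move=> s s' _ _; rewrite opprD addrACA subrr add0r -mulrBr normrM ler_wpM2r//.
      by rewrite ger0_norm; case/andP: tj => *; have := normr_ge0 Kt; lra.
    - move=> s s' s1 s1'; apply: le_trans (HKt s s' s1 s1') _; rewrite ler_wpM2r//.
      by have := ler_norm Kt; lra.
    - move=> s s1; split.
        by case/andP: tj => a b; case/andP: s1 => e f; apply/andP; split; nra.
      rewrite /t1 /cat; case: ifP => sh.
        have : 0 <= (2 * s) / M%:R <= M%:R^-1.
          have i0 : 0 <= M%:R^-1 :> R by rewrite invr_ge0 ltW.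
          by apply/andP; split; [apply: mulr_ge0 => //; lra|rewrite ler_piMl//; lra].
        by rewrite tS in tj'; move=> ?; lra.
      move/negbT: sh; rewrite -ltNge => sh; case/andP: tj' => a b; case/andP: s1 => e f.
      by apply/andP; split; nra.
    - by rewrite /t1 cat0 mulr0 mul0r.
    - by rewrite /t1 cat1 !mulr1 addrC subrK addrC subrK.
  have := hom_cat (piece j jM) IH; rewrite mul1r -tS mulr0 addr0 => /(_ erefl).
  by rewrite {2}/u (bchKr nf).
have := main M (leqnn M); rewrite subnn (_ : t 0 = 0); last by rewrite /t mul0r.
have -> : M%:R * (D / M%:R ^+ 2) = D / M%:R by field; exact: lt0r_neq0.
by apply: hom_eq => // s _; rewrite subr0 mul1r add0r.
Qed.

Definition sq (H : R -> R -> E) (b r t l : R -> E) A := [/\ fil H A,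
  forall s, 0 <= s <= 1 -> H s 0 = b s /\ H s 1 = t s &
  forall s, 0 <= s <= 1 -> H 0 s = l s /\ H 1 s = r s].

Lemma sq_ext H b r t l b' r' t' l' A : sq H b r t l A ->
  (forall s, 0 <= s <= 1 -> [/\ b s = b' s, r s = r' s, t s = t' s & l s = l' s]) -> sq H b' r' t' l' A.
Proof.
move=> [f h1 h2] e; split => // s s1; have [e1 e2 e3 e4] := e s s1.
  by rewrite -e1 -e3; exact: h1.
by rewrite -e2 -e4; exact: h2.
Qed.

Lemma sq_tr H b r t l A : sq H b r t l A -> sq (fun x y => H y x) l t r b A.
Proof. by move=> [f h1 h2]; split; [exact: fil_tr|exact: h2|exact: h1]. Qed.

Lemma sq_y H1 H2 b r1 m l1 r2 t l2 A1 A2 : sq H1 b r1 m l1 A1 -> sq H2 m r2 t l2 A2 ->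
  sq (glue H1 H2) b (cat r1 r2) t (cat l1 l2) (A1 + A2).
Proof.
move=> [f h1 h2] [f' h1' h2']; split.
- by apply: fil_glue => // s s1; rewrite (h1 s s1).2 (h1' s s1).1.
- move=> s s1; rewrite /glue invr_ge0 ler0n mulr0 (_ : (1 <= 2^-1 :> R) = false); last first.
    by apply/negbTE; rewrite -ltNge; lra.
  have -> : 2 * 1 - 1 = 1 :> R by ring.
  by rewrite (h1 s s1).1 (h1' s s1).2.
- move=> s s1; rewrite /glue /cat; case: (leP s 2^-1) => sh; first by apply: h2; lra.
  by apply: h2'; lra.
Qed.

Lemma sq_x H1 H2 b1 m t1 l b2 r t2 A1 A2 : sq H1 b1 m t1 l A1 -> sq H2 b2 r t2 m A2 ->
  sq (fun x y => glue (fun x y => H1 y x) (fun x y => H2 y x) y x) (cat b1 b2) r (cat t1 t2) l (A1 + A2).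
Proof.
move=> h h'; apply: (@sq_tr (glue (fun x y => H1 y x) (fun x y => H2 y x))).
by apply: sq_y; [exact: sq_tr h|exact: sq_tr h'].
Qed.

Definition lipx (t : R -> R) := exists K, @Lip1 R R^o t K.

Lemma lipx_aff a b : lipx (fun s => a + b * s).
Proof.
by exists `|b| => s s' _ _; rewrite opprD addrACA subrr add0r -mulrBr normrM.
Qed.

Lemma lipx_cat (t0 t1 : R -> R) : lipx t0 -> lipx t1 -> t0 1 = t1 0 -> lipx (@cat R R^o t0 t1).
Proof. by move=> [K0 h0] [K1 h1] e; exists (2 * (K0 + K1)); exact: Lip1_cat. Qed.

Lemma sq_al (al : R -> E) (B K : R) (t0 t1 : R -> R) : 0 <= B -> 0 <= K ->
  (forall s t, 0 <= s <= B -> 0 <= t <= B -> `|al s - al t| <= K * `|s - t|) ->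
  lipx t0 -> lipx t1 -> (forall s, 0 <= s <= 1 -> 0 <= t0 s <= B /\ 0 <= t1 s <= B) ->
  sq (fun x y => al ((1 - y) * t0 x + y * t1 x)) (fun s => al (t0 s)) (fun s => al ((1 - s) * t0 1 + s * t1 1))
    (fun s => al (t1 s)) (fun s => al ((1 - s) * t0 0 + s * t1 0)) 0.
Proof.
move=> B0 K0 alK [K1 h1] [K2 h2] r01; split.
- apply: (@fil_al al 0 B K (`|K1| + `|K2|)) => // s t s1 t1'.
    apply: le_trans (h1 s t s1 t1') _; rewrite ler_wpM2r//.
    by have := ler_norm K1; have := normr_ge0 K2; lra.
  apply: le_trans (h2 s t s1 t1') _; rewrite ler_wpM2r//.
  by have := ler_norm K2; have := normr_ge0 K1; lra.
- by move=> s _; rewrite subr0 subrr !mul1r !mul0r addr0 add0r.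
- by [].
Qed.

(* A homotopy between the two halves of a loop fills a square whose boundary runs along the loop
   at constant speed, starting at the corner (1, 0); everything added to the homotopy is degenerate. *)
Lemma square (al : R -> E) (q K A : R) : 0 < q -> 0 <= K ->
  (forall s t, 0 <= s <= 8 * q -> 0 <= t <= 8 * q -> `|al s - al t| <= K * `|s - t|) ->
  al 0 = al (8 * q) -> hom (fun s => al (4 * q + 4 * q * s)) (fun s => al (4 * q + - 4 * q * s)) A ->
  exists2 H, fil H A & forall s, 0 <= s <= 1 -> [/\ H s 0 = al (5 * q + 2 * q * s),
    H s 1 = al (3 * q - 2 * q * s), H 0 s = al (5 * q - 2 * q * s) &
    H 1 s = if s <= 2^-1 then al (7 * q + 2 * q * s) else al (2 * q * s - q)].
Proof.
move=> q0 K0 alK al8 [H [f h1 h2]].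
have B0 : 0 <= 8 * q by lra.
have lo := sq_al B0 K0 alK.
(* [tm] rests at both ends of the first half of the loop, and [tn] extends the second half by short
   arcs. The degenerate strips around the homotopy place the corners of the square at odd multiples
   of [q], which correspond to the corners of the square inscribed in the circle. *)
pose tm := @cat R R^o (fun s => 4 * q + 0 * s) (@cat R R^o (fun s => 4 * q + 4 * q * s) (fun s => 8 * q + 0 * s)).
pose tn := @cat R R^o (fun s => 7 / 2 * q + q / 2 * s) (@cat R R^o (fun s => 4 * q + - 4 * q * s) (fun s => 0 + q / 2 * s)).
have ltm : lipx tm.
  by do ?apply: lipx_cat; rewrite ?cat0; try exact: lipx_aff; lra.
have ltn : lipx tn.
  by do ?apply: lipx_cat; rewrite ?cat0; try exact: lipx_aff; lra.
have rtm s : 0 <= s <= 1 -> 0 <= 5 * q + 2 * q * s <= 8 * q /\ 0 <= tm s <= 8 * q.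
  move=> s1; split; first nra.
  by rewrite /tm /cat; case: ifP => sh; [lra|case: ifP => sh'; [nra|lra]].
have rtn s : 0 <= s <= 1 -> 0 <= tn s <= 8 * q /\ 0 <= 3 * q + - 2 * q * s <= 8 * q.
  move=> s1; split; last nra.
  by rewrite /tn /cat; case: ifP => sh; [nra|move/negbT: sh; rewrite -ltNge => sh; case: ifP => sh'; nra].
have rq1 s : 0 <= s <= 1 -> 0 <= 4 * q + 0 * s <= 8 * q /\ 0 <= 7 / 2 * q + q / 2 * s <= 8 * q.
  by move=> s1; split; nra.
have rq2 s : 0 <= s <= 1 -> 0 <= 0 + 0 * s <= 8 * q /\ 0 <= 0 + q / 2 * s <= 8 * q.
  by move=> s1; split; nra.
have tm0 : tm 0 = 4 * q by rewrite /tm cat0; ring.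
have tm1 : tm 1 = 8 * q by rewrite /tm !cat1; ring.
have tn0 : tn 0 = 7 / 2 * q by rewrite /tn cat0; ring.
have tn1 : tn 1 = q / 2 by rewrite /tn !cat1; ring.
have Low : exists H, sq H (fun s => al (5 * q + 2 * q * s)) (fun s => al (7 * q + q * s)) (fun s => al (tm s))
    (fun s => al (5 * q - q * s)) 0.
  eexists; apply: sq_ext (lo _ _ (lipx_aff _ _) ltm rtm) _ => s s1; split=> //; congr al.
    by rewrite tm1; ring.
  by rewrite tm0; ring.
have Up : exists H, sq H (fun s => al (tn s)) (fun s => al (q / 2 + q / 2 * s)) (fun s => al (3 * q + - 2 * q * s))
    (fun s => al (7 / 2 * q - q / 2 * s)) 0.
  eexists; apply: sq_ext (lo _ _ ltn (lipx_aff _ _) rtn) _ => s s1; split=> //; congr al.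
    by rewrite tn1; field.
  by rewrite tn0; field.
have Q1 : exists H, sq H (fun=> al (4 * q)) (fun=> al (4 * q)) (fun s => al (7 / 2 * q + q / 2 * s))
    (fun s => al (4 * q - q / 2 * s)) 0.
  eexists; apply: sq_ext (lo _ _ (lipx_aff _ _) (lipx_aff _ _) rq1) _ => s s1; split=> //; congr al; by field.
have Q2 : exists H, sq H (fun=> al (8 * q)) (fun s => al (q / 2 * s)) (fun s => al (0 + q / 2 * s))
    (fun=> al (8 * q)) 0.
  eexists; apply: sq_ext (lo _ _ (lipx_aff _ _) (lipx_aff _ _) rq2) _ => s s1; split=> //; rewrite -?al8; congr al; by field.
have sH : sq H (fun s => al (4 * q + 4 * q * s)) (fun=> al (8 * q)) (fun s => al (4 * q + - 4 * q * s)) (fun=> al (4 * q)) A.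
  split => // s s1; have [-> ->] := h2 s s1; rewrite mulr0 addr0 mulr1; split=> //; congr al; ring.
have [HL sL] := Low; have [HU sU] := Up; have [H1 s1] := Q1; have [H2 s2] := Q2.
have sM := sq_ext (sq_x s1 (sq_x sH s2)) (b' := fun s => al (tm s)) (r' := fun s => al (q / 2 * s))
  (t' := fun s => al (tn s)) (l' := fun s => al (4 * q - q / 2 * s)).
have {}sM := sM _.
have [|F FU F2] := sq_y sL (sq_y (sM _) sU).
  move=> s s01; split=> //; rewrite /tm /tn /cat; case: ifP => _; rewrite ?mul0r ?addr0//; case: ifP => _ //; congr al; ring.
exists (glue HL (glue (fun x y => glue (fun x y => H1 y x) (fun x y => glue (fun x y => H y x) (fun x y => H2 y x) x y) y x) HU)).
  by move: F; rewrite !add0r !addr0.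
move=> s s01; have [-> ->] := FU s s01; have [-> ->] := F2 s s01; split=> //.
- by congr al; ring.
- rewrite /cat; case: ifP => _; first by congr al; ring.
  by case: ifP => _; congr al; field.
- rewrite /cat; case: ifP => _; first by congr al; ring.
  by case: ifP => _; congr al; field.
Qed.

End fillings.

(** * Dyadic filling of words *)

(** Classes are encoded as the predicates [q x], so equality of classes is equality of sets and
    follows from extensionality. *)
Lemma quotient_group (T : Type) (q : T -> T -> Prop) (mul : T -> T -> T) (one : T) (inv : T -> T) :
  (forall x, q x x) -> (forall x y, q x y -> q y x) -> (forall x y z, q x y -> q y z -> q x z) ->
  (forall x x' y y', q x x' -> q y y' -> q (mul x y) (mul x' y')) ->
  (forall x y, q x y -> q (inv x) (inv y)) ->
  (forall x y z, q (mul x (mul y z)) (mul (mul x y) z)) ->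
  (forall x, q (mul one x) x) -> (forall x, q (mul x one) x) ->
  (forall x, q (mul (inv x) x) one) -> (forall x, q (mul x (inv x)) one) ->
  exists (H : groupType) (pi : T -> H), [/\ forall x y, pi x = pi y <-> q x y,
    forall x y, pi (mul x y) = (pi x * pi y)%g, pi one = 1%g & forall x, pi (inv x) = ((pi x)^-1)%g].
Proof.
move=> qr qs qt qm qi qA q1 q2 qV qV'.
pose cls := {A : set T | exists x, A = q x}.
pose pi x : cls := exist _ (q x) (ex_intro _ x erefl).
have piE x y : pi x = pi y <-> q x y.
  split=> [/(congr1 sval)/= e|xy]; first by rewrite e; exact: qr.
  by apply: eq_exist; apply/funext => z; apply/propext; split=> ?; [apply: qt (qs _ _ xy) _|apply: qt xy _].
have /choice[rp rpE] : forall a : cls, exists x, pi x = a.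
  by move=> [A [x AE]]; exists x; apply: eq_exist; rewrite /= AE.
pose Hc : choiceType := HB.pack cls (gen_eqMixin cls) (gen_choiceMixin cls).
pose mulc (a b : Hc) : Hc := pi (mul (rp a) (rp b)).
pose invc (a : Hc) : Hc := pi (inv (rp a)).
have rq x : q (rp (pi x)) x by apply/piE; rewrite rpE.
have mE x y : mulc (pi x) (pi y) = pi (mul x y) by apply/piE; apply: qm.
have iE x : invc (pi x) = pi (inv x) by apply/piE; apply: qi.
have mA : associative mulc.
  by move=> a b c; rewrite -(rpE a) -(rpE b) -(rpE c) !mE; apply/piE.
have m1 : left_id (pi one : Hc) mulc by move=> a; rewrite -(rpE a) mE; apply/piE.
have m2 : right_id (pi one : Hc) mulc by move=> a; rewrite -(rpE a) mE; apply/piE.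
have mV : left_inverse (pi one : Hc) invc mulc by move=> a; rewrite -(rpE a) iE mE; apply/piE.
have mV' : right_inverse (pi one : Hc) invc mulc by move=> a; rewrite -(rpE a) iE mE; apply/piE.
pose H : groupType := HB.pack Hc (isGroup.Build Hc mA m1 m2 mV mV').
by exists H, pi; split.
Qed.

Section words.
Variables (R : realType) (N : nat).
Notation E := 'rV[R]_N.
Variable be : E -> E -> E.
Hypothesis nf : nilform be.
Variable wr : seq E -> seq E -> R -> Prop.
Hypothesis Wwp : forall w w' A, wr w w' A -> wp be w = wp be w'.
Hypothesis Wrefl : forall w, wr w w 0.
Hypothesis Wsym : forall w w' A, wr w w' A -> wr w' w A.
Hypothesis Wtrans : forall w1 w2 w3 A B, wr w1 w2 A -> wr w2 w3 B -> wr w1 w3 (A + B).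
Hypothesis Wle : forall w w' A B, A <= B -> wr w w' A -> wr w w' B.
Hypothesis Wcat : forall a a' b b' A B, wr a a' A -> wr b b' B -> wr (a ++ b) (a' ++ b') (A + B).
Hypothesis W0 : wr [:: 0] [::] 0.
Hypothesis Wcol : forall a b u, wr [:: a *: u; b *: u] [:: (a + b) *: u] 0.
Variable Cf : R.
Hypothesis Cf0 : 0 <= Cf.
Hypothesis Wflat : forall u u', be u u' = 0 -> wr [:: u; u'] [:: u + u'] (Cf * (`|u| + `|u'|) ^+ 2).
Hypothesis Wbdd : forall (k : nat) (A : R), 0 <= A -> exists2 C, 0 <= C & forall w w',
  (size w <= k)%N -> (size w' <= k)%N -> (forall u, u \in w ++ w' -> `|u| <= A) -> wp be w = wp be w' ->
  wr w w' C.

Definition winv (w : seq E) : seq E := map -%R (rev w).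

Lemma Wtr0 w1 w2 w3 A : wr w1 w2 A -> wr w2 w3 0 -> wr w1 w3 A.
Proof. by move=> h1 h2; rewrite -[A]addr0; exact: Wtrans h2. Qed.
Lemma Wtr0l w1 w2 w3 A : wr w1 w2 0 -> wr w2 w3 A -> wr w1 w3 A.
Proof. by move=> h1 h2; rewrite -[A]add0r; exact: Wtrans h2. Qed.
Lemma Wcat0 a a' b b' A : wr a a' A -> wr b b' 0 -> wr (a ++ b) (a' ++ b') A.
Proof. by move=> h1 h2; rewrite -[A]addr0; exact: Wcat. Qed.
Lemma Wcat0l a a' b b' A : wr a a' 0 -> wr b b' A -> wr (a ++ b) (a' ++ b') A.
Proof. by move=> h1 h2; rewrite -[A]add0r; exact: Wcat. Qed.

Lemma winvK w : winv (winv w) = w.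
Proof. by rewrite /winv -map_rev revK -map_comp map_id_in// => u _ /=; rewrite opprK. Qed.

Lemma W_pair u : wr [:: u; - u] [::] 0.
Proof.
apply: Wtr0l (Wtr0l _ W0) (Wrefl _) => //.
by have := Wcol 1 (-1) u; rewrite scale1r scaleN1r subrr scale0r.
Qed.

Lemma W_inv w : wr (w ++ winv w) [::] 0.
Proof.
elim: w => [|u w IH]; first exact: Wrefl.
rewrite /winv rev_cons map_rcons -cats1 /= -cat1s catA -/(winv w).
apply: Wtr0l (W_pair u); rewrite -[[:: u; _]]/([:: u] ++ [::] ++ [:: - u]) -catA (catA w).
exact: Wcat0l (Wrefl _) (Wcat0 IH (Wrefl _)).
Qed.

Section family.
Variables (Th : Type) (lam : Th -> R).
Hypothesis lam0 : forall th, 0 < lam th.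

(* Up to homotopies of area quadratic in the scale [lam], families of words form
   a group. *)
Definition feq (w w' : Th -> seq E) := exists2 C, 0 <= C & forall th, wr (w th) (w' th) (C * lam th ^+ 2).

Lemma feq0 w w' : (forall th, wr (w th) (w' th) 0) -> feq w w'.
Proof. by move=> h; exists 0 => // th; rewrite mul0r. Qed.

Lemma fam_group : exists (H : groupType) (pi : (Th -> seq E) -> H),
  [/\ forall x y, pi x = pi y <-> feq x y, forall x y, pi (fun th => x th ++ y th) = (pi x * pi y)%g,
      pi (fun=> [::]) = 1%g & forall x, pi (fun th => winv (x th)) = ((pi x)^-1)%g].
Proof.
apply: (@quotient_group _ feq (fun x y th => x th ++ y th) (fun=> [::]) (fun x th => winv (x th))).
- by move=> x; apply: feq0 => th; exact: Wrefl.
- by move=> x y [C C0 h]; exists C => // th; apply: Wsym.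
- move=> x y z [C C0 h] [C' C0' h']; exists (C + C'); first exact: addr_ge0.
  by move=> th; rewrite mulrDl; apply: Wtrans (h th) (h' th).
- move=> x y z t [C C0 h] [C' C0' h']; exists (C + C'); first exact: addr_ge0.
  by move=> th; rewrite mulrDl; apply: Wcat (h th) (h' th).
- move=> x y [C C0 h]; exists C => // th.
  (* The chain is [x^-1], [x^-1 y y^-1], [x^-1 x y^-1], [y^-1]; its only costly step replaces [y] by
     [x] once. *)
  apply: (@Wtr0l _ (winv (x th) ++ (y th ++ winv (y th)))).
    by rewrite -{1}[winv (x th)]cats0; apply: Wcat0l (Wrefl _) (Wsym (W_inv _)).
  apply: (@Wtr0 _ (winv (x th) ++ (x th ++ winv (y th)))).
    by apply: Wcat0l (Wrefl _) _; apply: Wcat0 (Wsym (h th)) (Wrefl _).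
  rewrite catA -[X in wr _ X]cat0s; apply: Wcat0l _ (Wrefl _).
  by rewrite -{2}[x th]winvK; exact: W_inv.
- by move=> x y z; apply: feq0 => th; rewrite catA; exact: Wrefl.
- by move=> x; apply: feq0 => th; exact: Wrefl.
- by move=> x; apply: feq0 => th; rewrite cats0; exact: Wrefl.
- by move=> x; apply: feq0 => th; rewrite -{2}[x th]winvK; exact: W_inv.
- by move=> x; apply: feq0 => th; exact: W_inv.
Qed.
End family.

Variables (m n : nat).
Notation V := 'rV[R]_m.
Variables (copy : 'I_n -> V -> E) (sec : E -> 'I_n -> V) (Kc Ks : R).
Hypothesis copy_lin : forall c a t u, copy c (a *: t + u) = a *: copy c t + copy c u.
Hypothesis copy_bd : forall c t, `|copy c t| <= Kc * `|t|.
Hypothesis Kc0 : 0 < Kc.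
Hypothesis copy_neq : forall c d t u, c != d -> be (copy c t) (copy d u) = 0.
Hypothesis copy_eq : forall c d t u, be (copy c t) (copy c u) = be (copy d t) (copy d u).
Hypothesis secE : forall x, x = \sum_c copy c (sec x c).
Hypothesis sec_bd : forall x c, `|sec x c| <= Ks * `|x|.
Hypothesis Ks0 : 0 < Ks.
Variable c0 : 'I_n.
Hypothesis other : forall c : 'I_n, exists d, c != d.

Definition kwd c p q : seq E := [:: copy c p; copy c q; copy c (- p); copy c (- q)].
Definition ebase i : V := delta_mx 0 i.
(* A word with product [zv M]; the scale [r] balances the sizes [|M| / r] and [r]
   of its letters. *)
Definition zw (r : R) (M : 'M[R]_m) : seq E :=
  flatten [seq flatten [seq kwd c0 ((M i j / r) *: ebase i) (r *: ebase j) | j <- enum 'I_m] | i <- enum 'I_m].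
Definition zv (M : 'M[R]_m) : E :=
  \sum_(i <- enum 'I_m) \sum_(j <- enum 'I_m) M i j *: be (copy c0 (ebase i)) (copy c0 (ebase j)).

Lemma copyD c t u : copy c (t + u) = copy c t + copy c u.
Proof. by have := copy_lin c 1 t u; rewrite !scale1r. Qed.
Lemma copy0 c : copy c 0 = 0.
Proof. by apply: (addrI (copy c 0)); rewrite -copyD !addr0. Qed.
Lemma copyZ c a t : copy c (a *: t) = a *: copy c t.
Proof. by have := copy_lin c a t 0; rewrite copy0 !addr0. Qed.
Lemma copyN c t : copy c (- t) = - copy c t.
Proof. by rewrite -scaleN1r copyZ scaleN1r. Qed.

(** * Normal form of commutators for families of words *)

Section calculus.
Variables (Th : Type) (lam : Th -> R).
Hypothesis lam0 : forall th, 0 < lam th.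
Variables (H : groupType) (pi : (Th -> seq E) -> H).
Hypothesis piE : forall x y, pi x = pi y <-> feq lam x y.
Hypothesis piM : forall x y, pi (fun th => x th ++ y th) = (pi x * pi y)%g.
Hypothesis pi1 : pi (fun=> [::]) = 1%g.
Hypothesis piV : forall x, pi (fun th => winv (x th)) = ((pi x)^-1)%g.

(** Letters are of size [lam] and coefficient matrices of size [lam ^+ 2]; then the letters
    [M / lam] and [lam] of a commutator word are again of size [lam]. *)
Definition fbd (W : normedModType R) (p : Th -> W) := exists2 C, 0 <= C & forall th, `|p th| <= C * lam th.
Definition fbd2 (W : normedModType R) (p : Th -> W) := exists2 C, 0 <= C & forall th, `|p th| <= C * lam th ^+ 2.
Definition L c (p : Th -> V) : H := pi (fun th => [:: copy c (p th)]).
Definition B (p q : Th -> V) : Th -> E := fun th => be (copy c0 (p th)) (copy c0 (q th)).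

Lemma fbdD (W : normedModType R) (p q : Th -> W) : fbd p -> fbd q -> fbd (p + q).
Proof.
move=> [C C0 h] [D D0 k]; exists (C + D); first exact: addr_ge0.
by move=> th; rewrite mulrDl; apply: le_trans (ler_normD _ _) _; exact: lerD.
Qed.
Lemma fbdZ (W : normedModType R) (a : R) (p : Th -> W) : fbd p -> fbd (a *: p).
Proof.
move=> [C C0 h]; exists (`|a| * C); first exact: mulr_ge0.
by move=> th; rewrite normrZ -mulrA ler_wpM2l.
Qed.
Lemma fbdN (W : normedModType R) (p : Th -> W) : fbd p -> fbd (- p).
Proof. by rewrite -scaleN1r; exact: fbdZ. Qed.
Lemma fbd2D (W : normedModType R) (p q : Th -> W) : fbd2 p -> fbd2 q -> fbd2 (p + q).
Proof.
move=> [C C0 h] [D D0 k]; exists (C + D); first exact: addr_ge0.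
by move=> th; rewrite mulrDl; apply: le_trans (ler_normD _ _) _; exact: lerD.
Qed.
Lemma fbd_copy c (p : Th -> V) : fbd p -> fbd (fun th => copy c (p th)).
Proof.
move=> [C C0 h]; exists (Kc * C); first by rewrite mulr_ge0// ltW.
by move=> th; apply: le_trans (copy_bd _ _) _; rewrite -mulrA ler_pM2l.
Qed.

Lemma pi_flat (u v : Th -> E) : fbd u -> fbd v -> (forall th, be (u th) (v th) = 0) ->
  (pi (fun th => [:: u th]) * pi (fun th => [:: v th]))%g = pi (fun th => [:: u th + v th]).
Proof.
move=> [C C0 h] [D D0 k] uv; rewrite -piM; apply/piE; exists (Cf * (C + D) ^+ 2).
  by rewrite mulr_ge0// sqr_ge0.
move=> th; apply: Wle (Wflat (uv th)); rewrite -mulrA ler_wpM2l// -exprMn.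
by rewrite ler_pXn2r ?nnegrE ?addr_ge0// ?mulr_ge0 ?addr_ge0 ?(ltW (lam0 th))// mulrDl lerD.
Qed.

Lemma BDl p q r : B (p + q) r = B p r + B q r.
Proof. by apply/funext => th; rewrite /B /= copyD (nfDl nf). Qed.
Lemma BDr p q r : B r (p + q) = B r p + B r q.
Proof. by apply/funext => th; rewrite /B /= copyD (nfDr nf). Qed.
Lemma Bxx p : B p p = 0.
Proof. by apply/funext => th; rewrite /B (nfxx nf). Qed.
Lemma L0 e : L e 0 = 1%g.
Proof. by rewrite -pi1; apply/piE; apply: feq0 => th; rewrite copy0. Qed.
Lemma LN e p : fbd p -> L e (- p) = (L e p)^-1%g.
Proof. by move=> _; rewrite -piV; congr pi; apply/funext => th; rewrite /winv /= copyN. Qed.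

Lemma L_ind c d : c != d -> indep B (@fbd V) L c d.
Proof.
move=> cd; have dc : d != c by rewrite eq_sym.
split=> [p q bp bq|p q p' q' bp bq bp' bq' BE].
  rewrite /L !pi_flat; [|exact: fbd_copy|exact: fbd_copy|by move=> th; apply: copy_neq|exact: fbd_copy|exact: fbd_copy|by move=> th; apply: copy_neq].
  by congr pi; apply/funext => th; rewrite addrC.
rewrite -mulgA /L.
rewrite (pi_flat (fbd_copy c bp) (fbd_copy d bp')); last by move=> th; apply: copy_neq.
rewrite (pi_flat (fbd_copy c bq) (fbd_copy d (fbdN bq'))); last by move=> th; apply: copy_neq.
rewrite pi_flat; first 1 last.
- by apply: fbd_copy; exact: fbdD.
- by apply: fbd_copy; apply: fbdD => //; exact: fbdN.
- by move=> th; apply: copy_neq.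
rewrite pi_flat; first 1 last.
- by apply: fbdD; exact: fbd_copy.
- by apply: fbdD; apply: fbd_copy => //; exact: fbdN.
- move=> th; rewrite (nfDl nf) !(nfDr nf) (copy_neq _ _ cd) (copy_neq _ _ dc) addr0 add0r.
  rewrite -[(- q') th]/(- q' th) copyN (nfNr nf).
  have := congr1 (fun f => f th) BE; rewrite /B => BEt.
  by rewrite (copy_eq c c0) BEt (copy_eq c0 d) subrr.
by congr pi; apply/funext => th; rewrite !copyD; congr [:: _]; zmodc.
Qed.

Notation K := (Kw L c0).
Let Kform := Kw_form BDl BDr Bxx (@fbdD V) (@fbdZ V) LN L_ind other.
Let Kaddl := Kw_addl BDl BDr Bxx (@fbdD V) (@fbdZ V) LN L_ind other c0.
Let Kaddr := Kw_addr BDl BDr Bxx (@fbdD V) (@fbdZ V) LN L_ind other c0.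
Let KK := Kw_Kw BDl BDr Bxx (@fbdD V) (@fbdZ V) LN L_ind other.
Let KL := Kw_comm BDl BDr Bxx (@fbdD V) (@fbdZ V) LN L_ind other.

Lemma piK c p q : pi (fun th => kwd c (p th) (q th)) = Kw L c p q.
Proof.
rewrite /Kw /L -(piM (fun th => [:: copy c (p th)]) (fun th => [:: copy c (q th)])).
by rewrite -!piM.
Qed.

Lemma pi_flatten (J : Type) (s : seq J) (f : Th -> J -> seq E) :
  pi (fun th => flatten [seq f th j | j <- s]) = gprod s (fun j => pi (fun th => f th j)).
Proof.
elim: s => [|j s IH] /=; first exact: pi1.
by rewrite -IH -(piM (fun th => f th j)).
Qed.

Definition Zf (s : R) (M : Th -> 'M[R]_m) : H := pi (fun th => zw (s * lam th) (M th)).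
Definition zp s (M : Th -> 'M[R]_m) i j : Th -> V := fun th => (M th i j / (s * lam th)) *: ebase i.
Definition zq s j : Th -> V := fun th => (s * lam th) *: ebase j.

Lemma norm_ebase i : `|ebase i| <= 1.
Proof. by apply/mx_norm_leP => // k l; rewrite mxE; case: (_ && _); rewrite ?normr1 ?normr0. Qed.

Lemma fbd_zp s M i j : 0 < s -> fbd2 M -> fbd (zp s M i j).
Proof.
move=> s0 [C C0 h]; exists (C / s); first by rewrite divr_ge0// ltW.
move=> th; rewrite /zp normrZ; apply: le_trans (ler_wpM2l (normr_ge0 _) (norm_ebase i)) _.
have sl : 0 < s * lam th by exact: mulr_gt0.
rewrite mulr1 normrM normfV (gtr0_norm sl) ler_pdivrMr//.
apply: le_trans (mx_entry_le _ _ _) _; apply: le_trans (h th) _.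
by rewrite le_eqVlt; apply/orP; left; apply/eqP; field; rewrite gt_eqF.
Qed.

Lemma fbd_zq s j : 0 < s -> fbd (zq s j).
Proof.
move=> s0; exists s; first exact: ltW.
move=> th; rewrite /zq normrZ; apply: le_trans (ler_wpM2l (normr_ge0 _) (norm_ebase j)) _.
by rewrite mulr1 gtr0_norm// mulr_gt0.
Qed.

Lemma ZfE s M : Zf s M = gprod (enum 'I_m) (fun i => gprod (enum 'I_m) (fun j => K (zp s M i j) (zq s j))).
Proof.
rewrite /Zf /zw pi_flatten; apply: eq_gprod => i; rewrite pi_flatten; apply: eq_gprod => j.
exact: piK.
Qed.

(** Changing the scale moves a factor from one entry of each commutator to the other, which leaves
    the value of [B] unchanged. *)
Lemma Zf_resc s s' M : 0 < s -> 0 < s' -> fbd2 M -> Zf s M = Zf s' M.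
Proof.
move=> s0 s0' bM; rewrite !ZfE; apply: eq_gprod => i; apply: eq_gprod => j.
apply: Kform; [exact: fbd_zp|exact: fbd_zq|exact: fbd_zp|exact: fbd_zq|].
have := lam0; rewrite /B /zp /zq => l0; apply/funext => th.
rewrite !copyZ !(nfZl nf) !(nfZr nf) !scalerA; congr (_ *: _).
by field; rewrite !gt_eqF.
Qed.

Lemma ZfM s M M' : 0 < s -> fbd2 M -> fbd2 M' -> (Zf s M * Zf s M')%g = Zf s (M + M').
Proof.
move=> s0 bM bM'; rewrite !ZfE -gprodM ?enum_uniq//; last first.
  move=> i j _; apply: gprod_comm => k; apply/commute_sym; apply: gprod_comm => l.
  by apply: KK; [exact: fbd_zp|exact: fbd_zq|exact: fbd_zp|exact: fbd_zq].
apply: eq_gprod => i; rewrite -gprodM ?enum_uniq//; last first.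
  by move=> j k _; apply: KK; [exact: fbd_zp|exact: fbd_zq|exact: fbd_zp|exact: fbd_zq].
apply: eq_gprod => j; rewrite -Kaddl; [|exact: fbd_zp|exact: fbd_zp|exact: fbd_zq].
congr (Kw L c0 _ _); apply/funext => th; rewrite /zp.
rewrite -[LHS]/((M th i j / _) *: _ + (M' th i j / _) *: _) -scalerDl -mulrDl.
by rewrite -[(M + M') th]/(M th + M' th) mxE.
Qed.

Lemma Zf_comm s M c t : 0 < s -> fbd2 M -> fbd t -> commute (Zf s M) (L c t).
Proof.
move=> s0 bM bt; rewrite ZfE; apply: gprod_comm => i; apply: gprod_comm => j.
by apply: KL => //; [exact: fbd_zp|exact: fbd_zq].
Qed.

Lemma K0l q : fbd q -> K 0 q = 1%g.
Proof. by move=> bq; rewrite /Kw oppr0 !L0 mul1g mulg1 (LN c0 bq) mulgV. Qed.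
Lemma K0r q : fbd q -> K q 0 = 1%g.
Proof. by move=> bq; rewrite /Kw (LN _ bq) oppr0 L0 !mulg1 mulgV. Qed.

Lemma fbd_sum (J : Type) (s : seq J) (W : normedModType R) (f : J -> Th -> W) : (forall j, fbd (f j)) -> fbd (\sum_(j <- s) f j).
Proof.
move=> bf; elim: s => [|j s IH]; first by rewrite big_nil; exists 0 => // th; rewrite normr0 mul0r.
by rewrite big_cons; exact: fbdD.
Qed.
Lemma K_suml (J : Type) (s : seq J) f q : (forall j, fbd (f j)) -> fbd q ->
  K (\sum_(j <- s) f j) q = gprod s (fun j => K (f j) q).
Proof.
move=> bf bq; elim: s => [|j s IH]; first by rewrite big_nil K0l.
by rewrite big_cons Kaddl//= ?IH//; exact: fbd_sum.
Qed.
Lemma K_sumr (J : Type) (s : seq J) f q : (forall j, fbd (f j)) -> fbd q ->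
  K q (\sum_(j <- s) f j) = gprod s (fun j => K q (f j)).
Proof.
move=> bf bq; elim: s => [|j s IH]; first by rewrite big_nil K0r.
by rewrite big_cons Kaddr//= ?IH//; exact: fbd_sum.
Qed.

Lemma coord_sum (p : Th -> V) : p = \sum_(i <- enum 'I_m) (fun th => p th 0 i *: ebase i).
Proof.
apply/funext => th; rewrite fct_sumE big_enum /=; exact: row_sum_delta.
Qed.
Lemma fbd_coord (p : Th -> V) i : fbd p -> fbd (fun th => p th 0 i *: ebase i).
Proof.
move=> [C C0 h]; exists C => // th; rewrite normrZ.
apply: le_trans (ler_wpM2l (normr_ge0 _) (norm_ebase i)) _.
by rewrite mulr1; apply: le_trans (mx_entry_le _ _ _) (h th).
Qed.

Definition outer (p q : Th -> V) : Th -> 'M[R]_m := fun th => \matrix_(i, j) (p th 0 i * q th 0 j).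
Lemma fbd2_outer p q : fbd p -> fbd q -> fbd2 (outer p q).
Proof.
move=> [C C0 h] [D D0 k]; exists (C * D); first exact: mulr_ge0.
move=> th; have l0 := ltW (lam0 th).
have -> : C * D * lam th ^+ 2 = (C * lam th) * (D * lam th) by ring.
apply/mx_norm_leP; first by rewrite !mulr_ge0.
move=> i j; rewrite mxE normrM; apply: ler_pM => //; [apply: le_trans (h th)|apply: le_trans (k th)]; exact: mx_entry_le.
Qed.

Lemma K_outer s p q : 0 < s -> fbd p -> fbd q -> K p q = Zf s (outer p q).
Proof.
move=> s0 bp bq; rewrite {1}(coord_sum p) K_suml//; last by move=> i; exact: fbd_coord.
rewrite ZfE; apply: eq_gprod => i; rewrite {1}(coord_sum q) K_sumr; [|by move=> j; exact: fbd_coord|exact: fbd_coord].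
apply: eq_gprod => j; apply: Kform; [exact: fbd_coord|exact: fbd_coord| |exact: fbd_zq|].
  by apply: fbd_zp => //; exact: fbd2_outer.
have := lam0; rewrite /B /zp /zq => l0; apply/funext => th.
rewrite !copyZ !(nfZl nf) !(nfZr nf) !scalerA mxE; congr (_ *: _).
by field; rewrite !gt_eqF.
Qed.

Lemma pi_copies (s : seq 'I_n) (t : 'I_n -> Th -> V) : uniq s -> (forall c, fbd (t c)) ->
  pi (fun th => [:: \sum_(c <- s) copy c (t c th)]) = gprod s (fun c => L c (t c)).
Proof.
move=> + bt; elim: s => [_|c s IH] /=.
  by rewrite -pi1; apply/piE; apply: feq0 => th; rewrite big_nil.
move=> /andP[cs us]; rewrite -IH// /L pi_flat.
- by congr pi; apply/funext => th; rewrite big_cons.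
- exact: fbd_copy.
- rewrite (_ : (fun th => _) = \sum_(c <- s) (fun th => copy c (t c th))).
    by apply: fbd_sum => d; exact: fbd_copy.
  by apply/funext => th; rewrite fct_sumE.
- move=> th; rewrite (nf_sumr nf) big_seq big1// => d ds.
  by apply: copy_neq; apply: contraNneq cs => ->.
Qed.

(** The coefficients of the commutators created by adding letters copywise, one term [Kw (p / 2) q]
    for each copy, collected into a single matrix because [Kw] does not depend on the copy. *)
Definition Mnew (S S' : Th -> E) : Th -> 'M[R]_m :=
  \sum_(c <- enum 'I_n) outer (2^-1 *: (fun th => sec (S th) c)) (fun th => sec (S' th) c).

Lemma fbd_sec (S : Th -> E) c : fbd S -> fbd (fun th => sec (S th) c).
Proof.
move=> [C C0 h]; exists (Ks * C); first by rewrite mulr_ge0// ltW.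
by move=> th; apply: le_trans (sec_bd _ _) _; rewrite -mulrA ler_pM2l.
Qed.

Lemma fbd2_sum (J : Type) (s : seq J) (W : normedModType R) (f : J -> Th -> W) : (forall j, fbd2 (f j)) -> fbd2 (\sum_(j <- s) f j).
Proof.
move=> bf; elim: s => [|j s IH]; first by rewrite big_nil; exists 0 => // th; rewrite normr0 mul0r.
by rewrite big_cons; exact: fbd2D.
Qed.

Lemma fbd2_Mnew S S' : fbd S -> fbd S' -> fbd2 (Mnew S S').
Proof. by move=> bS bS'; apply: fbd2_sum => c; apply: fbd2_outer; [apply: fbdZ|]; exact: fbd_sec. Qed.

Lemma Zf_sum (J : Type) (s : seq J) (f : J -> Th -> 'M[R]_m) : (forall j, fbd2 (f j)) ->
  Zf 1 (\sum_(j <- s) f j) = gprod s (fun j => Zf 1 (f j)).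
Proof.
move=> bf; elim: s => [|j s IH]; last by rewrite big_cons -ZfM//= ?IH//; exact: fbd2_sum.
have z : fbd2 (0 : Th -> 'M[R]_m) by exists 0 => // th; rewrite normr0 mul0r.
by rewrite big_nil /=; apply: (mulgI (Zf 1 0)); rewrite ZfM// addr0 mulg1.
Qed.

(** The central factors are moved to the right. Letters in different copies commute, so the two
    products over copies are interleaved and added copy by copy. The result is rescaled to 2 because
    [S + S'] may be twice as large. *)
Lemma merge S S' M M' : fbd S -> fbd S' -> fbd2 M -> fbd2 M' ->
  (pi (fun th => [:: S th]) * Zf 1 M * (pi (fun th => [:: S' th]) * Zf 1 M'))%g =
  (pi (fun th => [:: S th + S' th]) * Zf 2 (M + M' + Mnew S S'))%g.
Proof.
move=> bS bS' bM bM'.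
have bt c : fbd (fun th => sec (S th) c) by exact: fbd_sec.
have bt' c : fbd (fun th => sec (S' th) c) by exact: fbd_sec.
have piS T : fbd T -> pi (fun th => [:: T th]) = gprod (enum 'I_n) (fun c => L c (fun th => sec (T th) c)).
  move=> bT; rewrite -pi_copies ?enum_uniq//; last by move=> c; exact: fbd_sec.
  by congr pi; apply/funext => th; rewrite {1}(secE (T th)) big_enum.
have e1 : pi (fun th => [:: S th + S' th]) = gprod (enum 'I_n) (fun c => L c ((fun th => sec (S th) c) + (fun th => sec (S' th) c))).
  rewrite -pi_copies ?enum_uniq//; last by move=> c; exact: fbdD.
  congr pi; apply/funext => th; rewrite {1}(secE (S th)) {1}(secE (S' th)) big_enum -big_split /=.
  by congr [:: _]; apply: eq_bigr => c _; rewrite -copyD.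
have bN := fbd2_Mnew bS bS'; have bMM := fbd2D bM bM'.
rewrite e1 (piS _ bS) (piS _ bS') (@Zf_resc 2 1)//; last exact: fbd2D.
rewrite -ZfM// -ZfM// (Zf_sum _ (fun c => fbd2_outer (fbdZ 2^-1 (bt c)) (bt' c))).
have -> : gprod (enum 'I_n) (fun j => Zf 1 (outer (2^-1 *: (fun th => sec (S th) j)) (fun th => sec (S' th) j))) =
   gprod (enum 'I_n) (fun c => Kw L c (2^-1 *: (fun th => sec (S th) c)) (fun th => sec (S' th) c)).
  apply: eq_gprod => c; rewrite -K_outer//; last exact: fbdZ.
  by apply: (Kw_copy BDl BDr Bxx (@fbdD V) (@fbdZ V) LN L_ind) => //; exact: fbdZ.
have cZ T : fbd T -> commute (Zf 1 M) (gprod (enum 'I_n) (fun c => L c (fun th => sec (T th) c))).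
  move=> bT; apply/commute_sym; apply: gprod_comm => c; apply/commute_sym.
  by apply: Zf_comm => //; exact: fbd_sec.
rewrite -[LHS]mulgA (mulgA (Zf 1 M)) cZ// -!mulgA (mulgA (gprod _ _)) -gprodM ?enum_uniq//; last first.
  by move=> c d cd; case: (L_ind cd) => cm _; apply: cm.
set KP := gprod _ (fun c => Kw L c _ _).
have cKP Q : fbd2 Q -> commute (Zf 1 Q) KP.
  move=> bQ; apply/commute_sym; apply: gprod_comm => c; apply/commute_sym.
  rewrite ZfE; apply: gprod_comm => i; apply: gprod_comm => j.
  by apply: KK => //; [exact: fbd_zp|exact: fbd_zq|exact: fbdZ].
rewrite (cKP _ bM') (mulgA (Zf 1 M)) (cKP _ bM) !mulgA; congr (_ * _ * _)%g.
rewrite -gprodM ?enum_uniq//; last first.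
  move=> c d _; apply/commute_sym; apply: KL => //; [exact: fbdZ|exact: fbdD].
apply: eq_gprod => c.
by apply: (Kw_add BDl BDr Bxx (@fbdD V) (@fbdZ V) L0 LN L_ind other).
Qed.

Lemma split4 M : fbd2 M -> Zf 2 M = (Zf 1 (4^-1 *: M) * (Zf 1 (4^-1 *: M) * (Zf 1 (4^-1 *: M) * Zf 1 (4^-1 *: M))))%g.
Proof.
move=> [C C0 h]; have bM : fbd2 M by exists C.
have b4 : fbd2 (4^-1 *: M).
  exists C => // th; rewrite normrZ ger0_norm//; apply: le_trans (h th).
  by rewrite ler_piMl// invf_le1// ler1n.
have b44 := fbd2D b4 b4; rewrite (ZfM _ b4 b4)// (ZfM _ b4 b44)// (ZfM _ b4 (fbd2D b4 b44))//.
rewrite (@Zf_resc 2 1)//; congr Zf.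
by rewrite -!scalerDl (_ : _ + _ = 1) ?scale1r//; field.
Qed.
End calculus.

Lemma wp1 u : wp be [:: u] = u.
Proof. by rewrite /wp /= (bch0 nf). Qed.

Lemma wp_kwd c p q : wp be (kwd c p q) = be (copy c p) (copy c q).
Proof.
rewrite /wp /kwd /= (bch0 nf) !copyN; set a := copy c p; set b := copy c q; set z := be a b.
have -> : bch be (- a) (- b) = - a - b + 2^-1 *: z by rewrite /bch (nfNl nf) (nfNr nf) opprK.
have -> : bch be b (- a - b + 2^-1 *: z) = - a + z.
  rewrite /bch !(nfDr nf) (nfZr nf) (nf_nilr nf) scaler0 !(nfNr nf) (nfxx nf) oppr0 !addr0.
  rewrite (nf_alt nf b a) opprK -/z; apply/rowP => i; rewrite !mxE; by field.
by rewrite /bch (nfDr nf) (nfNr nf) (nfxx nf) (nf_nilr nf) oppr0 addr0 scaler0 addr0 addrA subrr add0r.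
Qed.

Lemma wp_kwds (J : Type) (s : seq J) (f : J -> seq E) (z : J -> E) :
  (forall j, wp be (f j) = z j) -> (forall j u, be (z j) u = 0) ->
  wp be (flatten [seq f j | j <- s]) = \sum_(j <- s) z j.
Proof.
move=> fz zc; elim: s => [|j s IH] /=; first by rewrite big_nil.
by rewrite wp_cat// IH fz big_cons bch_flat.
Qed.

Lemma wp_zw r M : 0 < r -> wp be (zw r M) = zv M.
Proof.
move=> r0; pose z i j := M i j *: be (copy c0 (ebase i)) (copy c0 (ebase j)).
have zc i j u : be (z i j) u = 0 by rewrite /z (nfZl nf) (nf_nil nf) scaler0.
apply: wp_kwds => [i|i u]; last by rewrite (nf_suml nf) big1// => j _; exact: zc.
apply: wp_kwds => [j|j u]; last exact: zc.
rewrite wp_kwd !copyZ (nfZl nf) (nfZr nf) scalerA; congr (_ *: _); field; rewrite gt_eqF//.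
Qed.

Lemma zv_central M u : be (zv M) u = 0.
Proof.
rewrite (nf_suml nf) big1// => i _; rewrite (nf_suml nf) big1// => j _.
by rewrite (nfZl nf) (nf_nil nf) scaler0.
Qed.

Lemma zv_scale a M : zv (a *: M) = a *: zv M.
Proof.
rewrite /zv scaler_sumr; apply: eq_bigr => i _; rewrite scaler_sumr; apply: eq_bigr => j _.
by rewrite mxE scalerA.
Qed.

(** The calculus gives one constant for a whole family. Here the family consists of all admissible
    data, so that the constant is uniform in the scale, the letters and the matrices. *)
Lemma merge_words (C : R) : exists2 D, 0 <= D & forall r S S' M M', 0 < r ->
  `|S| <= r -> `|S'| <= r -> `|M| <= C * r ^+ 2 -> `|M'| <= C * r ^+ 2 -> exists2 M2 : 'M[R]_m,
   `|M2| <= `|M| + `|M'| + n%:R * Ks ^+ 2 * r ^+ 2 &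
   wr ([:: S] ++ zw r M ++ [:: S'] ++ zw r M') ([:: S + S'] ++ zw (2 * r) M2) (D * r ^+ 2).
Proof.
pose P (x : R * (E * E) * ('M[R]_m * 'M[R]_m)) := [/\ 0 < x.1.1, `|x.1.2.1| <= x.1.1, `|x.1.2.2| <= x.1.1,
  `|x.2.1| <= C * x.1.1 ^+ 2 & `|x.2.2| <= C * x.1.1 ^+ 2].
pose Th := {x | P x}; pose lam (th : Th) := (sval th).1.1.
have lam0 th : 0 < lam th by case: th => x [].
have [H [pi [piE piM pi1 piV]]] := fam_group lam.
pose S (th : Th) := (sval th).1.2.1; pose S' (th : Th) := (sval th).1.2.2.
pose M (th : Th) := (sval th).2.1; pose M' (th : Th) := (sval th).2.2.
have bS : fbd lam S by exists 1 => // -[x []] *; rewrite mul1r.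
have bS' : fbd lam S' by exists 1 => // -[x []] *; rewrite mul1r.
have CC : C <= `|C| by exact: ler_norm.
have bM : fbd2 lam M by exists `|C| => // th; have [_ _ _ h4 _] := svalP th; apply: le_trans h4 _; rewrite ler_wpM2r// sqr_ge0.
have bM' : fbd2 lam M' by exists `|C| => // th; have [_ _ _ _ h5] := svalP th; apply: le_trans h5 _; rewrite ler_wpM2r// sqr_ge0.
have := merge lam0 piE piM pi1 piV bS bS' bM bM'.
rewrite -!piM => /piE[D D0 HD]; exists D => // r s s' a a' r0 sr sr' ar ar'.
pose th : Th := exist P (r, (s, s'), (a, a')) (And5 r0 sr sr' ar ar').
exists ((M + M' + Mnew S S') th); last by have := HD th; rewrite mul1r.
rewrite -[X in `|X|]/(a + a' + Mnew S S' th).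
apply: le_trans (ler_normD _ _) _; apply: lerD; first exact: ler_normD.
have K0 : 0 <= Ks * r by rewrite mulr_ge0// ltW.
rewrite /Mnew fct_sumE big_enum /=; apply: le_trans (ler_norm_sum _ _ _) _.
apply: (@le_trans _ _ (\sum_(c < n) Ks ^+ 2 * r ^+ 2)); last by rewrite sumr_const card_ord -[leLHS]mulr_natl mulrA.
apply: ler_sum => c _; rewrite -exprMn; apply/mx_norm_leP; first exact: sqr_ge0.
move=> i j; rewrite mxE -[(_ *: _) th]/(2^-1 *: sec s c) mxE !normrM expr2.
have se x k : `|x| <= r -> `|sec x c 0 k| <= Ks * r.
  by move=> xr; apply: le_trans (mx_entry_le _ _ _) _; apply: le_trans (sec_bd _ _) _; rewrite ler_pM2l.
apply: ler_pM; rewrite ?mulr_ge0//; last exact: se.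
by apply: le_trans (se s i sr); rewrite ger0_norm ?invr_ge0// ler_piMl// invf_le1// ler1n.
Qed.

Lemma split_words (C : R) : exists2 D, 0 <= D & forall r M, 0 < r -> `|M| <= C * r ^+ 2 ->
  wr (zw (2 * r) M) (zw r (4^-1 *: M) ++ (zw r (4^-1 *: M) ++ (zw r (4^-1 *: M) ++ zw r (4^-1 *: M)))) (D * r ^+ 2).
Proof.
pose P (x : R * 'M[R]_m) := 0 < x.1 /\ `|x.2| <= C * x.1 ^+ 2.
pose Th := {x | P x}; pose lam (th : Th) := (sval th).1.
have lam0 th : 0 < lam th by case: th => x [].
have [H [pi [piE piM pi1 piV]]] := fam_group lam.
pose M (th : Th) := (sval th).2.
have CC : C <= `|C| by exact: ler_norm.
have bM : fbd2 lam M by exists `|C| => // th; have [_ h4] := svalP th; apply: le_trans h4 _; rewrite ler_wpM2r// sqr_ge0.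
have := split4 lam0 piE piM pi1 piV bM.
rewrite /Zf -!piM => /piE[D D0 HD]; exists D => // r a r0 ar.
pose th : Th := exist P (r, a) (conj r0 ar).
by have := HD th; rewrite /= mul1r.
Qed.

(** The size bound [CM * r ^+ 2] for matrices survives a merge: [2 * CM * r ^+ 2 + CM * r ^+ 2 <= CM
    * (2 * r) ^+ 2]. *)
Definition CM : R := n%:R * Ks ^+ 2.
Let CM0 : 0 <= CM. Proof. by rewrite mulr_ge0// sqr_ge0. Qed.

(** The two halves cost [2 * C * r ^+ 2] and their merge [D * r ^+ 2], against [4 * C * r ^+ 2]
    available at scale [2 * r]; hence there is no loss in the number of levels. *)
Lemma collect : exists2 C, 0 <= C & forall k w, size w = (2 ^ k)%N -> (forall u, u \in w -> `|u| <= 1) ->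
  exists S M, [/\ `|S| <= 2 ^+ k, `|M| <= CM * (2 ^+ k) ^+ 2 &
    wr w ([:: S] ++ zw (2 ^+ k) M) (C * (2 ^+ k) ^+ 2)].
Proof.
have [D D0 HD] := merge_words CM.
(* The word [zw 1 0] of the zero matrix has nonzero letters but trivial product; at level 0 it is
   inserted at bounded cost. *)
have [|D1 D10 HD1] := @Wbdd (1 + size (zw 1 0))%N (1 + \sum_(u <- zw 1 0) `|u|) _.
  by rewrite addr_ge0// sumr_ge0.
exists (D + D1); first exact: addr_ge0.
elim=> [|k IH] w sw wb.
  case: w sw wb => [|u []]//= _ wb; exists u, 0; split.
  - by rewrite expr0; apply: wb; rewrite inE.
  - by rewrite normr0 mulr_ge0// sqr_ge0.
  rewrite expr0 expr1n mulr1; apply: (@Wle _ _ D1); first by rewrite lerDr.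
  have u1 : `|u| <= 1 by apply: wb; rewrite inE.
  have s0 : 0 <= \sum_(u <- zw 1 0) `|u| by apply: sumr_ge0.
  apply: HD1 => //.
    move=> v; rewrite !inE /= => /or3P[/eqP->|/eqP->|vz]; [by rewrite ler_wpDr//|by rewrite ler_wpDr//|].
    by rewrite (big_rem v vz) /= addrCA ler_wpDr// addr_ge0// sumr_ge0.
  rewrite -[u :: zw 1 0]/([:: u] ++ zw 1 0) wp_cat// !wp1 wp_zw// -[0](scale0r 0) zv_scale scale0r (bch0 nf)//.
have kk : (2 ^ k <= size w)%N by rewrite sw leq_exp2l.
have [||S [M [Sb Mb h]]] := IH (take (2 ^ k) w).
- by rewrite size_take sw ltn_exp2l// leqnn.
- by move=> u /mem_take; exact: wb.
have [||S' [M' [Sb' Mb' h']]] := IH (drop (2 ^ k) w).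
- by rewrite size_drop sw expnS mul2n -addnn addnK.
- by move=> u /mem_drop; exact: wb.
have r0 : 0 < 2 ^+ k :> R by rewrite exprn_gt0.
have [M2 M2b HM2] := HD _ _ _ _ _ r0 Sb Sb' Mb Mb'.
exists (S + S'), M2; split.
- by apply: le_trans (ler_normD _ _) _; rewrite exprS; lra.
- apply: le_trans M2b _; rewrite (exprS (2 : R) k) exprMn -/CM.
  by have := mulr_ge0 CM0 (sqr_ge0 (2 ^+ k)); lra.
rewrite -{1}(cat_take_drop (2 ^ k) w) exprS.
apply: (@Wle _ _ ((D + D1) * (2 ^+ k) ^+ 2 + (D + D1) * (2 ^+ k) ^+ 2 + D * (2 ^+ k) ^+ 2)).
  rewrite exprMn; set q := (2 ^+ k) ^+ 2; have q0 : 0 <= q by exact: sqr_ge0.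
  by have := mulr_ge0 D0 q0; have := mulr_ge0 D10 q0; lra.
by apply: Wtrans (Wcat h h') _; rewrite -catA; exact: HM2.
Qed.

(* Splitting into four words at half the scale costs 4^k on each of the k levels. *)
Lemma contract : exists2 C, 0 <= C & forall k M, `|M| <= CM * (2 ^+ k) ^+ 2 ->
    wr (zw (2 ^+ k) M) [:: zv M] (C * k.+1%:R * (2 ^+ k) ^+ 2).
Proof.
have [D D0 HD] := split_words (4 * CM).
pose bz : R := \sum_(i <- enum 'I_m) \sum_(j <- enum 'I_m) `|be (copy c0 (ebase i)) (copy c0 (ebase j))|.
pose A : R := Kc * (1 + CM) + CM * bz.
have bz0 : 0 <= bz by rewrite sumr_ge0// => i _; rewrite sumr_ge0.
have A0 : 0 <= A by rewrite addr_ge0// mulr_ge0// ?addr_ge0// ltW.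
have [D1 D10 HD1] := @Wbdd (1 + size (zw 1 0))%N A A0.
exists (D + D1); first exact: addr_ge0.
elim=> [|k IH] M Mb.
  move: Mb; rewrite !expr0 expr1n !mulr1 => Mb.
  apply: (@Wle _ _ D1); first by rewrite lerDr.
  have Mij i j : `|M i j| <= CM by apply: le_trans (mx_entry_le _ _ _) Mb.
  have e1 c a i : `|a| <= 1 + CM -> `|copy c (a *: ebase i)| <= A.
    move=> a1; apply: le_trans (copy_bd _ _) _; rewrite normrZ.
    apply: (@le_trans _ _ (Kc * (1 + CM))); last by rewrite lerDl mulr_ge0.
    rewrite ler_pM2l//; apply: le_trans a1; rewrite ler_piMr// norm_ebase//.
  apply: HD1 => //.
  - rewrite leqW// /zw !size_flatten /shape -!map_comp.
    rewrite leq_eqVlt; apply/orP; left; apply/eqP; congr sumn; apply: eq_map => i /=.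
    by rewrite !size_flatten /shape -!map_comp; congr sumn; apply: eq_map.
  - move=> u; rewrite mem_cat => /orP[|].
      move=> /flattenP[w /mapP[i _ ->] /flattenP[w' /mapP[j _ ->]]].
      have b1 : `|M i j / 1| <= 1 + CM by rewrite divr1; apply: le_trans (Mij i j) _; rewrite lerDr.
      have b2 : `|1 : R| <= 1 + CM by rewrite normr1 lerDl.
      by rewrite !inE => /or4P[] /eqP->; rewrite ?copyN ?normrN; exact: e1.
    rewrite inE => /eqP->; apply: (@le_trans _ _ (CM * bz)); last by rewrite lerDr mulr_ge0// ?addr_ge0// ltW.
    rewrite /zv /bz mulr_sumr; apply: le_trans (ler_norm_sum _ _ _) _; apply: ler_sum => i _.
    rewrite mulr_sumr; apply: le_trans (ler_norm_sum _ _ _) _; apply: ler_sum => j _.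
    by rewrite normrZ ler_wpM2r.
  - by rewrite wp_zw// wp1.
have r0 : 0 < 2 ^+ k :> R by rewrite exprn_gt0.
have Mb' : `|M| <= 4 * CM * (2 ^+ k) ^+ 2 by move: Mb; rewrite (exprS (2 : R) k) exprMn; lra.
have Mb4 : `|4^-1 *: M| <= CM * (2 ^+ k) ^+ 2 by rewrite normrZ ger0_norm//; lra.
have h := HD _ _ r0 Mb'; have h4 := IH _ Mb4.
have hz := Wcat h4 (Wcat h4 (Wcat h4 h4)).
rewrite [in zw _ _]exprS; apply: (@Wle _ _ (D * (2 ^+ k) ^+ 2 + 4 * ((D + D1) * k.+1%:R * (2 ^+ k) ^+ 2))).
  rewrite (exprS (2 : R) k) exprMn -[in leRHS]natr1; set q := (2 ^+ k) ^+ 2; have q0 : 0 <= q by exact: sqr_ge0.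
  by have := mulr_ge0 D0 q0; have := mulr_ge0 D10 q0; lra.
apply: Wtrans h _; rewrite zv_scale in hz.
have -> : 4 * ((D + D1) * k.+1%:R * (2 ^+ k) ^+ 2) = (D + D1) * k.+1%:R * (2 ^+ k) ^+ 2 + ((D + D1) * k.+1%:R * (2 ^+ k) ^+ 2 +
    ((D + D1) * k.+1%:R * (2 ^+ k) ^+ 2 + (D + D1) * k.+1%:R * (2 ^+ k) ^+ 2)) by ring.
apply: Wtr0 hz _; set z := zv M.
have c2 a b : wr ([:: a *: z] ++ [:: b *: z]) [:: (a + b) *: z] 0 by exact: Wcol.
apply: (@Wtr0l _ ([:: 4^-1 *: z] ++ ([:: 4^-1 *: z] ++ [:: (4^-1 + 4^-1) *: z]))).
  by apply: Wcat0l (Wrefl _) _; apply: Wcat0l (Wrefl _) (c2 _ _).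
apply: (@Wtr0l _ ([:: 4^-1 *: z] ++ [:: (4^-1 + (4^-1 + 4^-1)) *: z])).
  by apply: Wcat0l (Wrefl _) (c2 _ _).
have q1 : 4^-1 + (4^-1 + (4^-1 + 4^-1)) = 1 :> R by field.
by have := c2 4^-1 (4^-1 + (4^-1 + 4^-1)); rewrite q1 [1 *: z]scale1r.
Qed.

Theorem loop_words : exists2 C, 0 <= C & forall k w, size w = (2 ^ k)%N -> (forall u, u \in w -> `|u| <= 1) ->
  wp be w = 0 -> wr w [::] (C * k.+1%:R * (2 ^+ k) ^+ 2).
Proof.
have [C C0 HC] := collect; have [D D0 HD] := contract.
exists (C + D); first exact: addr_ge0.
move=> k w sw wb w0; have [S [M [Sb Mb h]]] := HC k w sw wb.
have h2 := Wtrans h (Wcat (Wrefl [:: S]) (HD k M Mb)).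
have r0 : 0 < 2 ^+ k :> R by rewrite exprn_gt0.
(* The product of the whole word is trivial, so what remains after contraction is [S] followed by
   its inverse. *)
have SM : zv M = - S.
  have := Wwp h; rewrite w0 wp_cat// wp1 wp_zw// /bch (nf_alt nf) zv_central oppr0 scaler0 addr0.
  by move=> /esym/eqP; rewrite addr_eq0 => /eqP ->; rewrite opprK.
rewrite SM add0r in h2; apply: Wle (Wtr0 h2 (W_pair S)).
set q := (2 ^+ k) ^+ 2; have q0 : 0 <= q by exact: sqr_ge0.
by rewrite -mulrDl ler_wpM2r// [leRHS]mulrDl lerD2r// ler_peMr// ler1n.
Qed.
End words.

(** * Superadditivity of integrals over disjoint sets *)

Section superadditivity.
Import HBSimple HBNNSimple.

(* Without measurability of [f] only this inequality holds. *)
Lemma superadditive2 d (T : measurableType d) (R : realType)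
    (mu : {measure set T -> \bar R}) (D1 D2 D : set T) (f : T -> \bar R) :
  (forall x, 0 <= f x)%E -> D1 `<=` D -> D2 `<=` D -> D1 `&` D2 = set0 ->
  (\int[mu]_(x in D1) f x + \int[mu]_(x in D2) f x <= \int[mu]_(x in D) f x)%E.
Proof.
move=> f0 D1D D2D D12.
have i0 A : (0 <= \int[mu]_(x in A) f x)%E by apply: integral_ge0.
have [S|S] := eqVneq (\int[mu]_(x in D) f x)%E +oo%E; first by rewrite S leey.
have Sf : (\int[mu]_(x in D) f x)%E \is a fin_num by rewrite ge0_fin_numE// ltey.
have key (h1 h2 : {nnsfun T >-> R}) : (forall x, (h1 x)%:E <= (f \_ D1) x)%E -> (forall x, (h2 x)%:E <= (f \_ D2) x)%E ->
   (sintegral mu h1 + sintegral mu h2 <= \int[mu]_(x in D) f x)%E.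
  move=> H1 H2; rewrite -sintegralD ge0_integralE//; apply: ereal_sup_ubound.
  exists (add_nnsfun h1 h2) => //= x.
  have := H1 x; have := H2 x; rewrite /patch; case: ifPn => x2; case: ifPn => x1.
  - have : (D1 `&` D2) x by split; exact: set_mem.
    by rewrite D12.
  - rewrite (mem_set (D2D _ (set_mem x2))) => k2 k1.
    by rewrite EFinD -[leRHS]add0e; exact: leeD.
  - rewrite (mem_set (D1D _ (set_mem x1))) => k2 k1.
    by rewrite EFinD -[leRHS]adde0; exact: leeD.
  - move=> k2 k1; have : ((h1 x + h2 x)%:E <= 0 + 0)%E by rewrite EFinD; exact: leeD.
    by rewrite adde0 => k; apply: le_trans k _; case: ifP.
have n0 := i0 D1.
rewrite ge0_integralE// in n0; rewrite [X in (X + _)%E]ge0_integralE// [X in (_ + X)%E]ge0_integralE//.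
set I1 := ereal_sup _ in n0 *; set I2 := ereal_sup _.
have fin (h : {nnsfun T >-> R}) : (sintegral mu h <= \int[mu]_(x in D) f x)%E -> sintegral mu h \is a fin_num.
  by move=> hS; rewrite ge0_fin_numE ?sintegral_ge0//; apply: le_lt_trans hS _; rewrite ltey.
have z0 : forall x, (((cst_nnsfun T (0%:nng : {nonneg R})) x)%:E <= (f \_ D1) x)%E.
  by move=> x; rewrite /= /patch; case: ifP.
have z0' : forall x, (((cst_nnsfun T (0%:nng : {nonneg R})) x)%:E <= (f \_ D2) x)%E.
  by move=> x; rewrite /= /patch; case: ifP.
have f2 (h2 : {nnsfun T >-> R}) : (forall x, (h2 x)%:E <= (f \_ D2) x)%E -> sintegral mu h2 \is a fin_num.
  by move=> H2; apply: fin; apply: le_trans (key _ _ z0 H2); rewrite leeDr// sintegral_ge0.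
have f1 (h2 : {nnsfun T >-> R}) : (forall x, (h2 x)%:E <= (f \_ D1) x)%E -> sintegral mu h2 \is a fin_num.
  by move=> H2; apply: fin; apply: le_trans (key _ _ H2 z0'); rewrite leeDl// sintegral_ge0.
have s1 (h2 : {nnsfun T >-> R}) : (forall x, (h2 x)%:E <= (f \_ D2) x)%E ->
    (I1 + sintegral mu h2 <= \int[mu]_(x in D) f x)%E.
  move=> H2; rewrite -leeBrDr ?f2//; apply: ge_ereal_sup => _ [h1 /= H1 <-].
  by rewrite leeBrDr ?f2//; exact: key.
have nf1 : I1 \is a fin_num.
  rewrite ge0_fin_numE//; apply: le_lt_trans (_ : _ < +oo)%E; last by rewrite ltey; exact: S.
  by apply: le_trans (s1 _ z0'); rewrite leeDl// sintegral_ge0.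
rewrite addeC -leeBrDr//; apply: ge_ereal_sup => _ [h2 /= H2 <-].
by rewrite leeBrDr// addeC; exact: s1.
Qed.
End superadditivity.

(** * From the square to the disc *)

Section angle.
Variable R : realType.
Definition qpi : R := pi / 4.
Notation q := qpi.
Let q0 : 0 < q. Proof. by rewrite divr_gt0// pi_gt0. Qed.
Let piE : pi = 4 * q :> R. Proof. by rewrite /qpi; field. Qed.

Lemma cos_qpi t : - q <= t <= q -> cos q <= cos t.
Proof.
have main s : 0 <= s <= q -> cos q <= cos s.
  move=> s1; rewrite leNgt; apply/negP; rewrite ltr_cos ?in_itv/= ?piE; last 2 first.
  - by have := q0; lra.
  - by have := q0; lra.
  by move=> h; lra.
move=> t1; have [t0|t0] := leP 0 t; first by apply: main; lra.
by rewrite -(cosN t); apply: main; lra.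
Qed.

Lemma cos_qpi_gt0 : 0 < cos q.
Proof. by apply: cos_gt0_pihalf; rewrite piE; have := q0; lra. Qed.

Lemma sin_qpi : sin q = cos q.
Proof. by rewrite -(cosBpihalf q) -(cosN q) piE; congr cos; field. Qed.

Lemma sin_incr s t : - q <= s -> s <= t -> t <= q -> cos q * (t - s) <= sin t - sin s /\ sin t - sin s <= t - s.
Proof.
move=> qs; rewrite le_eqVlt => /orP[/eqP->|st tq]; first by rewrite !subrr mulr0.
have [|c] := @MVT R sin cos s t st (fun x _ => is_derive_sin x).
  by apply: continuous_subspaceT => x; exact: continuous_sin.
rewrite in_itv /= => /andP[sc ct] ->.
have := cos_qpi (t := c); have := cos_le1 c => h1 h2.
by split; rewrite ?ler_pM2r ?subr_gt0//; [apply: h2; lra|rewrite ler_piMl// subr_ge0 ltW].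
Qed.

Notation a := (sin q).
(* The unit square is mapped onto the square inscribed in the unit disc by sines,
   so that its edges run along the circle at constant speed; on the four
   circular segments that remain, [xi] is constant in one of the variables and
   no area is added. *)
Definition eta (X : R) : R := sin (2 * q * (X - 2^-1)).
Definition xi (x : R) : R := 2^-1 + asin (Num.max (- a) (Num.min x a)) / (2 * q).

Let a0 : 0 < a. Proof. by rewrite sin_qpi cos_qpi_gt0. Qed.
Let a1 : a <= 1. Proof. exact: sin_le1. Qed.
Let cl x : - a <= Num.max (- a) (Num.min x a) <= a.
Proof. by rewrite le_max lexx /= ge_max ge_min lexx orbT andbT; have := a0; lra. Qed.
Let asin_q y : - a <= y <= a -> - q <= asin y <= q /\ sin (asin y) = y.
Proof.
move=> ya; have y1 : -1 <= y <= 1 by have := a1; lra.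
have [h e] := asin_def y1; split => //; rewrite piE in h; have q0' := q0.
have hq : 4 * q / 2 = 2 * q by field.
rewrite hq in h.
apply/andP; split; rewrite leNgt; apply/negP => hh.
  have : sin (asin y) < sin (- q) by rewrite ltr_sin// in_itv /= piE hq; lra.
  by rewrite e sinN; lra.
have : sin q < sin (asin y) by rewrite ltr_sin// in_itv /= piE hq; lra.
by rewrite e; lra.
Qed.

Lemma xi01 x : 0 <= xi x <= 1.
Proof.
have [h _] := asin_q (cl x); rewrite /xi; have q0' := q0; have q2 : 0 < 2 * q by rewrite mulr_gt0.
set A := asin _ in h *; have /andP[hA1 hA2] := h.
have h1 : - 2^-1 <= A / (2 * q) by rewrite ler_pdivlMr// mulNr mulrA mulVf ?mul1r.
have h2 : A / (2 * q) <= 2^-1 by rewrite ler_pdivrMr// mulrA mulVf ?mul1r.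
lra.
Qed.

Lemma eta_xi x : - a <= x <= a -> eta (xi x) = x /\ 2 * q * (xi x - 2^-1) = asin x.
Proof.
move=> xa; have E : Num.max (- a) (Num.min x a) = x by case/andP: xa => h1 h2; rewrite min_l// max_r.
have e2 : 2 * q * (xi x - 2^-1) = asin x.
  by rewrite /xi E; field; rewrite gt_eqF.
by split=> //; rewrite /eta e2; have [] := asin_q xa.
Qed.

Lemma xi_lo x : x <= - a -> xi x = 0.
Proof.
move=> xa; have q0' := q0; have h : xi x = xi (- a).
  rewrite /xi (min_l (_ : x <= a)) ?(max_l xa) ?(min_l (_ : - a <= a)) ?maxxx//; have := a0; lra.
have hh : - (pi / 2) <= - q <= pi / 2 by rewrite piE; lra.
rewrite h /xi min_l ?maxxx -?sinN ?sinK ?in_itv//=; last by rewrite sinN; have := a0; lra.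
by field; rewrite gt_eqF.
Qed.

Lemma xi_hi x : a <= x -> xi x = 1.
Proof.
move=> xa; have q0' := q0; rewrite /xi min_r// max_r; last by have := a0; lra.
have hh : - (pi / 2) <= q <= pi / 2 by rewrite piE; lra.
by rewrite sinK ?in_itv//=; field; rewrite gt_eqF.
Qed.

Lemma eta_incr X Y : 0 <= X -> X <= Y -> Y <= 1 ->
  cos q * (2 * q) * (Y - X) <= eta Y - eta X /\ eta Y - eta X <= 2 * q * (Y - X).
Proof.
move=> X0 XY Y1; have q0' := q0; have := @sin_incr (2 * q * (X - 2^-1)) (2 * q * (Y - 2^-1)).
have -> : 2 * q * (Y - 2^-1) - 2 * q * (X - 2^-1) = 2 * q * (Y - X) by ring.
by rewrite mulrA; apply; nra.
Qed.

Lemma eta0 : eta 0 = - a.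
Proof. by rewrite /eta -sinN; congr sin; field. Qed.
Lemma eta1 : eta 1 = a.
Proof. by rewrite /eta; congr sin; field. Qed.

Lemma eta_itv X : 0 <= X <= 1 -> - a <= eta X <= a.
Proof.
move=> /andP[X0 X1]; have k : 0 < cos q * (2 * q) by rewrite mulr_gt0 ?cos_qpi_gt0// mulr_gt0.
have [h1 _] := eta_incr (lexx 0) X0 X1; have [h2 _] := eta_incr X0 X1 (lexx 1).
rewrite eta0 in h1; rewrite eta1 in h2; nra.
Qed.

Lemma xi_eta X : 0 <= X <= 1 -> xi (eta X) = X.
Proof.
move=> X01; have q0' := q0; have [_ e] := eta_xi (eta_itv X01).
have hh : - (pi / 2) <= 2 * q * (X - 2^-1) <= pi / 2 by rewrite piE; nra.
have : asin (eta X) = 2 * q * (X - 2^-1) by rewrite /eta sinK// in_itv.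
rewrite -e => /mulfI; rewrite mulf_neq0 ?gt_eqF// => /(_ isT); lra.
Qed.

Lemma xi_in x : - a < x < a -> 0 < xi x < 1.
Proof.
move=> xa; have xa' : - a <= x <= a by lra.
have [e _] := eta_xi xa'.
have /andP[h1 h2] := xi01 x; rewrite !lt_neqAle h1 h2 !andbT.
by apply/andP; split; apply/eqP => E; move: e; [rewrite -E eta0|rewrite E eta1]; lra.
Qed.

(** On the inscribed square [xi] inverts [eta], whose slope is at least [cos q * (2 * q)]; outside
    it is constant. *)
Lemma xi_lip : exists2 K : R, 0 < K & forall x y, `|xi x - xi y| <= K * `|x - y|.
Proof.
have q0' := q0; pose k := cos q * (2 * q).
have k0 : 0 < k by rewrite mulr_gt0 ?cos_qpi_gt0// mulr_gt0.
have mono x y : x <= y -> 0 <= xi y - xi x /\ k * (xi y - xi x) <= y - x.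
  move=> xy.
  have key u v : - a <= u -> u <= v -> v <= a -> 0 <= xi v - xi u /\ k * (xi v - xi u) <= v - u.
    move=> au uv va; have ua : - a <= u <= a by lra.
    have va' : - a <= v <= a by lra.
    have [eu _] := eta_xi ua; have [ev _] := eta_xi va'.
    have /andP[u0 u1] := xi01 u; have /andP[v0 v1] := xi01 v.
    have uv' : xi u <= xi v.
      rewrite leNgt; apply/negP => vu; have [h _] := eta_incr v0 (ltW vu) u1.
      by move: h; rewrite eu ev -/k => h; have : 0 < k * (xi u - xi v) by [rewrite mulr_gt0// subr_gt0]; lra.
    by have [h _] := eta_incr u0 uv' v1; rewrite eu ev -/k in h; split; lra.
  pose c (z : R) : R := Num.max (- a) (Num.min z a).
  have xc z : xi z = xi (c z).
    have [h|h] := leP z (- a); first by rewrite /c min_l ?max_l ?(xi_lo h) ?xi_lo//; have := a0; lra.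
    have [h'|h'] := leP a z; first by rewrite /c min_r// max_r ?(xi_hi h') ?xi_hi//; have := a0; lra.
    by rewrite /c min_l ?max_r// ltW.
  have cxy : c x <= c y /\ c y - c x <= y - x by exact: clamp_le.
  have /andP[cx _] := cl x; have /andP[_ cy] := cl y.
  have [h1 h2] := key _ _ cx cxy.1 cy; rewrite (xc x) (xc y); split; first exact: h1.
  by move: h2 cxy.2; rewrite -/(c x) -/(c y); lra.
exists k^-1; first by rewrite invr_gt0.
move=> x y; wlog xy : x y / x <= y.
  by move=> H; have [/H//|/ltW/H] := leP x y; rewrite distrC [X in _ <= _ * X]distrC.
have [h1 h2] := mono x y xy; rewrite distrC (ger0_norm h1) distrC ger0_norm ?subr_ge0//.
by rewrite mulrC ler_pdivlMr// mulrC.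
Qed.

Lemma circ_edge (x y : R) : x ^+ 2 + y ^+ 2 = 1 -> a <= x ->
  - a <= y <= a /\ circ (asin y) = (x, y).
Proof.
move=> xy ax; have c2 := cos2Dsin2 q; rewrite -sin_qpi in c2.
have ya : - a <= y <= a.
  have y2 : y ^+ 2 <= a ^+ 2 by have := a0; rewrite !expr2 in xy c2 *; nra.
  by rewrite -ler_norml -(@ler_pXn2r _ 2) ?nnegrE ?(ltW a0)// real_normK// num_real.
split => //; have [h e] := asin_q ya.
have c0 : 0 <= cos (asin y) by apply: le_trans (cos_qpi h); exact: ltW cos_qpi_gt0.
have c3 := cos2Dsin2 (asin y); rewrite e in c3.
rewrite /circ e; congr (_, _); apply/eqP; rewrite -(@eqrXn2 _ 2)//; last by have := a0; lra.
by apply/eqP; lra.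
Qed.
End angle.

Lemma dv_chain (R : realType) (W : normedModType R) (z : R -> W) (w : W) (e : R -> R) (k : R) :
  dv z 0 w -> @dv R R^o e 0 k -> e 0 = 0 -> dv (fun s => z (e s)) 0 (k *: w).
Proof.
move=> dz de e0 ep ep0.
have k1 : 0 < 2 * (`|k| + 1) by rewrite mulr_gt0// ltr_wpDl.
have w1 : 0 < 2 * (`|w| + 1) by rewrite mulr_gt0// ltr_wpDl.
have [d1 d10 H1] := dz _ (divr_gt0 ep0 k1).
pose e2 := Num.min 1 (ep / (2 * (`|w| + 1))).
have e20 : 0 < e2 by rewrite lt_min ltr01 divr_gt0.
have [d2 d20 H2] := de _ e20.
exists (Num.min d2 (d1 / (`|k| + 1))); first by rewrite lt_min d20 divr_gt0// ltr_wpDl.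
move=> s; rewrite lt_min ltr_pdivlMr ?ltr_wpDl// => /andP[s2 s1].
have := H2 s s2; rewrite !add0r e0 subr0 => h2.
have eb : `|e s| <= (`|k| + 1) * `|s|.
  have -> : e s = (e s - s * k) + s * k by ring.
  apply: le_trans (ler_normD _ _) _; rewrite normrM.
  have : e2 * `|s| <= 1 * `|s| by rewrite ler_wpM2r// ge_min lexx.
  by move: h2; rewrite -[s *: k]/(s * k); lra.
have := H1 (e s); rewrite add0r => h1.
have {}h1 : `|z (e s) - z 0 - e s *: w| <= ep / (2 * (`|k| + 1)) * `|e s|.
  by apply: h1; apply: le_lt_trans eb _; rewrite mulrC.
have -> : z (e s) - z 0 - s *: (k *: w) = (z (e s) - z 0 - e s *: w) + (e s - s * k) *: w.
  by rewrite scalerBl scalerA; zmodc.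
apply: le_trans (ler_normD _ _) _; rewrite normrZ.
have -> : ep * `|s| = ep / (2 * (`|k| + 1)) * ((`|k| + 1) * `|s|) + ep / (2 * (`|w| + 1)) * `|s| * (`|w| + 1).
  by field; rewrite !gt_eqF// ltr_wpDl.
apply: lerD; first by apply: le_trans h1 _; rewrite ler_wpM2l// ltW// divr_gt0.
apply: ler_pM => //; last by rewrite lerDl.
by apply: le_trans h2 _; rewrite ler_wpM2r// ge_min lexx orbT.
Qed.

(** * Jacobian of the map from the plane through the unit square *)

Section gram_form.
Variables (R : realType) (G : groupTopType) (m : nat) (A : atlas G 'rV[R]_m).
Hypothesis lieG : lie_group A.
Variables (N : nat) (be : 'rV[R]_N -> 'rV[R]_N -> 'rV[R]_N) (psi : 'rV[R]_N -> G).
Variables (L : 'rV[R]_N -> 'rV[R]_m) (c d : R).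
Hypothesis md : model A be psi L c d.
Variable h : metric A.
Hypotheses (riem_h : riemannian h) (linv_h : left_invariant h).
Notation E := 'rV[R]_N.
Notation ip := (ip L h).

Definition igram (u v : E) := Num.sqrt (ip u u * ip v v - ip u v ^+ 2).

Lemma igramC u v : igram u v = igram v u.
Proof. by rewrite /igram mulrC (ipC lieG L riem_h u v). Qed.

Lemma igramZ a u v : igram (a *: u) v = `|a| * igram u v.
Proof.
rewrite /igram !(ipZl md h) (ipZr lieG md riem_h).
have -> : a * (a * ip u u) * ip v v - (a * ip u v) ^+ 2 = a ^+ 2 * (ip u u * ip v v - ip u v ^+ 2) by ring.
by rewrite sqrtrM ?sqr_ge0// sqrtr_sqr.
Qed.

(** Area is invariant under shears; approximate proportionality then becomes a small second side in
    [igram0]. *)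
Lemma igram_shift u v l : igram u v = igram u (v - l *: u).
Proof.
have -> : v - l *: u = (- l) *: u + v by rewrite scaleNr addrC.
rewrite /igram !(ipDl md h) !(ipDr lieG md riem_h) !(ipZl md h) !(ipZr lieG md riem_h).
by rewrite (ipC lieG L riem_h v u); congr Num.sqrt; ring.
Qed.

Lemma igramB : exists2 Ci : R, 0 < Ci & forall u v, igram u v <= Ci * `|u| * `|v|.
Proof.
have [Ci Ci0 HC] := ip_bound md h; exists Ci => // u v.
have C0 : 0 <= Ci * `|u| * `|v| by rewrite !mulr_ge0// ltW.
rewrite -(ger0_norm C0) -sqrtr_sqr; apply: ler_wsqrtr.
have hu := ip_ge0 lieG md riem_h u; have hv := ip_ge0 lieG md riem_h v.
have bu : ip u u <= Ci * `|u| * `|u| by rewrite -[leLHS]ger0_norm.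
have bv : ip v v <= Ci * `|v| * `|v| by rewrite -[leLHS]ger0_norm.
have := ler_pM hu hv bu bv; have := sqr_ge0 (ip u v).
have -> : (Ci * `|u| * `|v|) ^+ 2 = Ci * `|u| * `|u| * (Ci * `|v| * `|v|) by ring.
lra.
Qed.

Lemma igram0 u v : (forall e, 0 < e -> exists l : R, `|v - l *: u| <= e) -> igram u v <= 0.
Proof.
move=> H; have [Ci Ci0 HC] := igramB; apply/ler_addgt0Pr => e e0; rewrite add0r.
have k0 : 0 < Ci * (`|u| + 1) by rewrite mulr_gt0// ltr_wpDl.
have [l hl] := H _ (divr_gt0 e0 k0).
rewrite (igram_shift u v l); apply: le_trans (HC _ _) _.
apply: (@le_trans _ _ (Ci * (`|u| + 1) * (e / (Ci * (`|u| + 1))))).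
  by apply: ler_pM => //; [rewrite mulr_ge0// ltW|rewrite ler_pM2l// lerDl].
by rewrite mulrC divfK// gt_eqF.
Qed.

Variables (H : R -> R -> E) (Ar : R).
Hypothesis fH : fil be igram H Ar.
Notation q := (qpi R).
Notation a := (sin q).
Notation xi := (@xi R).
Let F (p : R * R) : E := H (xi p.1) (xi p.2).
Let g (p : R * R) : G := psi (F p).
Let nf := md_nf md.

Lemma square_lip : exists2 K : R, 0 < K & forall p p', `|F p - F p'| <= K * (`|p.1 - p'.1| + `|p.2 - p'.2|).
Proof.
have [l [xs [ys [K [lip ok j ar]]]]] := fH; have [Kx Kx0 HK] := @xi_lip R.
have K0 := Lip2_ge0 lip.
exists (K * Kx + 1) => [|p p']; first by rewrite ltr_wpDl// mulr_ge0// ltW.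
apply: le_trans (lip _ _ _ _ (xi01 _) (xi01 _) (xi01 _) (xi01 _)) _.
have h1 := HK p.1 p'.1; have h2 := HK p.2 p'.2.
apply: (@le_trans _ _ (K * (Kx * (`|p.1 - p'.1| + `|p.2 - p'.2|)))).
  by rewrite ler_wpM2l// mulrDr lerD.
by rewrite mulrA ler_wpM2r ?addr_ge0// lerDl.
Qed.

Lemma square_riem_lip (S : set (R * R)) : riem_lipschitz h S g.
Proof.
have [K K0 HK] := square_lip; have [Kb Kb0 Hcl] := close_of_diff md.
have [Cd Cd0 HC] := riem_dist_le lieG md riem_h linv_h.
have [l [xs [ys [KH [lip ok j ar]]]]] := fH.
pose X := `|H 0 0| + KH * 2.
have KH0 := Lip2_ge0 lip.
have FX p : `|F p| <= X.
  have -> : F p = H 0 0 + (F p - H 0 0) by zmod.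
  apply: le_trans (ler_normD _ _) _; rewrite lerD2l.
  have z01 : 0 <= (0 : R) <= 1 by rewrite lexx ler01.
  apply: le_trans (lip _ _ _ _ (xi01 _) (xi01 _) z01 z01) _; rewrite ler_wpM2l// !subr0.
  have /andP[x0 x1] := xi01 p.1; have /andP[y0 y1] := xi01 p.2.
  by rewrite !ger0_norm//; lra.
have X0 : 0 <= X by rewrite addr_ge0// mulr_ge0.
have k0 : 0 <= 1 + Kb * X by rewrite addr_ge0// mulr_ge0// ltW.
exists (Cd * ((1 + Kb * X) * (2 * K))) => p p' _ _.
have := HC _ _ _ (Hcl (1%g : G) (F p) (F p')); rewrite !mul1g => hd.
apply: le_trans hd _; rewrite lee_fin -mulrA ler_pM2l// -mulrA.
apply: ler_pM => //; first by rewrite addr_ge0// mulr_ge0// ltW.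
  by rewrite lerD2l ler_pM2l.
rewrite distrC; apply: le_trans (HK p p') _; rewrite -mulrA [leRHS]mulrCA ler_pM2l//.
by have [h1 h2] := plane_dist_ge p p'; lra.
Qed.

Lemma square_slices p : exists z1 z2 : R -> E, exists k : R, [/\ 0 <= k,
  forall s, z1 s = bch be (- F p) (H (xi (s + p.1)) (xi p.2)),
  forall s, z2 s = bch be (- F p) (H (xi p.1) (xi (s + p.2))),
  forall s, g (s *: ((1 : R), (0 : R)) + p) = (g p * psi (z1 s))%g /\ `|z1 s| <= k * `|s| &
  forall s, g (s *: ((0 : R), (1 : R)) + p) = (g p * psi (z2 s))%g /\ `|z2 s| <= k * `|s|].
Proof.
have [K K0 HK] := square_lip; have [Kb Kb0 HB] := bchN_ka nf.
pose z (p' : R * R) := bch be (- F p) (F p').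
have zb p' : `|z p'| <= (1 + Kb * `|F p|) * (K * (`|p'.1 - p.1| + `|p'.2 - p.2|)).
  apply: le_trans (HB _ _) _; apply: ler_wpM2l; last exact: HK.
  by rewrite addr_ge0// mulr_ge0// ltW.
have gz p' : g p' = (g p * psi (z p'))%g by rewrite /g (md_mul md) (bchKr nf).
exists (fun s => z (s + p.1, p.2)), (fun s => z (p.1, s + p.2)), ((1 + Kb * `|F p|) * K); split => //.
- by rewrite mulr_ge0// ?(ltW K0)// addr_ge0// mulr_ge0// ltW.
- move=> s; have -> : s *: ((1 : R), (0 : R)) + p = (s + p.1, p.2).
    by rewrite -[LHS]/(_ + _, _ + _) /= /GRing.scale /= ?mulr1 ?mulr0 ?add0r.
  split; first exact: gz.
  by have := zb (s + p.1, p.2); rewrite /= addrK subrr normr0 addr0 mulrA.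
- move=> s; have -> : s *: ((0 : R), (1 : R)) + p = (p.1, s + p.2).
    by rewrite -[LHS]/(_ + _, _ + _) /= /GRing.scale /= ?mulr1 ?mulr0 ?add0r.
  split; first exact: gz.
  by have := zb (p.1, s + p.2); rewrite /= addrK subrr normr0 add0r mulrA.
Qed.

Lemma igram0l u : igram 0 u = 0.
Proof. by rewrite -(scale0r (0 : E)) igramZ normr0 mul0r. Qed.

Lemma square_jac_out p : a < `|p.1| \/ a < `|p.2| -> Defs.jacobian h g p = 0.
Proof.
have [z1 [z2 [k [k0 z1E z2E H1 H2]]]] := square_slices p.
have cst (x : R) : a < `|x| -> exists2 dl : R, 0 < dl & forall s, `|s| < dl -> xi (s + x) = xi x.
  move=> ax; exists (`|x| - a); first by rewrite subr_gt0.
  move=> s sd; have [x0|x0] := leP 0 x.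
    move: ax sd; rewrite (ger0_norm x0) ltr_norml => ax /andP[s1 s2].
    by rewrite !xi_hi//; lra.
  move: ax sd; rewrite (ltr0_norm x0) ltr_norml => ax /andP[s1 s2].
  by rewrite !xi_lo//; lra.
have z0 (z : R -> E) (w : E) (dl : R) : 0 < dl -> (forall s, `|s| < dl -> z s = 0) -> dv z 0 w -> w = 0.
  move=> dl0 zz dz; apply/eqP; rewrite -normr_le0; apply: (dv_le dl0 _ dz) => s /zz ->.
  by rewrite normr0 mul0r.
have FF : bch be (- F p) (F p) = 0 by exact: bchNl.
case=> /cst[dl dl0 Hd].
  have [//|[w1 [w2 [d1 d2 _ _ ->]]]] := jac_cases lieG md riem_h linv_h ltr01 k0 k0 (fun s _ => H1 s) (fun s _ => H2 s).
  have -> : w1 = 0 by apply: z0 dl0 _ d1 => s /Hd e; rewrite z1E e.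
  exact: igram0l.
have [//|[w1 [w2 [d1 d2 _ _ ->]]]] := jac_cases lieG md riem_h linv_h ltr01 k0 k0 (fun s _ => H1 s) (fun s _ => H2 s).
have -> : w2 = 0 by apply: z0 dl0 _ d2 => s /Hd e; rewrite z2E e.
by rewrite -/(igram w1 0) igramC igram0l.
Qed.
(** Derivatives of [g] are turned into derivatives of [H] by composing with [eta], the local inverse
    of [xi]. Each is multiplied by a slope of at least [cos q * (2 * q)], so the jacobian of [g] is
    the bound for [H] divided by the square of this number. *)
Lemma square_jac_in (l : seq (cell R)) (p : R * R) : - a < p.1 < a -> - a < p.2 < a ->
  jb be igram H (xi p.1) (xi p.2) (csum l (xi p.1) (xi p.2)) ->
  0 <= csum l (xi p.1) (xi p.2) ->
  Defs.jacobian h g p <= (cos q * (2 * q)) ^- 2 * csum l (xi p.1) (xi p.2).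
Proof.
move=> p1 p2 J J0; pose k0 := cos q * (2 * q).
have q0 : 0 < q by rewrite divr_gt0// pi_gt0.
have k00 : 0 < k0 by rewrite mulr_gt0 ?cos_qpi_gt0// mulr_gt0.
have [z1 [z2 [k [kk z1E z2E H1 H2]]]] := square_slices p.
have [->|[w1 [w2 [d1 d2 _ _ ->]]]] := jac_cases lieG md riem_h linv_h ltr01 kk kk (fun s _ => H1 s) (fun s _ => H2 s).
  by rewrite mulr_ge0// invr_ge0 sqr_ge0.
have chain (x : R) (z : R -> E) (y : R -> E) (w : E) : - a < x < a ->
    (forall s, z s = y (xi (s + x))) -> dv z 0 w ->
    exists2 k1, k0 <= k1 & dv (fun s => y (xi x + s)) 0 (k1 *: w).
  move=> xa zy dz; have xa' : - a <= x <= a by lra.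
  have [ex _] := eta_xi xa'; have /andP[X0 X1] := xi_in xa.
  pose th := 2 * q * (xi x - 2^-1).
  exists (2 * q * cos th).
    have cth : cos q <= cos th by apply: cos_qpi; rewrite /th; nra.
    by rewrite /k0 [leLHS]mulrC; apply: ler_wpM2l => //; rewrite mulr_ge0// ltW.
  pose e s := eta (xi x + s) - x.
  have e0 : e 0 = 0 by rewrite /e addr0 ex subrr.
  have de : @dv R R^o e 0 (2 * q * cos th).
    have ds : @dv R R^o (fun s => sin (th + s) - x) 0 (cos th).
      have ds' : @dv R R^o sin th (cos th) by apply/dv_derive; split; [exact: ex_derive|exact: derive_val].
      move=> ep ep0; have [dd dd0 Hd] := ds' ep ep0; exists dd => // s sd.
      by have := Hd s sd; rewrite add0r addr0 opprB addrA subrK.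
    have := dv_scale (2 * q) ds; apply: dv_ext => s; rewrite /e /eta /th; congr (sin _ - _); ring.
  have [dl dl0 Hd] : exists2 dl : R, 0 < dl & forall s, `|s| < dl -> 0 <= xi x + s <= 1.
    exists (Num.min (xi x) (1 - xi x)); first by rewrite lt_min X0 subr_gt0.
    by move=> s; rewrite lt_min !ltr_norml => /andP[/andP[s1 s2] /andP[s3 s4]]; apply/andP; split; lra.
  apply: dv_at0 dl0 _ (dv_chain dz de e0) => s sd.
  by rewrite zy /e subrK xi_eta// Hd.
have [k1 k1k c1] := chain p.1 z1 (fun X => bch be (- F p) (H X (xi p.2))) w1 p1 z1E d1.
have [k2 k2k c2] := chain p.2 z2 (fun Y => bch be (- F p) (H (xi p.1) Y)) w2 p2 z2E d2.
have := J _ _ c1 c2; rewrite igramZ igramC igramZ igramC -/(igram w1 w2).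
rewrite !ger0_norm ?(le_trans (ltW k00))// => h12.
have g12 : 0 <= igram w1 w2 by exact: sqrtr_ge0.
rewrite -/k0 mulrC ler_pdivlMr ?exprn_gt0//; apply: le_trans h12; rewrite mulrA mulrC ler_wpM2r//.
by rewrite expr2; apply: ler_pM => //; exact: ltW.
Qed.
End gram_form.

(** * Measurable majorants made of boxes *)

Section boxes.
Variable R : realType.
Notation leb := (@lebesgue_measure R).

(* The flag gives the box infinite weight: such boxes cover the lines on which
   the jacobian is not controlled. *)
Definition box : Type := ((bool * R) * (interval R * interval R))%type.
Definition bwt (b : box) : \bar R := if b.1.1 then +oo%E else (`|b.1.2|)%:E.
Definition bset (b : box) : set (R * R) := [set` b.2.1] `*` [set` b.2.2].
Definition bfun (b : box) (p : R * R) : \bar R := (bwt b * (\1_(bset b) p)%:E)%E.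

Lemma bwt_ge0 b : (0 <= bwt b)%E.
Proof. by rewrite /bwt; case: ifP => _; rewrite ?leey// lee_fin. Qed.
Lemma bfun_ge0 b p : (0 <= bfun b p)%E.
Proof. by rewrite mule_ge0 ?bwt_ge0// lee_fin indicE ler0n. Qed.

Lemma bset_meas b : measurable (bset b).
Proof. by apply: measurableX; exact: measurable_itv. Qed.

Lemma integral_boxes (bs : seq box) :
  (\int[leb \x leb]_(p in setT) (\sum_(b <- bs) bfun b p) =
   \sum_(b <- bs) bwt b * (leb [set` b.2.1] * leb [set` b.2.2]))%E.
Proof.
rewrite ge0_integral_sum//.
- apply: eq_bigr => b _; have mb : measurable (bset b) by exact: bset_meas.
  rewrite ge0_integralZl//; last exact: bwt_ge0.
  + rewrite integral_indic// setIT; congr (_ * _)%E.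
    rewrite /bset; apply: product_measure1E; exact: measurable_itv.
  + by apply/measurable_realfun.measurable_EFinP; exact: measurable_realfun.measurable_indic.
- move=> b; have mb : measurable (bset b) by exact: bset_meas.
  apply: emeasurable_funM; first exact: measurable_cst.
  by apply/measurable_realfun.measurable_EFinP; exact: measurable_realfun.measurable_indic.
- by move=> b p _; exact: bfun_ge0.
Qed.

Lemma le_bsum (bs : seq box) b p : b \in bs -> (bfun b p <= \sum_(b <- bs) bfun b p)%E.
Proof.
move=> bb; rewrite (big_rem b bb) /= leeDl//; apply: sume_ge0 => c _; exact: bfun_ge0.
Qed.
End boxes.

Lemma lee_sum_all (R : realType) (T : Type) (P : pred T) (l : seq T) (F G : T -> \bar R) :
  all P l -> (forall r, P r -> (F r <= G r)%E) -> (\sum_(r <- l) F r <= \sum_(r <- l) G r)%E.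
Proof.
move=> + FG; elim: l => [|r l IH] /=; first by rewrite !big_nil.
by move=> /andP[/FG rr /IH ll]; rewrite !big_cons leeD.
Qed.

Section square_area.
Variables (R : realType) (G : groupTopType) (m : nat) (A : atlas G 'rV[R]_m).
Hypothesis lieG : lie_group A.
Variables (N : nat) (be : 'rV[R]_N -> 'rV[R]_N -> 'rV[R]_N) (psi : 'rV[R]_N -> G).
Variables (L : 'rV[R]_N -> 'rV[R]_m) (c d : R).
Hypothesis md : model A be psi L c d.
Variable h : metric A.
Hypotheses (riem_h : riemannian h) (linv_h : left_invariant h).
Variables (H : R -> R -> 'rV[R]_N) (Ar : R).
Hypothesis fH : fil be (igram L h) H Ar.
Notation q := (qpi R).
Notation a := (sin q).
Notation xi := (@xi R).
Notation leb := (@lebesgue_measure R).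
Let g (p : R * R) : G := psi (H (xi p.1) (xi p.2)).

Lemma square_area : (disc_area h g <= (cos q ^- 2 * Ar)%:E)%E.
Proof.
have [l [xs [ys [K [lip ok J ar]]]]] := fH.
have q0 : 0 < q by rewrite divr_gt0// pi_gt0.
pose k0 := cos q * (2 * q).
have k00 : 0 < k0 by rewrite mulr_gt0 ?cos_qpi_gt0// mulr_gt0.
pose lx (x : R) : box R := ((true, 0), (`[x, x], `]-oo, +oo[)).
pose ly (y : R) : box R := ((true, 0), (`]-oo, +oo[, `[y, y])).
(* A cell may extend beyond the unit square, where [eta] is not monotone; its left edge is therefore
   clamped. *)
pose al (t : R) := eta (clamp t).
(* The preimage of a cell lies in a box with sides [2 * q] times as long. With the weight [k0 ^- 2]
   the factors [2 * q] cancel, and [cos q ^- 2] remains. *)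
pose cb (r : cell R) : box R := ((false, k0 ^- 2 * cJ r),
  (`[al (cxa r), al (cxa r) + 2 * q * (cxb r - cxa r)], `[al (cya r), al (cya r) + 2 * q * (cyb r - cya r)])).
pose nx := a :: - a :: map (@eta R) xs; pose ny := a :: - a :: map (@eta R) ys.
pose bs := (map lx nx ++ map ly ny) ++ map cb l.
have J0 p : (0 <= (Defs.jacobian h g p)%:E)%E by rewrite lee_fin; exact: sqrtr_ge0.
have pt p : ((Defs.jacobian h g p)%:E <= \sum_(b <- bs) bfun b p)%E.
  have [px|px] := boolP (p.1 \in nx).
    apply: le_trans (_ : bfun (lx p.1) p <= _)%E; last by apply: le_bsum; rewrite !mem_cat map_f.
    rewrite /bfun /bwt /= indicE mem_set ?mule1 ?leey//.
    by split => //=; rewrite in_itv /= lexx.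
  have [py|py] := boolP (p.2 \in ny).
    apply: le_trans (_ : bfun (ly p.2) p <= _)%E; last by apply: le_bsum; rewrite mem_cat (mem_cat _ (map lx nx)) (map_f ly py) orbT.
    rewrite /bfun /bwt /= indicE mem_set ?mule1 ?leey//.
    by split => //=; rewrite in_itv /= lexx.
  have sum0 s : (0 <= \sum_(b <- s) bfun b p)%E by apply: sume_ge0 => b _; exact: bfun_ge0.
  have [ax|ax] := ltP a `|p.1|.
    by rewrite (square_jac_out lieG md riem_h linv_h fH (or_introl ax)).
  have [ay|ay] := ltP a `|p.2|.
    by rewrite (square_jac_out lieG md riem_h linv_h fH (or_intror ay)).
  have ins (x : R) (s : seq R) : `|x| <= a -> x \notin a :: - a :: map (@eta R) s -> - a < x < a /\ xi x \notin s.
    rewrite ler_norml !inE !negb_or => /andP[x1 x2] /and3P[n1 n2 n3].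
    have x12 : - a <= x <= a by rewrite x1.
    split; first by rewrite !lt_neqAle x1 x2 n1 eq_sym n2.
    by apply: contra n3 => xs'; apply/mapP; exists (xi x) => //; have [-> _] := eta_xi x12.
  have [p1 nxs] := ins _ _ ax px; have [p2 nys] := ins _ _ ay py.
  have X01 := xi_in p1; have Y01 := xi_in p2.
  have c0 := csum_ge0 (xi p.1) (xi p.2) ok.
  have := square_jac_in lieG md riem_h linv_h fH p1 p2 (J _ _ X01 Y01 nxs nys) c0.
  rewrite -lee_fin => hJ; apply: le_trans hJ _.
  rewrite [leRHS]big_cat /= -[leLHS]add0e; apply: leeD => //.
  rewrite /csum mulr_sumr -sumEFin big_map; apply: lee_sum_all ok _ => r /and3P[r1 r2 r3].
  rewrite /cval; case: ifP => [/and4P[xa xb ya yb]|_]; last by rewrite mulr0; exact: bfun_ge0.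
  have edge (x u v : R) : - a < x < a -> u < xi x -> xi x < v -> al u <= x <= al u + 2 * q * (v - u).
    move=> xa' ux xv; have /andP[X0 X1] := xi_in xa'.
    have cu : 0 <= clamp u by case/andP: (clamp01 u).
    have uu : u <= clamp u by rewrite /clamp le_max le_min lexx /=; apply/orP; right; lra.
    have cx : clamp u <= xi x by rewrite /clamp ge_max ge_min (ltW X0) (ltW ux).
    have xa2 : - a <= x <= a by lra.
    have [ex _] := eta_xi xa2.
    have [h1 h2] := eta_incr cu cx (ltW X1); rewrite ex -/(al u) in h1 h2.
    have k1 : 0 <= cos q * (2 * q) * (xi x - clamp u) by rewrite mulr_ge0 ?subr_ge0// ltW.
    have k2 : 2 * q * (xi x - clamp u) <= 2 * q * (v - u) by apply: ler_wpM2l; [rewrite mulr_ge0// ltW|lra].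
    by apply/andP; split; lra.
  rewrite /bfun /bwt /= indicE mem_set ?mule1.
    by rewrite lee_fin ger0_norm// mulr_ge0// invr_ge0 sqr_ge0.
  by split => /=; rewrite in_itv /=; exact: edge.
have mono : (disc_area h g <= \int[leb \x leb]_(p in setT) (Defs.jacobian h g p)%:E)%E.
  have := @superadditive2 _ _ _ (leb \x leb)%E (@disc R) set0 setT _ J0 (@subsetT _ _) (@subsetT _ _) (setI0 _).
  by apply: le_trans; rewrite leeDl// integral_ge0.
apply: (le_trans mono); have := @le_integral_nonmeas _ _ _ (leb \x leb)%E setT _ _ (fun x _ => J0 x) (fun x _ => pt x).
move=> hle; apply: (le_trans hle).
rewrite integral_boxes /bs; clear hle mono pt bs; clearbody nx ny.
rewrite big_cat /= big_cat /= !big_map /=.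
(* A line has measure 0, and its infinite weight times 0 is 0. *)
rewrite [X in (X + _ + _)%E]big1 ?add0e; last first.
  by move=> x _; rewrite /= lebesgue_measure_itv /= ltxx mul0e mule0.
rewrite [X in (X + _)%E]big1 ?add0e; last first.
  by move=> x _; rewrite /= [X in (_ * (_ * X))%E]lebesgue_measure_itv /= ltxx mule0 mule0.
have len (u w : R) : 0 <= w -> leb [set` `[u, u + w]] = w%:E.
  move=> w0; rewrite lebesgue_measure_itv /= lte_fin ltrDl; case: ltP => hw.
    by rewrite -EFinB addrAC subrr add0r.
  by have -> : w = 0 by apply/le_anti; rewrite w0 hw.
apply: (@le_trans _ _ (\sum_(r <- l) (cos q ^- 2 * (cJ r * (cxb r - cxa r) * (cyb r - cya r)))%:E)%E); last first.
  rewrite sumEFin lee_fin -mulr_sumr ler_wpM2l// invr_ge0 sqr_ge0//.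
apply: lee_sum_all ok _ => r /and3P[r1 r2 r3].
have lw (x y : R) : x <= y -> 0 <= 2 * q * (y - x).
  by move=> xy; apply: mulr_ge0; [apply: mulr_ge0 => //; exact: ltW|rewrite subr_ge0].
rewrite /bwt /= !len ?lw//.
rewrite -!EFinM lee_fin ger0_norm; last by rewrite mulr_ge0// invr_ge0 sqr_ge0.
rewrite le_eqVlt; apply/orP; left; apply/eqP; rewrite /k0.
by field; rewrite !gt_eqF// cos_qpi_gt0.
Qed.
End square_area.

(** * Filling a loop *)

Lemma superadditive_seq d (T : measurableType d) (R : realType)
    (mu : {measure set T -> \bar R}) (D U : nat -> set T) (f : T -> \bar R) (k : nat) :
  (forall x, 0 <= f x)%E -> (forall i, D i `<=` U i.+1) -> (forall i, U i `<=` U i.+1) ->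
  (forall i, U i `&` D i = set0) ->
  (\sum_(i <- iota 0 k) \int[mu]_(x in D i) f x <= \int[mu]_(x in U k) f x)%E.
Proof.
move=> f0 DU UU DU0; elim: k => [|k IH]; first by rewrite big_nil integral_ge0.
rewrite -addn1 iotaD big_cat big_seq1 add0n addn1; apply: le_trans (leeD IH (lexx _)) _.
exact: superadditive2.
Qed.

Section assembly.
Variables (R : realType) (G : groupTopType) (m : nat) (A : atlas G 'rV[R]_m).
Hypothesis lieG : lie_group A.
Variables (N : nat) (be : 'rV[R]_N -> 'rV[R]_N -> 'rV[R]_N) (psi : 'rV[R]_N -> G).
Variables (L : 'rV[R]_N -> 'rV[R]_m) (c d : R).
Hypothesis md : model A be psi L c d.
Variable h : metric A.
Hypotheses (riem_h : riemannian h) (linv_h : left_invariant h).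
Notation E := 'rV[R]_N.
Notation q := (qpi R).
Notation leb := (@lebesgue_measure R).
Let nf := md_nf md.
Let gC := igramC lieG L riem_h.
Let gZ := igramZ lieG md riem_h.
Let g0 := igram0 lieG md riem_h.
Notation wr := (wr be (igram L h)).
Notation hom := (hom be (igram L h)).
Hypothesis LW : exists2 C, 0 <= C & forall k w, size w = (2 ^ k)%N -> (forall u, u \in w -> `|u| <= 1) ->
  wp be w = 0 -> wr w [::] (C * k.+1%:R * (2 ^+ k) ^+ 2).

Let Wrefl := wr_refl nf gC gZ g0.
Let Wcat a a' b b' (B D : R) := @wr_cat _ _ _ nf _ gC gZ g0 a a' b b' B D.
Let Wtrans w1 w2 w3 (B D : R) := @wr_trans _ _ be _ gC gZ w1 w2 w3 B D.
Let Wsym w1 w2 (B : R) := @wr_sym _ _ be _ gC gZ w1 w2 B.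
Let W0 := wr0 nf gC gZ g0.
Let Wcol := wr_collinear nf gC gZ g0.
Let WV := W_inv Wrefl Wtrans Wcat W0 Wcol.

Let q0 : 0 < q. Proof. by rewrite divr_gt0// pi_gt0. Qed.
Let piE : pi = 4 * q :> R. Proof. by rewrite /qpi; field. Qed.

(** The word [winv w2 ++ w1] has trivial product; zero letters, which cost nothing, pad it to a
    length that is a power of 2 before the dyadic filling. *)
Lemma wr_loops : exists2 C, 0 <= C & forall w1 w2 (y : R),
  (forall u, u \in w1 ++ w2 -> `|u| <= 1) -> wp be w1 = wp be w2 -> (size w1 + size w2)%:R <= y ->
  wr w1 w2 (C * ((4 * y + 2) ^+ 2 * ln (4 * y + 2))).
Proof.
have [C C0 HC] := LW; have l2 : 0 < ln 2 :> R by rewrite ln_gt0// ltr1n.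
exists (C / ln 2); first by rewrite divr_ge0// ltW.
move=> w1 w2 y wb ww sy; pose s := (size w1 + size w2)%N.
have y0 : 0 <= y by apply: le_trans sy.
have [k sk kb] : exists2 k, (s <= 2 ^ k)%N & (2 ^ k <= 2 * s + 1)%N.
  case: (posnP s) => [->|s0]; first by exists 0%N.
  exists (up_log 2 s); first exact: up_logP.
  have [s1|s1] := leqP s 1; first by have -> : s = 1%N by lia.
  have := up_log_bounds (isT : (1 < 2)%N) s1 => /andP[h1 h2].
  have : (0 < up_log 2 s)%N by rewrite up_log_gt0.
  by case: (up_log 2 s) h1 h2 => // j /= h1 _ _; rewrite expnS; lia.
have r2 : (2 ^+ k : R) <= 2 * y + 1.
  have : (2 ^ k)%:R <= (2 * s + 1)%:R :> R by rewrite ler_nat.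
  rewrite natrX (natrD _ (2 * s)) (natrM _ 2 s); have : s%:R <= y by exact: sy.
  by lra.
(* From [2 ^+ k <= 2 * y + 1] one gets [(k + 1) * ln 2 <= ln (4 * y + 2)]; this is where the number
   of levels becomes a logarithm. *)
have kk : k.+1%:R * (2 ^+ k) ^+ 2 <= (4 * y + 2) ^+ 2 * ln (4 * y + 2) / ln 2.
  rewrite ler_pdivlMr//.
  have e1 : k.+1%:R * ln 2 = ln (2 ^+ k.+1 : R) by rewrite lnXn ?mulr_natl.
  have e2 : ln (2 ^+ k.+1 : R) <= ln (4 * y + 2).
    by rewrite ler_ln ?posrE ?exprn_gt0//; [rewrite exprS; lra|lra].
  rewrite mulrAC e1 mulrC; apply: ler_pM; rewrite ?sqr_ge0//.
    by rewrite ln_ge0// exprn_ege1// ler1n.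
  by rewrite ler_pXn2r ?nnegrE ?exprn_ge0//; lra.
pose w := winv w2 ++ w1 ++ nseq (2 ^ k - s) 0.
have sw : size w = (2 ^ k)%N.
  have e (a b j : nat) : (a + b <= j)%N -> (b + (a + (j - (a + b))) = j)%N by move=> *; lia.
  by rewrite /w !size_cat size_nseq /winv size_map size_rev; apply: e sk.
have wz j : wr (nseq j (0 : E)) [::] 0.
  elim: j => [|j IH]; first exact: Wrefl.
  rewrite -[nseq j.+1 0]/([:: 0] ++ nseq j 0) -[X in wr _ X]cat0s -[X in wr _ _ X](addr0 0).
  exact: Wcat W0 IH.
have wpi v : wp be (winv v) = - wp be v.
  have [e _] := WV v; rewrite wp_cat// in e; apply: (bchI nf (x := wp be v)).
  by rewrite e (bchN nf).
have wp0 : wp be w = 0.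
  by rewrite /w !wp_cat// wpi ww (wz _).1 /= (bch0 nf) (bchNl nf).
have wb1 u : u \in w -> `|u| <= 1.
  rewrite /w !mem_cat => /or3P[/mapP[v]|uw|].
  - by rewrite mem_rev => vw ->; rewrite normrN; apply: wb; rewrite mem_cat vw orbT.
  - by apply: wb; rewrite mem_cat uw.
  - by move/nseqP => [-> _]; rewrite normr0.
have h1 := HC k w sw wb1 wp0.
set T := C * k.+1%:R * (2 ^+ k) ^+ 2 in h1.
have h2 : wr (winv w2 ++ w1) [::] T.
  rewrite -(add0r T); apply: Wtrans h1; rewrite /w -[X in wr _ _ X](addr0 0); apply: Wcat (Wrefl _) _.
  by rewrite -{1}[w1]cats0 -[X in wr _ _ X](addr0 0); apply: Wcat (Wrefl _) (Wsym (wz _)).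
have h3 : wr w1 w2 T.
  have e1 : wr w1 (w2 ++ (winv w2 ++ w1)) 0.
    rewrite catA -[X in wr X]cat0s -[X in wr _ _ X](addr0 0); apply: Wcat (Wrefl _); exact: Wsym (WV _).
  have e2 : wr (w2 ++ (winv w2 ++ w1)) (w2 ++ [::]) (0 + T) by apply: Wcat (Wrefl _) h2.
  rewrite cats0 in e2; have := Wtrans e1 e2; rewrite !add0r; exact.
apply: wr_le h3; rewrite /T -[X in X <= _]mulrA.
have -> : C / ln 2 * ((4 * y + 2) ^+ 2 * ln (4 * y + 2)) = C * ((4 * y + 2) ^+ 2 * ln (4 * y + 2) / ln 2) by ring.
exact: ler_wpM2l.
Qed.

(** As [psi] is a bijection the lift is forced at each point and closes up by itself; what needs
    proof is that it is Lipschitz. *)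
Lemma circle_lift (f : R * R -> G) : riem_lipschitz h (@circle R) f -> exists al K, [/\ 0 <= K,
  forall t, psi (al t) = f (circ t), al 0 = al (8 * q) &
  forall s t, 0 <= s <= 8 * q -> 0 <= t <= 8 * q -> `|al s - al t| <= K * `|s - t|].
Proof.
move=> lf; have [K [dl [K0 dl0 HK]]] := circle_close lieG md riem_h linv_h lf.
have /choice[al alE] : forall t : R, exists z, psi z = f (circ t) by move=> t; exact: md_surj md _.
have ll : loglip psi (fun t => f (circ t)) 0 (8 * q).
  exists (K * 2), (dl / 4); split; [by rewrite mulr_gt0|by rewrite divr_gt0|].
  move=> s t _ _ st; have cl := circ_lip s t.
  apply: close_le (HK _ _ (circ_circle s) (circ_circle t) _) _; first by apply: le_lt_trans cl _; lra.
  by rewrite -mulrA ler_pM2l.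
have B0 : 0 <= 8 * q by have := q0; lra.
have [|K' [K'0 HK']] := loglip_model (md_nf md) (md_mul md) (md_inj md) (y0 := 0) (w := al) B0 ll.
  by move=> t _; rewrite alE (md_psi0 md) mul1g.
exists al, K'; split => //; first exact: ltW.
apply: (md_inj md); rewrite !alE; congr f.
have -> : 8 * q = 2 * pi by rewrite piE; ring.
by rewrite /circ cos0 sin0 mulr_natl cos2pi sin2pi.
Qed.

(** The constant [Cc] is universal while [dl] depends on the loop. [curve_bound] covers arcs of
    length at most [ec]; for a longer arc the Lipschitz bound [K1 * dl <= Cc * ec] is already small
    enough. *)
Lemma letter_bound : exists2 Cc : R, 0 < Cc & forall (f : R * R -> G) al K, riem_lipschitz h (@circle R) f ->
  0 <= K -> (forall t, psi (al t) = f (circ t)) ->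
  (forall s t, 0 <= s <= 8 * q -> 0 <= t <= 8 * q -> `|al s - al t| <= K * `|s - t|) ->
  exists2 dl : R, 0 < dl & forall s t, 0 <= s -> s <= t -> t <= 8 * q -> t - s <= dl ->
    `|bch be (- al s) (al t)| <= 1 /\ forall l : R,
    (\int[leb]_(u in `]s, t[) (speed h (fun t => f (circ t)) u)%:E)%E = l%:E ->
    `|bch be (- al s) (al t)| <= Cc * l.
Proof.
have [Cc [ec [Cc0 ec0 HC]]] := curve_bound lieG md riem_h linv_h.
have [Kb Kb0 HB] := bchN_ka nf.
exists Cc => // f al K lf K0 alE alK.
have B0 : 0 <= 8 * q by have := q0; lra.
pose X := `|al 0| + K * (8 * q); have X0 : 0 <= X by rewrite addr_ge0// mulr_ge0.
have alX s : 0 <= s <= 8 * q -> `|al s| <= X.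
  move=> s1; have := alK s 0 s1 _; rewrite lexx B0 subr0 => /(_ isT) hh.
  have -> : al s = al 0 + (al s - al 0) by zmod.
  apply: le_trans (ler_normD _ _) _; rewrite lerD2l; apply: le_trans hh _.
  by rewrite ler_wpM2l//; case/andP: s1 => a b; rewrite ger0_norm.
pose K1 := (1 + Kb * X) * K + 1.
have K10 : 0 < K1 by rewrite ltr_wpDl// mulr_ge0// addr_ge0// mulr_ge0// ltW.
have small s t : 0 <= s -> s <= t -> t <= 8 * q -> `|bch be (- al s) (al t)| <= K1 * (t - s).
  move=> s0 st t8; have sI : 0 <= s <= 8 * q by lra.
  have tI : 0 <= t <= 8 * q by lra.
  apply: le_trans (HB _ _) _; have := alK t s tI sI; rewrite (ger0_norm (_ : 0 <= t - s)) ?subr_ge0// => ak.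
  have k1 : 0 <= 1 + Kb * `|al s| by rewrite addr_ge0// mulr_ge0// ltW.
  apply: le_trans (ler_wpM2l k1 ak) _; rewrite mulrA ler_wpM2r ?subr_ge0//.
  apply: (@le_trans _ _ ((1 + Kb * X) * K)); last by rewrite lerDl.
  by rewrite ler_wpM2r// lerD2l ler_pM2l// alX.
exists (Num.min (K1^-1) (Cc * ec / K1)); first by rewrite lt_min invr_gt0 K10 divr_gt0// mulr_gt0.
move=> s t s0 st t8; rewrite le_min ler_pdivlMr// => /andP[d1 d2].
have b1 := small s t s0 st t8; split.
  by apply: le_trans b1 _; rewrite -ler_pdivlMl// mulr1.
move=> l il; have [lec|lec] := leP l ec; last first.
  apply: le_trans b1 _; apply: (@le_trans _ _ (Cc * ec)); last by rewrite ler_pM2l// ltW.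
  by rewrite mulrC.
have ll : loglip psi (fun t => f (circ t)) s t.
  have [K2 [dl2 [K20 dl20 HK2]]] := circle_close lieG md riem_h linv_h lf.
  exists (K2 * 2), (dl2 / 4); split; [by rewrite mulr_gt0|by rewrite divr_gt0|].
  move=> u v _ _ uv; have cl := circ_lip u v.
  apply: close_le (HK2 _ _ (circ_circle u) (circ_circle v) _) _; first by apply: le_lt_trans cl _; lra.
  by rewrite -mulrA ler_pM2l.
have [] := HC _ s t l st ll _ lec; first by rewrite il.
move=> z; rewrite -!alE (md_mul md) => /(md_inj md) ->.
by rewrite (bchK nf).
Qed.

(** The loop is cut at the parameters 0 and [4 * q]; the flag [pos] selects the direction in which
    one runs from the latter point. Both halves then share their endpoints. *)
Lemma half_word : exists2 Cc : R, 0 < Cc & forall (pos : bool) (f : R * R -> G) al K (x : R),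
  riem_lipschitz h (@circle R) f -> 0 <= K -> (forall t, psi (al t) = f (circ t)) ->
  (forall s t, 0 <= s <= 8 * q -> 0 <= t <= 8 * q -> `|al s - al t| <= K * `|s - t|) ->
  (closed_curve_length h f <= x%:E)%E ->
  exists w, [/\ hom (fun s => al (4 * q + (if pos then 4 * q else - 4 * q) * s)) (P be (al (4 * q)) w) 1,
    forall u, u \in w -> `|u| <= 1 & wlen w <= Cc * x].
Proof.
have [Cc Cc0 HC] := letter_bound; exists Cc => // pos f al K x lf K0 alE alK lx.
have [dl dl0 Hd] := HC f al K lf K0 alE alK.
pose sg : R := if pos then 4 * q else - 4 * q.
pose c1 s := al (4 * q + sg * s).
have rg s : 0 <= s <= 1 -> 0 <= 4 * q + sg * s <= 8 * q.
  by move=> s1; have q0' := q0; rewrite /sg; case: (pos); nra.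
have [q4 q8] : 0 <= 4 * q /\ 4 * q <= 8 * q by have := q0; lra.
have nsg : `|sg| = 4 * q.
  by rewrite /sg; case: (pos); rewrite ?mulNr ?normrN ger0_norm.
have cK : Lip1 c1 (K * (4 * q)).
  move=> s t s1 t1; apply: le_trans (alK _ _ (rg s s1) (rg t t1)) _.
  by rewrite -mulrA ler_wpM2l// opprD addrACA subrr add0r -mulrBr normrM nsg.
have KK0 : 0 <= K * (4 * q) by rewrite mulr_ge0//; have := q0; lra.
have [Ci Ci0 gB] := igramB lieG md riem_h.
have [D D0 HP] := hom_poly nf gC gZ g0 gB Ci0 KK0 cK.
(* So many sides that the polygon is within area 1 of the curve and every step of the parameter is
   at most [dl]. *)
have [M M0 MR] : exists2 M, (0 < M)%N & D + 4 * q / dl < M%:R.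
  by exists (Num.trunc (D + 4 * q / dl)).+1 => //; exact: truncnS_gt.
have q4d : 0 <= 4 * q / dl by rewrite divr_ge0// ?(ltW dl0)//; have := q0; lra.
have m0 : 0 < M%:R :> R by rewrite ltr0n.
pose th i := 4 * q + sg * (i%:R / M%:R).
have thS i : th i.+1 = th i + sg / M%:R by rewrite /th -[i.+1%:R]natr1; ring.
pose u i := bch be (- c1 (i%:R / M%:R)) (c1 (i.+1%:R / M%:R)).
exists [seq u i | i <- iota 0 M].
have hM := HP M M0.
have i01 i : (i <= M)%N -> 0 <= (i%:R / M%:R : R) <= 1.
  by move=> iM; rewrite divr_ge0//= ler_pdivrMr// mul1r ler_nat.
pose lo i := if pos then th i else th i.+1.
pose hi i := if pos then th i.+1 else th i.
have lohi i : hi i - lo i = 4 * q / M%:R.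
  by rewrite /hi /lo !thS /sg; case: (pos); ring.
have stp : 4 * q / M%:R <= dl.
  by rewrite ler_pdivrMr// -ler_pdivrMl// [_^-1 * _]mulrC; apply: le_trans (ltW MR); rewrite lerDr.
have lh i : (i < M)%N -> [/\ 0 <= lo i, lo i <= hi i & hi i <= 8 * q].
  move=> iM; have a := rg _ (i01 i (ltnW iM)); have b := rg _ (i01 i.+1 iM).
  have le : lo i <= hi i by rewrite -subr_ge0 lohi divr_ge0// ltW.
  have /andP[a1 a2] := a; have /andP[b1 b2] := b.
  by split; [|exact: le|]; rewrite /lo /hi; case: (pos).
have un i : `|u i| = `|bch be (- al (lo i)) (al (hi i))|.
  rewrite /u /c1 /lo /hi -/(th i) -/(th i.+1); case: (pos) => //.
  by rewrite -[RHS]normrN (bch_opp nf) opprK.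
have Hu i : (i < M)%N -> `|u i| <= 1 /\ forall l : R,
    (\int[leb]_(t in `]lo i, hi i[) (speed h (fun t => f (circ t)) t)%:E)%E = l%:E -> `|u i| <= Cc * l.
  by move=> iM; have [h1 h2 h3] := lh i iM; rewrite un; apply: Hd => //; rewrite lohi.
split.
- have e0 : c1 0 = al (4 * q) by rewrite /c1 mulr0 addr0.
  rewrite -e0; apply: hom_le hM; rewrite ler_pdivrMr// mul1r; apply: le_trans (ltW MR).
  by rewrite lerDl.
- by move=> v /mapP[i]; rewrite mem_iota add0n => /= iM ->; have [] := Hu i iM.
(* The arc covered by the first [k] sides: it grows to the right or to the left according to [pos],
   and is disjoint from the next open arc, as superadditivity requires. *)
pose U k := `](if pos then 4 * q else th k), (if pos then th k else 4 * q)[%classic.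
have th0 : th 0 = 4 * q by rewrite /th mul0r mulr0 addr0.
have thM : (0 <= (if pos then 4 * q else th M)) /\ (if pos then th M else 4 * q) <= 8 * q.
  by have /andP[a1 a2] := rg _ (i01 M (leqnn M)); case: (pos); split.
have thm i : if pos then 4 * q <= th i else th i <= 4 * q.
  have : 0 <= (i%:R / M%:R : R) by rewrite divr_ge0// ltW.
  rewrite /th /sg; case: (pos) => a; first by rewrite lerDl mulr_ge0.
  by rewrite gerDl !mulNr oppr_le0 mulr_ge0.
have ths i : if pos then th i <= th i.+1 else th i.+1 <= th i.
  have : 0 <= hi i - lo i by rewrite lohi divr_ge0// ltW.
  by rewrite subr_ge0 /lo /hi; case: (pos).
pose F (t : R) := (speed h (fun t => f (circ t)) t)%:E.
have F0 t : (0 <= F t)%E by rewrite lee_fin; exact: sqrtr_ge0.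
have sup := @superadditive_seq _ _ _ leb (fun i => `]lo i, hi i[%classic) U F M F0.
have {}sup : (\sum_(i <- iota 0 M) \int[leb]_(t in `]lo i, hi i[) F t <= x%:E)%E.
  apply: le_trans (sup _ _ _) _.
  - move=> i t /=; rewrite /U /lo /hi /= !in_itv /=; have := thm i.
    case: (pos) => a /andP[b e]; first by rewrite (le_lt_trans a b) e.
    by rewrite b (lt_le_trans e a).
  - move=> i t /=; rewrite /U /= !in_itv /=; have := ths i.
    case: (pos) => a /andP[b e]; first by rewrite b (lt_le_trans e a).
    by rewrite (le_lt_trans a b) e.
  - move=> i; apply/seteqP; split => // t /=; rewrite /U /lo /hi /= !in_itv /=.
    case: (pos) => -[/andP[a b] /andP[e g]].
      by have := lt_trans b e; rewrite ltxx.
    by have := lt_trans g a; rewrite ltxx.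
  apply: le_trans lx; rewrite /closed_curve_length /curve_length.
  have e8 : 2 * pi = 8 * q by rewrite piE; ring.
  rewrite e8; have := @superadditive2 _ _ _ leb (U M) set0 `[0, 8 * q]%classic F F0 _ _ (setI0 _).
  rewrite integral_set0 adde0; apply => // t /=; rewrite /U /= !in_itv /=.
  by have [a b] := thM; move=> /andP[e g]; rewrite (le_trans a (ltW e)) (le_trans (ltW g) b).
have fi i : (i < M)%N -> exists2 l : R, 0 <= l & (\int[leb]_(t in `]lo i, hi i[) F t)%E = l%:E.
  move=> iM; have I0 j : (0 <= \int[leb]_(t in `]lo j, hi j[) F t)%E by apply: integral_ge0.
  have : (\int[leb]_(t in `]lo i, hi i[) F t <= x%:E)%E.
    apply: le_trans sup; rewrite (big_rem i) ?mem_iota//= leeDl//; exact: sume_ge0.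
  have := I0 i; case: (\int[leb]_(t in `]lo i, hi i[) F t)%E => [l|//|//].
  by rewrite lee_fin => l0 _; exists l.
have [l l0 lE] : exists2 l : nat -> R, (forall i, 0 <= l i) & forall i, (i < M)%N ->
    (\int[leb]_(t in `]lo i, hi i[) F t)%E = (l i)%:E.
  have /choice[l Hl] : forall i, exists l : R, 0 <= l /\ ((i < M)%N -> (\int[leb]_(t in `]lo i, hi i[) F t)%E = l%:E).
    by move=> i; have [/fi[l l0 lE]|_] := ltnP i M; [exists l|exists 0].
  by exists l => i; have [] := Hl i.
rewrite /wlen big_map.
have h1 : \sum_(i <- iota 0 M) `|u i| <= \sum_(i <- iota 0 M) Cc * l i.
  rewrite big_seq [leRHS]big_seq; apply: ler_sum => i; rewrite mem_iota add0n => /= iM.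
  by have [_] := Hu i iM; apply; exact: lE.
apply: le_trans h1 _; rewrite -mulr_sumr ler_pM2l// -lee_fin -sumEFin.
apply: le_trans sup; rewrite big_seq [leRHS]big_seq; apply: lee_sum => i; rewrite mem_iota add0n => /= iM.
by rewrite lE.
Qed.

Lemma fill_loop : exists C1 C2 C3 : R, [/\ 0 <= C1, 0 <= C2, 0 <= C3 & forall (f : R * R -> G) (x : R), 0 <= x ->
  riem_lipschitz h (@circle R) f -> (closed_curve_length h f <= x%:E)%E ->
  (filling_area h f <= (C1 * ((C3 * x + 10) ^+ 2 * ln (C3 * x + 10)) + C2 * (x + 1))%:E)%E].
Proof.
have [Ci Ci0 gB] := igramB lieG md riem_h.
have [Cg [Dg [Cg0 Dg0 HG]]] := wr_group nf gC gZ g0 gB Ci0.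
have [Cl Cl0 HL] := wr_loops; have [Cc Cc0 HW] := half_word.
pose k := cos q ^- 2; have k0 : 0 <= k by rewrite invr_ge0 sqr_ge0.
exists (k * Cl), (k * (2 + 2 * Cg * (Cc + 1))), (8 * Dg * Cc).
split; [exact: mulr_ge0|by rewrite mulr_ge0// addr_ge0// !mulr_ge0// addr_ge0// ltW|by rewrite !mulr_ge0// ltW|].
move=> f x x0 lf lx.
have [al [K [K0 alE al8 alK]]] := circle_lift lf.
have [w1 [h1 b1 l1]] := HW true f al K x lf K0 alE alK lx.
have [w2 [h2 b2 l2]] := HW false f al K x lf K0 alE alK lx.
have [v1 [g1 s1 c1]] := HG w1 b1; have [v2 [g2 s2 c2]] := HG w2 b2.
have wpE : wp be v1 = wp be v2.
  rewrite -g1.1 -g2.1; apply: (bchI nf (x := al (4 * q))).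
  have [_ e1] := hom_ends h1; have [_ e2] := hom_ends h2.
  rewrite !P1// in e1 e2; rewrite e1 e2 !mulr1 mulNr subrr al8; congr al; ring.
have sz : (size v1 + size v2)%:R <= 2 * Dg * Cc * x + 2.
  rewrite natrD; have := ler_wpM2l Dg0 l1; have := ler_wpM2l Dg0 l2; lra.
have cc u : u \in v1 ++ v2 -> `|u| <= 1 by rewrite mem_cat => /orP[/c1|/c2].
have HLv := HL v1 v2 _ cc wpE sz.
have ey : 4 * (2 * Dg * Cc * x + 2) + 2 = 8 * Dg * Cc * x + 10 by ring.
rewrite ey in HLv; set T := _ * ln _ in HLv *.
(* Each inscribed polygon costs 1, grouping the letters of a half costs a multiple of its length
   plus 1, and the dyadic filling gives the remaining term. *)
have hh : hom (fun s => al (4 * q + 4 * q * s)) (fun s => al (4 * q + - 4 * q * s))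
    (2 + 2 * Cg * (Cc + 1) * (x + 1) + Cl * T).
  have hw : wr w1 w2 (Cg * (wlen w1 + 1) + Cl * T + Cg * (wlen w2 + 1)).
    exact: Wtrans (Wtrans g1 HLv) (Wsym g2).
  have := hom_trans gC gZ (hom_trans gC gZ h1 (hw.2 (al (4 * q)))) (hom_sym gC gZ h2).
  apply: hom_le; have := ler_wpM2l Cg0 l1; have := ler_wpM2l Cg0 l2.
  have := mulr_ge0 Cg0 x0; have := mulr_ge0 Cg0 (ltW Cc0); lra.
have [H fH bH] := square nf gC gZ g0 q0 K0 alK al8 hh.
pose g (p : R * R) := psi (H (xi p.1) (xi p.2)).
apply: (@le_trans _ _ (disc_area h g)).
  apply: ereal_inf_lbound; exists g; split => //; first exact: (square_riem_lip lieG md riem_h linv_h fH).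
  move=> [u v] uv; have uv1 : u ^+ 2 + v ^+ 2 = 1 by exact: uv.
  have q1 : 0 < 2 * q by rewrite mulr_gt0.
  pose t z : R := asin z.
  have X01 (z : R) := xi01 z.
  have Xt z : - sin q <= z <= sin q -> 2 * q * xi z = q + t z.
    by move=> za; have [_ e] := eta_xi za; rewrite /t -e; field.
  have piE4 : pi / 2 = 2 * q by rewrite piE; field.
  have tr2 z : cos (2 * q - z) = sin z /\ sin (2 * q - z) = cos z.
    by rewrite -piE4 cosB sinB cos_pihalf sin_pihalf; split; ring.
  have tr4 z : cos (4 * q - z) = - cos z /\ sin (4 * q - z) = sin z.
    by rewrite -piE cosB sinB cospi sinpi; split; ring.
  have tr6 z : cos (6 * q + z) = sin z /\ sin (6 * q + z) = - cos z.
    have -> : 6 * q + z = 2 * q - (- z) + 4 * q by ring.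
    by have [a1 a2] := tr2 (- z); rewrite -piE cosDpi sinDpi a1 a2 sinN cosN opprK.
  have tr8 z : circ (8 * q + z) = circ z.
    have -> : 8 * q + z = z + pi *+ 2 by rewrite piE; ring.
    by rewrite /circ cosD2pi sinD2pi.
  (* On the unit circle one of [u], [- u], [v], [- v] is at least [sin q]. There one coordinate of
     the square is 0 or 1 and the other is affine in the angle, so the edge of [H] reproduces [f].
     On the edge [sin q <= u] the angle passes through a full turn, hence two branches. *)
  rewrite /g /=; have [ua|ua] := leP (sin q) u.
    have [va [e1 e2]] := circ_edge uv1 ua.
    rewrite (xi_hi ua); have [_ _ _ ->] := bH _ (X01 v).
    case: ifP => _; rewrite alE; first by rewrite (_ : _ + _ = 8 * q + t v) ?tr8; [rewrite /circ e1 e2|rewrite (Xt _ va); ring].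
    by rewrite (Xt _ va) (_ : _ - _ = t v); [rewrite /circ e1 e2|ring].
  have [ua'|ua'] := leP (sin q) (- u).
    have [|va [e1 e2]] := @circ_edge R (- u) v _ ua'; first by rewrite sqrrN.
    rewrite xi_lo; last by rewrite lerNr.
    have [_ _ -> _] := bH _ (X01 v); rewrite (Xt _ va) alE (_ : _ - _ = 4 * q - t v); last by ring.
    by rewrite /circ (tr4 _).1 (tr4 _).2 e1 e2 opprK.
  have [va|va] := leP (sin q) v.
    have [|ub [e1 e2]] := @circ_edge R v u _ va; first by rewrite addrC.
    rewrite (xi_hi va); have [_ -> _ _] := bH _ (X01 u).
    rewrite (Xt _ ub) alE (_ : _ - _ = 2 * q - t u); last by ring.
    by rewrite /circ (tr2 _).1 (tr2 _).2 e1 e2.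
  have va' : sin q <= - v.
    rewrite leNgt; apply/negP => vb.
    have := cos2Dsin2 q; rewrite -sin_qpi => sq; nra.
  have [|ub [e1 e2]] := @circ_edge R (- v) u _ va'; first by rewrite sqrrN addrC.
  rewrite (xi_lo (x := v)); last by rewrite lerNr.
  have [-> _ _ _] := bH _ (X01 u).
  rewrite (Xt _ ub) alE (_ : _ + _ = 6 * q + t u); last by ring.
  by rewrite /circ (tr6 _).1 (tr6 _).2 e1 e2 opprK.
apply: le_trans (square_area lieG md riem_h linv_h fH) _; rewrite lee_fin -/k.
have e1 : 0 <= k * (2 + 2 * Cg * (Cc + 1)) by rewrite mulr_ge0// addr_ge0// !mulr_ge0// addr_ge0// ltW.
rewrite -!(mulrA k) -mulrDr ler_wpM2l//; have := mulr_ge0 Cg0 x0; have := mulr_ge0 Cg0 (ltW Cc0).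
lra.
Qed.
End assembly.

Lemma uniform_linear_bound (R : realType) p s (I : finType) (L : I -> 'rV[R]_p -> 'rV[R]_s) :
  (forall i a u v, L i (a *: u + v) = a *: L i u + L i v) ->
  exists2 K : R, 0 < K & forall i v, `|L i v| <= K * `|v|.
Proof.
move=> LL; have /choice[K KP] : forall i, exists K : R, 0 < K /\ forall v, `|L i v| <= K * `|v|.
  move=> i; have [K K0 H] := @mulmx_bound R 1 _ _ (\matrix_(k, j) L i (delta_mx 0 k) 0 j).
  by exists K; split => // v; rewrite (linear_mx (LL i)).
have s0 : 0 <= \sum_i K i by apply: sumr_ge0 => i _; exact: ltW (KP i).1.
exists (1 + \sum_i K i); first by rewrite ltr_wpDr.
move=> i v; apply: le_trans ((KP i).2 v) _; rewrite ler_wpM2r// (bigD1 i)//=.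
rewrite addrCA lerDl addr_ge0// sumr_ge0// => j _; exact: ltW (KP j).1.
Qed.

Lemma power_loop_words (R : realType) m n (b : 'rV[R]_m -> 'rV[R]_m -> 'rV[R]_m) (nf : nilform b)
    (gram : 'rV[R]_(\rank (ker_mx n b)) -> 'rV[R]_(\rank (ker_mx n b)) -> R) (Ci : R) :
  (2 <= n)%N -> (forall u v, gram u v = gram v u) ->
  (forall a u v, gram (a *: u) v = `|a| * gram u v) -> (forall u v, (forall e, 0 < e -> exists l : R, `|v - l *: u| <= e) -> gram u v <= 0) ->
  (forall u v, gram u v <= Ci * `|u| * `|v|) -> 0 < Ci ->
  exists2 C, 0 <= C & forall k w, size w = (2 ^ k)%N -> (forall u, u \in w -> `|u| <= 1) ->
    wp (@beta R m n b) w = 0 -> wr (@beta R m n b) gram w [::] (C * k.+1%:R * (2 ^+ k) ^+ 2).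
Proof.
move=> n2 gC gZ g0 gB Ci0; have bnf := beta_nf n nf.
have [Kc Kc0 HKc] := uniform_linear_bound (@copy_lin R m n b).
have [Ks Ks0 HKs] : exists2 K : R, 0 < K & forall (c : 'I_n) x, `|row c (@sec R m n b x)| <= K * `|x|.
  by apply: (@uniform_linear_bound R _ _ _ (fun c x => row c (sec x))) => c a u v; rewrite sec_lin linearP.
have c0 : 'I_n by apply: (Ordinal (n := n) (m := 0)); apply: leq_trans n2.
(* This is where [n >= 2] enters: every copy has another copy that commutes with it. *)
have other (c : 'I_n) : exists d, c != d.
  have n1 : (0 < n)%N := ltnW n2.
  have [e|e] := eqVneq (val c) 0%N; last by exists (Ordinal n1).
  by exists (Ordinal n2); rewrite -val_eqE e.
have sbd x (c : 'I_n) : `|row c (@sec R m n b x)| <= Ks * `|x| by exact: HKs.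
have ceq (c d : 'I_n) t u : @beta R m n b (copy b c t) (copy b c u) = @beta R m n b (copy b d t) (copy b d u).
  by rewrite (beta_copy nf c c) (beta_copy nf d c).
have Cf0 : 0 <= 64 * Ci by rewrite mulr_ge0// ltW.
have Wwp w w' B : wr (@beta R m n b) gram w w' B -> wp (@beta R m n b) w = wp (@beta R m n b) w' by case.
have Wle w w' (B D : R) : B <= D -> wr (@beta R m n b) gram w w' B -> wr (@beta R m n b) gram w w' D by exact: wr_le.
exact: (@loop_words R _ _ bnf _ Wwp (wr_refl bnf gC gZ g0) (wr_sym gC gZ) (wr_trans gC gZ)
  Wle (wr_cat bnf gC gZ g0) (wr0 bnf gC gZ g0) (wr_collinear bnf gC gZ g0) _ Cf0 (wr_flat bnf gB Ci0)
  (wr_bdd bnf gB Ci0) m n (copy b) (fun x c => row c (sec x)) Kc Ks (@copy_lin R m n b) HKc Kc0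
  (beta_copy_neq nf) ceq (span_copy (b := b)) sbd Ks0 c0 other).
Qed.

Lemma precsim_sqr_ln (R : realType) (F : R -> \bar R) (C1 C2 C3 : R) : 0 <= C1 -> 0 <= C2 -> 0 <= C3 ->
  (forall x, 0 <= x -> (F x <= (C1 * ((C3 * x + 10) ^+ 2 * ln (C3 * x + 10)) + C2 * (x + 1))%:E)%E) ->
  precsim F (fun l => l ^+ 2 * ln l).
Proof.
(* The summand 10 makes [c * x + c] exceed the argument [C3 * x + 10], which is large enough for the
   logarithm to be positive and monotonicity to apply. *)
move=> C10 C20 C30 H; exists (C1 + C2 + C3 + 10); first by rewrite ltr_wpDl// !addr_ge0.
move=> x x0; apply: le_trans (H x x0) _; rewrite lee_fin.
set c := C1 + C2 + C3 + 10; set y := C3 * x + 10.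
have y1 : 10 <= y by rewrite /y lerDr mulr_ge0.
have yz : y <= c * x + c by rewrite /y /c; nra.
have h1 : y ^+ 2 * ln y <= (c * x + c) ^+ 2 * ln (c * x + c).
  apply: ler_pM; rewrite ?sqr_ge0//; first by rewrite ln_ge0//; lra.
    by rewrite ler_pXn2r ?nnegrE//; lra.
  by rewrite ler_ln ?posrE//; lra.
have l0 : 0 <= y ^+ 2 * ln y by rewrite mulr_ge0 ?sqr_ge0// ln_ge0//; lra.
have c1 : C1 <= c by rewrite /c; lra.
have h2 := ler_pM C10 l0 c1 h1.
have h3 : C2 * (x + 1) <= c * x + c by rewrite /c; nra.
by rewrite -addrA lerD.
Qed.

Theorem corollary4p9 (R : realType)
    (G : groupTopType) (m : nat) (A : atlas G 'rV[R]_m)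
    (lieG : lie_group A)
    (scG : simply_connected R G)
    (nilG : two_step_nilpotent G)
    (n : nat) (n_ge2 : (2 <= n)%N)
    (G' : groupTopType) (m' : nat) (A' : atlas G' 'rV[R]_m')
    (lieG' : lie_group A')
    (proj : {ptws 'I_n -> G} -> G')
    (cpG' : is_central_product A A' proj)
    (h : metric A') (riem_h : riemannian h) (linv_h : left_invariant h) :
  precsim (dehn h) (fun l : R => l ^+ 2 * ln l).
Proof.
have [r [C lc]] := lie_local_chart lieG; have [r' [C' lc']] := lie_local_chart lieG'.
have mulC := lie_mul_cont lieG; have invC := lie_inv_cont lieG.
have [ex [b [K [d ne]]]] := lie_exp lc invC nilG.
have c0 : 'I_n by apply: (Ordinal (n := n) (m := 0)); apply: leq_trans n_ge2.
have [L [c [d' md]]] := psi_model lieG lieG' cpG' lc ne (ex_surj lc ne mulC invC scG)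
  (ex_inj lc ne mulC invC scG) c0 lc'.
have [Ci Ci0 gB] := igramB lieG' md riem_h.
have LW := power_loop_words (ne_nf ne) n_ge2 (igramC lieG' L riem_h) (igramZ lieG' md riem_h)
  (igram0 lieG' md riem_h) gB Ci0.
have [C1 [C2 [C3 [C10 C20 C30 H]]]] := fill_loop lieG' md riem_h linv_h LW.
apply: (precsim_sqr_ln C10 C20 C30) => x x0; apply: ge_ereal_sup => _ [f [lf lx ->]].
exact: H.
Qed.
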